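(* Let $(X,W)$ be a Landau-Ginzburg pair of dimension $d$. There exists a natural isomorphism of $\mathbb Z$-graded $\mathrm O(X)$-modules $$\mathrm{HPV}(X,W)\simeq_{\mathrm O(X)}\mathbb H(\mathcal K_W),$$ where $\mathrm{HPV}(X,W)$ is endowed with the canonical $\mathbb Z$-grading. Thus $$\mathrm H^k(\mathrm{PV}(X),\delta_W)\simeq_{\mathrm O(X)}\mathbb H^k(\mathcal K_W)\qquad\text{for all }k\in\{-d,\ldots,d\}.$$ Moreover, we have $$\mathbb H^k(\mathcal K_W)=\bigoplus_{i+j=k}\mathbf E_\infty^{i,j},$$ where $\mathbf E_\infty^{i,j}$ is the limit of the spectral sequence $\mathbf E=(\mathbf E_r^{i,j},\mathrm d_r)_{r\ge0}$ of the bicomplex $(\mathrm{PV}(X),\iota_W,\overline\partial)$ which starts with $$\mathbf E_0^{i,j}=\mathrm{PV}^{i,j}(X)=\mathcal A^j(X,\wedge^{|i|}TX),\quad \mathrm d_0=\overline\partial=\overline\partial_{\wedge TX}\qquad(i=-d,\ldots,0,\ j=0,\ldots,d).$$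
   Context: All manifolds are smooth, paracompact, connected and of non-zero dimension. A Landau-Ginzburg (LG) pair of dimension $d$ is a pair $(X,W)$, where $X$ is a non-compact Kählerian complex manifold with $\dim_{\mathbb C}X=d$ whose canonical line bundle $\wedge^dT^\ast X$ is holomorphically trivial, and $W:X\to\mathbb C$ is a non-constant holomorphic function. $\mathcal O_X$ is the sheaf of holomorphic functions and $\mathrm O(X)=\Gamma(X,\mathcal O_X)$. $TX$ is the holomorphic tangent bundle; holomorphic vector bundles are identified with their locally-free sheaves of holomorphic sections. $\iota_W=-\mathbf i(\partial W)\lrcorner$ denotes left contraction with $-\mathbf i\,\partial W$ ($\mathbf i$ the imaginary unit), giving maps $\wedge^kTX\to\wedge^{k-1}TX$. The sheaf Koszul complex of $W$ is the complex of locally-free sheaves $(\mathcal K_W):\ 0\to\wedge^dTX\xrightarrow{\iota_W}\wedge^{d-1}TX\xrightarrow{\iota_W}\cdots\xrightarrow{\iota_W}\mathcal O_X\to0$ with $\mathcal O_X$ in degree zero (so it is concentrated in non-positive degrees); $\mathbb H(\mathcal K_W)$ denotes its hypercohomology. $\mathcal A^j(X,E)$ is the space of smooth $(0,j)$-forms valued in the holomorphic bundle $E$. For $i=-d,\ldots,0$ and $j=0,\ldots,d$ set $\mathrm{PV}^{i,j}(X)=\mathcal A^j(X,\wedge^{|i|}TX)$ (and zero otherwise), $\mathrm{PV}(X)=\bigoplus_{i,j}\mathrm{PV}^{i,j}(X)$, with canonical $\mathbb Z$-grading $\mathrm{PV}^k(X)=\bigoplus_{i+j=k}\mathrm{PV}^{i,j}(X)$.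 With $\overline\partial$ the Dolbeault differential of $\wedge TX$ (vertical) and $\iota_W$ extended trivially to $\mathrm{PV}(X)$ (horizontal), $(\mathrm{PV}(X),\iota_W,\overline\partial)$ is a bicomplex with total differential $\delta_W=\overline\partial+\iota_W$, and $\mathrm{HPV}(X,W)=\mathrm H(\mathrm{PV}(X),\delta_W)$. *)

(* Defs.v *)
From HB Require Import structures.
From mathcomp Require Import all_boot all_order all_algebra.
From mathcomp Require Import complex.
From mathcomp Require Import all_classical all_reals all_analysis.

Set Implicit Arguments.
Unset Strict Implicit.
Unset Printing Implicit Defensive.

Import Order.TTheory GRing.Theory Num.Theory.
Import numFieldNormedType.Exports.
Local Open Scope classical_set_scope.
Local Open Scope ring_scope.

(* The copy R[i]^o of the field R[i] carries the norm topology. *)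
Notation cplx R := (R[i]^o).
Notation cspace R d := 'rV[R[i]^o]_d.

Section Wirtinger.
Variables (R : realType) (d : nat).
Implicit Types (U : set (cspace R d)) (f : cspace R d -> cplx R).

Definition real_derivable f (v z : cspace R d) : Prop :=
  derivable (fun t : R => complex.Re (f (z + t%:C%C *: v) : R[i])) 0 1 /\
  derivable (fun t : R => complex.Im (f (z + t%:C%C *: v) : R[i])) 0 1.

Definition real_deriv (v : cspace R d) f (z : cspace R d) : cplx R :=
  (derive1 (fun t : R => complex.Re (f (z + t%:C%C *: v) : R[i])) 0
   +i* derive1 (fun t : R => complex.Im (f (z + t%:C%C *: v) : R[i])) 0)%C.

(* The real coordinate directions at z_k = x_k + 'i y_k. *)
Definition dir_x (k : 'I_d) : cspace R d := delta_mx 0 k.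
Definition dir_y (k : 'I_d) : cspace R d := ('i%C : R[i]^o) *: delta_mx 0 k.

(* The derivative of f at z along v, for real parameter, is c. *)
Definition is_real_deriv f (v z : cspace R d) (c : cplx R) : Prop :=
  real_derivable f v z /\ real_deriv v f z = c.

(* For open U: the real partial derivatives of order <= n exist and are
   continuous on U. *)
Fixpoint Ck (n : nat) U f : Prop :=
  (forall z, U z -> {for z, continuous f}) /\
  if n is m.+1 then
    forall k : 'I_d, exists fx fy : cspace R d -> cplx R,
      [/\ forall z, U z -> is_real_deriv f (dir_x k) z (fx z),
          forall z, U z -> is_real_deriv f (dir_y k) z (fy z),
          Ck m U fx & Ck m U fy]
  else True.

Definition smooth U f : Prop := forall n, Ck n U f.

Definition pd_z (k : 'I_d) f (z : cspace R d) : R[i] :=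
  2%:R^-1 * (real_deriv (dir_x k) f z - 'i%C * real_deriv (dir_y k) f z).

Definition pd_zbar (k : 'I_d) f (z : cspace R d) : R[i] :=
  2%:R^-1 * (real_deriv (dir_x k) f z + 'i%C * real_deriv (dir_y k) f z).

Definition holomorphic U f : Prop :=
  smooth U f /\ forall k z, U z -> pd_zbar k f z = 0.

End Wirtinger.

Definition paracompact_space (T : topologicalType) : Prop :=
  forall F : set (set T), (forall A, F A -> open A) -> \bigcup_(A in F) A = setT ->
  exists G : set (set T),
    [/\ forall B, G B -> open B /\ exists2 A, F A & B `<=` A,
        \bigcup_(B in G) B = setT &
        forall x : T, exists2 N, nbhs x N & finite_set [set B | G B /\ B `&` N !=set0]].

Record cmanifold (R : realType) (d : nat) := CManifold {
  cspace_of :> topologicalType;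
  chart_index : Type;
  dom : chart_index -> set cspace_of;
  chart : chart_index -> cspace_of -> cspace R d;
  param : chart_index -> cspace R d -> cspace_of;
  cm_hausdorff : hausdorff_space cspace_of;
  cm_paracompact : paracompact_space cspace_of;
  cm_connected : connected [set: cspace_of];
  dom_open : forall a, open (dom a);
  dom_cover : forall x, exists a, dom a x;
  chart_open : forall a, open (chart a @` dom a);
  chartK : forall a x, dom a x -> param a (chart a x) = x;
  chart_continuous : forall a x, dom a x -> {for x, continuous (chart a)};
  param_continuous : forall a z, (chart a @` dom a) z -> {for z, continuous (param a)};
  transition_holomorphic : forall a b k,
    holomorphic (chart a @` (dom a `&` dom b))
      (fun z => chart b (param a z) 0 k)
}.

Section Manifold.
Variables (R : realType) (d : nat) (X : cmanifold R d).

Definition local_expr (T : Type) (a : chart_index X) (f : X -> T) : cspace R d -> T :=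
  fun z => f (param a z).

Definition smooth_in (a : chart_index X) (U : set X) (f : X -> R[i]) : Prop :=
  smooth (chart a @` (dom a `&` U)) (local_expr a f).

Definition holomorphic_in (a : chart_index X) (U : set X) (f : X -> R[i]) : Prop :=
  holomorphic (chart a @` (dom a `&` U)) (local_expr a f).

(* Functions on U are restrictions of total functions X -> R[i]; values outside
   of U are irrelevant. *)
Definition holo_fun (U : set X) : set (X -> R[i]) :=
  [set f | forall a, holomorphic_in a U f].

(* (d w_k / d z_l)_{k,l}, for the coordinates w of b and z of a. *)
Definition jacobian (b a : chart_index X) (x : X) : 'M[R[i]]_d :=
  \matrix_(k, l) pd_z l (fun z => chart b (param a z) 0 k) (chart a x).

End Manifold.

Section LGPair.
Variables (R : realType) (d : nat) (X : cmanifold R d).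

(* g a x k l is the coefficient g_{k lbar}; the last clause is the closedness
   of the (1,1)-form 'i/2 sum g_{k lbar} dz_k /\ dzbar_l. *)
Definition kahlerian : Prop :=
  exists g : chart_index X -> X -> 'M[R[i]]_d,
    [/\ forall a k l, smooth_in a setT (fun x => g a x k l),
        forall a x, dom a x ->
          (forall k l, g a x l k = (g a x k l)^*) /\
          (forall v : 'I_d -> R[i], (exists k, v k != 0) ->
             0 < \sum_k \sum_l g a x k l * v k * (v l)^*),
        forall a b x, dom a x -> dom b x -> forall k l,
          g a x k l = \sum_m \sum_n
            jacobian b a x m k * (jacobian b a x n l)^* * g b x m n &
        forall a x, dom a x -> forall k l m,
          pd_z m (local_expr a (fun y => g a y k l)) (chart a x) =
          pd_z k (local_expr a (fun y => g a y m l)) (chart a x)].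

(* A nowhere vanishing holomorphic section w_a dz_1 /\ ... /\ dz_d. *)
Definition canonical_bundle_trivial : Prop :=
  exists w : chart_index X -> X -> R[i],
    [/\ forall a, holomorphic_in a setT (w a),
        forall a x, dom a x -> w a x != 0 &
        forall a b x, dom a x -> dom b x ->
          w a x = \det (jacobian b a x) * w b x].

Record LG_pair (W : X -> R[i]) : Prop := LGPair {
  lg_dim : (0 < d)%N;
  lg_noncompact : ~ compact [set: X];
  lg_kahlerian : kahlerian;
  lg_canonical : canonical_bundle_trivial;
  lg_holomorphic : holo_fun setT W;
  lg_nonconstant : exists x y, W x <> W y
}.

End LGPair.

Record subgroup (M : zmodType) := Subgroup {
  subgroup_set :> set M;
  subgroup_closed : zmod_closed (mem subgroup_set)
}.

Definition sub_mem (M : zmodType) (S : subgroup M) : {pred M} :=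
  mem (subgroup_set S).

HB.instance Definition _ (M : zmodType) (S : subgroup M) :=
  GRing.isZmodClosed.Build M (sub_mem S) (subgroup_closed S).

Definition subgroup_type (M : zmodType) (S : subgroup M) : Type :=
  {x | x \in sub_mem S}.
HB.instance Definition _ (M : zmodType) (S : subgroup M) :=
  SubChoice.on (subgroup_type S).
HB.instance Definition _ (M : zmodType) (S : subgroup M) :=
  [SubChoice_isSubZmodule of subgroup_type S by <:].

(* x as an element of S; the default 0 is for x outside of S. *)
Definition to_sub (M : zmodType) (S : subgroup M) (x : M) : subgroup_type S :=
  insubd (0 : subgroup_type S) x.

(* phi : M -> N, restricted to Z, induces an isomorphism Z / B ~ Z' / B' which
   is linear for the scalars in F, acting by aM and aN. *)
Definition subquotient_iso (S : Type) (F : set S) (M N : zmodType)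
    (aM : S -> M -> M) (aN : S -> N -> N)
    (Z B : set M) (Z' B' : set N) (phi : M -> N) : Prop :=
  [/\ forall z, Z z -> Z' (phi z),
      forall z1 z2, Z z1 -> Z z2 -> B' (phi (z1 + z2) - (phi z1 + phi z2)),
      forall f z, F f -> Z z -> B' (phi (aM f z) - aN f (phi z)),
      forall z, Z z -> (B' (phi z) <-> B z) &
      forall z', Z' z' -> exists2 z, Z z & B' (z' - phi z)].

Section OModules.
Variables (R : realType) (d : nat) (X : cmanifold R d).

Record omodule := OModule {
  osec :> set X -> zmodType;
  oact : forall U, (X -> R[i]) -> osec U -> osec U;
  ores : forall U V, osec U -> osec V
}.

(* Only open sets, functions holomorphic on U, and restrictions to V `<=` U
   are constrained. *)
Record is_omodule (E : omodule) : Prop := IsOModule {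
  oactDr : forall U f (s t : E U), open U -> holo_fun U f ->
    oact f (s + t) = oact f s + oact f t;
  oactDl : forall U f g (s : E U), open U -> holo_fun U f -> holo_fun U g ->
    oact (f \+ g) s = oact f s + oact g s;
  oactM : forall U f g (s : E U), open U -> holo_fun U f -> holo_fun U g ->
    oact (f \* g) s = oact f (oact g s);
  oact1 : forall U (s : E U), open U -> oact (fun=> 1) s = s;
  oact_ext : forall U f g (s : E U), open U -> holo_fun U f ->
    (forall x, U x -> f x = g x) -> oact f s = oact g s;
  ores_id : forall U (s : E U), open U -> ores U s = s;
  ores_comp : forall U V T (s : E U), open U -> open V -> open T ->
    V `<=` U -> T `<=` V -> ores T (ores V s) = ores T s;
  oresD : forall U V (s t : E U), open U -> open V -> V `<=` U ->
    ores V (s + t) = ores V s + ores V t;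
  ores_act : forall U V f (s : E U), open U -> open V -> V `<=` U ->
    holo_fun U f -> ores V (oact f s) = oact f (ores V s);
  osheaf_separated : forall U (F : set (set X)) (s t : E U),
    open U -> (forall V, F V -> open V) -> \bigcup_(V in F) V = U ->
    (forall V, F V -> ores V s = ores V t) -> s = t;
  osheaf_glue : forall U (F : set (set X)) (s : forall V, E V),
    open U -> (forall V, F V -> open V) -> \bigcup_(V in F) V = U ->
    (forall V V', F V -> F V' ->
       ores (V `&` V') (s V) = ores (V `&` V') (s V')) ->
    exists t : E U, forall V, F V -> ores V t = s V
}.

Definition omap (E F : omodule) := forall U, E U -> F U.

Record is_ohom (E F : omodule) (phi : omap E F) : Prop := IsOHom {
  ohomD : forall U s t, open U -> phi U (s + t) = phi U s + phi U t;
  ohomZ : forall U f s, open U -> holo_fun U f ->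
    phi U (oact f s) = oact f (phi U s);
  ohom_res : forall U V s, open U -> open V -> V `<=` U ->
    phi V (ores V s) = ores V (phi U s)
}.

Definition oinjective (I : omodule) : Prop :=
  forall (E F : omodule) (m : omap E F) (g : omap E I),
    is_omodule E -> is_omodule F -> is_ohom m -> is_ohom g ->
    (forall U, open U -> injective (m U)) ->
    exists2 h : omap F I, is_ohom h & forall U s, open U -> h U (m U s) = g U s.

(* The differential is indexed by source and target; it vanishes unless the
   target degree is the successor of the source degree. *)
Record ocomplex := OComplex {
  cobj :> int -> omodule;
  cdiff : forall m n : int, omap (cobj m) (cobj n)
}.

Record is_ocomplex (K : ocomplex) : Prop := IsOComplex {
  cobj_omodule : forall n, is_omodule (K n);
  cdiff_ohom : forall m n, is_ohom (@cdiff K m n);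
  cdiff0 : forall m n U (s : K m U), open U -> n != m + 1 -> cdiff n s = 0;
  cdiff_comp : forall m n p U (s : K m U), open U -> cdiff p (cdiff n s) = 0
}.

Definition bounded_below (K : ocomplex) : Prop :=
  exists N : int, forall n U (s : K n U), n < N -> open U -> s = 0.

Definition cocycle (K : ocomplex) (n : int) (U : set X) : set (K n U) :=
  [set s | cdiff (n + 1) s = 0].
Definition coboundary (K : ocomplex) (n : int) (U : set X) : set (K n U) :=
  [set s | exists t : K (n - 1) U, s = cdiff n t].

Definition cmap (K L : ocomplex) := forall n, omap (K n) (L n).

Record is_cmap (K L : ocomplex) (phi : cmap K L) : Prop := IsCMap {
  cmap_ohom : forall n, is_ohom (phi n);
  cmap_diff : forall m n U (s : K m U), open U ->
    phi n U (cdiff n s) = cdiff n (phi m U s)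
}.

(* phi is bijective on the stalks of the cohomology sheaves. *)
Definition quasi_iso (K L : ocomplex) (phi : cmap K L) : Prop :=
  forall n U (x : X), open U -> U x ->
    (forall s : K n U, cocycle s -> coboundary (phi n U s) ->
       exists V, [/\ open V, V x, V `<=` U & coboundary (ores V s)]) /\
    (forall t : L n U, cocycle t ->
       exists V, [/\ open V, V x, V `<=` U &
         exists2 s : K n V, cocycle s & coboundary (ores V t - phi n V s)]).

(* The hypercohomology HH^n(K) is cocycle / coboundary of the global sections
   of an injective resolution of K. *)
Record injective_resolution (K I : ocomplex) (rho : cmap K I) : Prop :=
  InjectiveResolution {
    ir_complex : is_ocomplex I;
    ir_bounded : bounded_below I;
    ir_injective : forall n, oinjective (I n);
    ir_cmap : is_cmap rho;
    ir_quasi_iso : quasi_iso rho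
  }.

End OModules.
Arguments cocycle {R d X} K n U.
Arguments coboundary {R d X} K n U.

(* s a x A B is the coefficient, in the chart a at the point x, of
   dzbar_B (x) d_A, where for A = {k_1 < ... < k_p} and B = {l_1 < ... < l_q},
   d_A = d/dz_{k_1} /\ ... /\ d/dz_{k_p} and
   dzbar_B = dzbar_{l_1} /\ ... /\ dzbar_{l_q}. *)
Notation chart_family R d X :=
  (chart_index X -> cspace_of X -> {set 'I_d} -> {set 'I_d} -> (R[i] : Type))
  (only parsing).

Section Wirtinger_additive.
Variables (R : realType) (d : nat).
Implicit Types (U : set (cspace R d)) (f g : cspace R d -> cplx R).

Lemma cplxB (a b c e : R) :
  ((a - b) +i* (c - e))%C = ((a +i* c)%C : cplx R) - ((b +i* e)%C : cplx R).
Proof. by []. Qed.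

Lemma derive1B (u w : R -> R) (t : R) : derivable u t 1 -> derivable w t 1 ->
  derive1 (u \- w) t = derive1 u t - derive1 w t.
Proof. by move=> du dw; rewrite !derive1E deriveB. Qed.

Lemma is_real_derivB f g v z c e :
  is_real_deriv f v z c -> is_real_deriv g v z e ->
  is_real_deriv (f \- g) v z (c - e).
Proof.
rewrite /is_real_deriv /real_derivable /real_deriv.
set fr := fun t : R => complex.Re (f (z + t%:C%C *: v) : R[i]).
set fi := fun t : R => complex.Im (f (z + t%:C%C *: v) : R[i]).
set gr := fun t : R => complex.Re (g (z + t%:C%C *: v) : R[i]).
set gi := fun t : R => complex.Im (g (z + t%:C%C *: v) : R[i]).
have -> : (fun t : R => complex.Re ((f \- g) (z + t%:C%C *: v) : R[i])) = fr \- gr.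
  apply/funext => t; rewrite /fr /gr /=.
  by case: (f _) => ? ?; case: (g _).
have -> : (fun t : R => complex.Im ((f \- g) (z + t%:C%C *: v) : R[i])) = fi \- gi.
  apply/funext => t; rewrite /fi /gi /=.
  by case: (f _) => ? ?; case: (g _).
move=> [[dfr dfi] <-] [[dgr dgi] <-]; split.
  by split; apply: derivableB.
by rewrite (derive1B dfr dgr) (derive1B dfi dgi); exact: cplxB.
Qed.

Lemma CkB n U f g : Ck n U f -> Ck n U g -> Ck n U (f \- g).
Proof.
have cB (f' g' : cspace R d -> cplx R) :
    (forall z, U z -> {for z, continuous f'}) ->
    (forall z, U z -> {for z, continuous g'}) ->
    forall z, U z -> {for z, continuous (f' \- g')}.
  by move=> cf cg z Uz; apply: continuousB; [exact: cf | exact: cg].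
elim: n f g => [|n IH] f g [cf hf] [cg hg]; first by split; first exact: cB.
split; first exact: cB.
move=> k; have [fx [fy [f1 f2 f3 f4]]] := hf k.
have [gx [gy [g1 g2 g3 g4]]] := hg k.
exists (fx \- gx), (fy \- gy); split.
- by move=> z Uz; apply: is_real_derivB; [exact: f1 | exact: g1].
- by move=> z Uz; apply: is_real_derivB; [exact: f2 | exact: g2].
- exact: IH.
- exact: IH.
Qed.

Lemma smoothB U f g : smooth U f -> smooth U g -> smooth U (f \- g).
Proof. by move=> sf sg n; exact: CkB. Qed.

Lemma smooth0 U : smooth U (fun=> 0 : cplx R).
Proof.
elim=> [|n IH]; split=> //; try by move=> z _; exact: cst_continuous.
have h v z : is_real_deriv (fun=> 0 : cplx R) v z 0.
  rewrite /is_real_deriv /real_derivable /real_deriv; split.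
    by split; exact: derivable_cst.
  by rewrite !derive1_cst.
by move=> k; exists (fun=> 0), (fun=> 0); split.
Qed.

Lemma pd_zbarB k f g z :
  (forall v, v = dir_x R k \/ v = dir_y R k -> real_derivable f v z) ->
  (forall v, v = dir_x R k \/ v = dir_y R k -> real_derivable g v z) ->
  pd_zbar k (f \- g) z = pd_zbar k f z - pd_zbar k g z.
Proof.
move=> df dg; rewrite /pd_zbar.
have hB v : v = dir_x R k \/ v = dir_y R k ->
    real_deriv v (f \- g) z = real_deriv v f z - real_deriv v g z.
  by move=> hv; apply: (is_real_derivB (conj (df v hv) erefl) (conj (dg v hv) erefl)).2.
rewrite !hB; [|by right|by left].
by rewrite -mulrBr; congr (_ * _); rewrite mulrBr opprD addrACA.
Qed.

Lemma holomorphicB U f g :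
  holomorphic U f -> holomorphic U g -> holomorphic U (f \- g).
Proof.
move=> [sf hf] [sg hg]; split; first exact: smoothB.
have dsm (h : cspace R d -> cplx R) k z v : smooth U h -> U z ->
    v = dir_x R k \/ v = dir_y R k -> real_derivable h v z.
  move=> /(_ 1%N) [_ /(_ k) [hx [hy [h1 h2 _ _]]]] Uz [] ->.
    by have [] := h1 z Uz.
  by have [] := h2 z Uz.
move=> k z Uz; rewrite pd_zbarB; last 2 first.
- by move=> v hv; apply: (dsm f k).
- by move=> v hv; apply: (dsm g k).
by rewrite hf// hg// subr0.
Qed.

Lemma holomorphic0 U : holomorphic U (fun=> 0 : cplx R).
Proof.
split; first exact: smooth0.
move=> k z _; rewrite /pd_zbar /real_deriv !derive1_cst.
by rewrite mulr0 addr0 mulr0.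
Qed.

End Wirtinger_additive.

Section Polyvectors.
Variables (R : realType) (d : nat) (X : cmanifold R d).
Local Notation family := (chart_family R d X).
Implicit Types (U : set X) (s : family) (A B : {set 'I_d}).

(* The determinant of the rows in A and columns in B, in increasing order. *)
Definition minor (J : 'M[R[i]]_d) A B : R[i] :=
  if #|A| == #|B| then
    \det (\matrix_(m < #|A|, n < #|A|)
            J (enum_val m) (nth (enum_val m) (enum B) n))
  else 0.

(* Coefficients vanish by convention where they have no meaning, so that
   families are equal iff the sections are. *)
Definition is_section U s : Prop :=
  [/\ forall a x A B, ~ (dom a `&` U) x -> s a x A B = 0,
      forall a A B, smooth_in a U (fun x => s a x A B) &
      forall a b x A B, U x -> dom a x -> dom b x ->
        s b x A B = \sum_A' \sum_B'
          minor (jacobian b a x) A A' * (minor (jacobian a b x) B' B)^* *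
          s a x A' B'].

Definition supported (D : {set 'I_d} -> {set 'I_d} -> bool) s : Prop :=
  forall a x A B, ~~ D A B -> s a x A B = 0.

Definition component (D : {set 'I_d} -> {set 'I_d} -> bool) s : family :=
  fun a x A B => if D A B then s a x A B else 0.

Definition restrict U s : family :=
  fun a x A B => if x \in U then s a x A B else 0.

Definition fact (f : X -> R[i]) s : family := fun a x A B => f x * s a x A B.

Definition koszul_sign (k : 'I_d) A : R[i] := (-1) ^+ #|[set l in A | (l < k)%N]%SET|.

(* dzbar_k /\ is applied on the left of dzbar_B. *)
Definition dolbeault_op U s : family := fun a x A B =>
  if x \in dom a `&` U then
    \sum_(k in B) koszul_sign k B *
      pd_zbar k (local_expr a (fun y => s a y A (B :\ k))) (chart a x)
  else 0.

(* - 'i dW contracts the polyvector from the left; (-1)^|B| is the sign of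
   moving dW past dzbar_B, so that the two differentials anticommute. *)
Definition contract_op (W : X -> R[i]) s : family := fun a x A B =>
  \sum_(k | k \notin A)
    (-1) ^+ #|B| * koszul_sign k A * (- 'i%C) *
    pd_z k (local_expr a W) (chart a x) * s a x (k |: A) B.

Definition delta_op (W : X -> R[i]) U s : family :=
  dolbeault_op U s + contract_op W s.

Lemma is_section_sub U s t : is_section U s -> is_section U t -> is_section U (s - t).
Proof.
move=> [s1 s2 s3] [t1 t2 t3]; split.
- by move=> a x A B h; rewrite !fctE /= s1// t1// subr0.
- by move=> a A B; apply: smoothB; [exact: s2 | exact: t2].
move=> a b x A B Ux ax bx.
have E (u v : family) c y A' B' : (u - v) c y A' B' = u c y A' B' - v c y A' B'.
  by [].
rewrite E (s3 a b)// (t3 a b)// -sumrB; apply: eq_bigr => A' _.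
by rewrite -sumrB; apply: eq_bigr => B' _; rewrite E mulrBr.
Qed.

Lemma is_section0 U : is_section U 0.
Proof.
split=> //; first by move=> a A B; exact: smooth0.
move=> a b x A B _ _ _; rewrite big1// => A' _; rewrite big1// => B' _.
by rewrite mulr0.
Qed.

Lemma supported_sub D s t : supported D s -> supported D t -> supported D (s - t).
Proof.
by move=> hs ht a x A B h; rewrite !fctE /= hs// ht// subr0.
Qed.

(* Degree n of the total complex of (0,|B|)-forms with values in
   |A|-vectors. *)
Definition pv_degree (n : int) A B : bool := #|B|%:Z - #|A|%:Z == n.

Definition pv_set U n : set family :=
  [set s | is_section U s /\ supported (pv_degree n) s].

Lemma pv_closed U n : zmod_closed (mem (pv_set U n)).
Proof.
split; first by rewrite inE; split; [exact: is_section0 | ].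
move=> s t; rewrite !inE => -[s1 s2] [t1 t2]; split.
  exact: is_section_sub.
exact: supported_sub.
Qed.

Definition pv_subgroup U n : subgroup family := Subgroup (pv_closed U n).

(* Holomorphic sections of the (-n)-th exterior power of TX. *)
Definition koszul_degree (n : int) A B : bool :=
  (#|A|%:Z == - n) && (B == finset.set0).

Definition koszul_set U n : set family :=
  [set s | [/\ is_section U s, supported (koszul_degree n) s &
             forall a A B, holomorphic_in a U (fun x => s a x A B)]].

Lemma koszul_closed U n : zmod_closed (mem (koszul_set U n)).
Proof.
split.
  rewrite inE; split; [exact: is_section0 | by [] | ].
  by move=> a A B; exact: holomorphic0.
move=> s t; rewrite !inE => -[s1 s2 s3] [t1 t2 t3]; split.
- exact: is_section_sub.
- exact: supported_sub.
by move=> a A B; apply: holomorphicB; [exact: s3 | exact: t3].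
Qed.

Definition koszul_subgroup U n : subgroup family := Subgroup (koszul_closed U n).

(* The operators below preserve sections, so that the default 0 of to_sub is
   only taken off the degrees of the differential, and for non-open sets or
   functions which are not holomorphic. *)
Definition family_module (S : set X -> subgroup family) : omodule X :=
  @OModule R d X (fun U => subgroup_type (S U))
    (fun U f (s : subgroup_type (S U)) => to_sub (S U) (fact f (val s)))
    (fun U V (s : subgroup_type (S U)) => to_sub (S V) (restrict V (val s))).

Definition koszul_complex (W : X -> R[i]) : ocomplex X :=
  @OComplex R d X (fun n => family_module (koszul_subgroup^~ n))
    (fun m n U (s : subgroup_type (koszul_subgroup U m)) =>
       to_sub (koszul_subgroup U n) (contract_op W (val s))).

Definition pv_complex (W : X -> R[i]) : ocomplex X :=
  @OComplex R d X (fun n => family_module (pv_subgroup^~ n))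
    (fun m n U (s : subgroup_type (pv_subgroup U m)) =>
       to_sub (pv_subgroup U n) (delta_op W U (val s))).

(* Holomorphic polyvector fields as polyvector-valued (0,0)-forms. *)
Definition koszul_incl (W : X -> R[i]) : cmap (koszul_complex W) (pv_complex W) :=
  fun n U (s : subgroup_type (koszul_subgroup U n)) => to_sub (pv_subgroup U n) (val s).


Definition pv_bidegree (i j : int) A B : bool :=
  (- #|A|%:Z == i) && (#|B|%:Z == j).

(* PV^{i,j}(X); the graded space PV(X) is pv_set setT. *)
Definition pv_bigraded (i j : int) : set family :=
  [set s | is_section setT s /\ supported (pv_bidegree i j) s].

(* The spectral sequence of the bicomplex (PV(X), contract_op W, dolbeault_op
   setT), that is of the filtration of the total complex by the horizontal
   degree i. Since F^i / F^(i+1) is PV^{i,j} in total degree i + j, the page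
   E_r^{i,j} is written as the subquotient ss_cycle / ss_boundary of
   PV^{i,j}. *)
Definition pv_filtration (p n : int) : set family :=
  [set s | pv_set setT n s /\ supported (fun A _ => p <= - #|A|%:Z) s].

Definition ss_cycle (W : X -> R[i]) (r : nat) (i j : int) : set family :=
  [set u | exists x, [/\ pv_filtration i (i + j) x,
      pv_filtration (i + r%:Z) (i + j + 1) (delta_op W setT x) &
      u = component (pv_bidegree i j) x]].

Definition ss_boundary (W : X -> R[i]) (r : nat) (i j : int) : set family :=
  [set u | exists y, [/\ pv_filtration (i - r%:Z + 1) (i + j - 1) y,
      pv_filtration i (i + j) (delta_op W setT y) &
      u = component (pv_bidegree i j) (delta_op W setT y)]].

(* v represents d_r of the class of u in E_r^{i+r,j-r+1}. *)
Definition ss_diff (W : X -> R[i]) (r : nat) (i j : int) (u v : family) : Prop :=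
  exists x, [/\ pv_filtration i (i + j) x,
    pv_filtration (i + r%:Z) (i + j + 1) (delta_op W setT x),
    u = component (pv_bidegree i j) x &
    v = component (pv_bidegree (i + r%:Z) (j - r%:Z + 1)) (delta_op W setT x)].

Definition ss_cycle_lim (W : X -> R[i]) (i j : int) : set family :=
  \bigcap_r ss_cycle W r i j.
Definition ss_boundary_lim (W : X -> R[i]) (i j : int) : set family :=
  \bigcup_r ss_boundary W r i j.

Definition ss_starts_with_dolbeault (W : X -> R[i]) : Prop :=
  forall i j,
    [/\ ss_cycle W 0 i j = pv_bigraded i j,
        ss_boundary W 0 i j = [set 0] &
        forall u v, pv_bigraded i j u ->
          (ss_diff W 0 i j u v <-> v = dolbeault_op setT u)].

Section Comparison.
Variables (W : X -> R[i]) (I : ocomplex X).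
Variable (g : cmap (pv_complex W) I).

(* H^k(PV(X), delta_W) ~ H^k(I(X)) over O(X), induced by g. *)
Definition cohomology_iso (k : int) : Prop :=
  subquotient_iso (holo_fun setT) (@oact _ _ _ (pv_complex W k) setT)
    (@oact _ _ _ (I k) setT)
    (cocycle (pv_complex W) k setT) (coboundary (pv_complex W) k setT)
    (cocycle I k setT) (coboundary I k setT) (@g k setT).

(* A C-linear isomorphism from H^k(I(X)) to the direct sum of the
   E_infinity^{i,k-i} (almost all of them 0), which on the image of the p-th
   step of the filtration of H^k(PV(X), delta_W) has no component i < p, and
   has the leading coefficient as its component i = p. *)
Definition converges (k : int) : Prop :=
  exists psi : I k setT -> int -> family,
    subquotient_iso (range (fun (c : R[i]) (_ : X) => c))
      (@oact _ _ _ (I k) setT) (fun f e i => fact f (e i))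
      (cocycle I k setT) (coboundary I k setT)
      [set e | forall i, ss_cycle_lim W i (k - i) (e i)]
      [set e | forall i, ss_boundary_lim W i (k - i) (e i)] psi /\
    forall (p : int) (w : subgroup_type (pv_subgroup setT k)),
      cocycle (pv_complex W) k setT w -> pv_filtration p k (val w) ->
      (forall i, i < p -> ss_boundary_lim W i (k - i) (psi (g w) i)) /\
      ss_boundary_lim W p (k - p)
        (psi (g w) p - component (pv_bidegree p (k - p)) (val w)).

Definition extends_koszul (rho : cmap (koszul_complex W) I) : Prop :=
  is_cmap g /\
  forall n U (s : koszul_complex W n U), open U ->
    g (koszul_incl s) = rho n U s.

End Comparison.

End Polyvectors.

(* Main.v *)
(* Locally, the Dolbeault lemma (proved with the Cauchy transform in polar
   coordinates, one variable at a time) allows one to remove the components of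
   highest antiholomorphic degree of a delta_W-cocycle, so that the inclusion
   of the Koszul complex into the sheaf complex PV is a quasi-isomorphism. For
   an injective resolution rho : K -> I, the injectivity of the terms of I
   extends rho to g : PV -> I, degree by degree, uniquely up to homotopy. The
   cone of g is locally exact and bounded below; its terms are soft, because PV
   has cutoff functions and injective sheaves are flasque. On the sigma-compact
   space X the sheaves of cocycles of such a complex are soft too, and the
   complex of global sections is exact: hence g induces an isomorphism
   H(PV(X), delta_W) ~ H(I(X)).
   The filtration is finite, so that the limit terms of the spectral sequence
   consist of the leading components of the cocycles (resp. coboundaries) in
   its successive steps. Mapping a class to its leading component is linear
   modulo boundaries; this is extended to all of I^k(X) by Zorn's lemma, and
   the collection of these maps is triangular, hence bijective. *)

From HB Require Import structures.
From mathcomp Require Import all_boot all_order all_algebra.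
From mathcomp Require Import complex.
From mathcomp Require Import all_classical all_reals all_analysis.
From mathcomp Require Import perm ring lra zify.
Require Import Defs.

Set Implicit Arguments.
Unset Strict Implicit.
Unset Printing Implicit Defensive.

Import Order.TTheory GRing.Theory Num.Theory.
Import numFieldNormedType.Exports.
Import ComplexField ComplexField.Normc.
Local Open Scope classical_set_scope.
Local Open Scope ring_scope.

(** * Real differentiation of functions on complex coordinate space *)

(** [Ck] speaks of partial derivatives along the real coordinate directions only, so the
    differential, the chain rule and the symmetry of second derivatives have to be obtained from
    one-variable calculus before anything can be transported between charts. In polar coordinates
    the area element r dr dt absorbs the singularity of the Cauchy kernel 1/zeta: the transform is
    an iterated integral of a continuous function over a fixed rectangle, and differentiating it is
    a matter of uniform continuity. For the comparison, injectivity extends morphisms along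
    monomorphisms, whereas the next component of [g] is prescribed on sums incl k + d t whose
    presentation is not unique. The prescription is therefore treated as a relation: the
    quasi-isomorphism shows that the ambiguity is locally harmless, and the sections on which the
    relation is locally defined form a subsheaf, to which injectivity applies. The same obstacle
    returns for the leading components, which depend on a class only modulo boundaries; there too a
    relation is extended instead of a map. *)

Section Modulus.
Variable R : realType.
Implicit Types (x y c : R[i]) (r : R).

(** The norm of R[i] is valued in R[i]. Estimates by real numbers use the R-valued modulus [normc],
    and this identity is the passage between the two. *)
Lemma normcE' x : `|x| = (normc x)%:C%C.
Proof. by case: x => a b; rewrite normc_def. Qed.

Lemma normc_ge0 x : 0 <= normc x.
Proof. by case: x => a b; exact: sqrtr_ge0. Qed.

Lemma normc_Re x : `|complex.Re x| <= normc x.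
Proof.
by have := normc_ge_Re x; rewrite normcE' lecR.
Qed.

Lemma normcJ' x : normc (x^*)%C = normc x.
Proof. by apply: complexI; rewrite -!normcE' normcJ. Qed.

Lemma normc_Im x : `|complex.Im x| <= normc x.
Proof.
case: x => a b /=; rewrite -sqrtr_sqr ler_sqrt ?lerDr ?sqr_ge0//.
by rewrite addr_ge0 ?sqr_ge0.
Qed.

Lemma normc_real r : normc (r%:C)%C = `|r|.
Proof. by rewrite /= expr0n addr0 sqrtr_sqr. Qed.

Lemma normc_le x : normc x <= `|complex.Re x| + `|complex.Im x|.
Proof.
case: x => a b /=; rewrite -(ger0_norm (addr_ge0 (normr_ge0 a) (normr_ge0 b))).
rewrite -sqrtr_sqr ler_sqrt ?sqr_ge0// sqrrD !real_normK ?num_real//.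
by rewrite -addrA [X in _ <= _ + X]addrC lerD2l lerDl mulrn_wge0// mulr_ge0.
Qed.

Lemma normc_eq0 x : normc x = 0 -> x = 0.
Proof. exact: eq0_normc. Qed.

Lemma normcB x y : normc (x - y) = normc (y - x).
Proof. by rewrite -normcN opprB. Qed.

Lemma normc_sum (I : Type) (s : seq I) (P : pred I) (F : I -> R[i]) :
  normc (\sum_(i <- s | P i) F i) <= \sum_(i <- s | P i) normc (F i).
Proof.
elim/big_ind2 : _ => //; first by rewrite normc0.
by move=> ? ? ? ? h1 h2; apply: le_trans (le_normcD _ _) _; exact: lerD.
Qed.

End Modulus.

Section Eps.
Variables (R : realType) (d : nat).
Implicit Types (U : set (cspace R d)) (f g : cspace R d -> cplx R) (z w : cspace R d).

(** The open polydisc, with a real radius; it replaces the balls of the norm topology, whose radii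
    are elements of R[i]. *)
Definition box z (r : R) : set (cspace R d) :=
  [set w | forall k, normc (w 0 k - z 0 k) < r].

Lemma box_nbhs z r : 0 < r -> nbhs z (box z r).
Proof.
move=> r0; apply/nbhs_ballP; exists (r%:C)%C => /=; first by rewrite ltcR.
move=> w [] /= _ h k; have := h 0 k.
by rewrite -ball_normE /= distrC normcE' ltcR.
Qed.

Lemma nbhs_box z (A : set (cspace R d)) :
  nbhs z A -> exists2 r : R, 0 < r & box z r `<=` A.
Proof.
move=> /nbhs_ballP[e /= e0 zA].
(* A positive element of R[i] is real, since the order only compares numbers with the same imaginary
   part. *)
have eE : e = (complex.Re e)%:C%C by rewrite RRe_real// gtr0_real.
exists (complex.Re e); first by move: e0; rewrite eE ltcR.
move=> w hw; apply: zA; split => // i j; rewrite -ball_normE /= distrC normcE' eE ltcR ord1.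
exact: hw.
Qed.

Lemma open_box U z : open U -> U z -> exists2 r : R, 0 < r & box z r `<=` U.
Proof. by move=> oU Uz; apply: nbhs_box; exact: open_nbhs_nbhs. Qed.

Lemma openP U : (forall z, U z -> exists2 r : R, 0 < r & box z r `<=` U) -> open U.
Proof.
move=> h; rewrite openE => z /h[r r0 zU]; rewrite /interior.
by apply: filterS zU _; exact: box_nbhs.
Qed.

Lemma box_open z r : open (box z r).
Proof.
apply: openP => w zw.
have h k : exists e : R, 0 < e /\ forall v : cspace R d, normc (v 0 k - w 0 k) < e -> normc (v 0 k - z 0 k) < r.
  exists (r - normc (w 0 k - z 0 k)); split; first by rewrite subr_gt0 zw.
  move=> v hv; have -> : v 0 k - z 0 k = (v 0 k - w 0 k) + (w 0 k - z 0 k) by rewrite addrA subrK.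
  by apply: le_lt_trans (le_normcD _ _) _; rewrite -ltrBrDr.
have [e he] := choice h.
exists (\big[Order.min/1]_k e k).
  by apply/bigmin_gtP; split=> [|k _]; [exact: ltr01 | case: (he k)].
move=> v hv k; have /bigmin_gtP[_ /(_ k isT) hk] := hv k; have [_] := he k; exact.
Qed.

Lemma continuousP_eps f z : {for z, continuous f} <->
  forall e : R, 0 < e -> exists2 r : R, 0 < r &
    forall w, box z r w -> normc (f w - f z) < e.
Proof.
split=> [/cvgrPdist_lt cf e e0|h].
  have e0' : 0 < (e%:C%C : R[i]) by rewrite ltcR.
  have [r r0 hr] := nbhs_box (cf _ e0').
  by exists r => // w /hr /=; rewrite distrC normcE' ltcR.
apply/(@cvgrPdist_lt _ (cplx R) _ (nbhs z) (nbhs_filter z)) => e e0.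
have eE : e = (complex.Re e)%:C%C by rewrite RRe_real// gtr0_real.
have [|r r0 hr] := h (complex.Re e); first by move: e0; rewrite eE ltcR.
apply: (@filterS _ (nbhs z) (nbhs_filter z) _ _ _ (box_nbhs z r0)) => w /hr hw.
by rewrite distrC normcE' eE ltcR.
Qed.

End Eps.

(** * Derivatives at 0 of curves in the complex plane *)

Section CurveDerivative.
Variable R : realType.
Implicit Types (u v : R -> R[i]) (c : R[i]).

(** The first-order expansion of [u] at 0. Written without a quotient, and including t = 0, it is
    directly usable for estimates of remainders. *)
Definition cder u c := forall e : R, 0 < e -> exists2 r : R, 0 < r &
  forall t : R, `|t| < r -> normc (u t - u 0 - t%:C%C * c) <= e * `|t|.

Lemma is_derive_eps (u : R -> R) (a c : R) : is_derive a 1 u c <->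
  forall e : R, 0 < e -> exists2 r : R, 0 < r &
  forall t : R, `|t| < r -> `|u (a + t) - u a - t * c| <= e * `|t|.
Proof.
split=> [[du <-] e e0|h].
  have /cvgrPdist_le/(_ e e0)[r /= r0 hr] := du.
  exists r => // t tr; have [->|t0] := eqVneq t 0.
    by rewrite addr0 subrr mul0r subrr normr0 mulr0.
  have := hr t; rewrite /ball /= sub0r normrN => /(_ tr t0).
  rewrite /GRing.scale /= mulr1 -/(derive _ _ _) [a + t]addrC => hh.
  have -> : u (t + a) - u a - t * 'D_1 u a = t * - ('D_1 u a - t^-1 * (u (t + a) - u a)).
    by rewrite opprB mulrBr mulrA mulfV// mul1r.
  by rewrite normrM normrN mulrC ler_wpM2r.
have cv : h^-1 *: (u (h *: 1 + a) - u a) @[h --> 0^'] --> c.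
  apply/cvgrPdist_le => e e0; have [r r0 hr] := h e e0.
  exists r => //= t; rewrite /ball_ /= sub0r normrN => tr t0.
  have := hr t tr; rewrite /GRing.scale /= mulr1 [a + t]addrC => hh.
  have -> : c - t^-1 * (u (t + a) - u a) = - (t^-1 * (u (t + a) - u a - t * c)).
    by field.
  by rewrite normrN normrM normfV mulrC ler_pdivrMr// normr_gt0.
by split; [exact: cvgP cv | exact: cvg_lim cv].
Qed.

Lemma cderP u c : cder u c <->
  is_derive (0 : R) 1 (fun t => complex.Re (u t)) (complex.Re c) /\
  is_derive (0 : R) 1 (fun t => complex.Im (u t)) (complex.Im c).
Proof.
have ReE t : complex.Re (u (0 + t)) - complex.Re (u 0) - t * complex.Re c =
    complex.Re (u t - u 0 - t%:C%C * c).
  by rewrite add0r; case: (u t) => ? ?; case: (u 0) => ? ?; case: (c) => ? ? /=; rewrite mul0r subr0.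
have ImE t : complex.Im (u (0 + t)) - complex.Im (u 0) - t * complex.Im c =
    complex.Im (u t - u 0 - t%:C%C * c).
  by rewrite add0r; case: (u t) => ? ?; case: (u 0) => ? ?; case: (c) => ? ? /=; rewrite mul0r addr0.
split=> [h|[/is_derive_eps h1 /is_derive_eps h2]].
  split; apply/is_derive_eps => e /h[r r0 hr]; exists r => // t /hr; apply: le_trans.
    by rewrite ReE; exact: normc_Re.
  by rewrite ImE; exact: normc_Im.
move=> e e0; have e20 : 0 < e / 2 by rewrite divr_gt0.
have [r1 r10 hr1] := h1 _ e20; have [r2 r20 hr2] := h2 _ e20.
exists (Num.min r1 r2); first by rewrite lt_min r10.
move=> t; rewrite lt_min => /andP[/hr1 t1 /hr2 t2].
apply: le_trans (normc_le _) _; rewrite -ReE -ImE (splitr e) mulrDl.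
exact: lerD.
Qed.

Lemma cder_cst c : cder (fun=> c) 0.
Proof.
move=> e e0; exists 1 => // t _; rewrite subrr mulr0 subr0 normc0.
by rewrite mulr_ge0// ltW.
Qed.

Lemma cder_lin c c' : cder (fun t => c' + t%:C%C * c) c.
Proof.
move=> e e0; exists 1 => // t _.
have -> : c' + t%:C%C * c - (c' + (0 : R)%:C%C * c) - t%:C%C * c = 0.
  by rewrite (rmorph0 (real_complex R)); ring.
by rewrite normc0 mulr_ge0// ltW.
Qed.

Lemma cderD u v c c' : cder u c -> cder v c' -> cder (fun t => u t + v t) (c + c').
Proof.
move=> hu hv e e0; have e20 : 0 < e / 2 by rewrite divr_gt0.
have [r1 r10 hr1] := hu _ e20; have [r2 r20 hr2] := hv _ e20.
exists (Num.min r1 r2); first by rewrite lt_min r10.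
move=> t; rewrite lt_min => /andP[/hr1 t1 /hr2 t2].
have -> : u t + v t - (u 0 + v 0) - t%:C%C * (c + c') =
  (u t - u 0 - t%:C%C * c) + (v t - v 0 - t%:C%C * c') by ring.
apply: le_trans (le_normcD _ _) _; rewrite (splitr e) mulrDl.
exact: lerD.
Qed.

Lemma cderJ u c : cder u c -> cder (fun t => (u t)^*%C) (c^*%C).
Proof.
move=> hu e /hu[r r0 hr]; exists r => // t /hr; rewrite -normcJ'.
by rewrite !rmorphB rmorphM /= oppr0.
Qed.

Lemma cder_ext u v c r : 0 < r -> (forall t : R, `|t| < r -> u t = v t) ->
  cder u c -> cder v c.
Proof.
move=> r0 uv hu e /hu[r' r'0 hr']; exists (Num.min r r'); first by rewrite lt_min r0.
move=> t; rewrite lt_min => /andP[tr tr']; rewrite -!uv ?normr0//.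
exact: hr'.
Qed.

Lemma cderM u v c c' : cder u c -> cder v c' ->
  cder (fun t => u t * v t) (c * v 0 + u 0 * c').
Proof.
move=> /cderP[h1 h2] /cderP[h3 h4]; apply/cderP.
pose ur t := complex.Re (u t); pose ui t := complex.Im (u t).
pose vr t := complex.Re (v t); pose vi t := complex.Im (v t).
split.
  have -> : (fun t => complex.Re (u t * v t)) = (ur * vr - ui * vi).
    by apply/funext => t; rewrite /ur /ui /vr /vi !fctE; case: (u t) => ? ?; case: (v t).
  apply: (is_derive_eq (is_deriveB (is_deriveM h1 h3) (is_deriveM h2 h4))); rewrite /ur /ui /vr /vi /GRing.scale/=.
  by case: (c) (c') (u 0) (v 0) => ? ? [? ?] [? ?] [? ?] /=; ring.
have -> : (fun t => complex.Im (u t * v t)) = (ur * vi + ui * vr).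
  by apply/funext => t; rewrite /ur /ui /vr /vi !fctE; case: (u t) => ? ?; case: (v t).
apply: (is_derive_eq (is_deriveD (is_deriveM h1 h4) (is_deriveM h2 h3))); rewrite /ur /ui /vr /vi /GRing.scale/=.
by case: (c) (c') (u 0) (v 0) => ? ? [? ?] [? ?] [? ?] /=; ring.
Qed.

Lemma cder_cts u c : cder u c -> forall e : R, 0 < e -> exists2 r : R, 0 < r &
  forall t : R, `|t| < r -> normc (u t - u 0) < e.
Proof.
move=> hu e e0; have [r r0 hr] := hu 1 ltr01.
pose K := 1 + normc c + 1; have K0 : 0 < K by rewrite !ltr_wpDr// ?normc_ge0.
exists (Num.min r (e / K)); first by rewrite lt_min r0 divr_gt0.
move=> t; rewrite lt_min => /andP[tr te].
rewrite -[u t - u 0](subrK (t%:C%C * c)).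
apply: le_lt_trans (le_normcD _ _) _; rewrite normcM normc_real.
apply: le_lt_trans (lerD (hr _ tr) (lexx _)) _.
move: te; rewrite ltr_pdivlMr// /K; have := normr_ge0 t; have := normc_ge0 c.
by move=> ? ?; nra.
Qed.

Lemma cderV u c : u 0 != 0 -> cder u c -> cder (fun t => (u t)^-1) (- c / u 0 ^+ 2).
Proof.
move=> u0 hu e e0.
have n0 : 0 < normc (u 0) by rewrite lt_neqAle normc_ge0 andbT eq_sym; apply: contra_neq u0; exact: normc_eq0.
have [r1 r10 hr1] := cder_cts hu (divr_gt0 n0 (ltr0Sn _ 1)).
have uv t : `|t| < r1 -> normc (u 0) / 2 < normc (u t).
  move=> /hr1; have := le_normcD (u t) (u 0 - u t); rewrite addrCA subrr addr0 normcB.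
  lra.
(* The remainder of 1/u is t c (u t - u 0) - u 0 (u t - u 0 - t c) divided by u(t) u(0)^2. Where |u
   t| > b/2 the inverse of this denominator is at most 2/b^3, and both terms of the numerator are at
   most K |t|: the product of the bounds is e |t|. *)
pose b := normc (u 0); pose K := e * b ^+ 3 / 4.
have b0 : 0 < b by [].
have K0 : 0 < K by rewrite divr_gt0// mulr_gt0// exprn_gt0.
have [r2 r20 hr2] := hu _ (divr_gt0 K0 b0).
pose cc := normc c; have cc0 : 0 <= cc by exact: normc_ge0.
pose K' := K / (cc + 1); have K'0 : 0 < K' by rewrite divr_gt0// ltr_wpDl.
have [r3 r30 hr3] := cder_cts hu K'0.
exists (Num.min r1 (Num.min r2 r3)); first by rewrite !lt_min r10 r20.
move=> t; rewrite !lt_min => /and3P[t1 t2 t3].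
have ut := uv _ t1; have ut0 : u t != 0.
  by apply: contraTneq ut => ->; rewrite normc0 -leNgt divr_ge0// ltW.
have -> : (u t)^-1 - (u 0)^-1 - t%:C%C * (- c / u 0 ^+ 2) =
  (t%:C%C * c * (u t - u 0) - u 0 * (u t - u 0 - t%:C%C * c)) * ((u t)^-1 * ((u 0)^-1 ^+ 2)).
  by field; rewrite ut0 u0.
rewrite normcM.
have hV : normc ((u t)^-1 * (u 0)^-1 ^+ 2) <= 2 / b ^+ 3.
  rewrite !normcM !normcV -/b.
  have -> : 2 / b ^+ 3 = (2 / b) * (b^-1 * b^-1) by field; rewrite gt_eqF.
  rewrite ler_wpM2r ?mulr_ge0 ?invr_ge0 ?(ltW b0)//.
  by rewrite -[2 / b]invf_div lef_pV2 ?posrE ?divr_gt0//; [exact: ltW|apply: lt_trans ut; rewrite divr_gt0].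
have hN : normc (t%:C%C * c * (u t - u 0) - u 0 * (u t - u 0 - t%:C%C * c)) <= 2 * K * `|t|.
  apply: le_trans (le_normcD _ _) _; rewrite normcN !normcM normc_real -/b -/cc.
  have h2 := hr2 _ t2; have h3 := hr3 _ t3.
  have -> : 2 * K * `|t| = `|t| * K + b * (K / b * `|t|) by field; rewrite gt_eqF.
  apply: lerD; last by rewrite ler_wpM2l// ltW.
  rewrite -mulrA ler_wpM2l//.
  apply: le_trans (ler_wpM2l cc0 (ltW h3)) _; rewrite /K' mulrCA ger_pMr//.
  by rewrite ler_pdivrMr ?mul1r ?lerDl// ltr_wpDl.
apply: le_trans (ler_pM (normc_ge0 _) (normc_ge0 _) hN hV) _.
by rewrite /K -subr_ge0 le_eqVlt; apply/orP; left; rewrite eq_sym subr_eq0; apply/eqP; field; rewrite gt_eqF.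
Qed.

End CurveDerivative.

(** * The algebra of C^n functions *)

Section Smooth.
Variables (R : realType) (d : nat).
Implicit Types (U V : set (cspace R d)) (f g : cspace R d -> cplx R) (z w v : cspace R d).

Definition line z v (t : R) : cspace R d := z + (t%:C%C : R[i]) *: v.

(** Indexing the 2d real directions by a boolean and a coordinate allows one argument to treat
    d/dx_k and d/dy_k at once. *)
Definition dir (b : bool) (k : 'I_d) : cspace R d := if b then dir_x R k else dir_y R k.

Lemma line0 z v : line z v 0 = z.
Proof. by rewrite /line (rmorph0 (real_complex R)) scale0r addr0. Qed.

Lemma line_shift z v s t : line (line z v s) v t = line z v (s + t).
Proof. by rewrite /line -addrA -scalerDl -rmorphD. Qed.

(** A derivative in a direction is the derivative at 0 of the restriction to a line; the rules for
    [is_real_deriv] are all read off from those for [cder] in this way. *)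
Lemma isdP f v z c : is_real_deriv f v z c <-> cder (fun t => f (line z v t)) c.
Proof.
rewrite cderP /is_real_deriv /real_derivable /real_deriv /line !derive1E; split.
  by move=> [[h1 h2] <-] /=; split; [exact: derivableP h1 | exact: derivableP h2].
move=> [h1 h2]; split; first by split; [have [] := h1 | have [] := h2].
rewrite (@derive_val _ _ _ _ _ _ _ h1) (@derive_val _ _ _ _ _ _ _ h2).
by case: c {h1 h2}.
Qed.

Lemma line_box z v r : 0 < r -> exists2 e : R, 0 < e &
  forall t : R, `|t| < e -> box z r (line z v t).
Proof.
move=> r0; pose K := \sum_k normc (v 0 k) + 1.
have K0 : 0 < K by rewrite ltr_wpDl// sumr_ge0// => k _; exact: normc_ge0.
exists (r / K); first by rewrite divr_gt0.
move=> t; rewrite ltr_pdivlMr// => tr k; rewrite /line !mxE addrAC subrr add0r.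
rewrite normcM normc_real; apply: le_lt_trans tr; rewrite ler_wpM2l//.
rewrite /K (bigD1 k)//= -addrA lerDl addr_ge0// sumr_ge0// => i _; exact: normc_ge0.
Qed.

Lemma line_open U z v : open U -> U z -> exists2 e : R, 0 < e &
  forall t : R, `|t| < e -> U (line z v t).
Proof.
move=> oU Uz; have [r r0 hr] := open_box oU Uz.
by have [e e0 he] := line_box z v r0; exists e => // t /he /hr.
Qed.

Lemma isd_ext U f g v z c : open U -> U z -> {in U, f =1 g} ->
  is_real_deriv f v z c -> is_real_deriv g v z c.
Proof.
move=> oU Uz fg /isdP h; apply/isdP.
have [e e0 he] := line_open v oU Uz.
by apply: cder_ext e0 _ h => t /he Ut; apply: fg; rewrite inE.
Qed.

Lemma isdD f g v z c e : is_real_deriv f v z c -> is_real_deriv g v z e ->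
  is_real_deriv (f \+ g) v z (c + e).
Proof. by move=> /isdP h1 /isdP h2; apply/isdP; exact: cderD. Qed.

Lemma isdM f g v z c e : is_real_deriv f v z c -> is_real_deriv g v z e ->
  is_real_deriv (f \* g) v z (c * g z + f z * e).
Proof.
move=> /isdP h1 /isdP h2; apply/isdP.
by have := cderM h1 h2; rewrite !line0.
Qed.

Lemma isdJ f v z c : is_real_deriv f v z c ->
  is_real_deriv (fun z => (f z)^*%C) v z (c^*%C).
Proof. by move=> /isdP h; apply/isdP; exact: (cderJ h). Qed.

Lemma isdV f v z c : f z != 0 -> is_real_deriv f v z c ->
  is_real_deriv (fun z => (f z)^-1) v z (- c / f z ^+ 2).
Proof.
move=> fz /isdP h; apply/isdP.
by have := @cderV _ (fun t => f (line z v t)) c; rewrite line0; apply.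
Qed.

Lemma isd_cst c v z : is_real_deriv (fun=> c : cplx R) v z 0.
Proof. by apply/isdP; exact: cder_cst. Qed.

Lemma isd_coord k v z : is_real_deriv (fun w => w 0 k) v z (v 0 k).
Proof.
apply/isdP; have := cder_lin (v 0 k) (z 0 k); apply: cder_ext ltr01 _ => t _.
by rewrite /line !mxE.
Qed.

Definition contOn U f := forall z, U z -> {for z, continuous f}.

Lemma contOnD U f g : contOn U f -> contOn U g -> contOn U (f \+ g).
Proof. by move=> cf cg z Uz; apply: continuousD; [exact: cf | exact: cg]. Qed.

Lemma contOnM U f g : contOn U f -> contOn U g -> contOn U (f \* g).
Proof. by move=> cf cg z Uz; apply: continuousM; [exact: cf | exact: cg]. Qed.

Lemma contOnJ U f : contOn U f -> contOn U (fun z => (f z)^*%C).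
Proof.
move=> cf z /cf/continuousP_eps h; apply/continuousP_eps => e /h[r r0 hr].
by exists r => // w /hr; rewrite -rmorphB normcJ'.
Qed.

Lemma contOnV U f : (forall z, U z -> f z != 0) -> contOn U f ->
  contOn U (fun z => (f z)^-1).
Proof. by move=> f0 cf z Uz; apply: continuousV; [exact: f0 | exact: cf]. Qed.

Lemma contOn_ext U f g : open U -> {in U, f =1 g} -> contOn U f -> contOn U g.
Proof.
move=> oU fg cf z Uz; have /continuousP_eps h := cf z Uz; apply/continuousP_eps => e /h[r r0 hr].
have [r' r'0 hr'] := open_box oU Uz.
exists (Num.min r r'); first by rewrite lt_min r0.
move=> w hw; rewrite -!fg ?inE//.
  by apply: hr => k; have := hw k; rewrite lt_min => /andP[].
by apply: hr' => k; have := hw k; rewrite lt_min => /andP[].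
Qed.

Lemma Ck0P U f : Ck 0 U f <-> contOn U f.
Proof. by split; [case | move=> h; split]. Qed.

Lemma Ck_cont n U f : Ck n U f -> contOn U f.
Proof. by case: n => [|n] []. Qed.

Lemma Ck_dirP n U f : Ck n.+1 U f <-> contOn U f /\ forall b k, exists g,
  (forall z, U z -> is_real_deriv f (dir b k) z (g z)) /\ Ck n U g.
Proof.
split=> [[cf h]|[cf h]]; (split; first exact: cf).
  by move=> b k; have [fx [fy [h1 h2 h3 h4]]] := h k; case: b; [exists fx | exists fy].
move=> k; have [fx [h1 h2]] := h true k; have [fy [h3 h4]] := h false k.
by exists fx, fy.
Qed.

Lemma Ck_sub n U V f : V `<=` U -> Ck n U f -> Ck n V f.
Proof.
move=> VU; elim: n f => [|n IH] f; first by move=> /Ck0P h; apply/Ck0P => z /VU; exact: h.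
move=> /Ck_dirP[cf h]; apply/Ck_dirP; split; first by move=> z /VU; exact: cf.
move=> b k; have [g [h1 h2]] := h b k; exists g; split; last exact: IH.
by move=> z /VU; exact: h1.
Qed.

Lemma Ck_ext n U f g : open U -> {in U, f =1 g} -> Ck n U f -> Ck n U g.
Proof.
move=> oU fg; case: n => [|n]; first by move=> /Ck0P h; apply/Ck0P; exact: (contOn_ext oU fg h).
move=> /Ck_dirP[cf h]; apply/Ck_dirP; split; first exact: (contOn_ext oU fg cf).
move=> b k; have [f' [h1 h2]] := h b k; exists f'; split=> // z Uz.
exact: (isd_ext oU Uz fg (h1 z Uz)).
Qed.

Lemma CkS n U f : Ck n.+1 U f -> Ck n U f.
Proof.
elim: n f => [|n IH] f; first by move=> /Ck_cont h; apply/Ck0P.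
move=> /Ck_dirP[cf h]; apply/Ck_dirP; split; first exact: cf.
move=> b k; by have [g [h1 h2]] := h b k; exists g; split=> //; exact: IH.
Qed.

Lemma Ck_isd n U f b k z : Ck n.+1 U f -> U z ->
  is_real_deriv f (dir b k) z (real_deriv (dir b k) f z).
Proof. by move=> /Ck_dirP[_ /(_ b k)[g [h _]]] /h[h1 h2]; split. Qed.

Lemma Ck_deriv n U f b k : open U -> Ck n.+1 U f -> Ck n U (real_deriv (dir b k) f).
Proof.
move=> oU /Ck_dirP[_ /(_ b k)[g [h hg]]]; apply: Ck_ext oU _ hg => z.
by rewrite inE => /h[_ ->].
Qed.

(** [Ck] asks for some partial derivatives on [U]; on an open set the function [real_deriv] is
    always a valid witness, hence a canonical one. *)
Lemma CkSP n U f : open U -> Ck n.+1 U f <-> contOn U f /\ forall b k,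
  (forall z, U z -> is_real_deriv f (dir b k) z (real_deriv (dir b k) f z)) /\
  Ck n U (real_deriv (dir b k) f).
Proof.
move=> oU; split=> [h|[cf h]].
  split; first exact: Ck_cont h.
  by move=> b k; split; [move=> z; exact: Ck_isd h | exact: Ck_deriv].
apply/Ck_dirP; split; first exact: cf.
by move=> b k; have [h1 h2] := h b k; exists (real_deriv (dir b k) f).
Qed.

(** The witnesses of the local hypotheses are unrelated to each other, whereas [real_deriv] is
    defined everywhere and is a witness on each of the neighbourhoods. *)
Lemma Ck_local n U f : open U ->
  (forall z, U z -> exists V, [/\ open V, V z & Ck n V f]) -> Ck n U f.
Proof.
move=> oU; elim: n f => [|n IH] f h.
  by apply/Ck0P => z Uz; have [V [oV Vz /Ck0P cV]] := h z Uz; exact: cV.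
apply/CkSP => //; split.
  by move=> z Uz; have [V [oV Vz /Ck_cont cV]] := h z Uz; exact: cV.
move=> b k; split; first by move=> z Uz; have [V [oV Vz cV]] := h z Uz; exact: Ck_isd cV Vz.
by apply: IH => z Uz; have [V [oV Vz cV]] := h z Uz; exists V; split=> //; exact: Ck_deriv.
Qed.

Lemma CkD n U f g : Ck n U f -> Ck n U g -> Ck n U (f \+ g).
Proof.
elim: n f g => [|n IH] f g.
  by move=> /Ck0P h /Ck0P h'; apply/Ck0P; exact: contOnD.
move=> /Ck_dirP[cf hf] /Ck_dirP[cg hg]; apply/Ck_dirP; split; first exact: contOnD.
move=> b k; have [f' [h1 h2]] := hf b k; have [g' [h3 h4]] := hg b k.
exists (f' \+ g'); split; last exact: IH.
by move=> z Uz; apply: isdD; [exact: h1 | exact: h3].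
Qed.

Lemma CkM n U f g : Ck n U f -> Ck n U g -> Ck n U (f \* g).
Proof.
elim: n f g => [|n IH] f g.
  by move=> /Ck0P h /Ck0P h'; apply/Ck0P; exact: contOnM.
move=> Hf Hg; have /Ck_dirP[cf hf] := Hf; have /Ck_dirP[cg hg] := Hg.
apply/Ck_dirP; split; first exact: contOnM.
move=> b k; have [f' [h1 h2]] := hf b k; have [g' [h3 h4]] := hg b k.
exists ((f' \* g) \+ (f \* g')); split; last first.
  by apply: CkD; apply: IH => //; exact: CkS.
by move=> z Uz; apply: isdM; [exact: h1 | exact: h3].
Qed.

Lemma CkJ n U f : Ck n U f -> Ck n U (fun z => (f z)^*%C).
Proof.
elim: n f => [|n IH] f.
  by move=> /Ck0P h; apply/Ck0P; exact: contOnJ.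
move=> /Ck_dirP[cf hf]; apply/Ck_dirP; split; first exact: contOnJ.
move=> b k; have [f' [h1 h2]] := hf b k; exists (fun z => (f' z)^*%C).
by split; [move=> z /h1; exact: isdJ | exact: IH].
Qed.

Lemma Ck_cst n U (c : cplx R) : Ck n U (fun=> c).
Proof.
elim: n c => [|n IH] c; first by apply/Ck0P => z _; exact: cst_continuous.
apply/Ck_dirP; split; first by move=> z _; exact: cst_continuous.
by move=> b k; exists (fun=> 0); split=> // z _; exact: isd_cst.
Qed.

Lemma coord_cont k z : {for z, continuous (fun w : cspace R d => w 0 k : cplx R)}.
Proof. by apply/continuousP_eps => e e0; exists e => // w; exact. Qed.

Lemma Ck_coord n U k : Ck n U (fun w : cspace R d => w 0 k : cplx R).
Proof.
case: n => [|n]; first by apply/Ck0P => z _; exact: coord_cont.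
apply/Ck_dirP; split; first by move=> z _; exact: coord_cont.
move=> b l; exists (fun=> dir b l 0 k); split; last exact: Ck_cst.
by move=> z _; exact: isd_coord.
Qed.

Lemma CkN n U f : Ck n U f -> Ck n U (fun z => - f z).
Proof.
move=> h; have -> : (fun z => - f z) = (fun=> -1 : cplx R) \* f.
  by apply/funext => z /=; rewrite mulN1r.
by apply: CkM => //; exact: Ck_cst.
Qed.

Lemma CkV n U f : (forall z, U z -> f z != 0) -> Ck n U f -> Ck n U (fun z => (f z)^-1).
Proof.
move=> f0; elim: n => [|n IH].
  by move=> /Ck0P h; apply/Ck0P; exact: contOnV.
move=> Hf; have /Ck_dirP[cf hf] := Hf; apply/Ck_dirP; split; first exact: contOnV.
move=> b k; have [f' [h1 h2]] := hf b k.
exists ((fun z => - f' z) \* ((fun z => (f z)^-1) \* (fun z => (f z)^-1))).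
split; last first.
  apply: CkM; first exact: CkN.
  by apply: CkM; apply: IH; exact: CkS.
move=> z Uz /=; rewrite -invfM -expr2; apply: isdV; first exact: f0.
exact: h1.
Qed.

Lemma Ck_sum n U (I : Type) (s : seq I) (P : pred I) (F : I -> cspace R d -> cplx R) :
  (forall i, P i -> Ck n U (F i)) -> Ck n U (fun z => \sum_(i <- s | P i) F i z).
Proof.
move=> h; elim: s => [|i s IH].
  have -> : (fun z => \sum_(i <- [::] | P i) F i z) = (fun=> 0).
    by apply/funext => z; rewrite big_nil.
  exact: Ck_cst.
have [Pi|Pi] := boolP (P i); last first.
  have -> : (fun z => \sum_(i <- i :: s | P i) F i z) = (fun z => \sum_(i <- s | P i) F i z).
    by apply/funext => z; rewrite big_cons (negbTE Pi).
  exact: IH.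
have -> : (fun z => \sum_(i <- i :: s | P i) F i z) = F i \+ (fun z => \sum_(i <- s | P i) F i z).
  by apply/funext => z; rewrite big_cons Pi.
by apply: CkD => //; exact: h.
Qed.

Lemma Ck_prod n U (I : Type) (s : seq I) (P : pred I) (F : I -> cspace R d -> cplx R) :
  (forall i, P i -> Ck n U (F i)) -> Ck n U (fun z => \prod_(i <- s | P i) F i z).
Proof.
move=> h; elim: s => [|i s IH].
  have -> : (fun z => \prod_(i <- [::] | P i) F i z) = (fun=> 1).
    by apply/funext => z; rewrite big_nil.
  exact: Ck_cst.
have [Pi|Pi] := boolP (P i); last first.
  have -> : (fun z => \prod_(i <- i :: s | P i) F i z) = (fun z => \prod_(i <- s | P i) F i z).
    by apply/funext => z; rewrite big_cons (negbTE Pi).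
  exact: IH.
have -> : (fun z => \prod_(i <- i :: s | P i) F i z) = F i \* (fun z => \prod_(i <- s | P i) F i z).
  by apply/funext => z; rewrite big_cons Pi.
by apply: CkM => //; exact: h.
Qed.

End Smooth.

(** * Mean value estimates and the symmetry of mixed derivatives *)

Section MeanValue.
Variable R : realType.

Lemma is_derive_shift0 (u : R -> R) (a c : R) :
  is_derive a (1 : R) u c <-> is_derive (0 : R) (1 : R) (fun t => u (a + t)) c.
Proof.
split=> /is_derive_eps h; apply/is_derive_eps => e /h[r r0 hr]; exists r => // t /hr;
  by rewrite add0r addr0.
Qed.

Lemma mvt0 (u du : R -> R) (t : R) :
  (forall s, `|s| <= `|t| -> is_derive s (1 : R) u (du s)) ->
  exists2 s, `|s| <= `|t| & u t - u 0 = du s * t.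
Proof.
move=> h.
have cu (a b : R) : (forall x, x \in `[a, b] -> is_derive x (1 : R) u (du x)) -> {within `[a, b], continuous u}.
  by move=> hd; apply: derivable_within_continuous => x /hd[].
have [t0|t0|<-] := ltgtP 0 t; last by exists 0 => //; rewrite subrr mulr0.
  have hd x : x \in `[0, t] -> is_derive x (1 : R) u (du x).
    rewrite in_itv /= => /andP[x0 xt]; apply: h; rewrite !ger0_norm//; exact: ltW.
  have [s] := @MVT_segment R u du 0 t (ltW t0) (fun x xI => hd x (subset_itv_oo_cc xI)) (cu 0 t hd).
  rewrite in_itv /= subr0 => /andP[s0 st] E; exists s => //.
  by rewrite !ger0_norm// ltW.
have hd x : x \in `[t, 0] -> is_derive x (1 : R) u (du x).
  rewrite in_itv /= => /andP[x0 xt]; apply: h; rewrite !ler0_norm ?lerN2//; exact: ltW.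
have [s] := @MVT_segment R u du t 0 (ltW t0) (fun x xI => hd x (subset_itv_oo_cc xI)) (cu t 0 hd).
rewrite in_itv /= sub0r => /andP[s0 st] E; exists s.
  by rewrite !ler0_norm ?lerN2// ltW.
by rewrite -[LHS]opprB E mulrN opprK.
Qed.

(** The real mean value theorem is applied to the real and to the imaginary part, at two different
    intermediate points; hence the factor 2. *)
Lemma mvt_cder (u : R -> R[i]) (du : R -> R[i]) (c : R[i]) (t e : R) :
  (forall s : R, `|s| <= `|t| -> cder (fun x => u (s + x)) (du s)) ->
  (forall s : R, `|s| <= `|t| -> normc (du s - c) <= e) ->
  normc (u t - u 0 - t%:C%C * c) <= 2 * e * `|t|.
Proof.
move=> h he.
have [s1 hs1 E1] := @mvt0 (fun s => complex.Re (u s)) (fun s => complex.Re (du s)) t (fun s hs =>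
  (is_derive_shift0 (fun s => complex.Re (u s)) s _).2 (proj1 ((cderP _ _).1 (h s hs)))).
have [s2 hs2 E2] := @mvt0 (fun s => complex.Im (u s)) (fun s => complex.Im (du s)) t (fun s hs =>
  (is_derive_shift0 (fun s => complex.Im (u s)) s _).2 (proj2 ((cderP _ _).1 (h s hs)))).
apply: le_trans (normc_le _) _.
have -> : complex.Re (u t - u 0 - t%:C%C * c) = (complex.Re (du s1 - c)) * t.
  rewrite -[t in RHS]/(t) (_ : complex.Re (du s1 - c) * t = complex.Re (du s1) * t - complex.Re c * t); last first.
    by case: (du s1) (c) => ? ? [? ?] /=; ring.
  by rewrite -E1; case: (u t) (u 0) (c) => ? ? [? ?] [? ?] /=; ring.
have -> : complex.Im (u t - u 0 - t%:C%C * c) = (complex.Im (du s2 - c)) * t.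
  rewrite -[t in RHS]/(t) (_ : complex.Im (du s2 - c) * t = complex.Im (du s2) * t - complex.Im c * t); last first.
    by case: (du s2) (c) => ? ? [? ?] /=; ring.
  by rewrite -E2; case: (u t) (u 0) (c) => ? ? [? ?] [? ?] /=; ring.
rewrite !normrM -mulrDl ler_wpM2r// mulr_natl mulr2n lerD//.
  exact: le_trans (normc_Re _) (he _ hs1).
exact: le_trans (normc_Im _) (he _ hs2).
Qed.

(** The second difference p(h,h) - p(h,0) - p(0,h) + p(0,0) is h^2 times a value of either mixed
    derivative at a point near the origin, and both are continuous there. *)
Lemma schwarz_real (p ps pt pst pts : R -> R -> R) (r : R) : 0 < r ->
  (forall s t, `|s| < r -> `|t| < r -> is_derive s (1 : R) (p ^~ t) (ps s t)) ->
  (forall s t, `|s| < r -> `|t| < r -> is_derive t (1 : R) (p s) (pt s t)) ->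
  (forall s t, `|s| < r -> `|t| < r -> is_derive t (1 : R) (ps s) (pst s t)) ->
  (forall s t, `|s| < r -> `|t| < r -> is_derive s (1 : R) (pt ^~ t) (pts s t)) ->
  (forall e : R, 0 < e -> exists2 r' : R, 0 < r' & forall s t, `|s| < r' -> `|t| < r' ->
     `|pst s t - pst 0 0| < e /\ `|pts s t - pts 0 0| < e) ->
  pst 0 0 = pts 0 0.
Proof.
move=> r0 h1 h2 h3 h4 hc; apply/eqP; rewrite -subr_eq0 -normr_le0; apply/ler_addgt0Pl => e e0.
rewrite addr0.
have [r' r'0 hr'] := hc (e / 2) (divr_gt0 e0 (ltr0Sn _ 1)).
pose h : R := Num.min r r' / 2.
have m0 : 0 < Num.min r r' by rewrite lt_min r0.
have h0 : 0 < h by rewrite divr_gt0.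
have hm : h < Num.min r r' by rewrite ltr_pdivrMr// ltr_pMr// ltr1n.
have hr (s : R) : `|s| <= `|h| -> `|s| < r /\ `|s| < r'.
  rewrite (ger0_norm (ltW h0)) => sh; apply/andP; rewrite -lt_min; exact: le_lt_trans hm.
have hh := hr h (lexx _); have h0r : `|0 : R| < r by rewrite normr0.
have [s1 /hr hs1 E1] := @mvt0 (fun s => p s h - p s 0) (fun s => ps s h - ps s 0) h
  (fun s hs => is_deriveB (h1 s h (hr s hs).1 hh.1) (h1 s 0 (hr s hs).1 h0r)).
have [t1 /hr ht1 E2] := @mvt0 (fun t => ps s1 t) (fun t => pst s1 t) h
  (fun t ht => h3 s1 t hs1.1 (hr t ht).1).
have [t2 /hr ht2 E3] := @mvt0 (fun t => p h t - p 0 t) (fun t => pt h t - pt 0 t) h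
  (fun t ht => is_deriveB (h2 h t hh.1 (hr t ht).1) (h2 0 t h0r (hr t ht).1)).
have [s2 /hr hs2 E4] := @mvt0 (fun s => pt s t2) (fun s => pts s t2) h
  (fun s hs => h4 s t2 (hr s hs).1 ht2.1).
have E : pst s1 t1 = pts s2 t2.
  have hn : h * h != 0 by rewrite mulf_neq0// gt_eqF.
  apply: (mulIf hn); rewrite /= in E1 E2 E3 E4.
  have -> : pst s1 t1 * (h * h) = p h h - p h 0 - (p 0 h - p 0 0) by rewrite mulrA -E2 -E1.
  have -> : pts s2 t2 * (h * h) = p h h - p 0 h - (p h 0 - p 0 0) by rewrite mulrA -E4 -E3.
  ring.
have [a1 _] := hr' s1 t1 hs1.2 ht1.2; have [_ a2] := hr' s2 t2 hs2.2 ht2.2.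
rewrite (_ : pst 0 0 - pts 0 0 = - (pst s1 t1 - pst 0 0) + (pts s2 t2 - pts 0 0)); last by rewrite E; ring.
apply: le_trans (ler_normD _ _) _; rewrite normrN (splitr e); apply: lerD; exact: ltW.
Qed.

End MeanValue.

(** * The real differential and the chain rule *)

Section Differential.
Variables (R : realType) (d : nat).
Implicit Types (U V : set (cspace R d)) (f g : cspace R d -> cplx R) (z w v : cspace R d).

(** The real differential of [f], written in the basis dz_k, dzbar_k so that holomorphic maps act
    without mixing the two kinds of terms. *)
Definition Dif f z (h : 'I_d -> R[i]) : R[i] :=
  \sum_k (h k * pd_z k f z + (h k)^*%C * pd_zbar k f z).

Lemma DifE f z h : Dif f z h = \sum_k
  ((complex.Re (h k))%:C%C * real_deriv (dir R true k) f z +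
   (complex.Im (h k))%:C%C * real_deriv (dir R false k) f z).
Proof.
apply: eq_bigr => k _; rewrite /pd_z /pd_zbar /dir.
set a := real_deriv _ _ _; set b := real_deriv _ _ _.
have E : 2%:R^-1 * (2 : R[i]) = 1 by rewrite mulVf// pnatr_eq0.
have -> : h k * (2%:R^-1 * (a - 'i%C * b)) + (h k)^*%C * (2%:R^-1 * (a + 'i%C * b)) =
  2%:R^-1 * (h k + (h k)^*%C) * a + 2%:R^-1 * ((h k)^*%C - h k) * 'i%C * b by ring.
rewrite addcJ mulrA E mul1r; congr (_ + _ * b).
by rewrite ImJ_sub; congr (_ * _); rewrite mulrC.
Qed.

Lemma DifZ f z h (c : R) : Dif f z (fun k => c%:C%C * h k) = c%:C%C * Dif f z h.
Proof.
rewrite /Dif big_distrr /=; apply: eq_bigr => k _.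
have -> : (c%:C%C * h k)^*%C = c%:C%C * (h k)^*%C by rewrite rmorphM /= oppr0.
ring.
Qed.

Lemma DifD f z h h' : Dif f z (fun k => h k + h' k) = Dif f z h + Dif f z h'.
Proof.
by rewrite /Dif -big_split /=; apply: eq_bigr => k _; rewrite rmorphD /=; ring.
Qed.

Lemma Dif_bound f z : exists2 M : R, 0 < M & forall h, normc (Dif f z h) <= M * \sum_k normc (h k).
Proof.
pose M := \sum_k (normc (pd_z k f z) + normc (pd_zbar k f z)).
exists (M + 1).
  by rewrite ltr_wpDl// sumr_ge0// => k _; rewrite addr_ge0// normc_ge0.
move=> h; apply: le_trans (normc_sum _ _ _) _; rewrite big_distrr /=; apply: ler_sum => k _.
apply: le_trans (le_normcD _ _) _.
rewrite (normcM (h k)) (normcM (h k)^*%C) normcJ' -mulrDr mulrC ler_wpM2r ?normc_ge0//.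
apply: (@le_trans _ _ M); last by rewrite lerDl.
by rewrite /M (bigD1 k)//= lerDl sumr_ge0// => i _; rewrite addr_ge0 ?normc_ge0.
Qed.

(** A displacement made of successive steps along real coordinate directions; the list structure
    gives an induction that moves one coordinate at a time. *)
Definition walk (t : bool * 'I_d -> R) (s : seq (bool * 'I_d)) : cspace R d :=
  \sum_(j <- s) ((t j)%:C%C : R[i]) *: dir R j.1 j.2.

Lemma normc_dir b (k l : 'I_d) : normc (dir R b k 0 l : R[i]) <= 1.
Proof.
have h (x : bool) : normc (x%:R : R[i]) <= 1.
  by case: x; rewrite ?normc1 ?normc0.
case: b; rewrite /= /dir_x /dir_y !mxE /=; first exact: h.
by rewrite normcM (_ : normc 'i%C = 1) ?mul1r ?h//= expr0n add0r expr1n sqrtr1.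
Qed.

Lemma walk_coord t s l : normc (walk t s 0 l) <= \sum_(j <- s) `|t j|.
Proof.
rewrite /walk summxE; apply: le_trans (normc_sum _ _ _) _; apply: ler_sum => j _.
by rewrite mxE normcM normc_real ler_piMr// normc_dir.
Qed.

(** Along one step a single real coordinate moves, so the mean value estimate applies to the partial
    derivative in this direction; the errors add up along the list. *)
Lemma walk_estimate U f z (e : R) : open U -> U z -> Ck 1 U f -> 0 < e ->
  exists2 r : R, 0 < r & forall t s, \sum_(j <- s) `|t j| < r ->
   normc (f (z + walk t s) - f z - \sum_(j <- s) (t j)%:C%C * real_deriv (dir R j.1 j.2) f z)
     <= e * \sum_(j <- s) `|t j|.
Proof.
move=> oU Uz Cf e0.
have e20 : 0 < e / 2 by rewrite divr_gt0.
have H (j : bool * 'I_d) : exists r : R, 0 < r /\ forall w, box z r w ->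
    U w /\ normc (real_deriv (dir R j.1 j.2) f w - real_deriv (dir R j.1 j.2) f z) < e / 2.
  have /Ck_cont/(_ z Uz)/continuousP_eps/(_ _ e20)[r1 r10 h1] := Ck_deriv j.1 j.2 oU Cf.
  have [r2 r20 h2] := open_box oU Uz.
  exists (Num.min r1 r2); split; first by rewrite lt_min r10.
  move=> w hw; split.
    by apply: h2 => k; have := hw k; rewrite lt_min => /andP[].
  by apply: h1 => k; have := hw k; rewrite lt_min => /andP[].
have [r hr] := choice H.
exists (\big[Order.min/1]_j r j).
  by apply/bigmin_gtP; split=> [|j _]; [exact: ltr01 | case: (hr j)].
move=> t s; elim: s => [|j s IH] hs.
  by rewrite !big_nil /walk big_nil addr0 subrr sub0r oppr0 normc0 mulr0.
move: hs; rewrite /walk !big_cons -/(walk t s) => hs.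
have hs' : \sum_(j <- s) `|t j| < \big[Order.min/1]_j r j.
  by apply: le_lt_trans hs; rewrite lerDr.
have {}IH := IH hs'.
set D := _ *: _; set c := real_deriv _ _ _; set S := \sum_(_ <- _) _ in IH *.
have -> : f (z + (D + walk t s)) - f z - ((t j)%:C%C * c + S) =
  (f (line (z + walk t s) (dir R j.1 j.2) (t j)) - f (line (z + walk t s) (dir R j.1 j.2) 0) - (t j)%:C%C * c)
  + (f (z + walk t s) - f z - S).
  have -> : line (z + walk t s) (dir R j.1 j.2) (t j) = z + (D + walk t s).
    by rewrite /line -addrA [X in z + X]addrC.
  rewrite line0; ring.
apply: le_trans (le_normcD _ _) _; rewrite mulrDr; apply: lerD => //.
have -> : e * `|t j| = 2 * (e / 2) * `|t j| by field.
have [r0 hrj] := hr j.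
have inb x : `|x| <= `|t j| -> box z (r j) (line (z + walk t s) (dir R j.1 j.2) x).
  move=> xt l; move: hs => /bigmin_gtP[_ /(_ j isT)]; apply: le_lt_trans.
  rewrite /line !mxE -addrA addrAC subrr add0r.
  rewrite [in X in _ <= X]addrC; apply: le_trans (le_normcD _ _) _; apply: lerD; first exact: walk_coord.
  by rewrite normcM normc_real; apply: le_trans xt; rewrite ler_piMr// normc_dir.
apply: (@mvt_cder R (fun x => f (line (z + walk t s) (dir R j.1 j.2) x))
  (fun x => real_deriv (dir R j.1 j.2) f (line (z + walk t s) (dir R j.1 j.2) x)) c (t j) (e / 2)) => x /inb /hrj[Ux hx].
  have /isdP := Ck_isd j.1 j.2 Cf Ux; apply: cder_ext ltr01 _ => y _.
  by rewrite line_shift.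
exact: ltW.
Qed.

Lemma differential U f z (e : R) : open U -> U z -> Ck 1 U f -> 0 < e ->
  exists2 r : R, 0 < r & forall w, box z r w ->
   normc (f w - f z - Dif f z (fun k => w 0 k - z 0 k)) <= e * \sum_k normc (w 0 k - z 0 k).
Proof.
move=> oU Uz Cf e0.
have [r r0 hr] := walk_estimate oU Uz Cf (divr_gt0 e0 (ltr0Sn _ 1)).
(* Each of the d coordinates contributes a real and an imaginary step, so the length of the walk is
   at most 2 d times this radius; the added 1 makes the bound strict and covers d = 0. *)
exists (r / (2 * d%:R + 1)).
  by rewrite divr_gt0// ltr_wpDl// mulr_ge0.
move=> w hw; pose h k := w 0 k - z 0 k.
pose t (j : bool * 'I_d) := if j.1 then complex.Re (h j.2) else complex.Im (h j.2).
pose s := [seq (b, k) | b <- [:: true; false], k <- enum 'I_d].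
have sumE (M : zmodType) (F : bool * 'I_d -> M) : \sum_(j <- s) F j = \sum_k (F (true, k) + F (false, k)).
  by rewrite /s big_allpairs_dep !big_cons big_nil /= addr0 !big_enum -big_split.
have hsum : \sum_(j <- s) `|t j| <= 2 * \sum_k normc (h k).
  rewrite sumE big_distrr /=; apply: ler_sum => k _; rewrite /t /= mulr_natl mulr2n lerD//.
    exact: normc_Re.
  exact: normc_Im.
have wE : w = z + walk t s.
  apply/rowP => l; rewrite mxE /walk sumE summxE (bigD1 l)//= big1 ?addr0.
    rewrite /t /= /dir_x /dir_y !mxE /= eqxx mulr1 mulrC [_ * 1]mulr1.
    by rewrite -complexE /h addrC subrK.
  move=> k kl; rewrite /t /= /dir_x /dir_y !mxE /= eq_sym (negbTE kl).
  by rewrite !mulr0 addr0.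
have := hr t s; rewrite -wE => /(_ _) h1.
have E : Dif f z (fun k => w 0 k - z 0 k) = \sum_(j <- s) (t j)%:C%C * real_deriv (dir R j.1 j.2) f z.
  by rewrite DifE sumE.
rewrite E; apply: le_trans (h1 _) _.
  apply: le_lt_trans hsum _.
  apply: (@le_lt_trans _ _ (2 * \sum_(k < d) (r / (2 * d%:R + 1)))).
    by rewrite ler_wpM2l//; apply: ler_sum => k _; apply: ltW; exact: hw.
  have D0 : 0 < 2 * d%:R + 1 :> R by rewrite ltr_wpDl// mulr_ge0.
  rewrite sumr_const card_ord -[X in _ * X]mulr_natl.
  have -> : 2 * (d%:R * (r / (2 * d%:R + 1))) = r * (2 * d%:R / (2 * d%:R + 1)) by ring.
  by rewrite gtr_pMr// ltr_pdivrMr// mul1r ltrDl.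
apply: le_trans (ler_wpM2l _ hsum) _; first by rewrite divr_ge0// ltW.
by rewrite mulrA divfK.
Qed.

Lemma chain_cder U f (g : R -> cspace R d) (c : 'I_d -> R[i]) :
  open U -> U (g 0) -> Ck 1 U f -> (forall k, cder (fun t => g t 0 k) (c k)) ->
  cder (fun t => f (g t)) (Dif f (g 0) c).
Proof.
move=> oU Ug Cf hg e e0.
(* For small t the increment of [g] is at most K |t|, where each added 1 accounts for the remainder
   of one coordinate. The error then consists of the remainder of [f] on this increment and of the
   differential of [f] on the remainder of [g], with e/2 for each. *)
pose K := \sum_k (normc (c k) + 1) + 1.
have K0 : 0 < K by rewrite ltr_wpDl// sumr_ge0// => k _; rewrite addr_ge0// normc_ge0.
have [M M0 hM] := Dif_bound f (g 0).
have [r r0 hr] := differential oU Ug Cf (divr_gt0 e0 (mulr_gt0 (ltr0Sn _ 1) K0)).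
pose e' := Num.min 1 (e / (2 * M * (d%:R + 1))).
have D0 : 0 < (d%:R + 1 : R) by rewrite ltr_wpDl.
have e'0 : 0 < e' by rewrite lt_min ltr01 divr_gt0// !mulr_gt0.
have H k : exists x : R, 0 < x /\ forall t : R, `|t| < x ->
    normc (g t 0 k - g 0 0 k) < r /\ normc (g t 0 k - g 0 0 k - t%:C%C * c k) <= e' * `|t|.
  have [r1 r10 h1] := cder_cts (hg k) r0; have [r2 r20 h2] := hg k _ e'0.
  exists (Num.min r1 r2); split; first by rewrite lt_min r10.
  by move=> t; rewrite lt_min => /andP[/h1 ? /h2].
have [x hx] := choice H.
exists (\big[Order.min/1]_k x k).
  by apply/bigmin_gtP; split=> [|j _]; [exact: ltr01 | case: (hx j)].
move=> t /bigmin_gtP[_ ht].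
have ht1 k : normc (g t 0 k - g 0 0 k) < r by have [_ h] := hx k; have [] := h t (ht k isT).
have ht2 k : normc (g t 0 k - g 0 0 k - t%:C%C * c k) <= e' * `|t|.
  by have [_ h] := hx k; have [] := h t (ht k isT).
have ht3 k : normc (g t 0 k - g 0 0 k) <= (normc (c k) + 1) * `|t|.
  rewrite -[g t 0 k - g 0 0 k](subrK (t%:C%C * c k)); apply: le_trans (le_normcD _ _) _.
  rewrite normcM normc_real mulrDl mul1r addrC [normc _ * _]mulrC lerD2l.
  by apply: le_trans (ht2 k) _; rewrite ler_piMl ?normr_ge0// /e' ge_min lexx.
pose h k := g t 0 k - g 0 0 k.
have -> : f (g t) - f (g 0) - t%:C%C * Dif f (g 0) c =
  (f (g t) - f (g 0) - Dif f (g 0) h) + Dif f (g 0) (fun k => h k - t%:C%C * c k).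
  have -> : Dif f (g 0) h = Dif f (g 0) (fun k => h k - t%:C%C * c k) + t%:C%C * Dif f (g 0) c.
    by rewrite -DifZ -DifD; congr Dif; apply/funext => k; rewrite subrK.
  ring.
apply: le_trans (le_normcD _ _) _; rewrite (splitr e) mulrDl; apply: lerD.
  apply: le_trans (hr _ ht1) _; rewrite -/h.
  apply: (@le_trans _ _ (e / (2 * K) * (K * `|t|))).
    rewrite ler_wpM2l ?divr_ge0 ?mulr_ge0 ?(ltW e0) ?(ltW K0)//.
    rewrite /K mulrDl mul1r big_distrl /= ler_wpDr//; apply: ler_sum => k _; exact: ht3.
  by rewrite mulrA le_eqVlt; apply/orP; left; apply/eqP; congr (_ * _); field; rewrite gt_eqF.
apply: le_trans (hM _) _.
apply: (@le_trans _ _ (M * (d%:R * (e' * `|t|)))).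
  rewrite ler_wpM2l ?(ltW M0)//; apply: (@le_trans _ _ (\sum_(k < d) (e' * `|t|))).
    by apply: ler_sum => k _; exact: ht2.
  by rewrite sumr_const card_ord mulr_natl.
rewrite !mulrA ler_wpM2r//.
apply: (@le_trans _ _ (M * d%:R * (e / (2 * M * (d%:R + 1))))).
  by rewrite ler_wpM2l ?mulr_ge0 ?(ltW M0)// /e' ge_min lexx orbT.
have -> : M * d%:R * (e / (2 * M * (d%:R + 1))) = e / 2 * (d%:R / (d%:R + 1)).
  by field; rewrite !gt_eqF.
by rewrite ger_pMr ?divr_gt0// ler_pdivrMr// mul1r lerDl.
Qed.

(** The function is restricted to the real plane through [z] spanned by the two directions, and the
    real statement is applied to its real and imaginary parts. *)
Lemma schwarz U f z b k b' k' : open U -> U z -> Ck 2 U f ->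
  real_deriv (dir R b k) (real_deriv (dir R b' k') f) z =
  real_deriv (dir R b' k') (real_deriv (dir R b k) f) z.
Proof.
move=> oU Uz Cf; set v := dir R b k; set w := dir R b' k'.
have C1 := CkS Cf.
pose L s t := line (line z v s) w t.
have LC s t : L s t = line (line z w t) v s by rewrite /L /line addrAC.
have Lz s t l : L s t 0 l - z 0 l = s%:C%C * v 0 l + t%:C%C * w 0 l.
  by rewrite /L /line; move: (v) (w) => v0 w0; rewrite !mxE; ring.
have [r r0 hr] : exists2 r : R, 0 < r & forall s t : R, `|s| < r -> `|t| < r -> U (L s t).
  have [r1 r10 h1] := open_box oU Uz.
  exists (r1 / 2); first by rewrite divr_gt0.
  move=> s t hs ht; apply: h1 => l; rewrite Lz.
  apply: le_lt_trans (le_normcD _ _) _; rewrite !normcM !normc_real (splitr r1).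
  by apply: ltrD; [apply: le_lt_trans hs | apply: le_lt_trans ht]; rewrite ler_piMr// normc_dir.
have cts (F : cspace R d -> cplx R) : contOn U F -> forall e : R, 0 < e -> exists2 r : R, 0 < r &
    forall s t : R, `|s| < r -> `|t| < r -> normc (F (L s t) - F z) < e.
  move=> /(_ z Uz)/continuousP_eps h e /h[r1 r10 h1]; exists (r1 / 2); first by rewrite divr_gt0.
  move=> s t hs ht; apply: h1 => l; rewrite Lz.
  apply: le_lt_trans (le_normcD _ _) _; rewrite !normcM !normc_real (splitr r1).
  by apply: ltrD; [apply: le_lt_trans hs | apply: le_lt_trans ht]; rewrite ler_piMr// normc_dir.
have dv F s t b1 k1 : Ck 1 U F -> `|s| < r -> `|t| < r ->
   cder (fun x => F (line (L s t) (dir R b1 k1) x)) (real_deriv (dir R b1 k1) F (L s t)).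
  by move=> CF hs ht; apply/isdP; apply: Ck_isd CF _; exact: hr.
have Lw s t x : line (L s t) w x = L s (t + x) by rewrite /L line_shift.
have Lv s t x : line (L s t) v x = L (s + x) t by rewrite !LC line_shift.
have L00 : L 0 0 = z by rewrite /L !line0.
have C1v := Ck_deriv b k oU Cf; have C1w := Ck_deriv b' k' oU Cf.
have c1 := cts _ (Ck_cont (Ck_deriv b' k' oU C1v)).
have c2 := cts _ (Ck_cont (Ck_deriv b k oU C1w)).
have cc (P : R[i] -> R) : (forall x y, `|P x - P y| <= normc (x - y)) ->
  forall e : R, 0 < e -> exists2 r' : R, 0 < r' & forall s t, `|s| < r' -> `|t| < r' ->
   `|P (real_deriv w (real_deriv v f) (L s t)) - P (real_deriv w (real_deriv v f) (L 0 0))| < e /\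
   `|P (real_deriv v (real_deriv w f) (L s t)) - P (real_deriv v (real_deriv w f) (L 0 0))| < e.
  move=> hP e e0; have [r1 r10 h1] := c1 e e0; have [r2 r20 h2] := c2 e e0.
  exists (Num.min r1 r2); first by rewrite lt_min r10.
  move=> s t; rewrite !lt_min => /andP[s1 s2] /andP[t1 t2]; rewrite L00.
  by split; apply: le_lt_trans (hP _ _) _; [exact: h1 | exact: h2].
have Pre (x y : R[i]) : `|complex.Re x - complex.Re y| <= normc (x - y).
  have -> : complex.Re x - complex.Re y = complex.Re (x - y) by case: x y => ? ? [].
  exact: normc_Re.
have Pim (x y : R[i]) : `|complex.Im x - complex.Im y| <= normc (x - y).
  have -> : complex.Im x - complex.Im y = complex.Im (x - y) by case: x y => ? ? [].
  exact: normc_Im.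
have dvw F s t : Ck 1 U F -> `|s| < r -> `|t| < r ->
   cder (fun x => F (L s (t + x))) (real_deriv w F (L s t)).
  move=> CF hs ht; have := dv F s t b' k' CF hs ht; apply: cder_ext ltr01 _ => x _.
  by rewrite -Lw.
have dvv F s t : Ck 1 U F -> `|s| < r -> `|t| < r ->
   cder (fun x => F (L (s + x) t)) (real_deriv v F (L s t)).
  move=> CF hs ht; have := dv F s t b k CF hs ht; apply: cder_ext ltr01 _ => x _.
  by rewrite -Lv.
rewrite -/v -/w in C1v C1w c1 c2 *.
clear LC dv Lw Lv Lz hr cts; clearbody L v w.
have key (P : R[i] -> R) : (forall x y, `|P x - P y| <= normc (x - y)) ->
    (forall u c, cder u c -> is_derive (0 : R) (1 : R) (fun t => P (u t)) (P c)) ->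
    P (real_deriv w (real_deriv v f) (L 0 0)) = P (real_deriv v (real_deriv w f) (L 0 0)).
  move=> hP hd.
  have dw F s t : Ck 1 U F -> `|s| < r -> `|t| < r ->
     is_derive t (1 : R) (fun t => P (F (L s t))) (P (real_deriv w F (L s t))).
    move=> CF hs ht; apply: (proj2 (is_derive_shift0 (fun t => P (F (L s t))) t _)).
    exact: hd _ _ (dvw F s t CF hs ht).
  have dv' F s t : Ck 1 U F -> `|s| < r -> `|t| < r ->
     is_derive s (1 : R) (fun s => P (F (L s t))) (P (real_deriv v F (L s t))).
    move=> CF hs ht; apply: (proj2 (is_derive_shift0 (fun s => P (F (L s t))) s _)).
    exact: hd _ _ (dvv F s t CF hs ht).
  exact: (@schwarz_real R (fun s t => P (f (L s t)))
    (fun s t => P (real_deriv v f (L s t))) (fun s t => P (real_deriv w f (L s t)))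
    (fun s t => P (real_deriv w (real_deriv v f) (L s t)))
    (fun s t => P (real_deriv v (real_deriv w f) (L s t))) r r0
    (fun s t => dv' f s t C1) (fun s t => dw f s t C1)
    (fun s t => dw _ s t C1v) (fun s t => dv' _ s t C1w) (cc P hP)).
suff : real_deriv w (real_deriv v f) (L 0 0) = real_deriv v (real_deriv w f) (L 0 0).
  by rewrite L00 => ->.
apply/eqP; rewrite eq_complex; apply/andP; split; apply/eqP.
  by apply: (key _ Pre) => u c /cderP[].
by apply: (key _ Pim) => u c /cderP[].
Qed.

End Differential.

(** * Wirtinger derivatives, holomorphic functions and changes of variables *)

Section WirtingerRules.
Variables (R : realType) (d : nat).
Implicit Types (U V : set (cspace R d)) (f g : cspace R d -> cplx R) (z w v : cspace R d) (k l : 'I_d).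

(* [wdir 'i] is d/dzbar_k and [wdir (- 'i)] is d/dz_k. *)
Definition wdir (c : R[i]) k f z : R[i] :=
  2%:R^-1 * (real_deriv (dir R true k) f z + c * real_deriv (dir R false k) f z).

Lemma pd_zbarE k f : pd_zbar k f = wdir 'i%C k f.
Proof. by []. Qed.

Lemma pd_zE k f : pd_z k f = wdir (- 'i%C) k f.
Proof. by apply/funext => z; rewrite /pd_z /wdir mulNr. Qed.

Local Opaque real_deriv dir.

Lemma wdir_isd c k f z a b : is_real_deriv f (dir R true k) z a ->
  is_real_deriv f (dir R false k) z b -> wdir c k f z = 2%:R^-1 * (a + c * b).
Proof. by move=> [_ <-] [_ <-]. Qed.

Lemma wdir_ext c k U f g z : open U -> U z -> Ck 1 U f -> {in U, f =1 g} ->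
  wdir c k f z = wdir c k g z.
Proof.
move=> oU Uz Cf fg; symmetry; apply: wdir_isd; apply: (isd_ext oU Uz fg);
  exact: Ck_isd Cf Uz.
Qed.

Lemma wdirD c k U f g z : U z -> Ck 1 U f -> Ck 1 U g ->
  wdir c k (f \+ g) z = wdir c k f z + wdir c k g z.
Proof.
move=> Uz Cf Cg.
rewrite (wdir_isd c (isdD (Ck_isd true k Cf Uz) (Ck_isd true k Cg Uz)) (isdD (Ck_isd false k Cf Uz) (Ck_isd false k Cg Uz))).
have E (t x y x' y' : R[i]) : t * ((x + y) + c * (x' + y')) = t * (x + c * x') + t * (y + c * y') by ring.
exact: E.
Qed.

Lemma wdirM c k U f g z : U z -> Ck 1 U f -> Ck 1 U g ->
  wdir c k (f \* g) z = wdir c k f z * g z + f z * wdir c k g z.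
Proof.
move=> Uz Cf Cg.
rewrite (wdir_isd c (isdM (Ck_isd true k Cf Uz) (Ck_isd true k Cg Uz)) (isdM (Ck_isd false k Cf Uz) (Ck_isd false k Cg Uz))).
have E (t x y x' y' F G : R[i]) : t * ((x * G + F * y) + c * (x' * G + F * y')) =
  t * (x + c * x') * G + F * (t * (y + c * y')) by ring.
exact: E.
Qed.

Lemma wdir_cst c k (a : R[i]) z : wdir c k (fun=> a : cplx R) z = 0.
Proof. by rewrite (wdir_isd c (isd_cst a _ z) (isd_cst a _ z)) mulr0 addr0 mulr0. Qed.

Lemma wdirZ c k U f (a : R[i]) z : U z -> Ck 1 U f ->
  wdir c k (fun z => a * f z) z = a * wdir c k f z.
Proof.
move=> Uz Cf; rewrite (wdirM c k Uz (Ck_cst 1 U (a : cplx R)) Cf).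
by rewrite wdir_cst mul0r add0r.
Qed.

Lemma wdirJ c k U f z : U z -> Ck 1 U f ->
  wdir c k (fun z => (f z)^*%C) z = (wdir (c^*%C) k f z)^*%C.
Proof.
move=> Uz Cf; rewrite (wdir_isd c (isdJ (Ck_isd true k Cf Uz)) (isdJ (Ck_isd false k Cf Uz))).
rewrite /wdir; set a := real_deriv _ _ _; set b := real_deriv _ _ _.
have -> : (2%:R^-1 * (a + c^*%C * b))^*%C = (2%:R^-1)^*%C * (a^*%C + (c^*%C)^*%C * b^*%C) :> R[i].
  by rewrite (rmorphM conjc) (rmorphD conjc) (rmorphM conjc).
by rewrite conjcK conjc_inv conjc_nat.
Qed.

Lemma wdir_sum c k U (I : Type) (s : seq I) (P : pred I) (F : I -> cspace R d -> cplx R) z :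
  U z -> (forall i, P i -> Ck 1 U (F i)) ->
  wdir c k (fun z => \sum_(i <- s | P i) F i z) z = \sum_(i <- s | P i) wdir c k (F i) z.
Proof.
move=> Uz h; elim: s => [|i s IH].
  rewrite big_nil (_ : (fun z => _) = (fun=> 0)) ?wdir_cst//.
  by apply/funext => x; rewrite big_nil.
rewrite big_cons; have [Pi|Pi] := boolP (P i); last first.
  have -> : (fun z => \sum_(j <- i :: s | P j) F j z) = (fun z => \sum_(j <- s | P j) F j z).
    by apply/funext => x; rewrite big_cons (negbTE Pi).
  exact: IH.
have -> : (fun z => \sum_(i <- i :: s | P i) F i z) = F i \+ (fun z => \sum_(i <- s | P i) F i z).
  by apply/funext => x; rewrite big_cons Pi.
rewrite (wdirD c k Uz (h i Pi) _) ?IH//.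
exact: Ck_sum.
Qed.

Lemma Ck_wdir n c k U f : open U -> Ck n.+1 U f -> Ck n U (wdir c k f).
Proof.
move=> oU Cf.
have C (b : bool) : Ck n U (real_deriv (dir R b k) f) by exact: Ck_deriv.
exact: CkM (Ck_cst n U (2%:R^-1 : cplx R)) (CkD (C true) (CkM (Ck_cst n U (c : cplx R)) (C false))).
Qed.

Lemma wdirC c k c' l U f z : open U -> U z -> Ck 2 U f ->
  wdir c k (wdir c' l f) z = wdir c' l (wdir c k f) z.
Proof.
move=> oU Uz Cf.
have E a m b j : real_deriv (dir R b j) (wdir a m f) z =
   2%:R^-1 * (real_deriv (dir R b j) (real_deriv (dir R true m) f) z + a * real_deriv (dir R b j) (real_deriv (dir R false m) f) z).
  have C (b' : bool) := Ck_isd b j (Ck_deriv b' m oU Cf) Uz.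
  have := isdM (isd_cst (2%:R^-1 : cplx R) (dir R b j) z) (isdD (C true) (isdM (isd_cst a (dir R b j) z) (C false))).
  move=> [_]; rewrite !mul0r !add0r => <-; congr real_deriv.
rewrite {1}/wdir [RHS]/wdir !E.
have G (t x y x' y' X Y X' Y' : R[i]) : x = X -> y = Y -> x' = X' -> y' = Y' ->
  t * (t * (x + c' * y) + c * (t * (x' + c' * y'))) =
  t * (t * (X + c * X') + c' * (t * (Y + c * Y'))) by move=> -> -> -> ->; ring.
apply: G.
- exact: (schwarz true k true l oU Uz Cf).
- exact: (schwarz true k false l oU Uz Cf).
- exact: (schwarz false k true l oU Uz Cf).
- exact: (schwarz false k false l oU Uz Cf).
Qed.

Lemma smooth_ext U f g : open U -> {in U, f =1 g} -> smooth U f -> smooth U g.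
Proof. by move=> oU fg h n; apply: Ck_ext oU fg _; exact: h. Qed.

Lemma smooth_sub U V f : V `<=` U -> smooth U f -> smooth V f.
Proof. by move=> VU h n; apply: Ck_sub VU _; exact: h. Qed.

Lemma smoothD U f g : smooth U f -> smooth U g -> smooth U (f \+ g).
Proof. by move=> hf hg n; apply: CkD; [exact: hf | exact: hg]. Qed.

Lemma smoothM U f g : smooth U f -> smooth U g -> smooth U (f \* g).
Proof. by move=> hf hg n; apply: CkM; [exact: hf | exact: hg]. Qed.

Lemma smoothJ U f : smooth U f -> smooth U (fun z => (f z)^*%C).
Proof. by move=> hf n; exact: CkJ. Qed.

Lemma smooth_cst U (a : cplx R) : smooth U (fun=> a).
Proof. by move=> n; exact: Ck_cst. Qed.

Lemma smoothZ U (a : R[i]) f : smooth U f -> smooth U (fun z => a * f z).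
Proof. by move=> hf; apply: smoothM hf; exact: smooth_cst. Qed.

Lemma smooth_sum U (I : Type) (s : seq I) (P : pred I) (F : I -> cspace R d -> cplx R) :
  (forall i, P i -> smooth U (F i)) -> smooth U (fun z => \sum_(i <- s | P i) F i z).
Proof. by move=> h n; apply: Ck_sum => i Pi; exact: h. Qed.

Lemma smooth_local U f : open U ->
  (forall z, U z -> exists V, [/\ open V, V z & smooth V f]) -> smooth U f.
Proof.
move=> oU h n; apply: Ck_local => // z /h[V [oV Vz sV]]; exists V. by split; [exact: oV | exact: Vz | exact: sV].
Qed.

Lemma smooth_wdir c k U f : open U -> smooth U f -> smooth U (wdir c k f).
Proof. by move=> oU h n; apply: Ck_wdir => //; exact: h. Qed.

Lemma holomorphic_ext U f g : open U -> {in U, f =1 g} -> holomorphic U f -> holomorphic U g.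
Proof.
move=> oU fg [sf hf]; split; first exact: smooth_ext fg sf.
by move=> k z Uz; rewrite pd_zbarE -(wdir_ext _ _ oU Uz (sf 1) fg) -pd_zbarE; exact: hf.
Qed.

Lemma holomorphic_sub U V f : V `<=` U -> holomorphic U f -> holomorphic V f.
Proof.
by move=> VU [sf hf]; split; [exact: smooth_sub sf | move=> k z /VU; exact: hf].
Qed.

Lemma holomorphic_local U f : open U ->
  (forall z, U z -> exists V, [/\ open V, V z & holomorphic V f]) -> holomorphic U f.
Proof.
move=> oU h; split.
  by apply: smooth_local => // z /h[V [oV Vz [sV _]]]; exists V; split.
by move=> k z /h[V [oV Vz [_ hV]]]; exact: hV.
Qed.

Lemma holomorphicD U f g : holomorphic U f -> holomorphic U g -> holomorphic U (f \+ g).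
Proof.
move=> [sf hf] [sg hg]; split; first exact: smoothD.
by move=> k z Uz; rewrite pd_zbarE (wdirD _ _ Uz (sf 1) (sg 1)) -!pd_zbarE hf// hg// addr0.
Qed.

Lemma holomorphicM U f g : holomorphic U f -> holomorphic U g -> holomorphic U (f \* g).
Proof.
move=> [sf hf] [sg hg]; split; first exact: smoothM.
by move=> k z Uz; rewrite pd_zbarE (wdirM _ _ Uz (sf 1) (sg 1)) -!pd_zbarE hf// hg// mul0r mulr0 addr0.
Qed.

Lemma holomorphic_cst U (a : cplx R) : holomorphic U (fun=> a).
Proof. by split; [exact: smooth_cst | move=> k z _; rewrite pd_zbarE wdir_cst]. Qed.

Lemma holomorphicZ U (a : R[i]) f : holomorphic U f -> holomorphic U (fun z => a * f z).
Proof. by move=> hf; apply: holomorphicM hf; exact: holomorphic_cst. Qed.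

Lemma holomorphic_sum U (I : Type) (s : seq I) (P : pred I) (F : I -> cspace R d -> cplx R) :
  (forall i, P i -> holomorphic U (F i)) -> holomorphic U (fun z => \sum_(i <- s | P i) F i z).
Proof.
move=> h; split; first by apply: smooth_sum => i /h[].
move=> k z Uz; rewrite pd_zbarE (wdir_sum _ _ _ Uz) => [|i /h[s1 _]]; last exact: s1.
by rewrite big1// => i /h[_ h1]; rewrite -pd_zbarE h1.
Qed.

Lemma holomorphic_prod U (I : Type) (s : seq I) (P : pred I) (F : I -> cspace R d -> cplx R) :
  (forall i, P i -> holomorphic U (F i)) -> holomorphic U (fun z => \prod_(i <- s | P i) F i z).
Proof.
move=> h; elim: s => [|i s IH].
  have -> : (fun z => \prod_(i <- [::] | P i) F i z) = (fun=> 1).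
    by apply/funext => z; rewrite big_nil.
  exact: holomorphic_cst.
have [Pi|Pi] := boolP (P i); last first.
  have -> : (fun z => \prod_(i <- i :: s | P i) F i z) = (fun z => \prod_(i <- s | P i) F i z).
    by apply/funext => z; rewrite big_cons (negbTE Pi).
  exact: IH.
have -> : (fun z => \prod_(i <- i :: s | P i) F i z) = F i \* (fun z => \prod_(i <- s | P i) F i z).
  by apply/funext => z; rewrite big_cons Pi.
by apply: holomorphicM => //; exact: h.
Qed.

(** d/dzbar_l commutes with d/dz_k, which is then applied to a function vanishing on an open set. *)
Lemma holomorphic_pd_z k U f : open U -> holomorphic U f -> holomorphic U (pd_z k f).
Proof.
move=> oU [sf hf]; rewrite pd_zE; split; first exact: smooth_wdir.
move=> l z Uz; rewrite pd_zbarE (wdirC _ _ _ _ oU Uz (sf 2)).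
have E : {in U, (fun=> 0 : cplx R) =1 wdir 'i%C l f}.
  by move=> x; rewrite inE => Ux; rewrite -pd_zbarE hf.
by rewrite -(wdir_ext _ _ oU Uz (Ck_cst 1 U 0) E) wdir_cst.
Qed.

Section Composition.
Variables (U V : set (cspace R d)) (T : cspace R d -> cspace R d).
Hypotheses (oU : open U) (oV : open V) (TV : forall z, U z -> V (T z)).

Lemma isd_comp f b k z : Ck 1 V f -> (forall l, Ck 1 U (fun z => T z 0 l)) -> U z ->
  is_real_deriv (f \o T) (dir R b k) z
    (Dif f (T z) (fun l => real_deriv (dir R b k) (fun z => T z 0 l) z)).
Proof.
move=> Cf CT Uz; apply/isdP.
have := @chain_cder R d V f (fun t => T (line z (dir R b k) t)) (fun l => real_deriv (dir R b k) (fun z => T z 0 l) z) oV.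
rewrite line0 => /(_ (TV Uz) Cf); apply => l.
exact: (proj1 (@isdP R d (fun z => T z 0 l) _ _ _) (Ck_isd b k (CT l) Uz)).
Qed.

Lemma contOn_comp f : contOn V f -> (forall l, contOn U (fun z => T z 0 l)) -> contOn U (f \o T).
Proof.
move=> cf cT z Uz; apply/continuousP_eps => e e0.
have /continuousP_eps/(_ e e0)[r r0 hr] := cf _ (TV Uz).
have H l : exists x : R, 0 < x /\ forall w, box z x w -> normc (T w 0 l - T z 0 l) < r.
  by have /continuousP_eps/(_ r r0)[x x0 hx] := cT l z Uz; exists x.
have [x hx] := choice H.
exists (\big[Order.min/1]_l x l).
  by apply/bigmin_gtP; split=> [|l _]; [exact: ltr01 | case: (hx l)].
move=> w hw; apply: hr => l; have [_] := hx l; apply => m.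
by have /bigmin_gtP[_ /(_ l isT)] := hw m.
Qed.

Lemma Ck_comp n f : Ck n V f -> (forall l, Ck n U (fun z => T z 0 l)) -> Ck n U (f \o T).
Proof.
elim: n f => [|n IH] f.
  move=> /Ck0P cf cT; apply/Ck0P; apply: contOn_comp cf _ => l; apply/Ck0P; exact: cT.
move=> Cf CT; apply/Ck_dirP; split.
  by apply: (contOn_comp (Ck_cont Cf)) => l; exact: Ck_cont (CT l).
have C1 m h W : Ck m.+1 W h -> Ck 1 W h.
  by elim: m h => // m IHm h /CkS; exact: IHm.
move=> b k; exists (fun z => Dif f (T z) (fun l => real_deriv (dir R b k) (fun z => T z 0 l) z)).
split; first by move=> z Uz; exact: (isd_comp b k (C1 _ _ _ _ _ Cf) (fun l => C1 _ _ _ _ _ (CT l)) Uz).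
apply: Ck_sum => l _.
have CTn m : Ck n U (fun z => T z 0 m) by exact: CkS.
have Cd : Ck n U (real_deriv (dir R b k) (fun z => T z 0 l)) by exact: Ck_deriv.
have Cz : Ck n U (pd_z l f \o T) by apply: IH => //; rewrite pd_zE; exact: Ck_wdir.
have Czb : Ck n U (pd_zbar l f \o T) by apply: IH => //; exact: Ck_wdir.
exact: CkD (CkM Cd Cz) (CkM (CkJ Cd) Czb).
Qed.

Lemma smooth_comp f : smooth V f -> (forall l, smooth U (fun z => T z 0 l)) -> smooth U (f \o T).
Proof. by move=> sf sT n; apply: Ck_comp => [|l]; [exact: sf | exact: sT]. Qed.

Hypothesis hT : forall l, holomorphic U (fun z => T z 0 l).

(** The differential of [f] is applied to the derivatives of the coordinates of [T]; conjugating
    such a coordinate turns [c] into its conjugate. For c = 'i or - 'i and holomorphic [T], one of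
    the two kinds of terms vanishes. *)
Lemma wdir_comp c f k z : Ck 1 V f -> U z ->
  wdir c k (f \o T) z = \sum_l (wdir c k (fun z => T z 0 l) z * pd_z l f (T z) +
     (wdir (c^*%C) k (fun z => T z 0 l) z)^*%C * pd_zbar l f (T z)).
Proof.
move=> Cf Uz; have CT l : Ck 1 U (fun z => T z 0 l) by have [sT _] := hT l; exact: sT.
rewrite (wdir_isd c (isd_comp true k Cf CT Uz) (isd_comp false k Cf CT Uz)) /Dif.
rewrite [c * _]big_distrr -big_split [_ * _]big_distrr /=; apply: eq_bigr => l _.
rewrite /wdir; set a := real_deriv _ _ _; set b := real_deriv _ _ _.
have -> : (2%:R^-1 * (a + c^*%C * b))^*%C = (2%:R^-1)^*%C * (a^*%C + (c^*%C)^*%C * b^*%C) :> R[i].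
  by rewrite (rmorphM conjc) (rmorphD conjc) (rmorphM conjc).
rewrite conjcK conjc_inv conjc_nat.
have G (t x y p q : R[i]) x' y' : t * (x * p + x' * q + c * (y * p + y' * q)) =
  t * (x + c * y) * p + t * (x' + c * y') * q by ring.
exact: G.
Qed.

Lemma pd_zbar_comp f k z : Ck 1 V f -> U z ->
  pd_zbar k (f \o T) z = \sum_l (pd_z k (fun z => T z 0 l) z)^*%C * pd_zbar l f (T z).
Proof.
move=> Cf Uz; rewrite pd_zbarE wdir_comp//; apply: eq_bigr => l _.
rewrite -pd_zbarE (proj2 (hT l))// mul0r add0r pd_zE.
by congr ((wdir _ _ _ _)^*%C * _); apply/eqP; rewrite eq_complex /= oppr0 !eqxx.
Qed.

Lemma pd_z_comp f k z : Ck 1 V f -> U z ->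
  pd_z k (f \o T) z = \sum_l (pd_z k (fun z => T z 0 l) z * pd_z l f (T z)).
Proof.
move=> Cf Uz; rewrite pd_zE wdir_comp//; apply: eq_bigr => l _.
rewrite [X in X^*%C](_ : _ = pd_zbar k (fun z => T z 0 l) z); last first.
  by rewrite pd_zbarE; congr wdir; apply/eqP; rewrite eq_complex /= opprK oppr0 !eqxx.
by rewrite (proj2 (hT l))// conjc0 mul0r addr0 -pd_zE.
Qed.

Lemma holomorphic_comp f : holomorphic V f -> holomorphic U (f \o T).
Proof.
move=> [sf hf]; split; first by apply: smooth_comp => // l; case: (hT l).
by move=> k z Uz; rewrite pd_zbar_comp// big1// => l _; rewrite hf ?mulr0//; exact: TV.
Qed.

End Composition.

End WirtingerRules.

(** * The Cauchy transform *)

Section RealIntegral.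
Variables (R : realType) (a : R).
Hypothesis a0 : 0 < a.
Implicit Types u v : R -> R.

Definition rint u : R := (\int[@lebesgue_measure R]_(x in `[0, a]) u x)%R.

Lemma integrable_rint u : continuous u ->
  (@lebesgue_measure R).-integrable `[0, a] (EFin \o u).
Proof.
move=> cu; apply: continuous_compact_integrable; first exact: segment_compact.
exact: continuous_subspaceT.
Qed.

Lemma rintD u v : continuous u -> continuous v ->
  rint (fun x => u x + v x) = rint u + rint v.
Proof. by move=> cu cv; apply: RintegralD => //; exact: integrable_rint. Qed.

Lemma rintZ u (c : R) : continuous u -> rint (fun x => c * u x) = c * rint u.
Proof. by move=> cu; apply: RintegralZl => //; exact: integrable_rint. Qed.

Lemma rint_bound u (M : R) : continuous u ->
  (forall x, 0 <= x <= a -> `|u x| <= M) -> `|rint u| <= M * a.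
Proof.
move=> cu hM; apply: le_trans (le_normr_Rintegral _ (integrable_rint cu)) _ => //.
have -> : M * a = \int[@lebesgue_measure R]_(x in `[0, a]) M.
  have E : lebesgue_measure `[0 : R, a] = a%:E by rewrite lebesgue_measure_itv /= lte_fin a0 EFinN sube0.
  rewrite Rintegral_cst//; congr (_ * _); exact: (congr1 fine (esym E)).
apply: le_Rintegral => //.
- apply: (@integrable_rint (fun x => `|u x|)) => x.
  by apply: (@continuous_comp _ _ _ u Num.norm); [exact: cu | exact: norm_continuous].
- by apply: integrable_rint => x; exact: cst_continuous.
Qed.

Lemma rint_FTC u v : (forall x, is_derive x (1 : R) v (u x)) -> continuous u ->
  rint u = v a - v 0.
Proof.
move=> hd cu; rewrite /rint /Rintegral.
have dv (x : R) : derivable v x 1 by have [] := hd x.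
have cv : continuous v by move=> x; apply/differentiable_continuous/derivable1_diffP.
rewrite (@continuous_FTC2 _ u v 0 a a0) //.
- exact: continuous_subspaceT.
- split=> //.
  + exact/cvg_at_right_filter/cv.
  + exact/cvg_at_left_filter/cv.
- by move=> x _; rewrite derive1E; exact: (@derive_val _ _ _ _ _ _ _ (hd x)).
Qed.

End RealIntegral.

(** * Complex-valued and iterated integrals *)

Section ComplexIntegral.
Variable R : realType.
Implicit Types (u v : R -> R[i]) (a : R).

Definition ccont u := forall x (e : R), 0 < e -> exists2 r : R, 0 < r &
  forall y, `|y - x| < r -> normc (u y - u x) < e.

Lemma ccont_re u : ccont u -> continuous (fun x => complex.Re (u x)).
Proof.
move=> cu x; apply/cvgrPdist_lt => e e0; have [r r0 hr] := cu x e e0.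
exists r => // y; rewrite /ball_ /= distrC => /hr; rewrite distrC; apply: le_lt_trans.
have -> : complex.Re (u y) - complex.Re (u x) = complex.Re (u y - u x).
  by case: (u y) (u x) => ? ? [].
exact: normc_Re.
Qed.

Lemma ccont_im u : ccont u -> continuous (fun x => complex.Im (u x)).
Proof.
move=> cu x; apply/cvgrPdist_lt => e e0; have [r r0 hr] := cu x e e0.
exists r => // y; rewrite /ball_ /= distrC => /hr; rewrite distrC; apply: le_lt_trans.
have -> : complex.Im (u y) - complex.Im (u x) = complex.Im (u y - u x).
  by case: (u y) (u x) => ? ? [].
exact: normc_Im.
Qed.

Lemma ccontD u v : ccont u -> ccont v -> ccont (fun x => u x + v x).
Proof.
move=> cu cv x e e0; have e20 : 0 < e / 2 by rewrite divr_gt0.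
have [r r0 hr] := cu x _ e20; have [r' r'0 hr'] := cv x _ e20.
exists (Num.min r r'); first by rewrite lt_min r0.
move=> y; rewrite lt_min => /andP[/hr h1 /hr' h2].
rewrite opprD addrACA (splitr e); apply: le_lt_trans (le_normcD _ _) _; exact: ltrD.
Qed.

Lemma ccont_cst (c : R[i]) : ccont (fun=> c).
Proof. by move=> x e e0; exists 1 => // y _; rewrite subrr normc0. Qed.

Lemma ccontM u v : ccont u -> ccont v -> ccont (fun x => u x * v x).
Proof.
move=> cu cv x e e0.
pose K := normc (u x) + normc (v x) + 1; have K0 : 0 < K by rewrite ltr_wpDl// addr_ge0 ?normc_ge0.
pose e' := Num.min 1 (e / (2 * K)).
have e'0 : 0 < e' by rewrite lt_min ltr01 divr_gt0// mulr_gt0.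
have [r r0 hr] := cu x _ e'0; have [r' r'0 hr'] := cv x _ e'0.
exists (Num.min r r'); first by rewrite lt_min r0.
move=> y; rewrite lt_min => /andP[/hr h1 /hr' h2].
have -> : u y * v y - u x * v x = (u y - u x) * (v y - v x) + ((u y - u x) * v x + u x * (v y - v x)) by ring.
apply: le_lt_trans (le_normcD _ _) _; apply: le_lt_trans (lerD (lexx _) (le_normcD _ _)) _.
rewrite !normcM.
have h1' : normc (u y - u x) < 1 by apply: lt_le_trans h1 _; rewrite ge_min lexx.
have h3 : e' * K <= e / 2.
  have -> : e / 2 = e / (2 * K) * K by field; rewrite gt_eqF.
  by rewrite ler_wpM2r ?(ltW K0)// ge_min lexx orbT.
apply: (@le_lt_trans _ _ (e' * K)); last by apply: le_lt_trans h3 _; rewrite ltr_pdivrMr// ltr_pMr// ltr1n.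
have A := normc_ge0 (u y - u x); have B := normc_ge0 (v y - v x); have C := normc_ge0 (u x); have D := normc_ge0 (v x).
rewrite /K; set p := normc (u y - u x) in A h1 h1' *; set q := normc (v y - v x) in B h2 *.
set s := normc (u x) in C *; set t := normc (v x) in D *.
have : p * q <= e' by apply: le_trans (ltW h2); rewrite ler_piMl// ltW.
have : p * t <= e' * t by rewrite ler_wpM2r// ltW.
have : s * q <= e' * s by rewrite mulrC ler_wpM2r// ltW.
rewrite !mulrDr mulr1; lra.
Qed.

Lemma ccontB u v : ccont u -> ccont v -> ccont (fun x => u x - v x).
Proof.
move=> cu cv; have -> : (fun x => u x - v x) = (fun x => u x + (-1) * v x).
  by apply/funext => x; rewrite mulN1r.
by apply: ccontD => //; apply: ccontM => //; exact: ccont_cst.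
Qed.

Lemma cder_ccont u (du : R -> R[i]) : (forall x, cder (fun t => u (x + t)) (du x)) -> ccont u.
Proof.
move=> h x e e0; have [r r0 hr] := cder_cts (h x) e0; exists r => // y /hr.
by rewrite addr0 addrCA subrr addr0.
Qed.

Definition cint a u : R[i] :=
  (rint a (fun x => complex.Re (u x)) +i* rint a (fun x => complex.Im (u x)))%C.

Lemma cintD a u v : 0 < a -> ccont u -> ccont v ->
  cint a (fun x => u x + v x) = cint a u + cint a v.
Proof.
move=> a0 cu cv; apply/eqP; rewrite eq_complex /=; apply/andP; split; apply/eqP.
  rewrite -rintD//; [|exact: ccont_re|exact: ccont_re].
  by congr rint; apply/funext => x; case: (u x) (v x) => ? ? [].
rewrite -rintD//; [|exact: ccont_im|exact: ccont_im].
by congr rint; apply/funext => x; case: (u x) (v x) => ? ? [].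
Qed.

Lemma cintZ a u (c : R[i]) : 0 < a -> ccont u -> cint a (fun x => c * u x) = c * cint a u.
Proof.
move=> a0 cu.
have c1 (k : R) : continuous (fun x => k * complex.Re (u x)).
  by move=> x; apply: continuousM; [exact: cst_continuous | exact: ccont_re].
have c2 (k : R) : continuous (fun x => k * complex.Im (u x)).
  by move=> x; apply: continuousM; [exact: cst_continuous | exact: ccont_im].
have E : c = (complex.Re c +i* complex.Im c)%C by case: (c).
rewrite [in RHS]E; apply/eqP; rewrite eq_complex /=; apply/andP; split; apply/eqP.
  rewrite -mulNr -!rintZ//; [|exact: ccont_im|exact: ccont_re].
  rewrite -rintD//.
  by congr rint; apply/funext => x; case: (c) (u x) => ? ? [? ?] /=; rewrite mulNr.
rewrite -!rintZ//; [|exact: ccont_re|exact: ccont_im].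
rewrite -rintD//; congr rint; apply/funext => x.
by case: (c) (u x) => ? ? [? ?] /=; rewrite addrC [X in X + _]mulrC [X in _ + X]mulrC mulrC [X in _ + X]mulrC.
Qed.

Lemma cintB a u v : 0 < a -> ccont u -> ccont v ->
  cint a (fun x => u x - v x) = cint a u - cint a v.
Proof.
move=> a0 cu cv; have -> : (fun x => u x - v x) = (fun x => u x + (-1) * v x).
  by apply/funext => x; rewrite mulN1r.
rewrite cintD//; last by apply: ccontM => //; exact: ccont_cst.
by rewrite cintZ// mulN1r.
Qed.

(** Real and imaginary parts are bounded separately, which costs a factor 2. *)
Lemma cint_bound a u (M : R) : 0 < a -> ccont u ->
  (forall x, 0 <= x <= a -> normc (u x) <= M) -> normc (cint a u) <= 2 * a * M.
Proof.
move=> a0 cu hM; apply: le_trans (normc_le _) _ => /=.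
have -> : 2 * a * M = M * a + M * a by ring.
apply: lerD; apply: rint_bound => //; try exact: ccont_re; try exact: ccont_im.
  by move=> x /hM; apply: le_trans; exact: normc_Re.
by move=> x /hM; apply: le_trans; exact: normc_Im.
Qed.

Lemma cint_FTC a u v : 0 < a -> (forall x, cder (fun t => v (x + t)) (u x)) -> ccont u ->
  cint a u = v a - v 0.
Proof.
move=> a0 hd cu; have E : v a - v 0 = ((complex.Re (v a) - complex.Re (v 0)) +i* (complex.Im (v a) - complex.Im (v 0)))%C.
  by case: (v a) (v 0) => ? ? [].
rewrite E /cint.
have d1 x : is_derive x (1 : R) (fun x => complex.Re (v x)) (complex.Re (u x)).
  apply: (proj2 (@is_derive_shift0 R (fun x => complex.Re (v x)) x _)).
  by have /cderP[] := hd x.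
have d2 x : is_derive x (1 : R) (fun x => complex.Im (v x)) (complex.Im (u x)).
  apply: (proj2 (@is_derive_shift0 R (fun x => complex.Im (v x)) x _)).
  by have /cderP[] := hd x.
by rewrite (rint_FTC a0 d1 (ccont_re cu)) (rint_FTC a0 d2 (ccont_im cu)).
Qed.

Definition dint a b (P : R -> R -> R[i]) : R[i] := cint a (fun r => cint b (P r)).

(** Continuity in the inner variable, and in the outer one uniformly in the inner: enough for the
    inner integral to be continuous, so that iterated integrals involve neither joint measurability
    nor Fubini's theorem. *)
Definition dcont (P : R -> R -> R[i]) := (forall r, ccont (P r)) /\
  forall r (e : R), 0 < e -> exists2 x : R, 0 < x &
    forall r', `|r' - r| < x -> forall t, normc (P r' t - P r t) <= e.

Lemma dint_inner b P : 0 < b -> dcont P -> ccont (fun r => cint b (P r)).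
Proof.
move=> b0 [c1 c2] r e e0.
have e'0 : 0 < e / (2 * (2 * b)) by rewrite divr_gt0// !mulr_gt0.
have [x x0 hx] := c2 r _ e'0; exists x => // r' /hx h.
rewrite -cintB//; apply: (@le_lt_trans _ _ (2 * b * (e / (2 * (2 * b))))).
  by apply: cint_bound => //; exact: ccontB.
have -> : 2 * b * (e / (2 * (2 * b))) = e / 2 by field; rewrite gt_eqF.
by rewrite ltr_pdivrMr// ltr_pMr// ltr1n.
Qed.

Lemma dcontD P Q : dcont P -> dcont Q -> dcont (fun r t => P r t + Q r t).
Proof.
move=> [p1 p2] [q1 q2]; split; first by move=> r; exact: ccontD.
move=> r e e0; have e20 : 0 < e / 2 by rewrite divr_gt0.
have [x x0 hx] := p2 r _ e20; have [y y0 hy] := q2 r _ e20.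
exists (Num.min x y); first by rewrite lt_min x0.
move=> r'; rewrite lt_min => /andP[/hx h1 /hy h2] t.
rewrite opprD addrACA (splitr e); apply: le_trans (le_normcD _ _) _; exact: lerD.
Qed.

Lemma dcontZ (c : R[i]) P : dcont P -> dcont (fun r t => c * P r t).
Proof.
move=> [p1 p2]; split; first by move=> r; apply: ccontM => //; exact: ccont_cst.
move=> r e e0; have K0 : 0 < normc c + 1 by rewrite ltr_wpDl// normc_ge0.
have [x x0 hx] := p2 r _ (divr_gt0 e0 K0).
exists x => // r' /hx h t; rewrite -mulrBr normcM.
apply: le_trans (ler_wpM2l (normc_ge0 c) (h t)) _.
by rewrite mulrCA ger_pMr// ler_pdivrMr// mul1r lerDl.
Qed.

Lemma dintD a b P Q : 0 < a -> 0 < b -> dcont P -> dcont Q ->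
  dint a b (fun r t => P r t + Q r t) = dint a b P + dint a b Q.
Proof.
move=> a0 b0 hP hQ; rewrite /dint -cintD//; try exact: dint_inner.
by congr cint; apply/funext => r; rewrite cintD//; [exact: (hP.1) | exact: (hQ.1)].
Qed.

Lemma dintZ a b (c : R[i]) P : 0 < a -> 0 < b -> dcont P ->
  dint a b (fun r t => c * P r t) = c * dint a b P.
Proof.
move=> a0 b0 hP; rewrite /dint -cintZ//; try exact: dint_inner.
by congr cint; apply/funext => r; rewrite cintZ//; exact: (hP.1).
Qed.

Lemma dint_bound a b P (M : R) : 0 < a -> 0 < b -> dcont P ->
  (forall r t, normc (P r t) <= M) -> normc (dint a b P) <= 2 * a * (2 * b * M).
Proof.
move=> a0 b0 hP hM; apply: cint_bound => //; first exact: dint_inner.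
by move=> r _; apply: cint_bound => //; exact: (hP.1).
Qed.

End ComplexIntegral.

(** * Compact boxes and uniform continuity *)

Section CompactBoxes.
Variables (R : realType) (d : nat).
Implicit Types (z w p : cspace R d) (f : cspace R d -> cplx R).

(** A product of squares rather than of discs: a square is the image of a product of two real
    segments, hence compact. Open polydiscs and these boxes are nested up to a factor above 2. *)
Definition cbox p (B : R) : set (cspace R d) :=
  [set z | forall k, `|complex.Re (z 0 k - p 0 k : R[i])| <= B /\ `|complex.Im (z 0 k - p 0 k : R[i])| <= B].

Lemma complex_of_pair_continuous :
  continuous (fun q : R * R => ((q.1 +i* q.2)%C : cplx R)).
Proof.
move=> q; apply/cvgrPdist_lt => e e0.
have eE : e = (complex.Re e)%:C%C by rewrite RRe_real// gtr0_real.
have e'0 : 0 < complex.Re e by move: e0; rewrite eE ltcR.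
exists (ball q.1 (complex.Re e / 2), ball q.2 (complex.Re e / 2)) => /=.
  by split; apply: nbhsx_ballx; rewrite divr_gt0.
move=> [x y] [/= bx by_]; rewrite normcE' eE ltcR.
apply: le_lt_trans (normc_le _) _; rewrite (splitr (complex.Re e)) /=.
move: bx by_; rewrite -!ball_normE /= => bx by_; exact: ltrD.
Qed.

Lemma compact_square (c : R[i]) (B : R) :
  compact ([set x | `|complex.Re (x - c)| <= B /\ `|complex.Im (x - c)| <= B] : set (cplx R)).
Proof.
have -> : ([set x | `|complex.Re (x - c)| <= B /\ `|complex.Im (x - c)| <= B] : set (cplx R)) =
  (fun q : R * R => ((q.1 +i* q.2)%C : cplx R)) @`
   (`[complex.Re c - B, complex.Re c + B] `*` `[complex.Im c - B, complex.Im c + B]).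
  apply/seteqP; split=> [x [h1 h2]|_ [[x y] [/= h1 h2] <-]].
    exists (complex.Re x, complex.Im x); last by case: (x).
    move: h1 h2; case: (x) (c) => x1 x2 [c1 c2] /=; rewrite !in_itv /= !ler_distl.
    by [].
  move: h1 h2; case: (c) => c1 c2 /=; rewrite !in_itv /= -!ler_distl.
  by [].
apply: continuous_compact; last by apply: compact_setX; exact: segment_compact.
apply: continuous_subspaceT; exact: complex_of_pair_continuous.
Qed.

Lemma compact_cbox p B : compact (cbox p B).
Proof.
exact: (@rV_compact (cplx R) d (fun k => [set x : cplx R | `|complex.Re (x - p 0 k : R[i])| <= B /\ `|complex.Im (x - p 0 k : R[i])| <= B])
  (fun k => @compact_square (p 0 k) B)).
Qed.

Lemma box_cbox p B : box p B `<=` cbox p B.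
Proof.
move=> z hz k; split.
  by apply: le_trans (normc_Re _) _; exact: ltW.
by apply: le_trans (normc_Im _) _; exact: ltW.
Qed.

Lemma cbox_box p B B' : 2 * B < B' -> cbox p B `<=` box p B'.
Proof.
move=> BB z hz k; apply: le_lt_trans (normc_le _) _; have [h1 h2] := hz k.
by apply: le_lt_trans (lerD h1 h2) _; rewrite -mulr2n -mulr_natl.
Qed.

(** The point [w] may leave [K]: continuity is assumed at the points of [K] within the whole space.
    The radius is found by a covering argument along the filter of radii tending to 0. *)
Lemma uniform_on_compact (K : set (cspace R d)) f : compact K -> contOn K f ->
  forall e : R, 0 < e -> exists2 r : R, 0 < r &
  forall z w, K z -> box z r w -> normc (f w - f z) < e.
Proof.
move=> /compact_near_coveringP cK cf e e0.
have e20 : 0 < e / 2 by rewrite divr_gt0.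
have H : \forall r \near (0 : R)^'+, K `<=` [set z | forall w, box z r w -> normc (f w - f z) < e].
  apply: (cK _ (0 : R)^'+ (fun r z => forall w, box z r w -> normc (f w - f z) < e)) => z Kz.
  have /continuousP_eps/(_ _ e20)[r r0 hr] := cf z Kz.
  have r20 : 0 < r / 2 by rewrite divr_gt0.
  exists (box z (r / 2), [set x | x < r / 2]) => /=.
    by split; [exact: box_nbhs | exact: nbhs_right_lt].
  move=> [z' x] [/= hz' hx] w hw.
  have -> : f w - f z' = (f w - f z) - (f z' - f z) by rewrite opprB addrA subrK.
  apply: le_lt_trans (le_normcD _ _) _; rewrite normcN (splitr e); apply: ltrD; apply: hr => k.
    have -> : w 0 k - z 0 k = (w 0 k - z' 0 k) + (z' 0 k - z 0 k) by rewrite addrA subrK.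
    apply: le_lt_trans (le_normcD _ _) _; rewrite (splitr r); apply: ltrD; last exact: hz'.
    exact: lt_trans (hw k) hx.
  by apply: lt_trans (hz' k) _; rewrite ltr_pdivrMr// ltr_pMr// ltr1n.
have [r [r0 hr]] : exists r : R, 0 < r /\ K `<=` [set z | forall w, box z r w -> normc (f w - f z) < e].
  have H2 : \forall r \near (0 : R)^'+, 0 < r by exact: nbhs_right_gt.
  by have [r [? ?]] := filter_ex (filterI H2 H); exists r.
by exists r => // z w Kz; exact: hr.
Qed.

Definition supp_in (B : R) f := forall z, (exists k, B <= normc (z 0 k : R[i])) -> f z = 0.

Lemma uniform_supp (B : R) f : contOn setT f -> supp_in B f ->
  forall e : R, 0 < e -> exists2 r : R, 0 < r &
  forall z w, box z r w -> normc (f w - f z) < e.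
Proof.
move=> cf sf e e0.
have [|r r0 hr] := @uniform_on_compact (cbox 0 (B + 1)) f (@compact_cbox 0 (B + 1)) _ e e0.
  by move=> z _; exact: cf.
(* Outside of the box of size B + 1 some coordinate of [z] exceeds B + 1 in modulus; at distance
   less than 1 it still exceeds [B], and [f] vanishes at both points. *)
exists (Num.min r 1); first by rewrite lt_min r0 ltr01.
move=> z w hw; have [zK|zK] := pselect (cbox 0 (B + 1) z).
  by apply: hr => // k; have := hw k; rewrite lt_min => /andP[].
have [k hk] : exists k, B + 1 < normc (z 0 k : R[i]).
  apply: contra_notP zK => /forallNP h k; have := h k => /negP; rewrite -leNgt => hk.
  by rewrite mxE subr0; split; apply: le_trans hk; [exact: normc_Re | exact: normc_Im].
rewrite (sf z) ?(sf w) ?subr0 ?normc0//.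
  exists k; have := hw k; rewrite lt_min => /andP[_ h].
  have := le_normcD (w 0 k) (z 0 k - w 0 k); rewrite addrCA subrr addr0 normcB.
  by lra.
by exists k; lra.
Qed.

End CompactBoxes.

(** * Flat functions and bump functions *)

Section Flat.
Variable R : realType.
Implicit Types (P : {poly R}) (x y : R).

(** Cutoffs only use P = 1; arbitrary polynomials make the class closed under differentiation, which
    gives smoothness by induction. *)
Definition flat P x : R := if 0 < x then P.[x^-1] * expR (- x^-1) else 0.

(** The inequality u <= exp u at u = y/(n+1), raised to the power n. *)
Lemma expR_ge_exp (n : nat) y : 0 <= y -> y ^+ n <= n.+1%:R ^+ n * expR y.
Proof.
move=> y0; have n0 : (0 : R) < n.+1%:R by rewrite ltr0n.
have h : y / n.+1%:R <= expR (y / n.+1%:R).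
  by apply: le_trans (expR_ge1Dx _); rewrite lerDr.
have : (y / n.+1%:R) ^+ n <= expR (y / n.+1%:R) ^+ n by apply: lerXn2r => //; rewrite nnegrE ?expR_ge0 ?divr_ge0// ltW.
rewrite expr_div_n ler_pdivrMr ?exprn_gt0// -expRM_natr mulrC => h2; apply: le_trans h2 _.
rewrite ler_wpM2l ?exprn_ge0 ?(ltW n0)// ler_expR -mulrA ler_piMr// mulrC ler_pdivrMr// mul1r ler_nat.
exact: leqnSn.
Qed.

(** The decay of exp(-1/x) beats the growth of P(1/x); a quadratic bound is what yields the
    derivative 0 at the origin. *)
Lemma flat_bound P : exists2 K : R, 0 < K & forall x, `|x| <= 1 -> `|flat P x| <= K * x ^+ 2.
Proof.
pose s := size P; pose C := \sum_(i < s) `|P`_i|.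
have C0 : 0 <= C by apply: sumr_ge0.
pose K := C * ((s + 2).+1%:R ^+ (s + 2)) + 1.
have K0 : 0 < K by rewrite ltr_wpDl// mulr_ge0// exprn_ge0.
exists K => // x x1; rewrite /flat; case: ltP => x0; last first.
  by rewrite normr0 mulr_ge0 ?(ltW K0)// sqr_ge0.
rewrite ger0_norm in x1; last exact: ltW.
have y1 : 1 <= x^-1 by rewrite invf_ge1.
have y0 : 0 <= x^-1 by rewrite invr_ge0 ltW.
have hP : `|P.[x^-1]| <= C * x^-1 ^+ s.
  rewrite horner_coef; apply: le_trans (ler_norm_sum _ _ _) _; rewrite /C big_distrl /=.
  apply: ler_sum => i _; rewrite normrM ler_wpM2l// normrX (ger0_norm y0).
  by apply: ler_weXn2l => //; exact: ltnW.
rewrite normrM (ger0_norm (expR_ge0 _)) expRN.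
have E0 := expR_gt0 x^-1.
rewrite ler_pdivrMr//; apply: le_trans hP _.
have h := expR_ge_exp (s + 2) y0.
have x20 : 0 < x ^+ 2 by rewrite exprn_gt0.
have -> : C * x^-1 ^+ s = C * (x^-1 ^+ (s + 2)) * x ^+ 2.
  have hx : x^-1 ^+ 2 * x ^+ 2 = 1 by rewrite -exprMn mulVf ?expr1n// gt_eqF.
  by rewrite exprD -[LHS]mulr1 -hx; ring.
rewrite [X in _ <= X]mulrAC ler_wpM2r ?sqr_ge0//.
apply: le_trans (ler_wpM2l C0 h) _; rewrite mulrA ler_wpM2r ?expR_ge0//.
by rewrite /K lerDl.
Qed.

(** In the variable y = 1/x, the derivation d/dx is - y^2 d/dy, here applied to P(y) exp(-y). *)
Definition flat_deriv P : {poly R} := 'X ^+ 2 * (P - P^`()).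

Lemma flat_derive P x : is_derive x (1 : R) (flat P) (flat (flat_deriv P) x).
Proof.
have [x0|x0|<-] := ltgtP 0 x.
- have E : flat (flat_deriv P) x =
      - x^-1 ^+ 2 * P^`().[x^-1] * expR (- x^-1) + P.[x^-1] * (x^-1 ^+ 2 * expR (- x^-1)).
    by rewrite /flat x0 /flat_deriv hornerM hornerD hornerN hornerXn; ring.
  have dV : is_derive x (1 : R) (fun y : R => y^-1) (- x^-1 ^+ 2).
    have x0' : id x != 0 by rewrite gt_eqF.
    have := @is_deriveV R id x 1 1 x0' (is_derive_id x 1).
    by rewrite /GRing.scale /= mulr1 exprVn.
  rewrite E; have h : is_derive x (1 : R) (fun y => P.[y^-1] * expR (- y^-1))
      (- x^-1 ^+ 2 * P^`().[x^-1] * expR (- x^-1) + P.[x^-1] * (x^-1 ^+ 2 * expR (- x^-1))).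
    have d1 : is_derive x (1 : R) (fun y => P.[y^-1]) (- x^-1 ^+ 2 * P^`().[x^-1]).
      rewrite mulrC; exact: (@is_derive1_comp R (horner P) (fun y => y^-1) x _ _ (is_derive_poly P x^-1) dV).
    have d2 : is_derive x (1 : R) (fun y => expR (- y^-1)) (x^-1 ^+ 2 * expR (- x^-1)).
      have dN : is_derive x (1 : R) (fun y : R => - y^-1) (x^-1 ^+ 2).
        by rewrite -[x^-1 ^+ 2]opprK; exact: is_deriveN.
      rewrite mulrC; exact: (@is_derive1_comp R expR (fun y => - y^-1) x _ _ (is_derive_expR _) dN).
    apply: (is_derive_eq (is_deriveM d1 d2)); rewrite /GRing.scale /=; ring.
  move/is_derive_eps: h => h; apply/is_derive_eps => e /h[r r0 hr].
  exists (Num.min r x); first by rewrite lt_min r0.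
  move=> t; rewrite lt_min => /andP[/hr tr tx]; move: tr; rewrite /flat x0.
  have -> // : 0 < x + t.
  by move: tx; rewrite ltr_norml => /andP[]; rewrite -subr_gt0 opprK addrC.
- apply/is_derive_eps => e e0; exists (- x); first by rewrite oppr_gt0.
  move=> t; rewrite ltr_norml => /andP[_ tx]; rewrite /flat.
  have xt : x + t < 0 by rewrite -ltrBrDl sub0r.
  by rewrite !ltNge (ltW xt) (ltW x0) /= !(subr0, mulr0) normr0 mulr_ge0// ltW.
apply/is_derive_eps => e e0; have [K K0 hK] := flat_bound P.
exists (Num.min 1 (e / K)); first by rewrite lt_min ltr01 divr_gt0.
move=> t; rewrite lt_min => /andP[t1 te]; rewrite add0r /flat ltxx mulr0 !subr0.
apply: le_trans (hK _ (ltW t1)) _; rewrite -[t ^+ 2]ger0_norm ?sqr_ge0// normrX expr2 mulrA.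
rewrite ler_wpM2r// mulrC -ler_pdivlMr//; exact: ltW.
Qed.

Lemma flat1_gt0 x : 0 < x -> 0 < flat 1 x.
Proof. by move=> x0; rewrite /flat x0 hornerE mul1r expR_gt0. Qed.

Lemma flat_le0 P x : x <= 0 -> flat P x = 0.
Proof. by move=> x0; rewrite /flat ltNge x0. Qed.

Lemma flat1_ge0 x : 0 <= flat 1 x.
Proof. by have [x0|x0] := ltP 0 x; [exact/ltW/flat1_gt0 | rewrite flat_le0]. Qed.

End Flat.

Section Bump.
Variables (R : realType) (d : nat).
Implicit Types (z w p : cspace R d) (f h : cspace R d -> cplx R).

Lemma real_complexB (a b : R) : a%:C%C - b%:C%C = (a - b)%:C%C :> R[i].
Proof. by rewrite rmorphB. Qed.

Lemma cder_real (u : R -> R[i]) (phi : R -> R) (a : R) c : cder u c ->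
  is_derive (complex.Re (u 0)) (1 : R) phi a ->
  cder (fun t => (phi (complex.Re (u t)))%:C%C) (a%:C%C * (complex.Re c)%:C%C).
Proof.
move=> /cderP[h1 _] hphi; apply/cderP; rewrite -rmorphM /=; split; last exact: is_derive_cst.
exact: (@is_derive1_comp R phi (fun t => complex.Re (u t)) 0 _ _ hphi h1).
Qed.

(** Induction on [n] for all polynomials at once: a derivative is again a flat function of Re h,
    times Re h' = (h' + conj h')/2. *)
Lemma Ck_flat n (U : set (cspace R d)) h : Ck n U h -> forall P : {poly R},
  Ck n U (fun z => ((flat P (complex.Re (h z : R[i])))%:C%C : cplx R)).
Proof.
have cont g P : contOn U g -> contOn U (fun z => ((flat P (complex.Re (g z : R[i])))%:C%C : cplx R)).
  move=> cg z /cg/continuousP_eps hz; apply/continuousP_eps => e e0.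
  have : {for complex.Re (g z : R[i]), continuous (flat P)}.
    by apply/differentiable_continuous/derivable1_diffP; have [] := flat_derive P (complex.Re (g z : R[i])).
  move=> /cvgrPdist_lt/(_ e e0)[r r0 hr]; have [x x0 hx] := hz r r0.
  exists x => // w /hx hw; rewrite [X in normc X](real_complexB _ _) normc_real distrC; apply: hr => /=.
  rewrite distrC; apply: le_lt_trans hw.
  have -> : complex.Re (g w : R[i]) - complex.Re (g z : R[i]) = complex.Re (g w - g z : R[i]).
    by case: (g w) (g z) => ? ? [].
  exact: normc_Re.
elim: n h => [|n IH] h; first by move=> /Ck0P ch P; apply/Ck0P; exact: cont.
move=> Ch P; have /Ck_dirP[ch hh] := Ch; apply/Ck_dirP; split; first exact: cont.
move=> b k; have [h' [h1 h2]] := hh b k.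
exists (fun z => (flat (flat_deriv P) (complex.Re (h z : R[i])))%:C%C * (2%:R^-1 * (h' z + (h' z)^*%C))); split.
  move=> z Uz; apply/isdP; have /isdP hz := h1 z Uz.
  have E : 2%:R^-1 * (h' z + (h' z)^*%C) = (complex.Re (h' z : R[i]))%:C%C :> R[i] by rewrite ReJ_add mulrC.
  rewrite E; have := @cder_real (fun t => h (line z (dir R b k) t)) (flat P) _ _ hz.
  by apply; rewrite line0; exact: flat_derive.
apply: CkM; first by apply: IH; exact: CkS.
by apply: CkM; [exact: Ck_cst | apply: CkD => //; exact: CkJ].
Qed.

Definition sqdist p k z : cplx R := (z 0 k - p 0 k) * (z 0 k - p 0 k)^*%C.

Lemma sqdistE p k z : sqdist p k z = (normc (z 0 k - p 0 k) ^+ 2)%:C%C.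
Proof. by rewrite /sqdist -sqr_normc normcE' -rmorphXn. Qed.

(** In each coordinate a quotient a/(a + b), where a vanishes from radius 2r on, b vanishes up to
    radius r, and one of them is positive at every point. Squared moduli are used because they are
    smooth. *)
Definition bump p (r : R) z : cplx R := \prod_k
  ((flat 1 (4 * r ^+ 2 - normc (z 0 k - p 0 k) ^+ 2))%:C%C *
  ((flat 1 (4 * r ^+ 2 - normc (z 0 k - p 0 k) ^+ 2))%:C%C +
   (flat 1 (normc (z 0 k - p 0 k) ^+ 2 - r ^+ 2))%:C%C)^-1).

Lemma bump_smooth p r : 0 < r -> smooth setT (bump p r).
Proof.
move=> r0 n; apply: Ck_prod => k _.
have Cs : Ck n setT (sqdist p k).
  have C1 : Ck n setT (fun z => z 0 k - p 0 k : cplx R).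
    exact: CkD (Ck_coord n setT k) (Ck_cst n setT (- p 0 k)).
  exact: CkM C1 (CkJ C1).
have C1 : Ck n setT (fun z => ((flat 1 (4 * r ^+ 2 - normc (z 0 k - p 0 k) ^+ 2))%:C%C : cplx R)).
  have := Ck_flat (CkD (Ck_cst n setT ((4 * r ^+ 2)%:C%C : cplx R)) (CkN Cs)) 1.
  by apply: Ck_ext => [|z _]; [exact: openT | rewrite /= sqdistE].
have C2 : Ck n setT (fun z => ((flat 1 (normc (z 0 k - p 0 k) ^+ 2 - r ^+ 2))%:C%C : cplx R)).
  have := Ck_flat (CkD Cs (Ck_cst n setT ((- r ^+ 2)%:C%C : cplx R))) 1.
  by apply: Ck_ext => [|z _]; [exact: openT | rewrite /= sqdistE].
apply: (CkM C1); apply: CkV (CkD C1 C2) => z _ /=.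
rewrite -rmorphD /= (_ : 0 = (0 : R)%:C%C)// (inj_eq (@complexI R)) gt_eqF//.
set x := normc _ ^+ 2; have [h|h] := ltP x (4 * r ^+ 2).
  by rewrite ltr_pwDl ?flat1_ge0// flat1_gt0// subr_gt0.
rewrite ltr_wpDl ?flat1_ge0// flat1_gt0// subr_gt0; apply: lt_le_trans h.
by rewrite ltr_pMl ?exprn_gt0// ltr1n.
Qed.

Lemma bump1 p r z : 0 < r -> box p r z -> bump p r z = 1.
Proof.
move=> r0 hz; rewrite /bump big1// => k _.
have h : normc (z 0 k - p 0 k) ^+ 2 < r ^+ 2 by rewrite ltrXn2r// ?nnegrE ?normc_ge0 ?(ltW r0)//; exact: hz.
rewrite (@flat_le0 R 1 (_ - r ^+ 2)) ?subr_le0 ?(ltW h)// (rmorph0 (real_complex R)) addr0 mulfV//.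
rewrite (_ : 0 = (0 : R)%:C%C)// (inj_eq (@complexI R)) gt_eqF// flat1_gt0// subr_gt0.
by apply: lt_trans h _; rewrite ltr_pMl ?exprn_gt0// ltr1n.
Qed.

Lemma bump0 p r z : 0 < r -> ~ box p (2 * r) z -> bump p r z = 0.
Proof.
move=> r0 /existsNP[k /negP]; rewrite -leNgt => hk; rewrite /bump (bigD1 k)//=.
rewrite (@flat_le0 R 1 (4 * r ^+ 2 - _)) ?(rmorph0 (real_complex R)) ?mul0r//.
have -> : 4 * r ^+ 2 = (2 * r) ^+ 2 by ring.
by rewrite subr_le0 lerXn2r ?nnegrE ?normc_ge0 ?mulr_ge0// ltW.
Qed.

End Bump.

(** * The Cauchy transform in one of the variables *)

Section CauchyTransform.
Variables (R : realType) (d : nat).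
Implicit Types (z w v : cspace R d) (f g : cspace R d -> cplx R) (B r rho t : R).

Definition circ t : R[i] := (cos t +i* sin t)%C.

Lemma normc_circ t : normc (circ t) = 1.
Proof. by rewrite /= cos2Dsin2 sqrtr1. Qed.

Lemma cder_circ t : cder (fun x => circ (t + x)) ('i%C * circ t).
Proof.
apply/cderP; split.
  have -> : complex.Re ('i%C * circ t) = - sin t by rewrite /=; ring.
  exact: (proj1 (@is_derive_shift0 R cos t _) (is_derive_cos t)).
have -> : complex.Im ('i%C * circ t) = cos t by rewrite /=; ring.
exact: (proj1 (@is_derive_shift0 R sin t _) (is_derive_sin t)).
Qed.

Lemma ccont_circ : ccont circ.
Proof. exact: cder_ccont cder_circ. Qed.

Lemma ccont_circJ : ccont (fun t => (circ t)^*%C).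
Proof.
move=> x e /(ccont_circ x)[r r0 hr]; exists r => // y /hr.
by rewrite -normcJ' (rmorphB conjc).
Qed.

Definition twopi : R := 2 * pi.

Lemma twopi_gt0 : 0 < twopi.
Proof. by rewrite mulr_gt0// pi_gt0. Qed.

Lemma circ_periodic : circ twopi = circ 0.
Proof. by rewrite /circ /twopi mulr_natl cos2pi sin2pi cos0 sin0. Qed.

(** Polar coordinates around [z] in the k-th complex coordinate line, with the sign of a
    convolution. *)
Definition shift k z r t : cspace R d := z - (r%:C%C * circ t : R[i]) *: delta_mx 0 k.

Lemma shiftE k z r t l : shift k z r t 0 l = z 0 l - (r%:C%C * circ t) * (l == k)%:R :> R[i].
Proof. by rewrite /shift !mxE eqxx. Qed.

Lemma shift_neq k z r t l : l != k -> shift k z r t 0 l = z 0 l.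
Proof. by move=> lk; rewrite shiftE (negbTE lk) mulr0 subr0. Qed.

Lemma shift_eq k z r t : shift k z r t 0 k = z 0 k - r%:C%C * circ t :> R[i].
Proof. by rewrite shiftE eqxx mulr1. Qed.

Lemma shift0 k z t : shift k z 0 t = z.
Proof. by rewrite /shift (rmorph0 (real_complex R)) mul0r scale0r subr0. Qed.

Lemma shift_periodic k z r : shift k z r twopi = shift k z r 0.
Proof. by rewrite /shift circ_periodic. Qed.

Lemma shift_line k z r t v s : shift k (line z v s) r t = line (shift k z r t) v s.
Proof. by rewrite /shift /line addrAC. Qed.

Lemma shiftB k z r r' t t' l : shift k z r' t' 0 l - shift k z r t 0 l =
  (r%:C%C * circ t - r'%:C%C * circ t') * (l == k)%:R :> R[i].
Proof.
have E (a b c e : R[i]) : a - b * e - (a - c * e) = (c - b) * e by ring.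
by rewrite -(E (z 0 l)) -!shiftE.
Qed.

Lemma shift_box_r k z r r' t e : `|r' - r| < e -> box (shift k z r t) e (shift k z r' t).
Proof.
move=> h l; suff : normc (shift k z r' t 0 l - shift k z r t 0 l) <= `|r' - r|.
  by move=> h'; apply: le_lt_trans h' h.
rewrite shiftB -mulrBl -rmorphB !normcM normc_real normc_circ mulr1 distrC.
by rewrite ler_piMr//; case: eqP => _; rewrite ?normc1 ?normc0.
Qed.

Lemma shift_box_t k z r t t' e : 0 < e -> `|r| * normc (circ t' - circ t) < e ->
  box (shift k z r t) e (shift k z r t').
Proof.
move=> e0 h l; suff : normc (shift k z r t' 0 l - shift k z r t 0 l) <= `|r| * normc (circ t' - circ t).
  by move=> h'; apply: le_lt_trans h' h.
rewrite shiftB -mulrBr !normcM normc_real (normcB (circ t)).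
by rewrite ler_piMr ?mulr_ge0 ?normc_ge0//; case: eqP => _; rewrite ?normc1 ?normc0.
Qed.

Lemma lineE z v s l : line z v s 0 l = z 0 l + s%:C%C * v 0 l :> R[i].
Proof. by rewrite /line !mxE. Qed.

Definition unif f := forall e, 0 < e -> exists2 x, 0 < x &
  forall z w, box z x w -> normc (f w - f z) < e.

Lemma unif_ccont f k z r : unif f -> ccont (fun t => f (shift k z r t)).
Proof.
move=> uf t e /uf[x x0 hx].
have K0 : 0 < `|r| + 1 by rewrite ltr_wpDl.
have [y y0 hy] := ccont_circ t (divr_gt0 x0 K0).
exists y => // t' /hy ht; apply: hx; apply: shift_box_t => //.
move: ht; rewrite ltr_pdivlMr// mulrC => ht; apply: le_lt_trans ht.
by rewrite ler_wpM2r ?normc_ge0// lerDl.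
Qed.

Lemma unif_dcont_gen (a : R -> R[i]) f k z : ccont a -> (forall t, normc (a t) <= 1) -> unif f ->
  dcont (fun r t => a t * f (shift k z r t)).
Proof.
move=> ca a1 uf; split.
  by move=> r; apply: ccontM => //; exact: unif_ccont.
move=> r e /uf[x x0 hx]; exists x => // r' hr t.
rewrite -mulrBr normcM; apply: le_trans (ltW (hx _ _ (shift_box_r k z t hr))).
by rewrite ler_piMl ?normc_ge0.
Qed.

Lemma unif_dcont f k z : unif f -> dcont (fun r t => (circ t)^*%C * f (shift k z r t)).
Proof.
by apply: unif_dcont_gen; [exact: ccont_circJ | move=> t; rewrite normcJ' normc_circ].
Qed.

(** This is 1/pi times the integral of f(z - zeta e_k)/zeta over the disc |zeta| < rho, as dA/zeta =
    exp(-it) dr dt. The truncation at rho is harmless once the disc reaches the support of [f]. *)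
Definition cauchy k rho f z : cplx R :=
  (pi^-1)%:C%C * dint rho twopi (fun r t => (circ t)^*%C * f (shift k z r t)).

Lemma dintE a b (P : R -> R -> R[i]) : dint a b P = cint a (fun r => cint b (P r)).
Proof. by []. Qed.

Local Opaque cint dint circ shift line real_deriv dir.

Section Fixed.
Variables (k : 'I_d) (rho : R).
Hypothesis rho0 : 0 < rho.
Notation T := (cauchy k rho).

(** A bound for the transform in the sup norm; each of the two integrations contributes a factor 2
    because of real and imaginary parts. *)
Let C : R := pi^-1 * (2 * rho * (2 * twopi)) + 1.

Let C0 : 0 < C.
Proof. by rewrite ltr_wpDl// !mulr_ge0 ?invr_ge0 ?pi_ge0 ?(ltW rho0) ?(ltW twopi_gt0). Qed.

Lemma cauchyD f g z : unif f -> unif g -> T (fun z => f z + g z) z = T f z + T g z.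
Proof.
move=> uf ug; rewrite /cauchy.
have E : dint rho twopi (fun r t => (circ t)^*%C * (f (shift k z r t) + g (shift k z r t))) =
    dint rho twopi (fun r t => (circ t)^*%C * f (shift k z r t)) +
    dint rho twopi (fun r t => (circ t)^*%C * g (shift k z r t)).
  rewrite -(dintD rho0 twopi_gt0 (unif_dcont k z uf) (unif_dcont k z ug)).
  by congr dint; apply/funext => r; apply/funext => t; exact: mulrDr.
by rewrite E; exact: mulrDr.
Qed.

Lemma cauchyZ (c : R[i]) f z : unif f -> T (fun z => c * f z) z = c * T f z.
Proof.
move=> uf; rewrite /cauchy.
have E : dint rho twopi (fun r t => (circ t)^*%C * (c * f (shift k z r t))) =
    c * dint rho twopi (fun r t => (circ t)^*%C * f (shift k z r t)).
  rewrite -(dintZ c rho0 twopi_gt0 (unif_dcont k z uf)).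
  by congr dint; apply/funext => r; apply/funext => t; exact: mulrCA.
by rewrite E; exact: mulrCA.
Qed.

Lemma unifD f g : unif f -> unif g -> unif (fun z => f z + g z).
Proof.
move=> uf ug e e0; have e20 : 0 < e / 2 by rewrite divr_gt0.
have [x x0 hx] := uf _ e20; have [y y0 hy] := ug _ e20.
exists (Num.min x y); first by rewrite lt_min x0.
move=> z w hw; have -> : f w + g w - (f z + g z) = (f w - f z) + (g w - g z) by rewrite opprD addrACA.
rewrite (splitr e); apply: le_lt_trans (le_normcD _ _) _.
apply: ltrD; [apply: hx | apply: hy] => l; by have := hw l; rewrite lt_min => /andP[].
Qed.

Lemma unifZ (c : R[i]) f : unif f -> unif (fun z => c * f z).
Proof.
move=> uf e e0; have K0 : 0 < normc c + 1 by rewrite ltr_wpDl// normc_ge0.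
have [x x0 hx] := uf _ (divr_gt0 e0 K0); exists x => // z w /hx h.
rewrite -mulrBr normcM; move: h; rewrite ltr_pdivlMr// mulrC; apply: le_lt_trans.
by rewrite ler_wpM2r ?normc_ge0// lerDl.
Qed.

Lemma unif_comp_line v s f : unif f -> unif (fun z => f (line z v s)).
Proof.
move=> uf e /uf[x x0 hx]; exists x => // z w hw; apply: hx => l.
by have := hw l; rewrite !lineE opprD addrACA subrr addr0.
Qed.

Lemma cauchy_bound f z (M : R) : unif f -> (forall r t, normc (f (shift k z r t)) <= M) ->
  normc (T f z) <= C * M.
Proof.
move=> uf hM.
have M0 : 0 <= M by apply: le_trans (hM 0 0); exact: normc_ge0.
rewrite /cauchy normcM normc_real (@ger0_norm _ pi^-1) ?invr_ge0 ?pi_ge0//.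
apply: (@le_trans _ _ (pi^-1 * (2 * rho * (2 * twopi * M)))).
  rewrite ler_wpM2l ?invr_ge0 ?pi_ge0//; apply: dint_bound => //; [exact: twopi_gt0|exact: unif_dcont|].
  by move=> r t; rewrite normcM normcJ' normc_circ mul1r.
by rewrite /C !mulrA mulrDl mul1r lerDl.
Qed.

(** By linearity the first-order remainder of the transform is the transform of the remainder, to
    which the sup norm bound applies. *)
Lemma cauchyB3 f g h (c : R[i]) z : unif f -> unif g -> unif h ->
  T f z - T g z - c * T h z = T (fun z => f z + ((-1) * g z + (- c) * h z)) z.
Proof.
move=> uf ug uh; have u1 := unifZ (-1) ug; have u2 := unifZ (- c) uh.
rewrite (cauchyD z uf (unifD u1 u2)) (cauchyD z u1 u2) (cauchyZ _ z ug) (cauchyZ _ z uh).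
have E (a b e : R[i]) : a - b - c * e = a + (-1 * b + - c * e) by ring.
exact: E.
Qed.

Lemma cauchy_line f z v s : T f (line z v s) = T (fun z => f (line z v s)) z.
Proof.
by rewrite /cauchy; congr (_ * dint _ _ _); apply/funext => r; apply/funext => t; rewrite shift_line.
Qed.

Lemma cauchy_contOn f : unif f -> contOn setT (T f).
Proof.
move=> uf z _; apply/continuousP_eps => e e0.
have [x x0 hx] := uf _ (divr_gt0 e0 (mulr_gt0 (ltr0Sn R 1) C0)).
exists x => // w hw.
have E : w = line z (w - z) 1 by apply/rowP => l; rewrite lineE !mxE mul1r addrCA subrr addr0.
have uf1 : unif (fun z => (-1) * f z) by exact: unifZ.
have ul := unif_comp_line (w - z) 1 uf.
have -> : T f w - T f z = T (fun y => f (line y (w - z) 1) + (-1) * f y) z.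
  by rewrite (cauchyD z ul uf1) (cauchyZ _ z uf) -cauchy_line -E mulN1r.
apply: (@le_lt_trans _ _ (C * (e / (2 * C)))).
  apply: cauchy_bound; first exact: unifD.
  move=> r t; rewrite mulN1r; apply/ltW/hx => l; have := hw l.
  by rewrite lineE mul1r !mxE addrAC subrr add0r.
have -> : C * (e / (2 * C)) = e / 2 by field; rewrite gt_eqF.
by rewrite ltr_pdivrMr// ltr_pMr// ltr1n.
Qed.

(** Differentiation under the integral: uniform continuity of the derivative makes the first-order
    remainder of [f] small uniformly over the domain of integration. *)
Lemma cauchy_isd f b l z : Ck 1 setT f -> unif f -> unif (real_deriv (dir R b l) f) ->
  is_real_deriv (T f) (dir R b l) z (T (real_deriv (dir R b l) f) z).
Proof.
move=> Cf uf uf'; apply/isdP => e e0.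
set v := dir R b l; set f' := real_deriv v f.
have [x x0 hx] := uf' _ (divr_gt0 e0 (mulr_gt0 (ltr0Sn R 1) C0)).
exists x => // s sx; rewrite line0 cauchy_line cauchyB3//; last exact: unif_comp_line.
have ub : unif (fun y => f (line y v s) + (-1 * f y + - s%:C%C * f' y)).
  by apply: unifD; [exact: unif_comp_line | apply: unifD; exact: unifZ].
apply: le_trans (cauchy_bound ub (M := 2 * (e / (2 * C)) * `|s|) _) _; last first.
  rewrite le_eqVlt; apply/orP; left; apply/eqP; field; rewrite gt_eqF//.
move=> r t; set y := shift k z r t.
have -> : f (line y v s) + (-1 * f y + - s%:C%C * f' y) =
   f (line y v s) - f (line y v 0) - s%:C%C * f' y by rewrite line0 mulN1r mulNr addrA.
have dl (q : R) : cder (fun p => f (line y v (q + p))) (f' (line y v q)).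
  have /isdP := @Ck_isd R d 0 setT f b l (line y v q) Cf I.
  by apply: cder_ext ltr01 _ => p _; rewrite line_shift.
apply: (@mvt_cder R (fun s => f (line y v s)) (fun q => f' (line y v q)) _ s _ (fun q _ => dl q)).
move=> q qs; apply/ltW/hx => m; rewrite lineE addrAC subrr add0r normcM normc_real.
apply: le_lt_trans sx; apply: le_trans qs; rewrite ler_piMr//; exact: normc_dir.
Qed.

(** A derivative depends on an open neighbourhood, and [f] is 0 on the open set |w_m| > B; enlarging
    [B] by 1 places the points considered inside this set. *)
Lemma supp_deriv B f b l : supp_in B f -> supp_in (B + 1) (real_deriv (dir R b l) f).
Proof.
move=> sf z [m hm].
pose U : set (cspace R d) := [set w | B < normc (w 0 m : R[i])].
have oU : open U.
  apply: openP => w hw; exists (normc (w 0 m : R[i]) - B); first by rewrite subr_gt0.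
  move=> y /(_ m) hy; have := le_normcD (y 0 m) (w 0 m - y 0 m); rewrite addrCA subrr addr0 normcB /U /=.
  by move=> h; lra.
have Uz : U z by rewrite /U /=; lra.
have E : {in U, (fun=> 0 : cplx R) =1 f}.
  by move=> w; rewrite inE => hw; rewrite sf//; exists m; exact: ltW.
exact: (proj2 (isd_ext oU Uz E (isd_cst 0 (dir R b l) z))).
Qed.

Lemma cauchy_Ck n B f : Ck n setT f -> supp_in B f -> Ck n setT (T f).
Proof.
elim: n B f => [|n IH] B f Cf sf.
  apply/Ck0P; apply: cauchy_contOn; exact: uniform_supp (Ck_cont Cf) sf.
have uf : unif f := uniform_supp (Ck_cont Cf) sf.
apply/Ck_dirP; split; first exact: cauchy_contOn.
move=> b l; exists (T (real_deriv (dir R b l) f)).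
have Cd : Ck n setT (real_deriv (dir R b l) f) by apply: Ck_deriv => //; exact: openT.
have C1 : Ck 1 setT f.
  by elim: n {IH Cd} Cf => // n IHn /CkS; exact: IHn.
split; last exact: IH Cd (supp_deriv b l sf).
move=> z _; apply: cauchy_isd => //.
exact: uniform_supp (Ck_cont Cd) (supp_deriv b l sf).
Qed.

Lemma cauchy_wdir c l B f z : Ck 1 setT f -> supp_in B f ->
  wdir c l (T f) z = T (wdir c l f) z.
Proof.
move=> Cf sf.
have uf : unif f := uniform_supp (Ck_cont Cf) sf.
have Cd b : Ck 0 setT (real_deriv (dir R b l) f) by apply: Ck_deriv => //; exact: openT.
have ud b : unif (real_deriv (dir R b l) f).
  exact: uniform_supp (Ck_cont (Cd b)) (supp_deriv b l sf).
rewrite (wdir_isd c (cauchy_isd z Cf uf (ud true)) (cauchy_isd z Cf uf (ud false))).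
rewrite -(cauchyZ c z (ud false)) -cauchyD; [|exact: ud|by apply: unifZ; exact: ud].
rewrite -(@cauchyZ 2%:R^-1)//; apply: unifD; [exact: ud|by apply: unifZ; exact: ud].
Qed.

Lemma cauchy0 f z : unif f -> (forall r t, f (shift k z r t) = 0) -> T f z = 0.
Proof.
move=> uf h; apply: normc_eq0; apply/eqP; rewrite eq_le normc_ge0 andbT.
have := @cauchy_bound f z 0 uf; rewrite mulr0; apply => r t; by rewrite h normc0.
Qed.

Lemma unif_wdir c l B f : Ck 1 setT f -> supp_in B f -> unif (wdir c l f).
Proof.
move=> Cf sf; have Cd b : Ck 0 setT (real_deriv (dir R b l) f) by apply: Ck_deriv => //; exact: openT.
have ud b : unif (real_deriv (dir R b l) f).
  exact: uniform_supp (Ck_cont (Cd b)) (supp_deriv b l sf).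
apply: (@unifZ _ (fun z => real_deriv (dir R true l) f z + c * real_deriv (dir R false l) f z)).
by apply: unifD => //; exact: unifZ.
Qed.

(* In polar coordinates d/dzbar = e^{it}/2 (d/dr + (i/r) d/dt); the angular
   part integrates to zero over each circle, and the radial part is the
   derivative of the circular means. *)
Lemma cauchy_solves B f z : Ck 1 setT f -> supp_in B f -> B + normc (z 0 k : R[i]) <= rho ->
  T (pd_zbar k f) z = f z.
Proof.
move=> Cf sf hz.
have uf : unif f := uniform_supp (Ck_cont Cf) sf.
have uz : unif (pd_z k f) by rewrite pd_zE; exact: unif_wdir Cf sf.
have uzb : unif (pd_zbar k f) by rewrite pd_zbarE; exact: unif_wdir Cf sf.
pose A r t := circ t * pd_z k f (shift k z r t).
pose G r t := (circ t)^*%C * pd_zbar k f (shift k z r t).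
have dA : dcont A.
  by apply: unif_dcont_gen => //; [exact: ccont_circ | move=> t; rewrite normc_circ].
have dG : dcont G by exact: unif_dcont.
have dfA r t (c : 'I_d -> R[i]) (x : R[i]) : (forall l, c l = x * (l == k)%:R) ->
    Dif f (shift k z r t) c = x * pd_z k f (shift k z r t) + x^*%C * pd_zbar k f (shift k z r t).
  move=> hc; rewrite /Dif (bigD1 k)//= big1 ?addr0; first by rewrite hc eqxx mulr1.
  by move=> l lk; rewrite hc (negbTE lk) mulr0 mul0r conjc0 mul0r addr0.
have hr r t : cder (fun x => f (shift k z (r + x) t)) (- (A r t + G r t)).
  have := @chain_cder R d setT f (fun x => shift k z (r + x) t) (fun l => - circ t * (l == k)%:R) openT I Cf.
  rewrite addr0 (dfA r t _ (- circ t))// (rmorphN conjc) !mulNr -opprD => h; apply: h => l.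
  have := cder_lin (- circ t * (l == k)%:R) (shift k z r t 0 l); apply: cder_ext ltr01 _ => x _.
  have F (a b q y : R[i]) : a - b * q * y + x%:C%C * (- q * y) = a - (b + x%:C%C) * q * y by ring.
  by rewrite (shiftE k z (r + x)) (shiftE k z r) F -rmorphD.
have ht r t : cder (fun x => f (shift k z r (t + x))) (r%:C%C * 'i%C * (G r t - A r t)).
  have := @chain_cder R d setT f (fun x => shift k z r (t + x)) (fun l => - (r%:C%C * ('i%C * circ t)) * (l == k)%:R) openT I Cf.
  rewrite addr0 (dfA r t _ (- (r%:C%C * ('i%C * circ t))))// => h.
  have -> : r%:C%C * 'i%C * (G r t - A r t) = - (r%:C%C * ('i%C * circ t)) * pd_z k f (shift k z r t)
       + (- (r%:C%C * ('i%C * circ t)))^*%C * pd_zbar k f (shift k z r t).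
    have J : (- (r%:C%C * ('i%C * circ t)))^*%C = r%:C%C * 'i%C * (circ t)^*%C.
      by case: (circ t) => p q; apply/eqP; rewrite eq_complex /=; apply/andP; split; apply/eqP; ring.
    by rewrite J /A /G; ring.
  apply: h => l.
  have := cderM (cder_cst (- r%:C%C * (l == k)%:R)) (cder_circ t).
  rewrite mul0r add0r => h1.
  have := cderD (cder_cst (z 0 l : R[i])) h1; rewrite add0r.
  have -> : - r%:C%C * (l == k)%:R * ('i%C * circ t) = - (r%:C%C * ('i%C * circ t)) * (l == k)%:R by ring.
  by apply: cder_ext ltr01 _ => x _; rewrite shiftE; ring.
have a0 := twopi_gt0.
have AG r : cint twopi (A r) = cint twopi (G r).
  (* At r = 0 the angular identity carries the factor r and gives nothing; both sides are then
     constants times the integrals of exp(it) and exp(-it) over a period, which vanish. *)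
  have [->|r0] := eqVneq r 0.
    have E (g : cspace R d -> cplx R) (a : R -> R[i]) : ccont a -> cint twopi (fun t => a t * g (shift k z 0 t)) = g z * cint twopi a.
      by move=> ca; rewrite -cintZ//; congr cint; apply/funext => t; rewrite shift0 mulrC.
    rewrite (E (pd_z k f) circ ccont_circ) (E (pd_zbar k f) (fun t => (circ t)^*%C) ccont_circJ).
    have c1 : cint twopi circ = 0.
      have h x : cder (fun t => - 'i%C * circ (x + t)) (circ x).
        have := cderM (cder_cst (- 'i%C : R[i])) (cder_circ x); rewrite mul0r add0r mulrA mulNr.
        by rewrite -expr2 sqr_i opprK mul1r.
      by rewrite (cint_FTC (v := fun t => - 'i%C * circ t) a0 h ccont_circ) circ_periodic subrr.
    have c2 : cint twopi (fun t => (circ t)^*%C) = 0.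
      have h x : cder (fun t => (- 'i%C * circ (x + t))^*%C) ((circ x)^*%C).
        apply: cderJ; have := cderM (cder_cst (- 'i%C : R[i])) (cder_circ x); rewrite mul0r add0r mulrA mulNr.
        by rewrite -expr2 sqr_i opprK mul1r.
      by rewrite (cint_FTC (v := fun t => (- 'i%C * circ t)^*%C) a0 h ccont_circJ) circ_periodic subrr.
    by rewrite c1 c2 !mulr0.
  have cB : ccont (fun t => G r t - A r t) := ccontB (dG.1 r) (dA.1 r).
  have : cint twopi (fun t => r%:C%C * 'i%C * (G r t - A r t)) = 0.
    rewrite (cint_FTC (v := fun t => f (shift k z r t)) a0 (ht r)).
      by rewrite shift_periodic subrr.
    by apply: ccontM => //; exact: ccont_cst.
  rewrite cintZ// cintB//; [|exact: dG.1|exact: dA.1].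
  move=> /eqP; rewrite mulf_eq0 => /orP[|]; last by rewrite subr_eq0 => /eqP ->.
  rewrite mulf_eq0 => /orP[]; last by rewrite eq_complex /= oner_eq0 andbF.
  by rewrite (_ : 0 = (0 : R)%:C%C)// (inj_eq (@complexI R)) (negbTE r0).
(* The derivative of [H] is - 2 times the integral of [G] over the circle; [H] vanishes at rho,
   where the circle has left the support, and is 2 pi f(z) at 0. *)
pose H r := cint twopi (fun t => f (shift k z r t)).
have uc r : ccont (fun t => f (shift k z r t)) by exact: unif_ccont.
have dAG : dcont (fun r t => (-1) * (A r t + G r t)) by apply: dcontZ; exact: dcontD.
have hH r : cder (fun x => H (r + x)) (- (2 : R[i]) * cint twopi (G r)).
  have -> : - (2 : R[i]) * cint twopi (G r) = cint twopi (fun t => (-1) * (A r t + G r t)).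
    rewrite (cintZ _ a0 (ccontD (dA.1 r) (dG.1 r))) (cintD a0 (dA.1 r) (dG.1 r)) AG.
    ring.
  move=> e e0; pose e' := e / (2 * (2 * twopi)).
  have e'0 : 0 < e' by rewrite divr_gt0// !mulr_gt0// ?pi_gt0.
  have [x x0 hx] := dAG.2 r e' e'0.
  exists x => // s sx; rewrite addr0 /H.
  have cs : ccont (fun t => s%:C%C * (-1 * (A r t + G r t))).
    by apply: ccontM; [exact: ccont_cst | exact: dAG.1].
  rewrite -(cintB a0 (uc (r + s)) (uc r)) -(cintZ _ a0 (dAG.1 r)).
  rewrite -(cintB a0 (ccontB (uc (r + s)) (uc r)) cs).
  apply: le_trans (cint_bound (M := 2 * e' * `|s|) a0 _ _) _.
  - exact: ccontB (ccontB (uc (r + s)) (uc r)) cs.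
  - move=> t _.
    have := @mvt_cder R (fun x => f (shift k z (r + x) t)) (fun x => (-1) * (A (r + x) t + G (r + x) t)) (-1 * (A r t + G r t)) s e'.
    rewrite addr0; apply.
      move=> y _; have := hr (r + y) t; rewrite mulN1r; apply: cder_ext ltr01 _ => q _.
      by rewrite addrA.
    by move=> y ys; apply: hx; rewrite addrAC subrr add0r; exact: le_lt_trans ys sx.
  rewrite le_eqVlt; apply/orP; left; apply/eqP; rewrite /e'; field; rewrite gt_eqF//.
have cH : ccont (fun r => - (2 : R[i]) * cint twopi (G r)).
  by apply: ccontM; [exact: ccont_cst | exact: dint_inner].
have HE : - (2 : R[i]) * dint rho twopi G = H rho - H 0.
  rewrite dintE -(cintZ _ rho0 (dint_inner a0 dG)); exact: cint_FTC.
have Hrho : H rho = 0.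
  have -> : H rho = cint twopi (fun t => 0 * circ t).
    congr cint; apply/funext => t; rewrite mul0r; apply: sf; exists k; rewrite shift_eq.
    have := le_normcD (z 0 k - rho%:C%C * circ t) (- z 0 k).
    rewrite addrAC subrr add0r normcN normcM normc_real normc_circ mulr1 normcN ger0_norm ?(ltW rho0)//.
    by move=> h; lra.
  by rewrite cintZ ?mul0r//; exact: ccont_circ.
have H0 : H 0 = f z * (twopi%:C%C).
  have -> : H 0 = cint twopi (fun t => f z * 1) by congr cint; apply/funext => t; rewrite shift0 mulr1.
  rewrite cintZ//; last exact: ccont_cst.
  congr (_ * _); have h x : cder (fun t => (x + t)%:C%C) (1 : R[i]).
    have := cder_lin 1 (x%:C%C); apply: cder_ext ltr01 _ => t _; by rewrite mulr1 rmorphD.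
  rewrite (cint_FTC (v := fun t => t%:C%C) a0 h); last exact: ccont_cst.
  by rewrite (rmorph0 (real_complex R)) subr0.
move: HE; rewrite Hrho H0 sub0r mulNr => /oppr_inj HE.
have p0 : (pi%:C%C : R[i]) != 0.
  by rewrite (_ : 0 = (0 : R)%:C%C)// (inj_eq (@complexI R)) gt_eqF// pi_gt0.
have two0 : (2 : R[i]) != 0 by rewrite pnatr_eq0.
rewrite /cauchy -/G; apply: (mulfI two0); rewrite mulrCA HE /twopi.
have -> : (pi^-1)%:C%C = (pi%:C%C)^-1 :> R[i] by rewrite fmorphV.
have -> : (2 * pi)%:C%C = 2 * pi%:C%C :> R[i] by rewrite rmorphM /= rmorph_nat.
have F (p a : R[i]) : p != 0 -> p^-1 * (a * (2 * p)) = 2 * a by move=> ?; field.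
exact: F.
Qed.

End Fixed.
End CauchyTransform.

(** * The Dolbeault lemma *)

Section Signs.
Variables (R : realType) (d : nat).
Implicit Types (A B : {set 'I_d}) (k l : 'I_d).
Notation sgn := (@koszul_sign R d).

Lemma sgn_sqr k B : sgn k B * sgn k B = 1.
Proof. by rewrite /koszul_sign -expr2 sqrr_sign. Qed.

Lemma sgn_neq0 k B : sgn k B != 0.
Proof. by rewrite /koszul_sign signr_eq0. Qed.

Lemma sgnD1 k l B : k \in B -> sgn l (B :\ k) = (-1) ^+ (k < l)%N * sgn l B.
Proof.
move=> kB; rewrite /koszul_sign.
have -> : [set j in B | (j < l)%N]%SET = [set j in B :\ k | (j < l)%N]%SET :|: (if (k < l)%N then [set k]%SET else finset.set0).
  apply/setP => j; rewrite !inE; have [->|jk] := eqVneq j k; case: ifP => kl; rewrite ?inE ?kB ?kl ?eqxx ?orbF//=.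
  by rewrite (negbTE jk) orbF.
case: ifP => kl; last by rewrite finset.setU0 mul1r.
by rewrite finset.setUC cardsU1 !inE eqxx /= expr1 addnC exprD expr1 mulN1r mulrN1 opprK.
Qed.

Lemma sgnD1_id k B : sgn k (B :\ k) = sgn k B.
Proof.
have [kB|kB] := boolP (k \in B); first by rewrite sgnD1// ltnn mul1r.
by congr koszul_sign; apply/finset.setDidPl; rewrite disjoint_sym disjoints1.
Qed.

Lemma sgnU1_id k B : sgn k (k |: B) = sgn k B.
Proof.
rewrite /koszul_sign; congr (_ ^+ _); apply: eq_card => j; rewrite !inE.
by have [->|//] := eqVneq j k; rewrite ltnn !andbF.
Qed.

Lemma sgn_anti k l B : k \in B -> l \in B -> k != l ->
  sgn k B * sgn l (B :\ k) = - (sgn l B * sgn k (B :\ l)).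
Proof.
move=> kB lB kl; rewrite !sgnD1//.
have [h|h|/val_inj h] := ltngtP k l; last by rewrite h eqxx in kl.
  by rewrite expr1 expr0 mul1r mulN1r mulrN mulrC.
by rewrite expr1 expr0 mul1r mulN1r mulrN opprK mulrC.
Qed.

(** The sum equals its own opposite, and R[i] has characteristic 0. *)
Lemma sum_antisym (P : rel 'I_d) (G : 'I_d -> 'I_d -> R[i]) :
  (forall k l, P k l -> P l k /\ G k l = - G l k) ->
  \sum_k \sum_(l | P k l) G k l = 0.
Proof.
move=> h; set S := \sum_k _.
have E : S = - S.
  rewrite {1}/S (exchange_big_dep predT)//= -sumrN; apply: eq_bigr => k _.
  rewrite -sumrN; apply: eq_big => [l|l /h[_]//].
  by apply/idP/idP => /h[].
have : S *+ 2 = 0 by rewrite mulr2n {2}E subrr.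
by move/eqP; rewrite mulrn_eq0 => /orP[//|/eqP].
Qed.

(** Removing k and then l gives the opposite sign of removing l and then k. Both the vanishing of
    the square of dbar and the anticommutation of exterior products are instances. *)
Lemma koszul_double_sum B (F : 'I_d -> 'I_d -> R[i]) : (forall k l, F k l = F l k) ->
  \sum_(k in B) sgn k B * (\sum_(l in B :\ k) sgn l (B :\ k) * F k l) = 0.
Proof.
move=> Fs.
have -> : \sum_(k in B) sgn k B * (\sum_(l in B :\ k) sgn l (B :\ k) * F k l) =
  \sum_k \sum_(l | [&& k \in B, l \in B & k != l]) sgn k B * sgn l (B :\ k) * F k l.
  rewrite big_mkcond /=; apply: eq_bigr => k _; case: ifP => kB; last by rewrite big1.
  rewrite big_distrr /=; apply: eq_big => [l|l _]; last by rewrite mulrA.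
  by rewrite !inE andbC eq_sym.
apply: sum_antisym => k l /and3P[kB lB kl]; split; first by rewrite kB lB eq_sym.
by rewrite sgn_anti// Fs mulNr.
Qed.

End Signs.

(** * Forms of type (0,q) on polydiscs *)

Section Dolbeault.
Variables (R : realType) (d : nat).
Implicit Types (z w p : cspace R d) (f g : cspace R d -> cplx R).
Implicit Types (B D : {set 'I_d}) (U : set (cspace R d)) (om eta : {set 'I_d} -> cspace R d -> cplx R).
Notation sgn := (@koszul_sign R d).
Local Opaque real_deriv dir cauchy bump.

(** A form is the family of its coefficients, indexed by subsets; all degrees are treated
    together. *)
Definition dbar om (B : {set 'I_d}) z : cplx R :=
  \sum_(k in B) sgn k B * pd_zbar k (om (B :\ k)) z.

Lemma dbar_smooth U om : open U -> (forall B, smooth U (om B)) -> forall B, smooth U (dbar om B).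
Proof.
move=> oU h B; apply: smooth_sum => k _; apply: smoothZ; rewrite pd_zbarE.
exact: smooth_wdir.
Qed.

Lemma dbarD U om eta B z : U z -> (forall B, smooth U (om B)) -> (forall B, smooth U (eta B)) ->
  dbar (fun B z => om B z + eta B z) B z = dbar om B z + dbar eta B z.
Proof.
move=> Uz h1 h2; rewrite /dbar -big_split /=; apply: eq_bigr => k _.
have E := wdirD 'i%C k Uz (h1 (B :\ k) 1) (h2 (B :\ k) 1).
by rewrite -mulrDr -E.
Qed.

Lemma dbarZ U om (c : R[i]) B z : U z -> (forall B, smooth U (om B)) ->
  dbar (fun B z => c * om B z) B z = c * dbar om B z.
Proof.
move=> Uz h1; rewrite /dbar big_distrr /=; apply: eq_bigr => k _.
have E := wdirZ 'i%C k c Uz (h1 (B :\ k) 1).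
by rewrite [RHS]mulrCA; congr (_ * _); exact: E.
Qed.

Lemma dbar_dbar U om B z : open U -> U z -> (forall B, smooth U (om B)) ->
  dbar (dbar om) B z = 0.
Proof.
move=> oU Uz h; rewrite /dbar.
rewrite -[RHS](@koszul_double_sum R d B (fun k l => pd_zbar k (pd_zbar l (om (B :\: [set k; l]%SET))) z)).
  apply: eq_bigr => k kB; congr (_ * _).
  have E := @wdir_sum R d 'i%C k U _ (index_enum _) (mem (B :\ k)) (fun l z => sgn l (B :\ k) * pd_zbar l (om (B :\ k :\ l)) z) z Uz.
  rewrite pd_zbarE E.
    apply: eq_bigr => l _; rewrite (wdirZ _ _ _ Uz); last by rewrite pd_zbarE; apply: Ck_wdir => //; exact: h.
    by rewrite finset.setDDl.
  move=> l _; apply: CkM; first exact: Ck_cst.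
  by rewrite pd_zbarE; apply: Ck_wdir => //; exact: h.
move=> k l; rewrite finset.setUC !pd_zbarE; apply: (wdirC _ _ _ _ oU Uz).
exact: h.
Qed.

Lemma dbar_ext U om eta B z : open U -> U z -> (forall B, smooth U (om B)) ->
  (forall B, {in U, om B =1 eta B}) -> dbar om B z = dbar eta B z.
Proof.
move=> oU Uz h1 h2; apply: eq_bigr => k _; congr (_ * _).
have E := wdir_ext 'i%C k oU Uz (h1 (B :\ k) 1) (h2 (B :\ k)). 
exact: E.
Qed.

(** Within radius [r] the factor of the coordinate [l] is constantly 1, so the cutoff does not
    depend on this coordinate there. *)
Lemma bump_eq p r w w' l : 0 < r -> (forall m, m != l -> w 0 m = w' 0 m) ->
  normc (w 0 l - p 0 l : R[i]) < r -> normc (w' 0 l - p 0 l : R[i]) < r ->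
  bump p r w = bump p r w'.
Proof.
Local Transparent bump.
move=> r0 h h1 h2; apply: eq_bigr => m _; have [->|ml] := eqVneq m l; last by rewrite h.
have E (x : R) : 0 <= x -> x < r -> ((flat 1 (4 * r ^+ 2 - x ^+ 2))%:C%C *
  ((flat 1 (4 * r ^+ 2 - x ^+ 2))%:C%C + (flat 1 (x ^+ 2 - r ^+ 2))%:C%C)^-1) = 1 :> R[i].
  move=> x0 xr; have x2 : x ^+ 2 < r ^+ 2 by rewrite ltrXn2r// ?nnegrE// ltW.
  rewrite (@flat_le0 R 1 (_ - r ^+ 2)) ?subr_le0 ?(ltW x2)// (rmorph0 (real_complex R)) addr0 mulfV//.
  rewrite (_ : 0 = (0 : R)%:C%C)// (inj_eq (@complexI R)) gt_eqF// flat1_gt0// subr_gt0.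
  by apply: lt_trans x2 _; rewrite ltr_pMl ?exprn_gt0// ltr1n.
by rewrite !E ?normc_ge0.
Qed.
Local Opaque bump.

(** The Cauchy transform in z_k of [f] cut off. The equations in the other zbar_l survive, because
    the cutoff is constant in z_l while z_l stays in the inner disc and the transform does not move
    z_l. The last clause, that zero data give exactly zero, preserves conditions on degrees. *)
Lemma dbar_solve1 p (r : R) f k : 0 < r -> smooth (box p r) f ->
  exists g, [/\ smooth setT g,
    forall z, box p (r / 3) z -> pd_zbar k g z = f z,
    forall l z, l != k -> (forall w, box p r w -> pd_zbar l f w = 0) -> box p (r / 3) z -> pd_zbar l g z = 0 &
    (forall w, box p r w -> f w = 0) -> g = fun=> 0].
Proof.
(* The cutoff is 1 on the polydisc of radius rho and 0 outside of that of radius 2 rho < r, so its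
   product with [f] extends by 0. *)
move=> r0 sf; pose rho := r / 3.
have rho0 : 0 < rho by rewrite divr_gt0.
have r3 : 2 * rho < r by rewrite /rho; lra.
pose F z : cplx R := if `[< box p r z >] then bump p rho z * f z else 0.
have Fin z : box p r z -> F z = bump p rho z * f z by move=> h; rewrite /F; case: asboolP.
pose V : set (cspace R d) := [set z | exists m, 2 * rho < normc (z 0 m - p 0 m : R[i])].
have F0 z : V z -> F z = 0.
  move=> [m hm]; rewrite /F; case: asboolP => // _; rewrite bump0 ?mul0r//.
  by move=> /(_ m) h; have := lt_trans hm h; rewrite ltxx.
have oV : open V.
  apply: openP => w [m hm]; exists (normc (w 0 m - p 0 m : R[i]) - 2 * rho); first by rewrite subr_gt0.
  move=> y /(_ m) hy; exists m; have := le_normcD (y 0 m - p 0 m) (w 0 m - y 0 m).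
  have -> : y 0 m - p 0 m + (w 0 m - y 0 m) = w 0 m - p 0 m :> R[i] by ring.
  by rewrite (normcB (w 0 m) (y 0 m)) => h; lra.
have cov z : box p r z \/ V z.
  have [h|/existsNP[m /negP]] := pselect (box p r z); [by left | rewrite -leNgt => hm; right].
  by exists m; apply: lt_le_trans hm.
have sbf : smooth (box p r) (fun z => bump p rho z * f z).
  by apply: smoothM sf; apply: smooth_sub (bump_smooth p rho0).
have Fb : {in box p r, (fun z => bump p rho z * f z) =1 F} by move=> z; rewrite inE => /Fin.
have FV : {in V, (fun=> 0 : cplx R) =1 F} by move=> z; rewrite inE => /F0.
have sF : smooth setT F.
  apply: smooth_local openT _ => z _; have [h|h] := cov z.
    exists (box p r); split=> //; first exact: box_open.
    exact: (smooth_ext (@box_open R d p r) Fb sbf).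
  by exists V; split=> //; exact: (smooth_ext oV FV (smooth_cst V (0 : cplx R))).
(* A size for the support as seen from the origin, as the Cauchy transform requires. It also bounds
   the coordinates of the points of the inner polydisc, so that B + B is a sufficient radius of
   integration. *)
pose B := 2 * rho + 1 + \sum_m normc (p 0 m : R[i]).
have pB m : normc (p 0 m : R[i]) <= \sum_m normc (p 0 m : R[i]).
  by rewrite (bigD1 m)//= lerDl sumr_ge0// => i _; exact: normc_ge0.
have B0 : 0 < B by rewrite /B; have := pB k; have := normc_ge0 (p 0 k : R[i]); lra.
have suppF : supp_in B F.
  move=> z [m hm]; apply: F0; exists m; have := le_normcD (z 0 m - p 0 m : R[i]) (p 0 m : R[i]).
  rewrite subrK => h; have hp := pB m; rewrite /B in hm. lra.
have unF : unif F := uniform_supp (Ck_cont (sF 0)) suppF.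
have R0 : 0 < B + B by rewrite addr_gt0.
exists (cauchy k (B + B) F); split.
- by move=> n; exact: (cauchy_Ck k R0 (sF n) suppF).
- move=> z hz.
  have zr : box p r z by move=> m; apply: lt_trans (hz m) _; rewrite /rho ltr_pdivrMr// ltr_pMr// ltr1n.
  rewrite pd_zbarE (cauchy_wdir k R0 _ _ _ (sF 1) suppF) -pd_zbarE.
  rewrite (cauchy_solves R0 (sF 1) suppF); first by rewrite Fin// bump1// mul1r.
  rewrite lerD2l /B; have := le_normcD (z 0 k - p 0 k : R[i]) (p 0 k : R[i]); rewrite subrK.
  by have := hz k; have := pB k; rewrite -/rho; lra.
- move=> l z lk hl hz.
  rewrite pd_zbarE (cauchy_wdir k R0 _ _ _ (sF 1) suppF) -pd_zbarE.
  apply: (cauchy0 R0).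
    by rewrite pd_zbarE; exact: (unif_wdir _ _ (sF 1) suppF).
  move=> s t; set y := shift k z s t.
  have yl : normc (y 0 l - p 0 l : R[i]) < rho by rewrite /y shift_neq//; exact: hz.
  have [h|h] := cov y; last first.
    by rewrite pd_zbarE -(wdir_ext _ _ oV h (Ck_cst 1 V 0) FV) wdir_cst.
  rewrite pd_zbarE -(wdir_ext _ _ (@box_open R d p r) h (sbf 1) Fb).
  rewrite (wdirM _ _ h (smooth_sub (fun _ _ => I) (bump_smooth p rho0) 1) (sf 1)).
  rewrite -(pd_zbarE l f) hl// mulr0 addr0.
  have bd b : is_real_deriv (bump p rho) (dir R b l) y 0.
    apply/isdP; have := cder_cst (bump p rho y : R[i]); apply: (@cder_ext _ _ _ _ (rho - normc (y 0 l - p 0 l : R[i]))).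
      by rewrite subr_gt0.
    move=> x hx; apply: (@bump_eq p rho _ _ l) => //.
      move=> m ml; rewrite lineE; have -> : dir R b l 0 m = 0 :> R[i]; last by rewrite mulr0 addr0.
      Local Transparent dir.
      by case: (b); rewrite /dir /dir_x /dir_y !mxE eqxx (negbTE ml) /= ?mulr0.
      Local Opaque dir.
    rewrite lineE addrAC; apply: le_lt_trans (le_normcD _ _) _; rewrite normcM normc_real.
    have h2 : `|x| * normc (dir R b l 0 l : R[i]) <= `|x| by rewrite ler_piMr// normc_dir.
    by lra.
  by rewrite (wdir_isd _ (bd true) (bd false)) mulr0 addr0 mulr0 mul0r.
move=> hf; apply/funext => z; apply: (cauchy0 R0) => // s t.
by have [h|h] := cov (shift k z s t); [rewrite Fin// hf// mulr0 | exact: F0].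
Qed.

(** Induction on the number [m] of variables whose differentials dzbar_l may occur. Integrating in
    zbar_k the coefficients that contain the last of them, and subtracting the boundary, removes
    dzbar_k; the later differentials do not come back, because all coefficients are holomorphic in
    those variables. *)
Lemma dolbeault_step (m : nat) p (r : R) om q : 0 < r -> (0 < q)%N ->
  (forall B, smooth (box p r) (om B)) ->
  (forall B z, box p r z -> #|B| != q -> om B z = 0) ->
  (forall B z, box p r z -> (exists2 l, l \in B & (m <= l)%N) -> om B z = 0) ->
  (forall B z, box p r z -> dbar om B z = 0) ->
  exists r' eta, [/\ 0 < r', r' <= r, forall B, smooth (box p r') (eta B),
    forall B z, box p r' z -> #|B|.+1 != q -> eta B z = 0 &
    forall B z, box p r' z -> dbar eta B z = om B z].
Proof.
move=> r0 q0; elim: m r om r0 => [|m IH] r om r0 sm deg low cl.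
  exists r, (fun _ _ => 0); split => //; first by move=> B; exact: smooth_cst.
  move=> B z hz; rewrite /dbar big1 => [|k _]; last by rewrite pd_zbarE wdir_cst mulr0.
  have [->|[l lB]] := set_0Vmem B.
    by rewrite deg// cards0 eq_sym -lt0n.
  by rewrite low//; exists l.
have [dm|md] := ltnP m d; last first.
  by apply: IH => // B z hz [l _ ml]; have := leq_ltn_trans (leq_trans md ml) (ltn_ord l); rewrite ltnn.
pose k := Ordinal dm.
(* For l outside of [B], the coefficient of index l |: B in the equation of closedness has a single
   nonzero term: all the others differentiate a coefficient whose index contains l. *)
have hol B (l : 'I_d) : (m < l)%N -> forall w, box p r w -> pd_zbar l (om B) w = 0.
  move=> ml w hw; have zero D : (exists2 j, j \in D & (m < j)%N) -> forall j, pd_zbar j (om D) w = 0.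
    move=> hD j; have E : {in box p r, (fun=> 0 : cplx R) =1 om D}.
      by move=> x; rewrite inE => hx; rewrite low.
    by rewrite pd_zbarE -(wdir_ext _ _ (@box_open R d p r) hw (Ck_cst 1 _ 0) E) wdir_cst.
  have [lB|lB] := boolP (l \in B); first by apply: zero; exists l.
  have := cl (l |: B) w hw; rewrite /dbar (bigD1 l) ?setU11//= setU1K// big1 ?addr0.
    by move=> /eqP; rewrite mulf_eq0 (negbTE (sgn_neq0 R _ _)) /= => /eqP.
  move=> j /andP[jB jl]; rewrite zero ?mulr0//; exists l => //.
  by rewrite !inE eqxx eq_sym jl.
have [G hG] := choice (fun B => @dbar_solve1 p r (om B) k r0 (sm B)).
pose r1 := r / 3; have r10 : 0 < r1 by rewrite divr_gt0.
have r1r : r1 <= r by rewrite /r1; lra.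
have sub1 : box p r1 `<=` box p r by move=> z hz j; apply: lt_le_trans (hz j) r1r.
(* Strips dzbar_k from the components containing it and integrates their coefficients; the sign is
   that of moving dzbar_k to the front. *)
pose gam (B : {set 'I_d}) : cspace R d -> cplx R := if k \in B then fun=> 0 else fun z => sgn k B * G (k |: B) z.
have sgam B : smooth setT (gam B).
  rewrite /gam; case: ifP => _; first exact: smooth_cst.
  by apply: smoothZ; have [] := hG (k |: B).
have sgam1 B : smooth (box p r1) (gam B) by apply: smooth_sub (sgam B).
have gam_hol B (l : 'I_d) z : (m < l)%N -> box p r1 z -> pd_zbar l (gam B) z = 0.
  move=> ml hz; rewrite pd_zbarE /gam; case: ifP => kB; first by rewrite wdir_cst.
  have [s1 _ h3 _] := hG (k |: B).
  rewrite (wdirZ _ _ _ (I : setT z) (s1 1)) -pd_zbarE h3 ?mulr0//.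
    by apply/eqP => lk; rewrite lk ltnn in ml.
  exact: hol.
have gam0 B : (exists2 j, j \in B & (m < j)%N) -> gam B = fun=> 0.
  move=> [j jB mj]; rewrite /gam; case: ifP => // kB; have [_ _ _ h4] := hG (k |: B).
  rewrite h4; first by apply/funext => z; rewrite mulr0.
  by move=> w hw; rewrite low//; exists j => //; rewrite !inE jB orbT.
have dgam_k B z : box p r1 z -> k \in B -> dbar gam B z = om B z.
  move=> hz kB; rewrite /dbar (bigD1 k)//= big1 ?addr0.
    rewrite /gam !inE eqxx /= finset.setD1K//; have [s1 h2 _ _] := hG B.
    by rewrite pd_zbarE (wdirZ _ _ _ (I : setT z) (s1 1)) -pd_zbarE h2// mulrA sgnD1_id sgn_sqr mul1r.
  move=> j /andP[jB jk]; rewrite /gam !inE eq_sym jk kB /=.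
  by rewrite pd_zbarE wdir_cst mulr0.
have dgam_l B z (l : 'I_d) : box p r1 z -> k \notin B -> l \in B -> (m < l)%N -> dbar gam B z = 0.
  move=> hz kB lB ml; rewrite /dbar big1// => j jB; have [mj|jm] := ltnP m j.
    by rewrite gam_hol// mulr0.
  rewrite gam0 ?pd_zbarE ?wdir_cst ?mulr0//; exists l => //; rewrite !inE lB andbT.
  by apply/eqP => lj; move: jm; rewrite -lj leqNgt ml.
pose om1 B z : cplx R := om B z + (-1) * dbar gam B z.
have sdg B : smooth (box p r1) (dbar gam B) by apply: dbar_smooth => //; exact: box_open.
have sm1 B : smooth (box p r1) (om1 B).
  by apply: smoothD; [apply: smooth_sub (sm B) | exact: smoothZ].
have deggam B z : box p r1 z -> #|B|.+1 != q -> gam B z = 0.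
  move=> hz hB; rewrite /gam; case: ifP => // kB; have [_ _ _ h4] := hG (k |: B).
  rewrite h4 ?mulr0// => w hw; rewrite deg// cardsU1 kB; exact: hB.
have gamdeg B : #|B|.+1 != q -> gam B = fun=> 0.
  move=> hB; rewrite /gam; case: ifP => // kB; have [_ _ _ h4] := hG (k |: B).
  rewrite h4; first by apply/funext => z; rewrite mulr0.
  by move=> w hw; rewrite deg// cardsU1 kB; exact: hB.
have [|||r2 [eta [r20 r21 seta degeta deta]]] := IH r1 om1 r10 sm1.
- move=> B z hz hB; rewrite /om1 deg//; last exact: sub1.
  rewrite /dbar big1 ?mulr0 ?addr0// => j jB; rewrite gamdeg ?pd_zbarE ?wdir_cst ?mulr0//.
  by move: hB; rewrite (cardsD1 j) jB.
- move=> B z hz [l lB ml]; rewrite /om1; have [kB|kB] := boolP (k \in B).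
    by rewrite dgam_k// mulN1r subrr.
  have ml' : (m < l)%N.
    by rewrite ltn_neqAle ml andbT; apply: contraNneq kB => h; rewrite (_ : k = l)//; exact: val_inj.
  rewrite (dgam_l B z l)// mulr0 addr0 low//; [exact: sub1 | by exists l].
- move=> B z hz; rewrite /om1.
  rewrite (@dbarD (box p r1) om (fun B z => (-1) * dbar gam B z))//.
  + rewrite (@dbarZ (box p r1) (dbar gam))// (dbar_dbar _ (@box_open R d p r1) hz)// mulr0 addr0.
    by apply: cl; exact: sub1.
  + by move=> D; apply: smooth_sub (sm D).
  + by move=> D; exact: smoothZ.
exists r2, (fun B z => eta B z + gam B z).
have sub2 : box p r2 `<=` box p r1 by move=> z hz j; apply: lt_le_trans (hz j) r21.
split => //; first exact: le_trans r1r.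
- by move=> B; apply: smoothD => //; apply: smooth_sub (sgam B).
- by move=> B z hz hB; rewrite degeta// deggam ?addr0//; exact: sub2.
move=> B z hz; rewrite (@dbarD (box p r2) eta gam)//.
  by rewrite deta// /om1 mulN1r subrK.
by move=> D; apply: smooth_sub (sgam D).
Qed.

Lemma dolbeault_lemma p (r : R) om q : 0 < r -> (0 < q)%N ->
  (forall B, smooth (box p r) (om B)) ->
  (forall B z, box p r z -> #|B| != q -> om B z = 0) ->
  (forall B z, box p r z -> dbar om B z = 0) ->
  exists r' eta, [/\ 0 < r', r' <= r, forall B, smooth (box p r') (eta B),
    forall B z, box p r' z -> #|B|.+1 != q -> eta B z = 0 &
    forall B z, box p r' z -> dbar eta B z = om B z].
Proof.
move=> r0 q0 sm deg cl; apply: (@dolbeault_step d) => // B z _ [l _].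
by rewrite leqNgt ltn_ord.
Qed.

End Dolbeault.

(** * Minors and exterior products *)

Section EnumOrd.
Variable d : nat.
Implicit Types (A B : {set 'I_d}) (k l : 'I_d) (s t : seq 'I_d).

Definition ordlt : rel 'I_d := fun x y => (x < y)%N.

Lemma ordlt_trans : transitive ordlt.
Proof. by move=> y x z; exact: ltn_trans. Qed.

Lemma enum_sorted B : sorted ordlt (enum B).
Proof.
rewrite /enum_mem; apply: (sorted_filter ordlt_trans).
have : sorted ltn [seq val i | i <- enum 'I_d] by rewrite val_enum_ord iota_ltn_sorted.
by rewrite sorted_map enumT.
Qed.

Lemma enum_setP B s : sorted ordlt s -> B =i s -> enum B = s.
Proof.
move=> ss Bs; apply: (irr_sorted_eq ordlt_trans) => //; first by move=> x; rewrite /ordlt ltnn.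
  exact: enum_sorted.
by move=> x; rewrite mem_enum Bs.
Qed.

Lemma enum_cons A l s : enum A = l :: s -> exists A',
  [/\ enum A' = s, l \notin A', A = l |: A' & forall j, j \in A' -> (l < j)%N].
Proof.
move=> E; have ss := enum_sorted A; rewrite E /= in ss.
have ls : all (ordlt l) s by apply: order_path_min ss; exact: ordlt_trans.
have es : enum [set x in s]%SET = s.
  by apply: enum_setP; [exact: path_sorted ss | move=> x; rewrite inE].
exists [set x in s]%SET; split => //.
- by rewrite inE; apply/negP => /(allP ls); rewrite /ordlt ltnn.
- by apply/setP => x; rewrite !inE -mem_enum E inE.
- by move=> j; rewrite inE => /(allP ls).
Qed.

Lemma enum_setU1_min l A : (forall j, j \in A -> (l < j)%N) -> enum (l |: A) = l :: enum A.
Proof.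
move=> h; apply: enum_setP; last by move=> x; rewrite !inE mem_enum.
rewrite /= (path_sortedE ordlt_trans) enum_sorted andbT.
by apply/allP => j; rewrite mem_enum => /h.
Qed.

(** The exponent in [koszul_sign] is thus the position in the increasing enumeration, that is the
    column index in a cofactor expansion. *)
Lemma card_lt_nth B x0 (j : nat) : (j < #|B|)%N ->
  #|[set l in B | (l < nth x0 (enum B) j)%N]%SET| = j.
Proof.
move=> jB; have jl : (j < size (enum B))%N by rewrite -cardE.
have E : count (fun x => x < nth x0 (enum B) j)%O (enum B) = j.
  by apply: Order.POrderTheory.count_lt_nth => //; exact: enum_sorted.
transitivity (count (fun x => x < nth x0 (enum B) j)%O (enum B)); last exact: E.
rewrite -size_filter cardE; congr size; apply: enum_setP.
  by apply: (sorted_filter ordlt_trans); exact: enum_sorted.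
by move=> x; rewrite mem_filter inE mem_enum andbC.
Qed.

Lemma nth_enum_setD1 B x0 (j i : nat) : (j < #|B|)%N ->
  nth x0 (enum (B :\ nth x0 (enum B) j)) i = nth x0 (enum B) (fintype.bump j i).
Proof.
move=> jB; have jl : (j < size (enum B))%N by rewrite -cardE.
set k := nth x0 (enum B) j.
have E : enum (B :\ k) = take j (enum B) ++ drop j.+1 (enum B).
  have := cat_take_drop j (enum B); rewrite (drop_nth x0 jl) -/k => E.
  have uB := enum_uniq (mem B); rewrite -E cat_uniq /= in uB.
  case/and3P: uB => u1 /norP[k1 h1] /andP[k2 u2].
  apply: enum_setP.
    have := enum_sorted B; rewrite -{1}E => ss.
    have sub : subseq (take j (enum B) ++ drop j.+1 (enum B)) (take j (enum B) ++ k :: drop j.+1 (enum B)).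
      by apply: cat_subseq => //; exact: subseq_cons.
    exact: subseq_sorted ordlt_trans _ _ sub ss.
  move=> x; rewrite !inE -mem_enum -{1}E !mem_cat inE.
  have [->|xk] := eqVneq x k; last by [].
  by rewrite (negbTE k1) (negbTE k2).
rewrite E nth_cat size_takel ?(ltnW jl)// /fintype.bump.
case: leqP => [ji|ij]; last by rewrite nth_take.
by rewrite add1n nth_drop addSn subnKC.
Qed.

End EnumOrd.

(** * Exterior products with covectors and the Cauchy-Binet formula *)

Section Wedge.
Variables (R : realType) (d : nat).
Implicit Types (A B C : {set 'I_d}) (k l : 'I_d) (u : {set 'I_d} -> R[i]) (v w : 'I_d -> R[i]) (J : 'M[R[i]]_d).
Notation sgn := (@koszul_sign R d).

(** The coefficients of the exterior product of the covector [v] with the form [u]. *)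
Definition wedge v u B : R[i] := \sum_(k in B) sgn k B * (v k * u (B :\ k)).

Lemma eq_wedge v u u' : u =1 u' -> wedge v u =1 wedge v u'.
Proof. by move=> h B; apply: eq_bigr => k _; rewrite h. Qed.

Lemma wedgeZ v u (c : R[i]) B : wedge v (fun B => c * u B) B = c * wedge v u B.
Proof. by rewrite /wedge big_distrr; apply: eq_bigr => k _ /=; ring. Qed.

Lemma wedge_suml (I : Type) (s : seq I) (P : pred I) (v : I -> 'I_d -> R[i]) u B :
  wedge (fun k => \sum_(i <- s | P i) v i k) u B = \sum_(i <- s | P i) wedge (v i) u B.
Proof.
rewrite /wedge exchange_big /=; apply: eq_bigr => k _.
by rewrite big_distrl big_distrr.
Qed.

Lemma wedgeZl v u (c : R[i]) B : wedge (fun k => c * v k) u B = c * wedge v u B.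
Proof. by rewrite /wedge big_distrr; apply: eq_bigr => k _ /=; ring. Qed.

Lemma wedge2E v w u B : wedge v (wedge w u) B =
  \sum_(k in B) sgn k B * \sum_(l in B :\ k) sgn l (B :\ k) * (v k * w l * u (B :\: [set k; l]%SET)).
Proof.
apply: eq_bigr => k _; congr (_ * _); rewrite /wedge big_distrr; apply: eq_bigr => l _ /=.
by rewrite finset.setDDl; ring.
Qed.

Lemma wedge_anti v w u B : wedge v (wedge w u) B = - wedge w (wedge v u) B.
Proof.
apply/eqP; rewrite -subr_eq0 opprK; apply/eqP.
rewrite !wedge2E -big_split /= -[RHS](@koszul_double_sum R d B
  (fun k l => (v k * w l + w k * v l) * u (B :\: [set k; l]%SET))).
  apply: eq_bigr => k _; rewrite -mulrDr -big_split /=; congr (_ * _); apply: eq_bigr => l _; ring.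
by move=> k l; rewrite finset.setUC; ring.
Qed.

Lemma wedge_sq v u B : wedge v (wedge v u) B = 0.
Proof.
have : wedge v (wedge v u) B *+ 2 = 0 by rewrite mulr2n {1}wedge_anti addNr.
by move/eqP; rewrite mulrn_eq0 => /orP[//|/eqP].
Qed.

Lemma minor_det J A B n x0 : #|A| = n -> #|B| = n ->
  minor J A B = \det (\matrix_(i < n, j < n) J (nth x0 (enum A) i) (nth x0 (enum B) j)).
Proof.
move=> hA hB; subst n; rewrite /minor hB eqxx; congr (\det _); apply/matrixP => i j; rewrite !mxE.
by rewrite (enum_val_nth x0); congr (J _ _); apply: set_nth_default; rewrite -cardE hB.
Qed.

Lemma minor_card J A B : #|A| != #|B| -> minor J A B = 0.
Proof. by move=> h; rewrite /minor (negbTE h). Qed.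

Lemma minor0 J B : minor J finset.set0 B = (B == finset.set0)%:R.
Proof.
have det0 n (M : 'M[R[i]]_n) : n = 0 -> \det M = 1.
  by move=> n0; subst n; rewrite det_mx00.
rewrite -cards_eq0; have [h|h] := eqVneq #|B| 0; last first.
  by rewrite minor_card ?cards0 1?eq_sym.
rewrite /minor; case: eqP => [_|]; first by apply: det0; exact: cards0.
by rewrite cards0 h.
Qed.

Lemma sum_enum B x0 (F : 'I_d -> R[i]) n : #|B| = n ->
  \sum_(k in B) F k = \sum_(j < n) F (nth x0 (enum B) j).
Proof.
by move=> <-; rewrite -big_enum (big_nth x0) big_mkord -cardE.
Qed.

(** Laplace expansion along the first row: row [l] comes first in the enumeration because it
    precedes all of [A]. *)
Lemma minor_min J A B l : (forall j, j \in A -> (l < j)%N) ->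
  minor J (l |: A) B = wedge (J l) (minor J A) B.
Proof.
move=> hl; have lA : l \notin A by apply/negP => /hl; rewrite ltnn.
have cA : #|l |: A| = #|A|.+1 by rewrite cardsU1 lA.
have [hB|hB] := eqVneq #|B| #|A|.+1; last first.
  rewrite minor_card ?cA 1?eq_sym// /wedge big1// => k kB.
  rewrite minor_card ?mulr0//; move: hB; rewrite (cardsD1 k) kB add1n eqSS.
  by rewrite eq_sym.
rewrite (minor_det J l cA hB) (expand_det_row _ ord0) /wedge (sum_enum l _ hB).
apply: eq_bigr => j _; rewrite mxE enum_setU1_min//=.
have jB : (j < #|B|)%N by rewrite hB.
set k := nth l (enum B) j.
have kB : k \in B by rewrite -mem_enum mem_nth// -cardE.
rewrite /cofactor add0n mulrCA; congr (_ * _).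
  by rewrite /koszul_sign card_lt_nth.
congr (_ * _); rewrite (minor_det J l (n := #|A|))//; last first.
  by move: hB; rewrite (cardsD1 k) kB add1n => -[].
congr (\det _); apply/matrixP => a b; rewrite !mxE /=; congr (J _ _).
by rewrite nth_enum_setD1.
Qed.

(** Building a subset by adding new minima is the order in which no sign occurs. *)
Lemma set_min_ind (P : {set 'I_d} -> Prop) : P finset.set0 ->
  (forall l A, (forall j, j \in A -> (l < j)%N) -> P A -> P (l |: A)) -> forall A, P A.
Proof.
move=> P0 PS A; move: {2}(enum A) (erefl (enum A)) => s; elim: s A => [|l s IH] A E.
  have A0 : A = finset.set0 by apply/setP => x; rewrite -(mem_enum (mem A)) E in_nil finset.inE.
  by rewrite A0.
have [A1 [E1 _ AE hl]] := enum_cons E; rewrite AE; exact: PS hl (IH _ E1).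
Qed.

(** The minors with rows [A] are the coefficients of the exterior product of these rows; a further
    row is moved to its place at the cost of the sign, and a repeated row gives 0. *)
Lemma wedge_minor J l A B :
  wedge (J l) (minor J A) B = if l \in A then 0 else sgn l A * minor J (l |: A) B.
Proof.
move: A l B; apply: set_min_ind => // [l B|h A hA IH l B].
  rewrite inE -minor_min; last by move=> j; rewrite inE.
  rewrite [sgn _ _](_ : _ = 1) ?mul1r// /koszul_sign (_ : [set _ in _ | _]%SET = finset.set0) ?cards0//.
  by apply/setP => x; rewrite !inE.
have hA' : h \notin A by apply/negP => /hA; rewrite ltnn.
rewrite (eq_wedge _ (fun B => minor_min J B hA)).
have [->|lh] := eqVneq l h; first by rewrite wedge_sq !inE eqxx.
rewrite !inE (negbTE lh) /=.
have [lt_lh|le_hl] := ltnP l h.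
  have la j : j \in h |: A -> (l < j)%N.
    by rewrite !inE => /orP[/eqP ->//|/hA]; exact: ltn_trans.
  have lA : l \notin A by apply/negP => /hA/(ltn_trans lt_lh); rewrite ltnn.
  rewrite (negbTE lA) (minor_min J B la) (eq_wedge _ (fun B => minor_min J B hA)).
  rewrite [sgn _ _](_ : _ = 1) ?mul1r// /koszul_sign (_ : [set _ in _ | _]%SET = finset.set0) ?cards0//.
  by apply/setP => x; rewrite !inE; apply/negP => /andP[/orP[/eqP ->|/hA hx] xl];
    [have := ltn_trans lt_lh xl | have := ltn_trans (ltn_trans lt_lh hx) xl]; rewrite ltnn.
have hl : (h < l)%N by rewrite ltn_neqAle le_hl andbT; apply: contraNneq lh => e; apply/eqP/val_inj.
rewrite wedge_anti (eq_wedge _ (IH l)); case: ifP => lA.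
  by rewrite /wedge big1 ?oppr0// => k _; rewrite !mulr0.
rewrite wedgeZ -mulNr; congr (_ * _).
  have := @sgnD1 R d h l (h |: A); rewrite setU1K// setU11 hl expr1 mulN1r => /(_ isT) ->.
  by rewrite opprK.
rewrite finset.setUCA -minor_min// => j; rewrite !inE => /orP[/eqP ->//|]; exact: hA.
Qed.

Lemma sum_insert (F : 'I_d -> {set 'I_d} -> R[i]) :
  \sum_(B : {set 'I_d}) \sum_(l | l \notin B) F l B = \sum_(C : {set 'I_d}) \sum_(l in C) F l (C :\ l).
Proof.
rewrite (exchange_big_dep predT)//= [RHS](exchange_big_dep predT)//=; apply: eq_bigr => l _.
rewrite (reindex_onto (fun C => C :\ l) (fun B => l |: B)) /=; last by move=> B lB; rewrite setU1K.
apply: eq_bigl => C; rewrite !inE eqxx /=; apply/eqP/idP => [<-|]; first by rewrite setU11.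
exact: finset.setD1K.
Qed.

(** The map induced on exterior powers is multiplicative: the image of a product with [v] is the
    product with the image of [v]. *)
Lemma sum_wedge_minor J v u B :
  \sum_C wedge v u C * minor J C B =
  \sum_C u C * wedge (fun k => \sum_l v l * J l k) (minor J C) B.
Proof.
have -> : \sum_C wedge v u C * minor J C B =
   \sum_(C : {set 'I_d}) \sum_(l in C) sgn l (C :\ l) * v l * u (C :\ l) * minor J (l |: (C :\ l)) B.
  apply: eq_bigr => C _; rewrite /wedge big_distrl; apply: eq_bigr => l lC /=.
  by rewrite finset.setD1K// sgnD1_id; ring.
rewrite -(sum_insert (fun l B' => sgn l B' * v l * u B' * minor J (l |: B') B)).
apply: eq_bigr => C _; rewrite wedge_suml big_distrr /= big_mkcond; apply: eq_bigr => l _ /=.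
by rewrite wedgeZl wedge_minor; case: (l \in C) => /=; ring.
Qed.

(** The Cauchy-Binet formula, that is the functoriality of exterior powers, by induction on the
    rows. *)
Lemma minorM J1 J2 A B : minor (J1 *m J2) A B = \sum_C minor J1 A C * minor J2 C B.
Proof.
move: A B; apply: set_min_ind => // [B|l A hl IH B].
  rewrite minor0 (bigD1 finset.set0)//= big1 ?addr0 => [|C /negbTE C0].
    by rewrite !minor0 eqxx mul1r.
  by rewrite minor0 C0 mul0r.
rewrite minor_min// (eq_wedge _ IH).
under [RHS]eq_bigr do rewrite minor_min//.
rewrite sum_wedge_minor {1}/wedge.
under [RHS]eq_bigr do rewrite /wedge big_distrr /=.
rewrite [RHS]exchange_big /=; apply: eq_big => // k kB; rewrite !big_distrr; apply: eq_bigr => C _ /=.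
by rewrite mxE; ring.
Qed.

Lemma minor1 A B : minor (1%:M : 'M[R[i]]_d) A B = (A == B)%:R.
Proof.
move: A B; apply: set_min_ind => // [B|l A hl IH B]; first by rewrite minor0 eq_sym.
have lA : l \notin A by apply/negP => /hl; rewrite ltnn.
rewrite minor_min// (eq_wedge _ IH) /wedge big_mkcond (bigD1 l)//= big1 ?addr0; last first.
  by move=> k kl; rewrite mxE eq_sym (negbTE kl) mul0r mulr0; case: ifP.
rewrite mxE eqxx mul1r; case: ifP => lB; last first.
  by rewrite (_ : (l |: A == B) = false)//; apply/eqP => E; rewrite -E setU11 in lB.
have [AB|AB] := eqVneq A (B :\ l); last first.
  rewrite mulr0 (_ : (l |: A == B) = false)//; apply/eqP => E; case/eqP: AB.
  by rewrite -E setU1K.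
rewrite AB finset.setD1K// eqxx mulr1 -sgnD1_id -AB /koszul_sign (_ : [set _ in _ | _]%SET = finset.set0) ?cards0//.
by apply/setP => x; rewrite !inE; apply/negP => /andP[/hl h1 h2]; have := ltn_trans h1 h2; rewrite ltnn.
Qed.

Lemma minorJ J A B : minor (map_mx conjc J) A B = (minor J A B)^*%C.
Proof.
rewrite /minor; case: ifP => _; last by rewrite conjc0.
by rewrite -(det_map_mx conjc); congr (\det _); apply/matrixP => i j; rewrite !mxE.
Qed.

End Wedge.

(** * Pullback of polyvectors and forms by holomorphic maps *)

Section Pullback.
Variables (R : realType) (d : nat).
Implicit Types (z w p : cspace R d) (f g h : cspace R d -> cplx R).
Implicit Types (A B C D : {set 'I_d}) (k l : 'I_d) (U V : set (cspace R d)) (om eta : {set 'I_d} -> cspace R d -> cplx R).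
Notation sgn := (@koszul_sign R d).
Local Opaque real_deriv dir.

(** Contraction with a covector is dual to the exterior product with it, and [M] carries the
    covector along. *)
Lemma contract_pull (M : 'M[R[i]]_d) (c : 'I_d -> R[i]) (s : {set 'I_d} -> R[i]) A :
  \sum_(k | k \notin A) sgn k A * c k * (\sum_A' minor M (k |: A) A' * s A') =
  \sum_A' minor M A A' * \sum_(l | l \notin A') sgn l A' * (\sum_k c k * M k l) * s (l |: A').
Proof.
transitivity (\sum_A' s A' * wedge (fun l => \sum_k c k * M k l) (minor M A) A').
  under eq_bigr do rewrite big_distrr /=.
  rewrite exchange_big /=; apply: eq_bigr => A' _.
  rewrite wedge_suml big_distrr /= big_mkcond; apply: eq_bigr => k _ /=.
  by rewrite wedgeZl wedge_minor; case: (k \in A) => /=; ring.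
rewrite [RHS](_ : _ = \sum_(A' : {set 'I_d}) \sum_(l | l \notin A')
   minor M A A' * (sgn l A' * (\sum_k c k * M k l) * s (l |: A'))); last first.
  by apply: eq_bigr => A' _; rewrite big_distrr.
rewrite (sum_insert (fun l B => minor M A B * (sgn l B * (\sum_k c k * M k l) * s (l |: B)))).
apply: eq_bigr => C _; rewrite /wedge big_distrr; apply: eq_bigr => l lC /=.
by rewrite finset.setD1K// sgnD1_id; ring.
Qed.

Lemma holomorphic_minor U (N : cspace R d -> 'M[R[i]]_d) C B :
  (forall l k, holomorphic U (fun z => N z l k : cplx R)) ->
  holomorphic U (fun z => minor (N z) C B : cplx R).
Proof.
move=> h; have [e|e] := boolP (#|C| == #|B|); last first.
  have -> : (fun z => minor (N z) C B) = fun=> 0 by apply/funext => z; rewrite /minor (negbTE e).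
  exact: holomorphic_cst.
have -> : (fun z => minor (N z) C B) = fun z => \sum_(s : {perm 'I_#|C|}) (-1) ^+ s *
    \prod_i N z (enum_val i) (nth (enum_val i) (enum B) (s i)).
  by apply/funext => z; rewrite /minor e; apply: eq_bigr => s _; congr (_ * _); apply: eq_bigr => i _; rewrite mxE.
apply: holomorphic_sum => s _; apply: holomorphicZ; apply: holomorphic_prod => i _; exact: h.
Qed.

Lemma dbar_sum U (I : Type) (s : seq I) (P : pred I) (F : I -> {set 'I_d} -> cspace R d -> cplx R) B z :
  U z -> (forall i B, P i -> smooth U (F i B)) ->
  dbar (fun B z => \sum_(i <- s | P i) F i B z) B z = \sum_(i <- s | P i) dbar (F i) B z.
Proof.
move=> Uz h; rewrite /dbar exchange_big /=; apply: eq_bigr => k _.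
rewrite pd_zbarE (wdir_sum _ _ _ Uz); first by rewrite big_distrr.
by move=> i Pi; exact: h.
Qed.

Lemma dbar_holoM U h om B z : U z -> holomorphic U h -> (forall B, smooth U (om B)) ->
  dbar (fun B z => h z * om B z) B z = h z * dbar om B z.
Proof.
move=> Uz [sh hh] so; rewrite /dbar big_distrr; apply: eq_bigr => k _ /=.
have E := wdirM 'i%C k Uz (sh 1) (so (B :\ k) 1).
rewrite -(pd_zbarE k h) hh// mul0r add0r in E.
by rewrite [RHS]mulrCA; congr (_ * _); exact: E.
Qed.

(** The Leibniz rule for a covector closed at [z]: the terms that differentiate [v] form a double
    sum with symmetric coefficients and vanish. The sign comes from moving dzbar_k past [v]. *)
Lemma dbar_wedge U (v : 'I_d -> cspace R d -> cplx R) om B z : open U -> U z ->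
  (forall k, smooth U (v k)) -> (forall B, smooth U (om B)) ->
  (forall k l, pd_zbar k (v l) z = pd_zbar l (v k) z) ->
  dbar (fun B z => wedge (v^~ z) (om^~ z) B) B z = - wedge (v^~ z) (fun B => dbar om B z) B.
Proof.
move=> oU Uz sv so cl.
have -> : dbar (fun B z => wedge (v^~ z) (om^~ z) B) B z =
  \sum_(k in B) sgn k B * \sum_(l in B :\ k) sgn l (B :\ k) * (pd_zbar k (v l) z * om (B :\: [set k; l]%SET) z)
  + \sum_(k in B) sgn k B * \sum_(l in B :\ k) sgn l (B :\ k) * (v l z * pd_zbar k (om (B :\ k :\ l)) z).
  rewrite /dbar -big_split; apply: eq_bigr => k _ /=; rewrite -mulrDr; congr (_ * _).
  rewrite pd_zbarE (wdir_sum _ _ _ Uz); last first.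
    move=> l _; apply: smoothZ; apply: smoothM; [exact: sv | exact: so].
  rewrite -big_split; apply: eq_bigr => l _ /=.
  have s2 : Ck 1 U (fun z => v l z * om (B :\ k :\ l) z) by apply: CkM; [exact: sv | exact: so].
  rewrite (wdirZ _ _ _ Uz s2) -mulrDr; congr (_ * _).
  have E := wdirM 'i%C k Uz (sv l 1) (so (B :\ k :\ l) 1).
  by rewrite finset.setDDl in E *; exact: E.
rewrite (@koszul_double_sum R d B (fun k l => pd_zbar k (v l) z * om (B :\: [set k; l]%SET) z)); last first.
  by move=> k l; rewrite finset.setUC cl.
rewrite add0r /wedge /dbar -sumrN.
have -> : \sum_(k in B) sgn k B * \sum_(l in B :\ k) sgn l (B :\ k) * (v l z * pd_zbar k (om (B :\ k :\ l)) z)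
   = \sum_k \sum_(l | [&& k \in B, l \in B & k != l]) sgn k B * sgn l (B :\ k) * (v l z * pd_zbar k (om (B :\ k :\ l)) z).
  rewrite big_mkcond /=; apply: eq_bigr => k _; case: ifP => kB; last by rewrite big1.
  rewrite big_distrr /=; apply: eq_big => [l|l _]; last by rewrite mulrA.
  by rewrite !inE andbC eq_sym.
rewrite (exchange_big_dep predT)//= [RHS]big_mkcond /=; apply: eq_bigr => l _; case: ifP => lB; last first.
  by rewrite big1// => k /and3P[_ lB1 _]; rewrite lB1 in lB.
rewrite !big_distrr /= -sumrN; apply: eq_big => [k|k /andP[kB kl]].
  by rewrite !inE andbC.
rewrite sgn_anti// !finset.setDDl (finset.setUC [set l]%SET); ring.
Qed.

Section Transition.
Variables (U V : set (cspace R d)) (T : cspace R d -> cspace R d).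
Hypotheses (oU : open U) (oV : open V) (TV : forall z, U z -> V (T z)).
Hypothesis hT : forall l, holomorphic U (fun z => T z 0 l).

Definition jac z : 'M[R[i]]_d := \matrix_(l, k) pd_z k (fun z => T z 0 l) z.

Lemma holomorphic_jac l k : holomorphic U (fun z => jac z l k : cplx R).
Proof.
have -> : (fun z => jac z l k) = pd_z k (fun z => T z 0 l) by apply/funext => z; rewrite mxE.
exact: holomorphic_pd_z.
Qed.

Lemma smooth_minorJ C B : smooth U (fun z => (minor (jac z) C B)^*%C : cplx R).
Proof. by apply: smoothJ; have [] := holomorphic_minor C B holomorphic_jac. Qed.

Lemma pd_zbarJ k f z : U z -> smooth U f -> pd_zbar k (fun z => (f z)^*%C) z = (pd_z k f z)^*%C.
Proof.
move=> Uz sf; rewrite pd_zbarE (wdirJ _ _ Uz (sf 1)) pd_zE.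
by congr ((wdir _ _ _ _)^*%C); apply/eqP; rewrite eq_complex /= oppr0 !eqxx.
Qed.

(** The conjugate minors are the coefficients of the pullback of dzbar_C, a product of the forms
    dbar(conj T_l); each of these is closed by the symmetry of second derivatives. *)
Lemma dbar_minorJ C B z : U z -> dbar (fun B z => (minor (jac z) C B)^*%C) B z = 0.
Proof.
move: C B z; apply: set_min_ind => [B z Uz|l A hl IH B z Uz].
  rewrite /dbar big1// => k _.
  have -> : (fun z => (minor (jac z) finset.set0 (B :\ k))^*%C) = fun=> (B :\ k == finset.set0)%:R.
    by apply/funext => w; rewrite minor0; case: eqP => _; rewrite ?conjc1 ?conjc0.
  by rewrite pd_zbarE wdir_cst mulr0.
pose v k z : cplx R := (jac z l k)^*%C.
have -> : (fun B z => (minor (jac z) (l |: A) B)^*%C) =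
    (fun B z => wedge (v^~ z) (fun B => (minor (jac z) A B)^*%C) B).
  apply/funext => D; apply/funext => w; rewrite -minorJ minor_min//.
  by apply: eq_bigr => k _; rewrite mxE minorJ.
have sjac k m : smooth U (fun z => jac z k m) by have [] := holomorphic_jac k m.
refine (etrans (@dbar_wedge U v (fun B z => (minor (jac z) A B)^*%C) B z oU Uz _ _ _) _); last first.
- rewrite {1}/wedge big1 ?oppr0// => k _; rewrite IH// mulr0 mulr0//.
- move=> k m.
have F j : (fun w => jac w l j : cplx R) = wdir (- 'i%C) j (fun w => T w 0 l).
  by apply/funext => w; rewrite mxE pd_zE.
have E i j : pd_zbar i (v j) z = (wdir (- 'i%C) i (wdir (- 'i%C) j (fun w => T w 0 l)) z)^*%C.
  by rewrite -F -pd_zE; exact: (pd_zbarJ i Uz (sjac l j)).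
have [sT _] := hT l.
exact: (etrans (E k m) (etrans (congr1 conjc (wdirC _ _ _ _ oU Uz (sT 2))) (esym (E m k)))).
- by move=> D; exact: smooth_minorJ.
- by move=> k; apply: smoothJ; exact: sjac.
Qed.

(** The pullback of forms by [T]; conjugate minors suffice because [T] is holomorphic. *)
Definition pull om B z : cplx R := \sum_C (minor (jac z) C B)^*%C * om C (T z).

Lemma smooth_pull om : (forall B, smooth V (om B)) -> forall B, smooth U (pull om B).
Proof.
move=> so B; apply: smooth_sum => C _; apply: smoothM; first exact: smooth_minorJ.
by apply: (smooth_comp oU oV TV (so C)) => l; have [] := hT l.
Qed.

(** Each term is a function times the closed form that is the pullback of dzbar_C, so only the
    function is differentiated; the covector given by the chain rule is absorbed into the minor. *)
Lemma dbar_pull om B z : U z -> (forall B, smooth V (om B)) ->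
  dbar (pull om) B z = pull (dbar om) B z.
Proof.
move=> Uz so.
have sc C : smooth U (om C \o T) by apply: (smooth_comp oU oV TV (so C)) => l; have [] := hT l.
rewrite (@dbar_sum U _ _ predT (fun C B z => (minor (jac z) C B)^*%C * om C (T z)))//; last first.
  by move=> C D _; apply: smoothM; [exact: smooth_minorJ | exact: sc].
have E C : dbar (fun B z => (minor (jac z) C B)^*%C * om C (T z)) B z =
   \sum_l pd_zbar l (om C) (T z) * wedge (fun k => (jac z l k)^*%C) (fun B => (minor (jac z) C B)^*%C) B.
  have -> : dbar (fun B z => (minor (jac z) C B)^*%C * om C (T z)) B z =
     dbar (fun B z => (minor (jac z) C B)^*%C) B z * om C (T z) +
     wedge (fun k => pd_zbar k (om C \o T) z) (fun B => (minor (jac z) C B)^*%C) B.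
    rewrite /dbar /wedge big_distrl -big_split; apply: eq_bigr => k _ /=.
    have E := wdirM 'i%C k Uz (smooth_minorJ C (B :\ k) 1) (sc C 1).
    rewrite -mulrA -mulrDr; congr (_ * _); rewrite [X in _ = _ + X]mulrC; exact: E.
  rewrite dbar_minorJ// mul0r add0r.
  have -> : (fun k => pd_zbar k (om C \o T) z) = fun k => \sum_l pd_zbar l (om C) (T z) * (jac z l k)^*%C.
    apply/funext => k; rewrite (pd_zbar_comp oV TV hT k (so C 1) Uz).
    by apply: eq_bigr => l _; rewrite mxE mulrC.
  by rewrite wedge_suml; apply: eq_bigr => l _; rewrite wedgeZl.
rewrite (eq_bigr _ (fun C _ => E C)).
have {}E C l : wedge (fun k => (jac z l k)^*%C) (fun B => (minor (jac z) C B)^*%C) B =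
    if l \in C then 0 else sgn l C * (minor (jac z) (l |: C) B)^*%C.
  rewrite -minorJ -(wedge_minor (map_mx conjc (jac z))).
  have E1 k : map_mx conjc (jac z) l k = (jac z l k)^*%C by rewrite [LHS]mxE.
  by apply: eq_bigr => k _; rewrite minorJ E1.
transitivity (\sum_(C : {set 'I_d}) \sum_(l | l \notin C) pd_zbar l (om C) (T z) * (sgn l C * (minor (jac z) (l |: C) B)^*%C)).
  apply: eq_bigr => C _; rewrite [RHS]big_mkcond; apply: eq_bigr => l _ /=.
  by rewrite E; case: (l \in C); rewrite ?mulr0.
rewrite (sum_insert (fun l C => pd_zbar l (om C) (T z) * (sgn l C * (minor (jac z) (l |: C) B)^*%C))).
apply: eq_bigr => C _; rewrite /dbar big_distrr; apply: eq_bigr => l lC /=.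
rewrite finset.setD1K// sgnD1_id.
have G (a b c : R[i]) : a * (b * c) = c * (b * a) by ring.
exact: G.
Qed.

End Transition.
End Pullback.

(** * Sections over a complex manifold *)

Section Charts.
Variables (R : realType) (d : nat) (X : cmanifold R d).
Implicit Types (U V : set X) (a b c : chart_index X) (x y : X) (f g : X -> R[i]).
Local Opaque real_deriv dir.

Definition img a U : set (cspace R d) := chart a @` (dom a `&` U).

Lemma imgP a U z : img a U z <-> [/\ dom a (param a z), U (param a z) & chart a (param a z) = z].
Proof.
split=> [[x [ax Ux] <-]|[h1 h2 h3]]; first by rewrite chartK.
by exists (param a z).
Qed.

Lemma img_chart a U x : dom a x -> U x -> img a U (chart a x).
Proof. by move=> ax Ux; exists x. Qed.

Lemma img_open a U : open U -> open (img a U).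
Proof.
move=> oU; rewrite openE => _ [x [ax Ux] <-]; rewrite /interior.
have az : (chart a @` dom a) (chart a x) by exists x.
have h1 : nbhs (chart a x) (chart a @` dom a) by apply: open_nbhs_nbhs; split => //; exact: chart_open.
have h2 : nbhs (chart a x) (param a @^-1` (dom a `&` U)).
  apply: (param_continuous az); rewrite chartK//; apply: open_nbhs_nbhs; split => //.
  by apply: openI => //; exact: dom_open.
apply: filterS (filterI h1 h2) => w [[y ay <-] /=]; rewrite chartK// => -[_ Uy].
by exists y.
Qed.

Lemma img_sub a U V : V `<=` U -> img a V `<=` img a U.
Proof. by move=> VU _ [x [ax /VU Ux] <-]; exists x. Qed.

Definition cbx a x (r : R) : set X := dom a `&` chart a @^-1` (box (chart a x) r).

Lemma cbx_open a x r : open (cbx a x r).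
Proof.
rewrite openE => y [ay by_]; rewrite /interior.
have h1 : nbhs y (dom a) by apply: open_nbhs_nbhs; split => //; exact: dom_open.
have h2 : nbhs y (chart a @^-1` (box (chart a x) r)).
  by apply: (chart_continuous ay); apply: open_nbhs_nbhs; split => //; exact: box_open.
exact: filterS (filterI h1 h2).
Qed.

Lemma cbx_center a x r : 0 < r -> dom a x -> cbx a x r x.
Proof. by move=> r0 ax; split => // k; rewrite subrr normc0. Qed.

Lemma cbx_img a U x r : box (chart a x) r `<=` img a U -> cbx a x r `<=` U /\ img a (cbx a x r) = box (chart a x) r.
Proof.
move=> h; split; first by move=> y [ay /h/imgP[_]]; rewrite chartK.
apply/seteqP; split; first by move=> _ [y [ay [_ by_]] <-].
move=> z hz; have /imgP[h1 h2 h3] := h z hz; exists (param a z) => //; split => //; split => //.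
by rewrite /= h3.
Qed.

Lemma cbx_exists a U x : open U -> dom a x -> U x -> exists2 r : R, 0 < r & box (chart a x) r `<=` img a U.
Proof. by move=> oU ax Ux; apply: open_box; [exact: img_open | exact: img_chart]. Qed.

Definition tr a b (z : cspace R d) : cspace R d := chart b (param a z).

Lemma tr_maps a b U z : img a (dom b `&` U) z -> img b (dom a `&` U) (tr a b z).
Proof. by move=> /imgP[h1 [h2 h3] h4]; exists (param a z). Qed.

Lemma tr_holo a b U l : holomorphic (img a (dom b `&` U)) (fun z => tr a b z 0 l : cplx R).
Proof.
by apply: holomorphic_sub (transition_holomorphic a b l) => _ [x [ax [bx _]] <-]; exists x.
Qed.

Lemma jacobianE a b x : jacobian b a x = jac (tr a b) (chart a x).
Proof. by []. Qed.

Lemma jacobian_entry a b x k l :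
  jacobian b a x k l = pd_z l (fun z => tr a b z 0 k) (chart a x).
Proof. by rewrite mxE. Qed.

Local Opaque jacobian jac.

Lemma domI_open a U : open U -> open (dom a `&` U).
Proof. by move=> oU; apply: openI => //; exact: dom_open. Qed.

Lemma local_expr_tr (T : Type) a b (f : X -> T) U :
  {in img a (dom b `&` U), local_expr b f \o tr a b =1 local_expr a f}.
Proof. by move=> z; rewrite inE => /imgP[h1 [h2 _] _]; rewrite /local_expr /tr /= chartK. Qed.

Lemma mulmx_entry (M N : 'M[R[i]]_d) k l : (M *m N) k l = \sum_m M k m * N m l.
Proof. by rewrite mxE. Qed.

Lemma jacobian_cocycle a b c x : dom a x -> dom b x -> dom c x ->
  jacobian c a x = jacobian c b x *m jacobian b a x.
Proof.
move=> ax bx cx; apply/matrixP => k l.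
apply: (etrans (jacobian_entry a c x k l)); apply/esym; apply: (etrans (mulmx_entry _ _ k l)).
pose U := img a (dom b `&` dom c); pose V := img b (dom a `&` dom c).
have Uz : U (chart a x) by apply: img_chart.
have oU : open U by apply: img_open; apply: domI_open; exact: dom_open.
have oV : open V by apply: img_open; apply: domI_open; exact: dom_open.
have TV z : U z -> V (tr a b z) by exact: tr_maps.
have hk : holomorphic V (fun z => tr b c z 0 k).
  by apply: holomorphic_sub (@tr_holo b c (dom a) k); apply: img_sub => y [? ?].
have hT l' : holomorphic U (fun z => tr a b z 0 l') by exact: tr_holo.
have E := pd_z_comp oV TV hT l (hk.1 1) Uz.
have E2 : {in U, (fun z => tr b c z 0 k) \o tr a b =1 (fun z => tr a c z 0 k)}.
  by move=> z; rewrite inE => /imgP[h1 [h2 _] _]; rewrite /tr /= chartK.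
have hc : holomorphic U ((fun z => tr b c z 0 k) \o tr a b) := holomorphic_comp oU oV TV hT hk.
rewrite pd_zE -(wdir_ext _ _ oU Uz (hc.1 1) E2) -pd_zE E; apply: eq_bigr => m _.
have -> : tr a b (chart a x) = chart b x by rewrite /tr chartK.
by rewrite mulrC; congr (_ * _); exact: jacobian_entry.
Qed.

Lemma jacobian_id a x : dom a x -> jacobian a a x = 1%:M.
Proof.
move=> ax; apply/matrixP => k l; rewrite (jacobian_entry a a x k l) [RHS]mxE.
pose U := img a setT.
have Uz : U (chart a x) by apply: img_chart.
have oU : open U by apply: img_open; exact: openT.
have E : {in U, (fun z : cspace R d => z 0 k : cplx R) =1 (fun z => tr a a z 0 k)}.
  by move=> z; rewrite inE => /imgP[_ _ E]; rewrite /tr E.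
rewrite pd_zE -(wdir_ext _ _ oU Uz (Ck_coord 1 U k) E).
rewrite (wdir_isd _ (isd_coord k _ _) (isd_coord k _ _)).
Local Transparent dir.
rewrite /dir /dir_x /dir_y !mxE eqxx /= mulrA mulNr -expr2 sqr_i opprK mul1r.
by case: (k == l); rewrite ?addr0 ?mulr0// mulVf ?pnatr_eq0.
Local Opaque dir.
Qed.

Lemma smooth_in_ext a U f g : open U -> (forall x, U x -> dom a x -> f x = g x) ->
  smooth_in a U f -> smooth_in a U g.
Proof.
move=> oU fg; apply: smooth_ext; first exact: img_open.
by move=> z; rewrite inE => /imgP[h1 h2 _]; exact: fg.
Qed.

Lemma holomorphic_in_ext a U f g : open U -> (forall x, U x -> dom a x -> f x = g x) ->
  holomorphic_in a U f -> holomorphic_in a U g.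
Proof.
move=> oU fg; apply: holomorphic_ext; first exact: img_open.
by move=> z; rewrite inE => /imgP[h1 h2 _]; exact: fg.
Qed.

(** The Jacobian of the change from [a] to [b] is a function of the coordinates of [a]; it is
    evaluated along the change from [b] to [a] because it multiplies coefficients read in the chart
    [b]. *)
Lemma holomorphic_minor_jacobian a b U A A' :
  open U -> holomorphic (img b (dom a `&` U)) (fun z => minor (jac (tr a b) (tr b a z)) A A').
Proof.
move=> oU; apply: (holomorphic_minor A A' (N := fun z => jac (tr a b) (tr b a z))) => l k.
apply: (@holomorphic_comp _ _ _ (img a (dom b `&` U)) (tr b a) _ _ _ _ (fun z => jac (tr a b) z l k)).
- by apply: img_open; exact: domI_open.
- by apply: img_open; exact: domI_open.
- by move=> z; exact: tr_maps.
- by move=> m; exact: tr_holo.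
apply: holomorphic_jac; first by apply: img_open; exact: domI_open.
by move=> m; exact: tr_holo.
Qed.

End Charts.

(** Inserting k and then l into [A] gives the opposite sign of inserting l and then k. *)
Lemma contract_sq (R : realType) (d : nat) (A : {set 'I_d}) (c : 'I_d -> R[i]) (u : {set 'I_d} -> R[i]) :
  \sum_(k | k \notin A) koszul_sign R k A * c k *
    (\sum_(l | l \notin k |: A) koszul_sign R l (k |: A) * c l * u (l |: (k |: A))) = 0.
Proof.
transitivity (\sum_k \sum_(l | [&& k \notin A, l \notin A & k != l])
     (koszul_sign R k A * koszul_sign R l (k |: A) * (c k * c l * u (l |: (k |: A))))).
  rewrite big_mkcond; apply: eq_bigr => k _; case: ifP => kA; last by rewrite big1.
  rewrite big_distrr; apply: eq_big => [l|l _] /=; last by ring.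
  by rewrite !inE negb_or eq_sym andbC.
apply: sum_antisym => k l /and3P[kA lA kl]; split; first by rewrite kA lA eq_sym kl.
pose D := k |: (l |: A).
have kD : k \in D by rewrite !inE eqxx.
have lD : l \in D by rewrite !inE eqxx orbT.
have E1 : D :\ k = l |: A by rewrite setU1K// !inE negb_or kl.
have E2 : D :\ l = k |: A by rewrite /D finset.setUCA setU1K// !inE negb_or eq_sym kl.
have := sgn_anti R kD lD kl; rewrite E1 E2.
have -> : koszul_sign R k D = koszul_sign R k (l |: A) by rewrite sgnU1_id.
have -> : koszul_sign R l D = koszul_sign R l (k |: A) by rewrite /D finset.setUCA sgnU1_id.
rewrite !sgnU1_id => E; rewrite [l |: _]finset.setUCA.
have E3 : koszul_sign R k A * koszul_sign R l (k |: A) = - (koszul_sign R l A * koszul_sign R k (l |: A)).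
  by rewrite [in RHS]mulrC E opprK mulrC.
rewrite E3; ring.
Qed.

Lemma dbarE (R : realType) (d : nat) (om : {set 'I_d} -> cspace R d -> cplx R) B z :
  dbar om B z = \sum_(k in B) koszul_sign R k B * pd_zbar k (om (B :\ k)) z.
Proof. by []. Qed.

(** * The Dolbeault operator and the contraction on sections *)

Section SectionCalculus.
Variables (R : realType) (d : nat) (X : cmanifold R d) (W : X -> R[i]).
Local Notation family := (chart_family R d X).
Implicit Types (U V : set X) (a b c : chart_index X) (x y : X) (f g : X -> R[i]) (s t : family) (A B : {set 'I_d}).
Local Opaque real_deriv dir jacobian jac dbar.

Lemma familyP s t : (forall a x A B, s a x A B = t a x A B) -> s = t.
Proof.
by move=> h; apply/funext => a; apply/funext => x; apply/funext => A; apply/funext => B.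
Qed.

Lemma familyDE s t a x A B : (s + t) a x A B = s a x A B + t a x A B.
Proof. by []. Qed.

Lemma familyBE s t a x A B : (s - t) a x A B = s a x A B - t a x A B.
Proof. by []. Qed.

Lemma is_sectionN U s : is_section U s -> is_section U (- s).
Proof. by rewrite -[- s]sub0r; apply: is_section_sub; exact: is_section0. Qed.

Lemma is_sectionD U s t : is_section U s -> is_section U t -> is_section U (s + t).
Proof. by move=> hs /is_sectionN ht; rewrite -[t]opprK; exact: is_section_sub. Qed.

Lemma restrictE V s a x A B : V x -> restrict V s a x A B = s a x A B.
Proof. by move=> Vx; rewrite /restrict mem_set. Qed.

Lemma restrict_out V s a x A B : ~ V x -> restrict V s a x A B = 0.
Proof. by move=> Vx; rewrite /restrict memNset. Qed.

Lemma restrict_section U V s : open U -> open V -> V `<=` U -> is_section U s -> is_section V (restrict V s).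
Proof.
move=> oU oV VU [s1 s2 s3]; split.
- move=> a x A B h; have [Vx|Vx] := pselect (V x); last by rewrite restrict_out.
  by rewrite restrictE// s1// => -[ax _]; apply: h.
- move=> a A B; have s2V : smooth_in a V (fun x => s a x A B).
    by apply: smooth_sub (s2 a A B); exact: img_sub.
  by apply: (smooth_in_ext oV _ s2V) => x Vx _; rewrite restrictE.
- move=> a b x A B Vx ax bx; rewrite restrictE// (s3 a b)//; last exact: VU.
  by apply: eq_bigr => A' _; apply: eq_bigr => B' _; rewrite restrictE.
Qed.

Lemma section_local U s : open U -> (forall a x A B, ~ (dom a `&` U) x -> s a x A B = 0) ->
  (forall x, U x -> exists V, [/\ open V, V x, V `<=` U & is_section V (restrict V s)]) ->
  is_section U s.
Proof.
move=> oU s1 h; split => //.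
- move=> a A B; apply: smooth_local; first exact: img_open.
  move=> z /imgP[az Uz zE]; have [V [oV Vz VU [_ s2 _]]] := h _ Uz.
  exists (img a V); split; [exact: img_open | by apply/imgP | ].
  apply: (smooth_in_ext oV _ (s2 a A B)) => x Vx _.
  by rewrite restrictE.
move=> a b x A B Ux ax bx; have [V [oV Vx VU [_ _ s3]]] := h _ Ux.
have := s3 a b x A B Vx ax bx; rewrite restrictE// => ->.
by apply: eq_bigr => A' _; apply: eq_bigr => B' _; rewrite restrictE.
Qed.

Lemma smooth_in_holo U f a : holo_fun U f -> smooth_in a U f.
Proof. by move=> h; have [] := h a. Qed.

Lemma fact_section U f s : open U -> (forall a, smooth_in a U f) -> is_section U s -> is_section U (fact f s).
Proof.
move=> oU sf [s1 s2 s3]; split.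
- by move=> a x A B h; rewrite /fact s1// mulr0.
- by move=> a A B; apply: smoothM; [exact: sf | exact: s2].
move=> a b x A B Ux ax bx; rewrite /fact (s3 a b)// big_distrr; apply: eq_bigr => A' _ /=.
by rewrite big_distrr; apply: eq_bigr => B' _ /=; ring.
Qed.

Definition coef s a A B : cspace R d -> cplx R := local_expr a (fun y => s a y A B).

Lemma dolbeault_inE U s a x A B : dom a x -> U x ->
  dolbeault_op U s a x A B = dbar (coef s a A) B (chart a x).
Proof. by move=> ax Ux; rewrite /dolbeault_op mem_set. Qed.

Lemma dolbeault_out U s a x A B : ~ (dom a `&` U) x -> dolbeault_op U s a x A B = 0.
Proof. by move=> h; rewrite /dolbeault_op memNset. Qed.

(** The transformation law regrouped as holomorphic factors for the polyvector index and a pullback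
    for the form index. Since dbar commutes with both, the Dolbeault operator does not depend on the
    chart. *)
Lemma section_pull U s a b : open U -> is_section U s -> forall A B,
  {in img b (dom a `&` U), coef s b A B =1
    (fun z => \sum_A' minor (jac (tr a b) (tr b a z)) A A' * pull (tr b a) (coef s a A') B z)}.
Proof.
move=> oU [_ _ s3] A B z; rewrite inE => /imgP[h1 [h2 h3] h4].
rewrite /coef /local_expr (s3 a b)//; apply: eq_bigr => A' _.
rewrite /pull big_distrr; apply: eq_bigr => B' _ /=.
have -> : param a (tr b a z) = param b z by rewrite /tr chartK.
by rewrite !jacobianE h4 /tr; ring.
Qed.

Lemma dolbeault_section U s : open U -> is_section U s -> is_section U (dolbeault_op U s).
Proof.
move=> oU hs; have [s1 s2 s3] := hs; split.
- by move=> a x A B h; rewrite dolbeault_out.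
- move=> a A B; apply: (@smooth_ext _ _ _ (dbar (coef s a A) B)); first exact: img_open.
    by move=> z; rewrite inE => /imgP[h1 h2 h3]; rewrite /local_expr (dolbeault_inE s A B h1 h2) h3.
  apply: dbar_smooth; first exact: img_open.
  by move=> D; exact: s2.
move=> a b x A B Ux ax bx; rewrite dolbeault_inE//.
pose U' := img b (dom a `&` U); pose V' := img a (dom b `&` U).
have oU' : open U' by apply: img_open; exact: domI_open.
have oV' : open V' by apply: img_open; exact: domI_open.
have Uz : U' (chart b x) by apply: img_chart.
have TV z : U' z -> V' (tr b a z) by exact: tr_maps.
have hT l : holomorphic U' (fun z => tr b a z 0 l) by exact: tr_holo.
have sb D : smooth U' (coef s b A D) by apply: smooth_sub (s2 b A D); apply: img_sub => y [].
have sa A' D : smooth V' (coef s a A' D) by apply: smooth_sub (s2 a A' D); apply: img_sub => y [].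
rewrite (dbar_ext _ oU' Uz sb (section_pull (a := a) (b := b) oU hs A)).
have sp A' D : smooth U' (pull (tr b a) (coef s a A') D) by exact: (smooth_pull oU' oV' TV hT (sa A')).
have hm A' : holomorphic U' (fun z => minor (jac (tr a b) (tr b a z)) A A') by exact: holomorphic_minor_jacobian.
rewrite (@dbar_sum _ _ U' _ _ predT (fun A' B z => minor (jac (tr a b) (tr b a z)) A A' * pull (tr b a) (coef s a A') B z))//; last first.
  by move=> A' D _; exact: (smoothM (hm A').1 (sp A' D)).
apply: eq_bigr => A' _; rewrite (dbar_holoM _ Uz (hm A') (sp A')).
have trx : tr b a (chart b x) = chart a x by rewrite /tr chartK.
have E := dbar_pull oU' oV' TV hT B Uz (sa A'); rewrite E trx -jacobianE.
transitivity (\sum_B' minor (jacobian b a x) A A' * ((minor (jac (tr b a) (chart b x)) B' B)^*%C *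
   dbar (coef s a A') B' (tr b a (chart b x)))); first exact: big_distrr.
apply: eq_bigr => B' _; rewrite trx -jacobianE (dolbeault_inE s A' B' ax Ux).
exact: mulrA.
Qed.

Hypothesis hW : holo_fun setT W.

Lemma dW_transition a b x l : dom a x -> dom b x ->
  \sum_k pd_z k (local_expr b W) (chart b x) * jacobian b a x k l = pd_z l (local_expr a W) (chart a x).
Proof.
move=> ax bx; pose U := img a (dom b `&` setT); pose V := img b (dom a `&` setT).
have oU : open U by apply: img_open; apply: domI_open; exact: openT.
have oV : open V by apply: img_open; apply: domI_open; exact: openT.
have Uz : U (chart a x) by apply: img_chart.
have TV z : U z -> V (tr a b z) by exact: tr_maps.
have hT l' : holomorphic U (fun z => tr a b z 0 l') by exact: tr_holo.
have hV : holomorphic V (local_expr b W) by apply: holomorphic_sub (hW b); exact: img_sub.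
have hc := holomorphic_comp oU oV TV hT hV.
rewrite [RHS](_ : _ = pd_z l (local_expr b W \o tr a b) (chart a x)).
  rewrite (pd_z_comp oV TV hT l (hV.1 1) Uz); apply: eq_bigr => k _.
  have -> : tr a b (chart a x) = chart b x by rewrite /tr chartK.
  by rewrite mulrC; congr (_ * _); exact: jacobian_entry.
by rewrite !pd_zE (wdir_ext _ _ oU Uz (hc.1 1) (local_expr_tr (U := setT) W)).
Qed.

Lemma contractE s a x A B : contract_op W s a x A B = (-1) ^+ #|B| * - 'i%C *
  \sum_(k | k \notin A) koszul_sign R k A * pd_z k (local_expr a W) (chart a x) * s a x (k |: A) B.
Proof.
by rewrite big_distrr; apply: eq_bigr => k _ /=; ring.
Qed.

Lemma contract_law U s a b x A B : open U -> is_section U s -> U x -> dom a x -> dom b x ->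
  contract_op W s b x A B = \sum_A' \sum_B'
          minor (jacobian b a x) A A' * (minor (jacobian a b x) B' B)^*%C *
          contract_op W s a x A' B'.
Proof.
move=> oU [s1 s2 s3] Ux ax bx; rewrite contractE.
pose S A' := \sum_B' (minor (jacobian a b x) B' B)^*%C * s a x A' B'.
under eq_bigr => k _.
  rewrite (s3 a b)// (_ : \sum_A' _ = \sum_A' minor (jacobian b a x) (k |: A) A' * S A'); last first.
    by apply: eq_bigr => A' _; rewrite /S big_distrr; apply: eq_bigr => B' _ /=; rewrite mulrA.
  over.
rewrite contract_pull big_distrr; apply: eq_bigr => A' _ /=.
(* The sign of the contraction depends on the degree of the form, and the minor vanishes between
   different degrees. *)
have E B' : (minor (jacobian a b x) B' B)^*%C * (-1) ^+ #|B'| = (minor (jacobian a b x) B' B)^*%C * (-1) ^+ #|B| :> R[i].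
  have [<-//|h] := eqVneq #|B'| #|B|; by rewrite minor_card// conjc0 !mul0r.
transitivity (\sum_B' \sum_(l | l \notin A') minor (jacobian b a x) A A' * ((-1) ^+ #|B| * - 'i%C *
   (koszul_sign R l A' * pd_z l (local_expr a W) (chart a x) * ((minor (jacobian a b x) B' B)^*%C * s a x (l |: A') B')))).
  rewrite exchange_big /= !big_distrr; apply: eq_bigr => l _ /=.
  rewrite (dW_transition l ax bx) /S !big_distrr; apply: eq_bigr => B' _ /=; ring.
apply: eq_bigr => B' _; rewrite contractE; apply/esym; set S' := \sum_(_ | _) _.
have G (m m' e e' i : R[i]) : m' * e' = m' * e -> m * m' * (e' * i * S') = m * m' * e * i * S'.
  by move=> h; rewrite -!mulrA; congr (m * _); rewrite !mulrA h.
rewrite (G _ _ _ _ _ (E B')) big_distrr; apply: eq_bigr => l _ /=; ring.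
Qed.

Lemma contract_smooth U s a A B : open U -> (forall A B, smooth_in a U (fun x => s a x A B)) ->
  smooth_in a U (fun x => contract_op W s a x A B).
Proof.
move=> oU hs; apply: (@smooth_ext _ _ _ (fun z => \sum_(k | k \notin A)
    ((-1) ^+ #|B| * koszul_sign R k A * (- 'i%C)) * (pd_z k (local_expr a W) z * coef s a (k |: A) B z))).
- exact: img_open.
- move=> z; rewrite inE => /imgP[_ _ h]; apply: eq_bigr => k _; rewrite h /coef /local_expr; ring.
apply: smooth_sum => k _; apply: smoothZ; apply: smoothM; last exact: hs.
by rewrite pd_zE; apply: smooth_wdir; [exact: img_open | apply: smooth_sub (hW a).1; exact: img_sub].
Qed.

Lemma contract_holo U s a A B : open U -> (forall A B, holomorphic_in a U (fun x => s a x A B)) ->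
  holomorphic_in a U (fun x => contract_op W s a x A B).
Proof.
move=> oU hs; apply: (@holomorphic_ext _ _ _ (fun z => \sum_(k | k \notin A)
    ((-1) ^+ #|B| * koszul_sign R k A * (- 'i%C)) * (pd_z k (local_expr a W) z * coef s a (k |: A) B z))).
- exact: img_open.
- move=> z; rewrite inE => /imgP[_ _ h]; apply: eq_bigr => k _; rewrite h /coef /local_expr; ring.
apply: holomorphic_sum => k _; apply: holomorphicZ; apply: holomorphicM; last exact: hs.
by apply: holomorphic_pd_z; [exact: img_open | apply: holomorphic_sub (hW a); exact: img_sub].
Qed.

Lemma contract_section U s : open U -> is_section U s -> is_section U (contract_op W s).
Proof.
move=> oU hs; have [s1 s2 s3] := hs; split.
- by move=> a x A B h; rewrite /contract_op big1// => k _; rewrite s1// mulr0.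
- by move=> a A B; apply: contract_smooth.
by move=> a b x A B Ux ax bx; exact: contract_law hs Ux ax bx.
Qed.

Lemma delta_section U s : open U -> is_section U s -> is_section U (delta_op W U s).
Proof. by move=> oU hs; apply: is_sectionD; [exact: dolbeault_section | exact: contract_section]. Qed.

Lemma contractD s t : contract_op W (s + t) = contract_op W s + contract_op W t.
Proof.
apply: familyP => a x A B; rewrite familyDE -big_split; apply: eq_bigr => k _ /=.
by rewrite familyDE mulrDr.
Qed.

Lemma dolbeaultD U s t : open U -> is_section U s -> is_section U t ->
  dolbeault_op U (s + t) = dolbeault_op U s + dolbeault_op U t.
Proof.
move=> oU [_ s2 _] [_ t2 _]; apply: familyP => a x A B; rewrite familyDE.
have [[ax Ux]|h] := pselect ((dom a `&` U) x); last by rewrite !dolbeault_out// addr0.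
rewrite !dolbeault_inE//; exact: (dbarD _ (img_chart ax Ux) (s2 a A) (t2 a A)).
Qed.

Lemma deltaD U s t : open U -> is_section U s -> is_section U t ->
  delta_op W U (s + t) = delta_op W U s + delta_op W U t.
Proof. by move=> oU hs ht; rewrite /delta_op contractD dolbeaultD// addrACA. Qed.

Lemma fact_cst_holo U (e : R[i]) : holo_fun U (fun=> e).
Proof. by move=> a; exact: holomorphic_cst. Qed.

Lemma delta_fact U f s : open U -> holo_fun U f -> is_section U s ->
  delta_op W U (fact f s) = fact f (delta_op W U s).
Proof.
move=> oU hf [_ s2 _]; apply: familyP => a x A B; rewrite /fact /delta_op !familyDE mulrDr; congr (_ + _).
  have [[ax Ux]|h] := pselect ((dom a `&` U) x); last by rewrite !dolbeault_out// mulr0.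
  have E : local_expr a f (chart a x) = f x by rewrite /local_expr chartK.
  rewrite (dolbeault_inE _ _ _ ax Ux) (dolbeault_inE s _ _ ax Ux) -E.
  exact: (dbar_holoM B (img_chart ax Ux) (hf a) (s2 a A)).
by rewrite big_distrr; apply: eq_bigr => k _ /=; ring.
Qed.

Lemma delta0 U : open U -> delta_op W U 0 = 0.
Proof.
move=> oU; have := deltaD oU (is_section0 U) (is_section0 U); rewrite addr0.
by move=> /(congr1 (fun t => t - delta_op W U 0)); rewrite subrr addrK => <-.
Qed.

Lemma deltaN U s : open U -> is_section U s -> delta_op W U (- s) = - delta_op W U s.
Proof.
move=> oU hs; apply/eqP; rewrite -subr_eq0 opprK -deltaD//; last exact: is_sectionN.
by rewrite addNr delta0.
Qed.

Lemma deltaB U s t : open U -> is_section U s -> is_section U t ->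
  delta_op W U (s - t) = delta_op W U s - delta_op W U t.
Proof. by move=> oU hs ht; rewrite deltaD// ?deltaN//; exact: is_sectionN. Qed.

Lemma dolbeault_restrict U V s : open U -> open V -> V `<=` U -> is_section U s ->
  dolbeault_op V (restrict V s) = restrict V (dolbeault_op U s).
Proof.
move=> oU oV VU [_ s2 _]; apply: familyP => a x A B.
have [Vx|Vx] := pselect (V x); last by rewrite restrict_out// dolbeault_out// => -[].
rewrite (restrictE _ a A B Vx); have [ax|ax] := pselect (dom a x); last first.
  have h1 : ~ (dom a `&` V) x by case.
  have h2 : ~ (dom a `&` U) x by case.
  by rewrite (dolbeault_out _ A B h1) (dolbeault_out s A B h2).
rewrite (dolbeault_inE (restrict V s) A B ax Vx) (dolbeault_inE s A B ax (VU _ Vx)).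
have oV' : open (img a V) by exact: img_open.
symmetry; apply: (dbar_ext B oV' (img_chart ax Vx)).
  by move=> D; apply: smooth_sub (s2 a A D); exact: img_sub.
by move=> D z; rewrite inE => /imgP[_ Vz _]; rewrite /coef /local_expr restrictE.
Qed.

Lemma contract_restrict V s : contract_op W (restrict V s) = restrict V (contract_op W s).
Proof.
apply: familyP => a x A B; have [Vx|Vx] := pselect (V x).
  by rewrite restrictE//; apply: eq_bigr => k _; rewrite restrictE.
by rewrite restrict_out// /contract_op big1// => k _; rewrite restrict_out// mulr0.
Qed.

Lemma delta_restrict U V s : open U -> open V -> V `<=` U -> is_section U s ->
  delta_op W V (restrict V s) = restrict V (delta_op W U s).
Proof.
move=> oU oV VU hs; rewrite /delta_op contract_restrict (dolbeault_restrict oU)//.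
by apply: familyP => a x A B; rewrite familyDE /restrict; case: ifP => _; rewrite ?addr0.
Qed.

Lemma dolbeault_dolbeault U s : open U -> is_section U s -> dolbeault_op U (dolbeault_op U s) = 0.
Proof.
move=> oU hs; have [_ s2 _] := hs; apply: familyP => a x A B.
have [[ax Ux]|h] := pselect ((dom a `&` U) x); last by rewrite dolbeault_out.
have oU' : open (img a U) by exact: img_open.
have Uz := img_chart ax Ux; rewrite dolbeault_inE//.
have [_ d2 _] := dolbeault_section oU hs.
rewrite (dbar_ext (eta := dbar (coef s a A)) B oU' Uz (d2 a A)).
  exact: (dbar_dbar B oU' Uz (s2 a A)).
by move=> D z; rewrite inE => /imgP[az Uz' zE]; rewrite /coef /local_expr (dolbeault_inE s A D az Uz') zE.
Qed.

Lemma contract_contract s : contract_op W (contract_op W s) = 0.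
Proof.
apply: familyP => a x A B; rewrite contractE.
pose K : R[i] := (-1) ^+ #|B| * - 'i%C.
pose c k := pd_z k (local_expr a W) (chart a x).
rewrite (_ : \sum_(k | k \notin A) _ = K * \sum_(k | k \notin A) koszul_sign R k A * c k *
  (\sum_(l | l \notin k |: A) koszul_sign R l (k |: A) * c l * s a x (l |: (k |: A)) B)).
  by rewrite (contract_sq A c (fun D => s a x D B)) !mulr0.
rewrite [RHS]big_distrr; apply: eq_bigr => k _ /=; rewrite contractE.
exact: mulrCA.
Qed.

(** The derivatives of [W] are holomorphic, so dbar passes through them; as it raises |B| by one,
    the sign (-1)^|B| makes the two compositions opposite. *)
Lemma dolbeault_contract U s : open U -> is_section U s ->
  dolbeault_op U (contract_op W s) + contract_op W (dolbeault_op U s) = 0.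
Proof.
move=> oU hs; have [s1 s2 _] := hs; apply: familyP => a x A B; rewrite familyDE.
have [[ax Ux]|h] := pselect ((dom a `&` U) x); last first.
  by rewrite dolbeault_out// add0r /contract_op big1// => k _; rewrite dolbeault_out// mulr0.
have oU' : open (img a U) by exact: img_open.
have Uz := img_chart ax Ux; rewrite dolbeault_inE//.
have hWa : holomorphic (img a U) (local_expr a W) by apply: holomorphic_sub (hW a); exact: img_sub.
pose h k z : cplx R := pd_z k (local_expr a W) z.
have hh k : holomorphic (img a U) (h k) by exact: holomorphic_pd_z.
have sh k D : smooth (img a U) (fun z => h k z * coef s a (k |: A) D z).
  by apply: smoothM; [exact: (hh k).1 | exact: s2].
have [_ c2 _] := contract_section oU hs.
have E D : {in img a U, coef (contract_op W s) a A D =1 (fun z => \sum_(k | k \notin A)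
    ((-1) ^+ #|D| * koszul_sign R k A * (- 'i%C)) * (h k z * coef s a (k |: A) D z))}.
  by move=> z; rewrite inE => /imgP[_ _ zE]; apply: eq_bigr => k _; rewrite zE /coef /local_expr /h; ring.
rewrite (dbar_ext B oU' Uz (c2 a A) E).
rewrite (@dbar_sum _ _ (img a U) _ _ (fun k => k \notin A) (fun k D z =>
  ((-1) ^+ #|D| * koszul_sign R k A * (- 'i%C)) * (h k z * coef s a (k |: A) D z)))//; last first.
  by move=> k D _; apply: smoothZ.
rewrite -big_split big1// => k kA /=.
rewrite (dolbeault_inE s (k |: A) B ax Ux) -/(h k (chart a x)) -[_ * h k _ * _]mulrA.
have E0 := dbar_holoM B Uz (hh k) (s2 a (k |: A)); rewrite -/(coef s a (k |: A)) in E0.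
rewrite -E0 !dbarE big_distrr -big_split big1// => l lB /=.
have E1 := wdirZ 'i%C l ((-1) ^+ #|B :\ l| * koszul_sign R k A * - 'i%C) Uz (sh k (B :\ l) 1).
rewrite -pd_zbarE in E1; rewrite E1 -pd_zbarE.
have E2 : (-1) ^+ #|B| = - (-1) ^+ #|B :\ l| :> R[i] by rewrite (cardsD1 l B) lB add1n exprS mulN1r.
have G (p e q i P : R[i]) : p * (e * q * i * P) + - e * q * i * (p * P) = 0 by ring.
rewrite E2; exact: G.
Qed.

Lemma delta_delta U s : open U -> is_section U s -> delta_op W U (delta_op W U s) = 0.
Proof.
move=> oU hs; have h1 := dolbeault_section oU hs; have h2 := contract_section oU hs.
rewrite {1}/delta_op contractD dolbeaultD// dolbeault_dolbeault// contract_contract addr0 add0r.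
exact: dolbeault_contract.
Qed.

End SectionCalculus.

(** * Sheaves of families; the Koszul complex and the complex PV *)

Section SubgroupTypes.
Variables (M : zmodType) (S : subgroup M).

Lemma sub_memP (x : M) : x \in sub_mem S <-> subgroup_set S x.
Proof. by split=> [/set_mem|/mem_set]. Qed.

Lemma to_subK (x : M) : subgroup_set S x -> val (to_sub S x) = x.
Proof. by move=> Sx; apply: insubdK; exact/sub_memP. Qed.

Lemma to_sub_out (x : M) : ~ subgroup_set S x -> to_sub S x = 0.
Proof.
move=> Sx; rewrite /to_sub /insubd insubF//; apply/negP => /sub_memP; exact: Sx.
Qed.

Lemma sub_valP (s : subgroup_type S) : subgroup_set S (val s).
Proof. exact/sub_memP/(valP s). Qed.

End SubgroupTypes.

Section FamilyModule.
Variables (R : realType) (d : nat) (X : cmanifold R d).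
Local Notation family := (chart_family R d X).
Variable S : set X -> subgroup family.
Implicit Types (U V : set X) (f : X -> R[i]) (s t : family).
Local Notation inS U := (subgroup_set (S U)).
Hypothesis S_out : forall U s a x A B, inS U s -> ~ (dom a `&` U) x -> s a x A B = 0.
Hypothesis S_fact : forall U f s, open U -> holo_fun U f -> inS U s -> inS U (fact f s).
Hypothesis S_res : forall U V s, open U -> open V -> V `<=` U -> inS U s -> inS V (restrict V s).
Hypothesis S_loc : forall U s, open U -> (forall a x A B, ~ (dom a `&` U) x -> s a x A B = 0) ->
  (forall x, U x -> exists V, [/\ open V, V x, V `<=` U & inS V (restrict V s)]) -> inS U s.
Notation E := (family_module S).

Lemma val_act U f (s : E U) : open U -> holo_fun U f -> val (oact f s) = fact f (val s).
Proof. by move=> oU hf; apply: to_subK; apply: S_fact => //; exact: sub_valP. Qed.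

Lemma val_res U V (s : E U) : open U -> open V -> V `<=` U -> val (ores V s) = restrict V (val s).
Proof. by move=> oU oV VU; apply: to_subK; apply: S_res oU oV VU _; exact: sub_valP. Qed.

Lemma valD U (s t : E U) : val (s + t) = val s + val t.
Proof. exact: (raddfD val). Qed.

(** Sections are functions, so they are glued pointwise: a member of the covering is chosen at each
    point, and agreement on intersections removes the dependence on the choice. Vanishing outside of
    [U] makes restriction to [U] the identity. *)
Lemma family_omodule : is_omodule E.
Proof.
have holoD U f g : holo_fun U f -> holo_fun U g -> holo_fun U (f \+ g).
  by move=> hf hg a; apply: holomorphicD; [exact: hf | exact: hg].
have holoM U f g : holo_fun U f -> holo_fun U g -> holo_fun U (f \* g).
  by move=> hf hg a; apply: holomorphicM; [exact: hf | exact: hg].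
have holo1 U : holo_fun U (fun=> 1 : R[i]) by exact: fact_cst_holo.
split.
- move=> U f s t oU hf; apply: val_inj; rewrite (val_act _ oU hf) (valD s t) (valD (oact f s)).
  rewrite (val_act s oU hf) (val_act t oU hf).
  by apply: familyP => a x A B; rewrite /fact familyDE mulrDr.
- move=> U f g s oU hf hg; apply: val_inj; rewrite (val_act s oU (holoD _ _ _ hf hg)).
  rewrite (valD (oact f s)) (val_act s oU hf) (val_act s oU hg).
  by apply: familyP => a x A B; rewrite familyDE /fact mulrDl.
- move=> U f g s oU hf hg; apply: val_inj; rewrite (val_act s oU (holoM _ _ _ hf hg)).
  rewrite (val_act _ oU hf) (val_act s oU hg).
  by apply: familyP => a x A B; rewrite /fact mulrA.
- move=> U s oU; apply: val_inj; rewrite (val_act s oU (holo1 U)).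
  by apply: familyP => a x A B; rewrite /fact mul1r.
- move=> U f g s oU hf fg.
  have hg : holo_fun U g by move=> a; apply: (holomorphic_in_ext oU _ (hf a)) => x Ux _; exact: fg.
  apply: val_inj; rewrite (val_act s oU hf) (val_act s oU hg).
  apply: familyP => a x A B; rewrite /fact.
  have [Ux|Ux] := pselect (U x); first by rewrite fg.
  by rewrite (S_out A B (sub_valP s)) ?mulr0// => -[].
- move=> U s oU; apply: val_inj; rewrite val_res//; apply: familyP => a x A B.
  have [Ux|Ux] := pselect (U x); first by rewrite restrictE.
  by rewrite restrict_out// (S_out A B (sub_valP s))// => -[].
- move=> U V T s oU oV oT VU TV; apply: val_inj; rewrite !val_res//; last exact: subset_trans VU.
  apply: familyP => a x A B; have [Tx|Tx] := pselect (T x); last by rewrite !restrict_out.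
  by rewrite !restrictE//; exact: TV.
- move=> U V s t oU oV VU; apply: val_inj; rewrite (val_res _ oU oV VU) (valD s t) (valD (ores V s)).
  rewrite (val_res s oU oV VU) (val_res t oU oV VU).
  by apply: familyP => a x A B; rewrite familyDE /restrict familyDE; case: ifP; rewrite ?addr0.
- move=> U V f s oU oV VU hf; have hf' : holo_fun V f.
    by move=> a; apply: holomorphic_sub (hf a); exact: img_sub.
  apply: val_inj; rewrite !(val_res, val_act)//; apply: familyP => a x A B.
  by rewrite /restrict /fact; case: ifP; rewrite ?mulr0.
- move=> U F s t oU oF FU h; apply: val_inj; apply: familyP => a x A B.
  have [Ux|Ux] := pselect (U x); last by rewrite !(S_out A B (sub_valP _))// => -[].
  have : (\bigcup_(V in F) V) x by rewrite FU.
  move=> [V FV Vx]; have VU : V `<=` U by move=> y Vy; rewrite -FU; exists V.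
  have := congr1 (fun q : E V => val q a x A B) (h V FV).
  by rewrite (val_res s oU (oF V FV) VU) (val_res t oU (oF V FV) VU) !(restrictE _ _ _ _ Vx).
move=> U F s oU oF FU h.
have VU V : F V -> V `<=` U by move=> FV y Vy; rewrite -FU; exists V.
have ex x : U x -> exists V, F V /\ V x.
  by rewrite -FU => -[V FV Vx]; exists V.
pose ch x := match pselect (U x) with left Ux => projT1 (cid (ex x Ux)) | right _ => set0 end.
have chP x : U x -> F (ch x) /\ ch x x.
  by move=> Ux; rewrite /ch; case: pselect => // Ux'; case: cid.
pose t : family := fun a x A B => if x \in U then val (s (ch x)) a x A B else 0.
have tE V a x A B : F V -> V x -> t a x A B = val (s V) a x A B.
  move=> FV Vx; have Ux := VU V FV x Vx; rewrite /t mem_set//; have [Fc cx] := chP x Ux.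
  have oI : open (ch x `&` V) by apply: openI; exact: oF.
  have := congr1 (fun q : E (ch x `&` V) => val q a x A B) (h (ch x) V Fc FV).
  rewrite (val_res _ (oF _ Fc) oI (@subIsetl _ _ _)) (val_res _ (oF _ FV) oI (@subIsetr _ _ _)).
  by rewrite !restrictE.
have tres V : F V -> restrict V t = val (s V).
  move=> FV; apply: familyP => a x A B; have [Vx|Vx] := pselect (V x).
    by rewrite restrictE// (tE V).
  by rewrite restrict_out// (S_out A B (sub_valP _))// => -[].
have St : inS U t.
  apply: S_loc => // [a x A B h1|x Ux].
    rewrite /t; case: ifPn => // /set_mem Ux; have [Fc cx] := chP x Ux.
    by rewrite (S_out A B (sub_valP _))// => -[ax _]; apply: h1.
  have [Fc cx] := chP x Ux; exists (ch x); split => //; [exact: oF | exact: VU |].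
  by rewrite tres//; exact: sub_valP.
exists (to_sub (S U) t) => V FV; apply: val_inj; rewrite val_res//; [|exact: oF|exact: VU].
by rewrite to_subK// tres.
Qed.

End FamilyModule.

Section Complexes.
Variables (R : realType) (d : nat) (X : cmanifold R d) (W : X -> R[i]).
Hypothesis hW : holo_fun setT W.
Local Notation family := (chart_family R d X).
Implicit Types (U V : set X) (f : X -> R[i]) (s t : family) (A B : {set 'I_d}).
Local Opaque real_deriv dir jacobian jac dbar.

Lemma supported_res D V s : supported D s -> supported D (restrict V s).
Proof. by move=> h a x A B /h hs; rewrite /restrict hs; case: ifP. Qed.

Lemma supported_fact D f s : supported D s -> supported D (fact f s).
Proof. by move=> h a x A B /h hs; rewrite /fact hs mulr0. Qed.

Lemma supported_loc D U s : (forall a x A B, ~ (dom a `&` U) x -> s a x A B = 0) ->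
  (forall x, U x -> exists V, [/\ open V, V x, V `<=` U & supported D (restrict V s)]) -> supported D s.
Proof.
move=> h1 h2 a x A B hD; have [Ux|Ux] := pselect (U x); last by rewrite h1// => -[].
by have [V [_ Vx _ hV]] := h2 x Ux; have := hV a x A B hD; rewrite restrictE.
Qed.

Lemma coef0 s a A B : (forall x, s a x A B = 0) -> coef s a A B = fun=> 0.
Proof. by move=> h; apply/funext => z; exact: h. Qed.

Lemma supported_delta (D D' : {set 'I_d} -> {set 'I_d} -> bool) U s :
  (forall A B k, k \in B -> ~~ D' A B -> ~~ D A (B :\ k)) ->
  (forall A B k, k \notin A -> ~~ D' A B -> ~~ D (k |: A) B) ->
  supported D s -> supported D' (delta_op W U s).
Proof.
move=> h1 h2 hs a x A B hD; rewrite /delta_op familyDE [X in _ + X]big1 ?addr0; last first.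
  by move=> k kA; rewrite hs ?mulr0//; exact: h2.
have [[ax Ux]|h] := pselect ((dom a `&` U) x); last by rewrite dolbeault_out.
rewrite (dolbeault_inE s A B ax Ux) dbarE big1// => k kB.
rewrite coef0 ?pd_zbarE ?wdir_cst ?mulr0// => y; apply: hs; exact: h1.
Qed.

Lemma pv_degree_delta n U s : supported (pv_degree n) s -> supported (pv_degree (n + 1)) (delta_op W U s).
Proof.
apply: supported_delta => A B k; rewrite /pv_degree.
  move=> kB; apply: contraNN => /eqP <-; rewrite (cardsD1 k B) kB.
  by rewrite PoszD; apply/eqP; lia.
move=> kA; apply: contraNN => /eqP <-; rewrite cardsU1 kA PoszD.
by apply/eqP; lia.
Qed.

Lemma pv_out U n s a x A B : pv_set U n s -> ~ (dom a `&` U) x -> s a x A B = 0.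
Proof. by move=> [[h _ _] _]; exact: h. Qed.

Lemma pv_fact U n f s : open U -> (forall a, smooth_in a U f) -> pv_set U n s -> pv_set U n (fact f s).
Proof. by move=> oU hf [h1 h2]; split; [exact: fact_section | exact: supported_fact]. Qed.

Lemma pv_res U V n s : open U -> open V -> V `<=` U -> pv_set U n s -> pv_set V n (restrict V s).
Proof. by move=> oU oV VU [h1 h2]; split; [exact: restrict_section h1 | exact: supported_res]. Qed.

Lemma pv_loc U n s : open U -> (forall a x A B, ~ (dom a `&` U) x -> s a x A B = 0) ->
  (forall x, U x -> exists V, [/\ open V, V x, V `<=` U & pv_set V n (restrict V s)]) -> pv_set U n s.
Proof.
move=> oU h0 h; split.
  by apply: section_local => // x /h[V [? ? ? []]]; exists V.
by apply: (supported_loc h0) => x /h[V [? ? ? []]]; exists V.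
Qed.

Lemma pv_delta U n s : open U -> pv_set U n s -> pv_set U (n + 1) (delta_op W U s).
Proof. by move=> oU [h1 h2]; split; [exact: delta_section | exact: pv_degree_delta]. Qed.

Lemma pv_omodule n : is_omodule (pv_complex W n).
Proof.
apply: family_omodule.
- by move=> U s a x A B; exact: pv_out.
- by move=> U f s oU hf; apply: pv_fact => // a; exact: smooth_in_holo.
- by move=> U V s; exact: pv_res.
- by move=> U s; exact: pv_loc.
Qed.

Lemma koszul_pv U n s : koszul_set U n s -> pv_set U n s.
Proof.
move=> [h1 h2 _]; split => // a x A B hD; apply: h2; apply: contraNN hD => /andP[/eqP h /eqP ->].
by rewrite /pv_degree cards0 h sub0r opprK.
Qed.

Lemma koszul_out U n s a x A B : koszul_set U n s -> ~ (dom a `&` U) x -> s a x A B = 0.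
Proof. by move=> [[h _ _] _ _]; exact: h. Qed.

Lemma koszul_fact U n f s : open U -> holo_fun U f -> koszul_set U n s -> koszul_set U n (fact f s).
Proof.
move=> oU hf [h1 h2 h3]; split; [|exact: supported_fact|].
  by apply: fact_section => // a; exact: smooth_in_holo.
by move=> a A B; apply: holomorphicM; [exact: hf | exact: h3].
Qed.

Lemma koszul_res U V n s : open U -> open V -> V `<=` U -> koszul_set U n s -> koszul_set V n (restrict V s).
Proof.
move=> oU oV VU [h1 h2 h3]; split; [exact: restrict_section h1 | exact: supported_res |].
move=> a A B; have h4 : holomorphic_in a V (fun x => s a x A B).
  by apply: holomorphic_sub (h3 a A B); exact: img_sub.
by apply: (holomorphic_in_ext oV _ h4) => x Vx _; rewrite restrictE.
Qed.

Lemma koszul_loc U n s : open U -> (forall a x A B, ~ (dom a `&` U) x -> s a x A B = 0) ->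
  (forall x, U x -> exists V, [/\ open V, V x, V `<=` U & koszul_set V n (restrict V s)]) -> koszul_set U n s.
Proof.
move=> oU h0 h; split.
- by apply: section_local => // x /h[V [? ? ? []]]; exists V.
- by apply: (supported_loc h0) => x /h[V [? ? ? []]]; exists V.
move=> a A B; apply: holomorphic_local; first exact: img_open.
move=> z /imgP[az Uz zE]; have [V [oV Vz VU [_ _ h3]]] := h _ Uz.
exists (img a V); split; [exact: img_open | by apply/imgP | ].
by apply: (holomorphic_in_ext oV _ (h3 a A B)) => x Vx _; rewrite restrictE.
Qed.

Lemma koszul_dolbeault U n s : koszul_set U n s -> dolbeault_op U s = 0.
Proof.
move=> [h1 h2 h3]; apply: familyP => a x A B.
have [[ax Ux]|h] := pselect ((dom a `&` U) x); last by rewrite dolbeault_out.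
rewrite (dolbeault_inE s A B ax Ux) dbarE big1// => k kB.
by have [_ hs] := h3 a A (B :\ k); rewrite hs ?mulr0//; exact: img_chart.
Qed.

Lemma koszul_delta U n s : koszul_set U n s -> delta_op W U s = contract_op W s.
Proof. by move=> h; rewrite /delta_op (koszul_dolbeault h) add0r. Qed.

Lemma koszul_contract U n s : open U -> koszul_set U n s -> koszul_set U (n + 1) (contract_op W s).
Proof.
move=> oU hs; have [h1 h2 h3] := hs; split; [exact: contract_section | | by move=> a A B; exact: contract_holo].
move=> a x A B hD; rewrite /contract_op big1// => k kA; rewrite h2 ?mulr0//.
apply: contraNN hD => /andP[/eqP h hB]; apply/andP; split => //; move: h; rewrite cardsU1 kA PoszD => h.
by apply/eqP; lia.
Qed.

Lemma koszul_omodule n : is_omodule (koszul_complex W n).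
Proof.
apply: family_omodule.
- by move=> U s a x A B; exact: koszul_out.
- by move=> U f s; exact: koszul_fact.
- by move=> U V s; exact: koszul_res.
- by move=> U s; exact: koszul_loc.
Qed.

Lemma pv_valP U n (s : pv_complex W n U) : pv_set U n (val s).
Proof. exact: (@sub_valP _ (pv_subgroup U n) s). Qed.

Lemma koszul_valP U n (s : koszul_complex W n U) : koszul_set U n (val s).
Proof. exact: (@sub_valP _ (koszul_subgroup U n) s). Qed.

Lemma val_pv_act U n f (s : pv_complex W n U) : open U -> holo_fun U f -> val (oact f s) = fact f (val s).
Proof. by move=> oU hf; apply: to_subK; apply: pv_fact => // [a|]; [exact: smooth_in_holo | exact: pv_valP]. Qed.

Lemma val_pv_res U V n (s : pv_complex W n U) : open U -> open V -> V `<=` U ->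
  val (ores V s) = restrict V (val s).
Proof. by move=> oU oV VU; apply: to_subK; apply: pv_res oU oV VU _; exact: pv_valP. Qed.

Lemma val_pv_diff U n (s : pv_complex W n U) : open U -> val (cdiff (n + 1) s) = delta_op W U (val s).
Proof. by move=> oU; apply: to_subK; apply: pv_delta => //; exact: pv_valP. Qed.

Lemma val_koszul_act U n f (s : koszul_complex W n U) : open U -> holo_fun U f -> val (oact f s) = fact f (val s).
Proof. by move=> oU hf; apply: to_subK; apply: koszul_fact => //; exact: koszul_valP. Qed.

Lemma val_koszul_res U V n (s : koszul_complex W n U) : open U -> open V -> V `<=` U ->
  val (ores V s) = restrict V (val s).
Proof. by move=> oU oV VU; apply: to_subK; apply: koszul_res oU oV VU _; exact: koszul_valP. Qed.

Lemma val_koszul_diff U n (s : koszul_complex W n U) : open U ->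
  val (cdiff (n + 1) s) = contract_op W (val s).
Proof. by move=> oU; apply: to_subK; apply: koszul_contract => //; exact: koszul_valP. Qed.

Lemma val_incl U n (s : koszul_complex W n U) : val (koszul_incl s) = val s.
Proof. by apply: to_subK; apply: koszul_pv; exact: koszul_valP. Qed.

Lemma degree_disjoint (D D' : {set 'I_d} -> {set 'I_d} -> bool) s :
  (forall A B, D A B -> ~~ D' A B) -> supported D s -> supported D' s -> s = 0.
Proof.
move=> h h1 h2; apply: familyP => a x A B; have [hD|hD] := boolP (D A B); last exact: h1.
by rewrite h2//; exact: h.
Qed.

(** Either [delta_op] lands in degree [n], and is 0 as it also has degree m + 1, or it does not, and
    [to_sub] takes its default 0. *)
Lemma pv_diff_off U m n (s : pv_complex W m U) : open U -> n != m + 1 -> cdiff n s = 0.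
Proof.
move=> oU nm; have vs : pv_set U m (val s) := pv_valP s.
have [h|h] := pselect (pv_set U n (delta_op W U (val s))).
  have h' : pv_set U (m + 1) (delta_op W U (val s)) := pv_delta oU vs.
  apply: val_inj; refine (etrans (@to_subK _ (pv_subgroup U n) _ h) _).
  apply: (degree_disjoint _ h.2 h'.2) => A B /eqP hn.
  by apply: contraNN nm => /eqP hm; rewrite -hn -hm.
exact: (@to_sub_out _ (pv_subgroup U n)).
Qed.

Lemma koszul_diff_off U m n (s : koszul_complex W m U) : open U -> n != m + 1 -> cdiff n s = 0.
Proof.
move=> oU nm; have vs : koszul_set U m (val s) := koszul_valP s.
have [h|h] := pselect (koszul_set U n (contract_op W (val s))).
  have h' : koszul_set U (m + 1) (contract_op W (val s)) := koszul_contract oU vs.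
  apply: val_inj; refine (etrans (@to_subK _ (koszul_subgroup U n) _ h) _).
  have [_ h2 _] := h; have [_ h2' _] := h'.
  apply: (degree_disjoint _ h2 h2') => A B /andP[/eqP hn _].
  by apply: contraNN nm => /andP[/eqP hm _]; rewrite hn in hm; rewrite -(inj_eq oppr_inj) hm.
exact: (@to_sub_out _ (koszul_subgroup U n)).
Qed.

Lemma pv_valD U n (s t : pv_complex W n U) : val (s + t) = val s + val t.
Proof. exact: (raddfD val). Qed.

Lemma koszul_valD U n (s t : koszul_complex W n U) : val (s + t) = val s + val t.
Proof. exact: (raddfD val). Qed.

Lemma pv_act0 U n f : open U -> holo_fun U f -> oact f (0 : pv_complex W n U) = 0.
Proof.
move=> oU hf; apply: val_inj; apply: (etrans (val_pv_act _ oU hf)).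
by apply: familyP => a x A B; exact: mulr0.
Qed.

Lemma pv_res0 U V n : open U -> open V -> V `<=` U -> ores V (0 : pv_complex W n U) = 0.
Proof.
move=> oU oV VU; apply: val_inj; apply: (etrans (val_pv_res _ oU oV VU)).
by apply: familyP => a x A B; rewrite /restrict; case: ifP.
Qed.

Lemma koszul_act0 U n f : open U -> holo_fun U f -> oact f (0 : koszul_complex W n U) = 0.
Proof.
move=> oU hf; apply: val_inj; apply: (etrans (val_koszul_act _ oU hf)).
by apply: familyP => a x A B; exact: mulr0.
Qed.

Lemma koszul_res0 U V n : open U -> open V -> V `<=` U -> ores V (0 : koszul_complex W n U) = 0.
Proof.
move=> oU oV VU; apply: val_inj; apply: (etrans (val_koszul_res _ oU oV VU)).
by apply: familyP => a x A B; rewrite /restrict; case: ifP.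
Qed.

Lemma pv_diff_ohom m n : is_ohom (@cdiff _ _ _ (pv_complex W) m n).
Proof.
have [->|nm] := eqVneq n (m + 1); last first.
  split.
  - move=> U s t oU; rewrite (pv_diff_off s oU nm) (pv_diff_off t oU nm) addr0.
    exact: (pv_diff_off _ oU nm).
  - move=> U f s oU hf; rewrite (pv_diff_off s oU nm) (pv_act0 n oU hf).
    exact: (pv_diff_off _ oU nm).
  - move=> U V s oU oV VU; rewrite (pv_diff_off s oU nm) (pv_res0 n oU oV VU).
    exact: (pv_diff_off _ oV nm).
split.
- move=> U s t oU; apply: val_inj; apply: (etrans (val_pv_diff (s + t) oU)).
  rewrite (pv_valD s t); have E := @deltaD R d X W U (val s) (val t) oU (pv_valP s).1 (pv_valP t).1.
  refine (etrans E _).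
  apply: esym; apply: (etrans (pv_valD _ _)).
  by rewrite (val_pv_diff s oU) (val_pv_diff t oU).
- move=> U f s oU hf; apply: val_inj; apply: (etrans (val_pv_diff _ oU)).
  rewrite (val_pv_act s oU hf); have E := @delta_fact R d X W U f (val s) oU hf (pv_valP s).1.
  refine (etrans E _).
  apply: esym; apply: (etrans (val_pv_act _ oU hf)); congr fact; exact: val_pv_diff.
- move=> U V s oU oV VU; apply: val_inj; apply: (etrans (val_pv_diff _ oV)).
  rewrite (val_pv_res s oU oV VU); have E := @delta_restrict R d X W U V (val s) oU oV VU (pv_valP s).1.
  refine (etrans E _).
  apply: esym; apply: (etrans (val_pv_res _ oU oV VU)); congr restrict; exact: val_pv_diff.
Qed.

Lemma pv_diff_diff m n p U (s : pv_complex W m U) : open U -> cdiff p (cdiff n s) = 0.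
Proof.
move=> oU; have [nm|nm] := eqVneq n (m + 1); last first.
  rewrite (pv_diff_off s oU nm); have [pn|pn] := eqVneq p (n + 1); last exact: pv_diff_off.
  by subst p; apply: val_inj; apply: (etrans (val_pv_diff _ oU)); exact: delta0.
subst n; have [pn|pn] := eqVneq p (m + 1 + 1); last exact: pv_diff_off.
subst p; apply: val_inj; apply: (etrans (val_pv_diff _ oU)).
rewrite (val_pv_diff s oU); exact: (@delta_delta R d X W hW U (val s) oU (pv_valP s).1).
Qed.

Lemma pv_ocomplex : is_ocomplex (pv_complex W).
Proof.
split; [exact: pv_omodule | exact: pv_diff_ohom | |].
  by move=> m n U s oU; exact: pv_diff_off.
by move=> m n p U s oU; exact: pv_diff_diff.
Qed.

Lemma koszul_diff_ohom m n : is_ohom (@cdiff _ _ _ (koszul_complex W) m n).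
Proof.
have [->|nm] := eqVneq n (m + 1); last first.
  split.
  - move=> U s t oU; rewrite (koszul_diff_off s oU nm) (koszul_diff_off t oU nm) addr0.
    exact: (koszul_diff_off _ oU nm).
  - move=> U f s oU hf; rewrite (koszul_diff_off s oU nm) (koszul_act0 n oU hf).
    exact: (koszul_diff_off _ oU nm).
  - move=> U V s oU oV VU; rewrite (koszul_diff_off s oU nm) (koszul_res0 n oU oV VU).
    exact: (koszul_diff_off _ oV nm).
split.
- move=> U s t oU; apply: val_inj; apply: (etrans (val_koszul_diff (s + t) oU)).
  rewrite (koszul_valD s t) contractD.
  apply: esym; apply: (etrans (koszul_valD _ _)).
  by congr (_ + _); exact: (val_koszul_diff _ oU).
- move=> U f s oU hf; apply: val_inj; apply: (etrans (val_koszul_diff _ oU)).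
  rewrite (val_koszul_act s oU hf); apply: esym; apply: (etrans (val_koszul_act _ oU hf)).
  rewrite (val_koszul_diff s oU).
  by apply: familyP => a x A B; rewrite /fact big_distrr; apply: eq_bigr => k _ /=; ring.
- move=> U V s oU oV VU; apply: val_inj; apply: (etrans (val_koszul_diff _ oV)).
  rewrite (val_koszul_res s oU oV VU) contract_restrict.
  apply: esym; apply: (etrans (val_koszul_res _ oU oV VU)); congr restrict; exact: val_koszul_diff.
Qed.

Lemma koszul_diff_diff m n p U (s : koszul_complex W m U) : open U -> cdiff p (cdiff n s) = 0.
Proof.
move=> oU; have [nm|nm] := eqVneq n (m + 1); last first.
  rewrite (koszul_diff_off s oU nm); have [pn|pn] := eqVneq p (n + 1); last exact: koszul_diff_off.
  subst p; apply: val_inj; apply: (etrans (val_koszul_diff _ oU)).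
  by apply: familyP => a x A B; rewrite /contract_op big1// => k _; rewrite mulr0.
subst n; have [pn|pn] := eqVneq p (m + 1 + 1); last exact: koszul_diff_off.
subst p; apply: val_inj; apply: (etrans (val_koszul_diff _ oU)).
rewrite (val_koszul_diff s oU); exact: contract_contract.
Qed.

Lemma koszul_ocomplex : is_ocomplex (koszul_complex W).
Proof.
split; [exact: koszul_omodule | exact: koszul_diff_ohom | |].
  by move=> m n U s oU; exact: koszul_diff_off.
by move=> m n p U s oU; exact: koszul_diff_diff.
Qed.

Lemma koszul_incl_cmap : is_cmap (koszul_incl (X := X) (W := W)).
Proof.
split.
- move=> n; split.
  + move=> U s t oU; apply: val_inj; apply: (etrans (val_incl _)); rewrite (koszul_valD s t).
    by apply: esym; apply: (etrans (pv_valD _ _)); congr (_ + _); exact: val_incl.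
  + move=> U f s oU hf; apply: val_inj; apply: (etrans (val_incl _)).
    rewrite (val_koszul_act s oU hf); apply: esym; apply: (etrans (val_pv_act _ oU hf)).
    by rewrite (val_incl s).
  + move=> U V s oU oV VU; apply: val_inj; apply: (etrans (val_incl _)).
    rewrite (val_koszul_res s oU oV VU); apply: esym; apply: (etrans (val_pv_res _ oU oV VU)).
    by rewrite (val_incl s).
move=> m n U s oU; have [nm|nm] := eqVneq n (m + 1); last first.
  rewrite (koszul_diff_off s oU nm) (pv_diff_off _ oU nm).
  by apply: val_inj; exact: val_incl.
subst n; apply: val_inj; apply: (etrans (val_incl _)); rewrite (val_koszul_diff s oU).
apply: esym; apply: (etrans (val_pv_diff _ oU)); rewrite (val_incl s).
exact: (koszul_delta (koszul_valP s)).
Qed.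

Lemma koszul_incl_inj n U : injective (koszul_incl (W := W) (n := n) (U := U)).
Proof. by move=> s t /(congr1 val); rewrite !val_incl => /val_inj. Qed.

Lemma pv_bounded : bounded_below (pv_complex W).
Proof.
exists (- d%:Z) => n U s nd oU; apply: val_inj; apply: familyP => a x A B.
have [_ h] := pv_valP s; apply: h; rewrite /pv_degree.
have hA : (#|A| <= d)%N by rewrite -[X in (_ <= X)%N](card_ord d) max_card.
by apply/eqP; lia.
Qed.

End Complexes.

(** * PV as a resolution of the Koszul complex *)

Lemma zero_termL (R : realType) (J K o : R[i]) : J = 0 -> J * K^*%C * o = 0.
Proof. by move=> ->; rewrite !mul0r. Qed.

Lemma zero_termR (R : realType) (J K o : R[i]) : K = 0 -> J * K^*%C * o = 0.
Proof. by move=> ->; rewrite (rmorph0 conjc) mulr0 mul0r. Qed.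

Lemma one_term (R : realType) (J K o : R[i]) : J = 1 -> K = 1 -> J * K^*%C * o = o.
Proof. by move=> -> ->; rewrite (rmorph1 conjc) !mul1r. Qed.

Section ChartSection.
Variables (R : realType) (d : nat) (X : cmanifold R d).
Local Notation family := (chart_family R d X).
Implicit Types (U V : set X) (s t : family) (A B : {set 'I_d}) (a b c : chart_index X).
Local Opaque real_deriv dir jacobian jac dbar.

(** The Cauchy-Binet formula in both indices: transformation laws compose as the Jacobians are
    multiplied. *)
Lemma law_compose (P Q P' Q' : 'M[R[i]]_d) (o : {set 'I_d} -> {set 'I_d} -> R[i]) A B :
  \sum_A' \sum_B' minor (P *m Q) A A' * (minor (Q' *m P') B' B)^*%C * o A' B' =
  \sum_A1 \sum_B1 minor P A A1 * (minor P' B1 B)^*%C *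
    \sum_A' \sum_B' minor Q A1 A' * (minor Q' B' B1)^*%C * o A' B'.
Proof.
pose t A' B' A1 B1 := minor P A A1 * (minor P' B1 B)^*%C * (minor Q A1 A' * (minor Q' B' B1)^*%C * o A' B').
transitivity (\sum_A' \sum_B' \sum_A1 \sum_B1 t A' B' A1 B1).
  apply: eq_bigr => A' _; apply: eq_bigr => B' _.
  rewrite !minorM (raddf_sum conjc) /= -mulrA big_distrl; apply: eq_bigr => A1 _ /=.
  rewrite [X in _ * X]big_distrl big_distrr; apply: eq_bigr => B1 _ /=.
  rewrite (rmorphM conjc) /t; ring.
transitivity (\sum_A1 \sum_B1 \sum_A' \sum_B' t A' B' A1 B1).
  under eq_bigr do rewrite exchange_big.
  rewrite exchange_big; apply: eq_bigr => A1 _ /=.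
  under eq_bigr do rewrite exchange_big.
  by rewrite exchange_big.
apply: eq_bigr => A1 _; apply: eq_bigr => B1 _; rewrite big_distrr; apply: eq_bigr => A' _ /=.
by rewrite big_distrr.
Qed.

(** Coefficients in one chart determine those in all the others by the transformation law, which is
    consistent by the cocycle relation of the Jacobians. Minors relate subsets of equal size, so a
    support condition is inherited when it depends on cardinals. *)
Lemma chart_section a (x0 : X) (r : R) (om : {set 'I_d} -> {set 'I_d} -> cspace R d -> cplx R)
    (D : {set 'I_d} -> {set 'I_d} -> bool) :
  box (chart a x0) r `<=` img a setT ->
  (forall A B, smooth (box (chart a x0) r) (om A B)) ->
  (forall A B A' B', #|A| = #|A'| -> #|B| = #|B'| -> D A B = D A' B') ->
  (forall A B, ~~ D A B -> om A B = fun=> 0) ->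
  exists s : family, [/\ is_section (cbx a x0 r) s, supported D s &
    forall A B x, cbx a x0 r x -> s a x A B = om A B (chart a x)].
Proof.
move=> hbox som hD om0; set V := cbx a x0 r.
have oV : open V by exact: cbx_open.
pose T b x A B : R[i] := \sum_A' \sum_B' minor (jacobian b a x) A A' *
  (minor (jacobian a b x) B' B)^*%C * om A' B' (chart a x).
pose s : family := fun b x A B => if x \in dom b `&` V then T b x A B else 0.
have sE b x A B : dom b x -> V x -> s b x A B = T b x A B by move=> bx Vx; rewrite /s mem_set.
have s_out b x A B : ~ (dom b `&` V) x -> s b x A B = 0 by move=> h; rewrite /s memNset.
exists s; split; first split.
- exact: s_out.
- move=> b A B; pose U' := img b (dom a `&` V).
  have oU' : open U' by apply: img_open; exact: domI_open.
  have TV z : U' z -> box (chart a x0) r (tr b a z) by move=> /imgP[_ [_ [_ h]] _].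
  have hT l : holomorphic U' (fun z => tr b a z 0 l) by exact: tr_holo.
  have sm : smooth U' (fun z => \sum_A' minor (jac (tr a b) (tr b a z)) A A' * pull (tr b a) (om A') B z).
    apply: smooth_sum => A' _.
    have hm := holomorphic_minor_jacobian a b A A' oV.
    exact: (smoothM hm.1 (smooth_pull oU' (@box_open R d (chart a x0) r) TV hT (som A') B)).
  have sub : img b V `<=` U' by apply: img_sub => y Vy; split => //; exact: Vy.1.
  move: (smooth_sub sub sm); apply: smooth_ext; first exact: img_open.
  move=> z; rewrite inE => /imgP[bz Vz zE]; rewrite /local_expr (sE _ _ _ _ bz Vz) /T.
  apply: eq_bigr => A' _; apply: (etrans (big_distrr _ _ _)); apply: eq_bigr => B' _ /=.
  have -> : jacobian b a (param b z) = jac (tr a b) (tr b a z) by rewrite jacobianE.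
  have -> : jacobian a b (param b z) = jac (tr b a) z by rewrite jacobianE zE.
  by rewrite /tr mulrA.
- move=> b c x A B Vx bx cx; have ax : dom a x := Vx.1.
  rewrite (sE _ _ _ _ cx Vx) /T (jacobian_cocycle ax bx cx) (jacobian_cocycle cx bx ax).
  rewrite (law_compose _ _ _ _ (fun A' B' => om A' B' (chart a x))).
  by apply: eq_bigr => A1 _; apply: eq_bigr => B1 _; rewrite (sE _ _ _ _ bx Vx).
- move=> b x A B hAB; have [[bx Vx]|h] := pselect ((dom b `&` V) x); last exact: s_out.
  rewrite (sE _ _ _ _ bx Vx) /T big1// => A' _; rewrite big1// => B' _.
  have [hA|hA] := eqVneq #|A| #|A'|; last exact: (zero_termL _ _ (minor_card _ hA)).
  have [hB|hB] := eqVneq #|B'| #|B|; last exact: (zero_termR _ _ (minor_card _ hB)).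
  by rewrite om0 ?mulr0// -(hD A B).
move=> A B x Vx; have ax : dom a x := Vx.1.
rewrite (sE _ _ _ _ ax Vx) /T (jacobian_id ax) (bigD1 A)//= (bigD1 B)//=.
rewrite (one_term (J := minor 1%:M A A) (K := minor 1%:M B B)); last 2 first.
- by rewrite minor1 eqxx.
- by rewrite minor1 eqxx.
rewrite [X in _ + X + _]big1 => [|B' /negbTE hB]; last first.
  by apply: zero_termR; rewrite minor1 hB.
rewrite big1 ?addr0// => A' hA; rewrite big1// => B' _.
by apply: zero_termL; rewrite minor1 eq_sym (negbTE hA).
Qed.

Lemma section_vanish U s a b (x : X) A B : is_section U s -> U x -> dom a x -> dom b x ->
  (forall A' B', #|B'| = #|B| -> s a x A' B' = 0) -> s b x A B = 0.
Proof.
move=> [_ _ s3] Ux ax bx h; rewrite (s3 a b)// big1// => A' _; rewrite big1// => B' _.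
have [hB|hB] := eqVneq #|B'| #|B|; first by rewrite h// mulr0.
exact: (zero_termR _ _ (minor_card _ hB)).
Qed.

End ChartSection.

Section KoszulResolution.
Variables (R : realType) (d : nat) (X : cmanifold R d) (W : X -> R[i]).
Hypothesis hW : holo_fun setT W.
Local Notation family := (chart_family R d X).
Implicit Types (U V : set X) (s t u w : family) (A B : {set 'I_d}) (a b c : chart_index X).
Local Opaque real_deriv dir jacobian jac dbar.

Lemma dolbeault_delta0 U w a (x : X) A B : dom a x -> U x ->
  delta_op W U w a x A B = 0 -> (forall A', w a x A' B = 0) ->
  dbar (coef w a A) B (chart a x) = 0.
Proof.
move=> ax Ux h h'; rewrite -(dolbeault_inE w A B ax Ux).
by move: h; rewrite /delta_op familyDE [X in _ + X]big1 ?addr0// => k _; rewrite h' mulr0.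
Qed.

(** In antiholomorphic degree 1 only dbar contributes to [delta_op], and its vanishing is the system
    of Cauchy-Riemann equations. *)
Lemma koszul_of_bottom U n w : open U -> pv_set U n w ->
  (forall a y A B, B != finset.set0 -> w a y A B = 0) ->
  (forall a y A B, B != finset.set0 -> delta_op W U w a y A B = 0) -> koszul_set U n w.
Proof.
move=> oU [hw hn] w0 dw0; split => //.
  move=> a x A B; rewrite /koszul_degree; have [->|B0] := eqVneq B finset.set0; last by move=> _; exact: w0.
  rewrite andbT => h; apply: hn; apply: contraNN h; rewrite /pv_degree cards0 sub0r => /eqP <-.
  by rewrite opprK.
move=> a A B; have oU' := img_open (a := a) oU.
have [->|B0] := eqVneq B finset.set0; last first.
  by apply: (holomorphic_ext oU' _ (holomorphic_cst (img a U) (0 : cplx R))) => z _; rewrite /local_expr w0.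
have [_ s2 _] := hw; split; first exact: s2.
move=> k z /imgP[az Uz zE].
have kB : [set k]%SET != finset.set0 by rewrite -cards_eq0 cards1.
have := dolbeault_delta0 az Uz (dw0 a (param a z) A [set k]%SET kB) (fun A' => w0 a _ A' _ kB).
rewrite dbarE big_set1 zE finset.setDv => /eqP; rewrite mulf_eq0 (negbTE (sgn_neq0 R _ _)) /=.
by move/eqP.
Qed.

(** The part of delta w without antiholomorphic differentials is left free, so that the statement
    serves both for cocycles and for cochains whose boundary is a Koszul section. The component with
    |B| = q + 1 is dbar-closed, because the contraction of the absent next component contributes
    nothing to delta w. *)
Lemma zigzag q n U w (x : X) : open U -> U x -> pv_set U n w ->
  (forall a y A B, (q < #|B|)%N -> w a y A B = 0) ->
  (forall a y A B, B != finset.set0 -> delta_op W U w a y A B = 0) ->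
  exists V u, [/\ open V, V x, V `<=` U, pv_set V (n - 1) u &
    koszul_set V n (restrict V w - delta_op W V u)].
Proof.
elim: q U w => [|q IH] U w oU Ux hw wq dw.
  exists U, 0; split => //; first by split; [exact: is_section0 | ].
  have -> : restrict U w - delta_op W U 0 = w.
    rewrite delta0// subr0; apply: familyP => a y A B; have [Uy|Uy] := pselect (U y).
      by rewrite restrictE.
    by rewrite restrict_out// (pv_out A B hw)// => -[].
  apply: koszul_of_bottom => // a y A B B0; apply: wq.
  by rewrite lt0n cards_eq0.
have [a ax] := dom_cover x; have [r r0 hr] := cbx_exists oU ax Ux; set p := chart a x in hr.
have hn := hw.2; have [_ s2 _] := hw.1.
(* The component of highest degree, as one form for each [A]. The Dolbeault lemma is applied to
   these forms separately, and the least of the finitely many radii is kept. *)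
pose om A B : cspace R d -> cplx R := if #|B| == q.+1 then coef w a A B else fun=> 0.
have som A B : smooth (box p r) (om A B).
  rewrite /om; case: ifP => _; last exact: smooth_cst.
  by apply: smooth_sub (s2 a A B).
have H A : exists r', exists eta : {set 'I_d} -> cspace R d -> cplx R, [/\ 0 < r', r' <= r, forall B, smooth (box p r') (eta B),
    forall B z, box p r' z -> #|B|.+1 != q.+1 -> eta B z = 0 &
    forall B z, box p r' z -> dbar eta B z = om A B z].
  apply: dolbeault_lemma => // [B z _ hB|B z hz]; first by rewrite /om (negbTE hB).
  have /imgP[az Uz zE] := hr z hz.
  have [hB|hB] := eqVneq #|B| q.+2; last first.
    rewrite dbarE big1// => k kB; rewrite /om.
    have -> : (#|B :\ k| == q.+1) = false.
      by apply/negbTE; move: hB; rewrite (cardsD1 k B) kB add1n eqSS.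
    by rewrite pd_zbarE wdir_cst mulr0.
  have -> : dbar (om A) B z = dbar (coef w a A) B z.
    rewrite !dbarE; apply: eq_bigr => k kB; rewrite /om.
    by have -> : (#|B :\ k| == q.+1) by move: hB; rewrite (cardsD1 k B) kB add1n => -[->].
  rewrite -zE; apply: dolbeault_delta0 az Uz _ _ => [|A']; last by apply: wq; rewrite hB.
  by apply: dw; rewrite -cards_eq0 hB.
have [rr Hr] := choice H; have [et Het] := choice Hr.
pose r1 := \big[Order.min/r]_A rr A.
have r10 : 0 < r1 by apply/bigmin_gtP; split => // A _; case: (Het A).
have r1r A : r1 <= rr A by rewrite /r1 (bigD1 A)//= ge_min lexx.
have r1r' : r1 <= r by have [_ h _ _ _] := Het finset.set0; exact: le_trans (r1r _) h.
have bsub A : box p r1 `<=` box p (rr A) by move=> z hz k; apply: lt_le_trans (hz k) (r1r A).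
have bsubr : box p r1 `<=` img a U by move=> z hz; apply: hr => k; apply: lt_le_trans (hz k) r1r'.
(* The Dolbeault lemma has provided a form for every [A]; this retains those of total degree n -
   1. *)
pose D A B := (#|B| == q) && pv_degree (n - 1) A B.
pose eta A B : cspace R d -> cplx R := if D A B then et A B else fun=> 0.
have [V1U imgV1] := cbx_img bsubr.
have oV1 := cbx_open a x r1; have V1x := cbx_center r10 ax.
have [||||u [hu1 hu2 hu3]] := @chart_section R d X a x r1 eta D.
- by apply: subset_trans bsubr _; exact: img_sub.
- move=> A B; rewrite /eta; case: ifP => _; last exact: smooth_cst.
  by have [_ _ h _ _] := Het A; apply: smooth_sub (h B); exact: bsub.
- by move=> A B A' B' hA hB; rewrite /D /pv_degree hA hB.
- by move=> A B h; rewrite /eta (negbTE h).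
set V1 := cbx a x r1 in V1U imgV1 oV1 V1x hu1 hu2 hu3.
have hu : pv_set V1 (n - 1) u by split => // b y A B h; apply: hu2; apply: contraNN h => /andP[].
have hdu : pv_set V1 n (delta_op W V1 u) by have := pv_delta hW oV1 hu; rewrite subrK.
have hrw := pv_res oU oV1 V1U hw.
pose w1 := restrict V1 w - delta_op W V1 u.
have hw1 : pv_set V1 n w1.
  by split; [exact: is_section_sub hrw.1 hdu.1 | exact: supported_sub hrw.2 hdu.2].
(* Vanishing is verified in the chart [a], where the equation was solved, and carried over to [b] by
   the transformation law. *)
have w1q b y A B : (q < #|B|)%N -> w1 b y A B = 0.
  move=> qB; have [[by_ V1y]|h] := pselect ((dom b `&` V1) y); last exact: (pv_out A B hw1).
  have ay : dom a y := V1y.1.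
  refine (@section_vanish R d X V1 w1 a b y A B hw1.1 V1y ay by_ _) => A' B' hB'; rewrite -hB' in qB.
  rewrite /w1 familyBE restrictE// /delta_op familyDE [X in _ - (_ + X)]big1 ?addr0; last first.
    move=> k _; rewrite hu2 ?mulr0// /D; apply/negP => /andP[/eqP h _].
    by rewrite h ltnn in qB.
  rewrite (dolbeault_inE u A' B' ay V1y).
  have by1 : box p r1 (chart a y) := V1y.2.
  have [_ c2 _] := hu1.
  have E0 B0 : {in box p r1, coef u a A' B0 =1 eta A' B0}.
    by move=> z; rewrite inE -imgV1 => /imgP[_ V1z zE]; rewrite /coef /local_expr hu3// zE.
  have c2' B0 : smooth (box p r1) (coef u a A' B0) by rewrite -imgV1; exact: c2.
  rewrite (dbar_ext B' (@box_open R d p r1) by1 c2' E0).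
  have [hB|hB] := eqVneq #|B'| q.+1; last first.
    rewrite wq; last by rewrite ltn_neqAle eq_sym hB.
    rewrite dbarE big1 ?subr0// => k kB; rewrite /eta /D.
    have -> : (#|B' :\ k| == q) = false.
      by apply/negbTE; move: hB; rewrite (cardsD1 k B') kB add1n eqSS.
    by rewrite pd_zbarE wdir_cst mulr0.
  have cB k : k \in B' -> #|B' :\ k| = q by move=> kB; move: hB; rewrite (cardsD1 k B') kB add1n => -[].
  have [hd|hd] := boolP (pv_degree n A' B').
    have etaE k : k \in B' -> eta A' (B' :\ k) = et A' (B' :\ k).
      move=> kB; rewrite /eta /D cB// eqxx /=; have -> // : pv_degree (n - 1) A' (B' :\ k).
      by move: hd; rewrite /pv_degree cB// hB => /eqP <-; apply/eqP; lia.
    have -> : dbar (eta A') B' (chart a y) = dbar (et A') B' (chart a y).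
      by rewrite !dbarE; apply: eq_bigr => k /etaE ->.
    have [_ _ _ _ h5] := Het A'; rewrite h5; last exact: bsub.
    by rewrite /om hB eqxx /coef /local_expr chartK// subrr.
  rewrite hn// dbarE big1 ?subr0// => k kB; rewrite /eta /D.
  have -> : pv_degree (n - 1) A' (B' :\ k) = false.
    apply/negbTE; apply: contraNN hd; rewrite /pv_degree cB// hB => /eqP h.
    by apply/eqP; lia.
  by rewrite andbF pd_zbarE wdir_cst mulr0.
have dw1 : delta_op W V1 w1 = restrict V1 (delta_op W U w).
  rewrite (deltaB _ oV1 hrw.1 hdu.1) (delta_delta hW oV1 hu1) subr0.
  exact: (delta_restrict W oU oV1 V1U hw.1).
have [|V2 [u2 [oV2 V2x V21 hu2' hk]]] := IH V1 w1 oV1 V1x hw1 w1q.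
  by move=> b y A B B0; rewrite dw1 /restrict dw//; case: ifP.
exists V2, (restrict V2 u + u2); have ru := pv_res oV1 oV2 V21 hu.
split; [exact: oV2 | exact: V2x | exact: (subset_trans V21 V1U) | | ].
  split; first by apply: is_sectionD; [exact: ru.1 | exact: hu2'.1].
  by move=> b y A B h; rewrite familyDE (ru.2 _ _ _ _ h) (hu2'.2 _ _ _ _ h) addr0.
rewrite (_ : _ - _ = restrict V2 w1 - delta_op W V2 u2)//.
rewrite (deltaD _ oV2 ru.1 hu2'.1) (delta_restrict W oV1 oV2 V21 hu1).
apply: familyP => b y A B; rewrite !familyBE familyDE opprD addrA; congr (_ - _).
rewrite /w1; have [V2y|V2y] := pselect (V2 y); last by rewrite !restrict_out// subr0.
by rewrite !restrictE ?familyBE ?restrictE//; exact: V21.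
Qed.

(** Both halves start the zigzag at q = d, above which there are no components: injectivity with a
    cochain bounding a Koszul section, surjectivity with a cocycle. *)
Lemma koszul_incl_quasi_iso : quasi_iso (koszul_incl (X := X) (W := W)).
Proof.
have cob n V (s : pv_complex W n V) (u : family) : open V -> pv_set V (n - 1) u ->
    val s = delta_op W V u -> coboundary (pv_complex W) n V s.
  move=> oV hu E; exists (to_sub (pv_subgroup V (n - 1)) u); apply: val_inj; rewrite E.
  have h : pv_set V n (delta_op W V u) by have := pv_delta hW oV hu; rewrite subrK.
  apply: esym; apply: (etrans (@to_subK _ (pv_subgroup V n) _ _)).
    by rewrite (@to_subK _ (pv_subgroup V (n - 1)) u).
  by rewrite (@to_subK _ (pv_subgroup V (n - 1)) u).
have cocy n V (s : pv_complex W n V) : open V -> cocycle (pv_complex W) n V s -> delta_op W V (val s) = 0.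
  by move=> oV /(congr1 val); rewrite (val_pv_diff hW s oV).
have cardq (B : {set 'I_d}) : (d < #|B|)%N -> False.
  by move=> h; have := max_card (mem B); rewrite card_ord leqNgt h.
move=> n U x oU Ux; split.
  move=> s cs [t E].
  have Ev : val s = delta_op W U (val t).
    have h1 := congr1 val E; rewrite (val_incl s) in h1; rewrite h1.
    apply: (@to_subK _ (pv_subgroup U n)); have := pv_delta hW oU (pv_valP t); by rewrite subrK.
  have [_ ks _] := koszul_valP s.
  have [||V [u [oV Vx VU hu hk]]] := @zigzag d (n - 1) U (val t) x oU Ux (pv_valP t).
  - by move=> a y A B /cardq.
  - by move=> a y A B B0; rewrite -Ev; apply: ks; rewrite /koszul_degree (negbTE B0) andbF.
  exists V; split => //; exists (to_sub (koszul_subgroup V (n - 1)) (restrict V (val t) - delta_op W V u)).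
  have hrt := pv_res oU oV VU (pv_valP t).
  have Ek : contract_op W (restrict V (val t) - delta_op W V u) = restrict V (val s).
    have hdu := pv_delta hW oV hu; rewrite -(koszul_delta W hk) (deltaB _ oV hrt.1 hdu.1).
    by rewrite (delta_delta hW oV hu.1) subr0 (delta_restrict W oU oV VU (pv_valP t).1) Ev.
  apply: val_inj; apply: (etrans (val_koszul_res s oU oV VU)); rewrite -Ek.
  have kk := koszul_contract hW oV hk; rewrite subrK in kk.
  apply: esym; apply: (etrans (@to_subK _ (koszul_subgroup V n) _ _));
    by rewrite (@to_subK _ (koszul_subgroup V (n - 1)) _ hk).
move=> t ct; have dt := cocy _ _ t oU ct.
have [||V [u [oV Vx VU hu hk]]] := @zigzag d n U (val t) x oU Ux (pv_valP t).
- by move=> a y A B /cardq.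
- by move=> a y A B _; rewrite dt.
have hrt := pv_res oU oV VU (pv_valP t).
pose ks : koszul_complex W n V := to_sub (koszul_subgroup V n) (restrict V (val t) - delta_op W V u).
exists V; split => //; exists ks.
  apply: val_inj; apply: (etrans (val_koszul_diff hW _ oV)).
  rewrite (@to_subK _ (koszul_subgroup V n) _ hk) -(koszul_delta W hk).
  have hdu := pv_delta hW oV hu; rewrite (deltaB _ oV hrt.1 hdu.1).
  by rewrite (delta_delta hW oV hu.1) subr0 (delta_restrict W oU oV VU (pv_valP t).1) dt;
    apply: familyP => a y A B; rewrite /restrict; case: ifP.
apply: (cob _ _ _ u oV hu).
have e1 := val_pv_res t oU oV VU.
have e2 := etrans (val_incl ks) (@to_subK _ (koszul_subgroup V n) _ hk).
exact: (etrans (raddfB val (ores V t) (koszul_incl ks)) (etrans (f_equal2 (fun p q => p - q) e1 e2) (subKr _ _))).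
Qed.

End KoszulResolution.

(** * Comparison with injective complexes *)

Lemma additive_map0 (M N : zmodType) (f : M -> N) : (forall x y, f (x + y) = f x + f y) -> f 0 = 0.
Proof. by move=> h; apply: (addrI (f 0)); rewrite -h !addr0. Qed.

Lemma additive_mapN (M N : zmodType) (f : M -> N) (x : M) :
  (forall x y, f (x + y) = f x + f y) -> f (- x) = - f x.
Proof. by move=> h; apply: (addrI (f x)); rewrite -h !subrr (additive_map0 h). Qed.

Lemma additive_mapB (M N : zmodType) (f : M -> N) (x y : M) :
  (forall x y, f (x + y) = f x + f y) -> f (x - y) = f x - f y.
Proof. by move=> h; rewrite h (additive_mapN _ h). Qed.

(** * Sheaves of O-modules and the extension of linear relations *)

Section OModuleTheory.
Variables (R : realType) (d : nat) (X : cmanifold R d).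
Implicit Types U V T : set X.

Section Restriction.
Variables (E : omodule X) (hE : is_omodule E).

Lemma ores0 U V : open U -> open V -> V `<=` U -> ores V (0 : E U) = 0.
Proof. by move=> oU oV VU; apply: additive_map0 => s t; exact: (oresD hE). Qed.

Lemma oresN U V (s : E U) : open U -> open V -> V `<=` U -> ores V (- s) = - ores V s.
Proof. by move=> oU oV VU; apply: additive_mapN => ? ?; exact: (oresD hE). Qed.

Lemma oresB U V (s t : E U) : open U -> open V -> V `<=` U -> ores V (s - t) = ores V s - ores V t.
Proof. by move=> oU oV VU; apply: additive_mapB => ? ?; exact: (oresD hE). Qed.

Lemma oact0 U f : open U -> holo_fun U f -> oact f (0 : E U) = 0.
Proof. by move=> oU hf; apply: additive_map0 => s t; exact: (oactDr hE). Qed.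

Lemma oactB U f (s t : E U) : open U -> holo_fun U f -> oact f (s - t) = oact f s - oact f t.
Proof. by move=> oU hf; apply: additive_mapB => ? ?; exact: (oactDr hE). Qed.

Lemma sections_eq U (s t : E U) : open U ->
  (forall x, U x -> exists V, [/\ open V, V x, V `<=` U & ores V s = ores V t]) -> s = t.
Proof.
move=> oU h.
apply: (osheaf_separated hE (F := [set V | [/\ open V, V `<=` U & ores V s = ores V t]]) oU).
- by move=> V [].
- apply/seteqP; split => [x [V [_ VU _] Vx]|x Ux]; first exact: VU.
  by have [V [oV Vx VU e]] := h x Ux; exists V.
- by move=> V [].
Qed.

(** Gluing of sections given by a characterisation instead of a family: uniqueness of the section
    with property [P] provides the agreement on overlaps. *)
Lemma sections_glue U (P : forall V, E V -> Prop) : open U ->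
  (forall V V' a, open V -> open V' -> V `<=` U -> V' `<=` V -> P V a -> P V' (ores V' a)) ->
  (forall V a b, open V -> V `<=` U -> P V a -> P V b -> a = b) ->
  (forall x, U x -> exists V, [/\ open V, V x, V `<=` U & exists a, P V a]) ->
  exists t : E U, forall V a, open V -> V `<=` U -> P V a -> ores V t = a.
Proof.
move=> oU Pres Puniq Pex.
pose F : set (set X) := [set V | [/\ open V, V `<=` U & exists a, P V a]].
pose s V : E V := match pselect (exists a, P V a) with left h => projT1 (cid h) | right _ => 0 end.
have sP V : F V -> P V (s V).
  by case=> _ _ h; rewrite /s; case: pselect => // h'; case: cid.
have [|||t ht] := osheaf_glue hE (U := U) (F := F) (s := s) oU.
- by move=> V [].
- apply/seteqP; split => [x [V [_ VU _] Vx]|x Ux]; first exact: VU.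
  by have [V [oV Vx VU e]] := Pex x Ux; exists V.
- move=> V V' FV FV'; have [[oV VU _] [oV' VU' _]] := (FV, FV').
  have oI : open (V `&` V') by exact: openI.
  apply: (Puniq (V `&` V')) => //; first by move=> x [/VU].
  + by apply: (Pres V) => //; exact: sP.
  + by apply: (Pres V') => //; exact: sP.
exists t => V a oV VU hP; have FV : F V by split => //; exists a.
by rewrite ht//; apply: (Puniq V) => //; exact: sP.
Qed.

End Restriction.

Section Homomorphisms.
Variables (E F : omodule X) (phi : omap E F) (hphi : is_ohom phi).

Lemma ohom0 U : open U -> @phi U (0 : E U) = 0.
Proof. by move=> oU; apply: additive_map0 => ? ?; exact: (ohomD hphi). Qed.

Lemma ohomN U (s : E U) : open U -> @phi U (- s) = - @phi U s.
Proof. by move=> oU; apply: additive_mapN => ? ?; exact: (ohomD hphi). Qed.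

Lemma ohomB U (s t : E U) : open U -> @phi U (s - t) = @phi U s - @phi U t.
Proof. by move=> oU; apply: additive_mapB => ? ?; exact: (ohomD hphi). Qed.

End Homomorphisms.

Section ExtendRelation.
Variables (F I : omodule X) (hF : is_omodule F) (hI : is_omodule I).
Variable G : forall U, F U -> I U -> Prop.
Hypothesis G0 : forall U, open U -> G (0 : F U) 0.
Hypothesis GB : forall U (s t : F U) y z, open U -> G s y -> G t z -> G (s - t) (y - z).
Hypothesis Gact : forall U f (s : F U) y, open U -> holo_fun U f -> G s y -> G (oact f s) (oact f y).
Hypothesis Gres : forall U V (s : F U) y, open U -> open V -> V `<=` U -> G s y -> G (ores V s) (ores V y).
Hypothesis Gfun : forall U y, open U -> G (0 : F U) y -> y = 0.

(** The relation localised. It remains single-valued because sections that agree locally are equal,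
    and its domain satisfies the gluing axiom. *)
Let GL U (s : F U) (y : I U) : Prop :=
  forall x, U x -> exists V, [/\ open V, V x, V `<=` U & G (ores V s) (ores V y)].

Let GL_of U (s : F U) y : open U -> G s y -> GL s y.
Proof. by move=> oU h x Ux; exists U; split => //; exact: Gres. Qed.

Let GL_B U (s t : F U) y z : open U -> GL s y -> GL t z -> GL (s - t) (y - z).
Proof.
move=> oU h1 h2 x Ux; have [V1 [ov1 x1 s1 g1]] := h1 x Ux; have [V2 [ov2 x2 s2 g2]] := h2 x Ux.
have oI : open (V1 `&` V2) by exact: openI.
have s3 : (V1 `&` V2) `<=` U by move=> y' [y'1 _]; exact: s1.
exists (V1 `&` V2); split => //.
rewrite (oresB hF) ?(oresB hI)//; apply: GB => //.
  rewrite -(ores_comp hF (V := V1)) -1?(ores_comp hI (V := V1))//; exact: Gres.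
rewrite -(ores_comp hF (V := V2)) -1?(ores_comp hI (V := V2))//; exact: Gres.
Qed.

Let GL_res U V (s : F U) y : open U -> open V -> V `<=` U -> GL s y -> GL (ores V s) (ores V y).
Proof.
move=> oU oV VU h x Vx; have [T [oT Tx TU g]] := h x (VU x Vx).
have oI : open (V `&` T) by exact: openI.
exists (V `&` T); split => //.
rewrite (ores_comp hF) ?(ores_comp hI)//.
by rewrite -(ores_comp hF (V := T)) -1?(ores_comp hI (V := T))//; exact: Gres.
Qed.

Let GL_fun U (s : F U) y z : open U -> GL s y -> GL s z -> y = z.
Proof.
move=> oU h1 h2; have := GL_B oU h1 h2; rewrite subrr => h.
apply/eqP; rewrite -subr_eq0; apply/eqP; apply: (sections_eq hI oU) => x Ux.
have [V [oV Vx VU g]] := h x Ux; exists V; split => //.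
by rewrite (ores0 hI)//; apply: Gfun => //; move: g; rewrite (ores0 hF).
Qed.

Let GL_act U f (s : F U) y : open U -> holo_fun U f -> GL s y -> GL (oact f s) (oact f y).
Proof.
move=> oU hf h x Ux; have [V [oV Vx VU g]] := h x Ux; exists V; split => //.
have hfV : holo_fun V f by move=> a; apply: holomorphic_sub (hf a); exact: img_sub.
by rewrite (ores_act hF) ?(ores_act hI)//; exact: Gact.
Qed.

(** The axioms of an [omodule] constrain open sets only; over the other sets all of [F U] is taken,
    so that a subgroup is obtained for every [U]. *)
Let dom_set U : set (F U) := [set s | open U -> exists y, GL s y].

Let dom_closed U : zmod_closed (mem (@dom_set U)).
Proof.
split; first by rewrite inE => oU; exists 0; apply: GL_of => //; exact: G0.
move=> s t; rewrite !inE => hs ht oU; have [[y hy] [z hz]] := (hs oU, ht oU).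
by exists (y - z); exact: GL_B.
Qed.

Let D U : subgroup (F U) := Subgroup (@dom_closed U).

Let E : omodule X := @OModule R d X (fun U => subgroup_type (D U))
    (fun U f (s : subgroup_type (D U)) => to_sub (D U) (oact f (val s)))
    (fun U V (s : subgroup_type (D U)) => to_sub (D V) (ores V (val s))).

Let valK U (s : F U) : dom_set s -> val (to_sub (D U) s) = s.
Proof. by move=> h; apply: insubdK; exact/mem_set. Qed.

Let valP' U (s : E U) : open U -> exists y, GL (val s) y.
Proof. by move: (valP s) => /set_mem. Qed.

Let val_act U f (s : E U) : open U -> holo_fun U f -> val (oact f s) = oact f (val s).
Proof. by move=> oU hf; apply: valK => _; have [y hy] := valP' s oU; exists (oact f y); exact: GL_act. Qed.

Let val_res U V (s : E U) : open U -> open V -> V `<=` U -> val (ores V s) = ores V (val s).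
Proof. by move=> oU oV VU; apply: valK => _; have [y hy] := valP' s oU; exists (ores V y); exact: GL_res. Qed.

Let valD U (s t : E U) : val (s + t) = val s + val t.
Proof. exact: (raddfD val). Qed.

Let holoD U f g : holo_fun U f -> holo_fun U g -> holo_fun U (f \+ g).
Proof. by move=> hf hg a; apply: holomorphicD; [exact: hf | exact: hg]. Qed.

Let holoM U f g : holo_fun U f -> holo_fun U g -> holo_fun U (f \* g).
Proof. by move=> hf hg a; apply: holomorphicM; [exact: hf | exact: hg]. Qed.

Let holo1 U : holo_fun U (fun=> 1 : R[i]).
Proof. exact: fact_cst_holo. Qed.

Let holo_ext U f g : open U -> (forall x, U x -> f x = g x) -> holo_fun U f -> holo_fun U g.
Proof. by move=> oU fg hf a; apply: (holomorphic_in_ext oU _ (hf a)) => x Ux _; exact: fg. Qed.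

Let holo_sub U V f : V `<=` U -> holo_fun U f -> holo_fun V f.
Proof. by move=> VU hf a; apply: holomorphic_sub (hf a); exact: img_sub. Qed.

Let E_omodule : is_omodule E.
Proof.
split.
- move=> U f s t oU hf; apply: val_inj.
  by rewrite (val_act _ oU hf) (valD s t) (valD (oact f s)) !val_act// (oactDr hF).
- move=> U f g s oU hf hg; apply: val_inj; have hfg := holoD hf hg.
  by rewrite (val_act _ oU hfg) (valD (oact f s)) !val_act// (oactDl hF).
- move=> U f g s oU hf hg; apply: val_inj; have hfg := holoM hf hg.
  by rewrite (val_act _ oU hfg) !val_act// (oactM hF).
- by move=> U s oU; apply: val_inj; rewrite (val_act _ oU (@holo1 U)) (oact1 hF).
- move=> U f g s oU hf fg; apply: val_inj; have hg := holo_ext oU fg hf.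
  by rewrite (val_act _ oU hf) (val_act _ oU hg); exact: (oact_ext hF).
- by move=> U s oU; apply: val_inj; rewrite val_res// (ores_id hF).
- move=> U V T s oU oV oT VU TV; apply: val_inj; have TU := subset_trans TV VU.
  by rewrite !val_res// (ores_comp hF).
- move=> U V s t oU oV VU; apply: val_inj.
  by rewrite (val_res _ oU oV VU) (valD s t) (valD (ores V s)) !val_res// (oresD hF).
- move=> U V f s oU oV VU hf; apply: val_inj; have hfV := holo_sub VU hf.
  by rewrite !(val_res, val_act)// (ores_act hF).
- move=> U C s t oU oC CU h; apply: val_inj; apply: (osheaf_separated hF oU oC CU) => V CV.
  have VU : V `<=` U by move=> x Vx; rewrite -CU; exists V.
  by have := congr1 val (h V CV); rewrite !val_res//; exact: oC.
move=> U C s oU oC CU h.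
have VU V : C V -> V `<=` U by move=> CV x Vx; rewrite -CU; exists V.
have UC x : U x -> exists2 V, C V & V x by rewrite -CU.
have [|||t ht] := osheaf_glue hF (U := U) (F := C) (s := fun V => val (s V)) oU.
- exact: oC.
- exact: CU.
- move=> V V' CV CV'; have oI : open (V `&` V') by apply: openI; exact: oC.
  by have := congr1 val (h V V' CV CV'); rewrite !val_res//; exact: oC.
have Dt : dom_set t.
  move=> _; have [|||y hy] := sections_glue hI (U := U) (P := fun V y => GL (ores V t) y) oU.
  - move=> V V' a oV oV' sV sV' ha.
    by rewrite -(ores_comp hF (V := V))//; exact: GL_res.
  - by move=> V a b oV sV; exact: GL_fun.
  - move=> x /UC[V CV Vx]; exists V; split => //; [exact: oC|exact: VU|].
    by rewrite ht//; exact: (valP' (s V) (oC V CV)).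
  exists y => x /UC[V CV Vx]; have oV := oC V CV.
  have := valP' (s V) oV; rewrite -ht// => -[a ha].
  have [T [oT Tx TV g]] := ha x Vx; have TU := subset_trans TV (VU V CV).
  exists T; split => //; move: g; rewrite -(hy V a oV (VU V CV) ha).
  by rewrite (ores_comp hF) ?(ores_comp hI)//; exact: VU.
exists (to_sub (D U) t) => V CV; apply: val_inj; rewrite val_res//; [|exact: oC|exact: VU].
by rewrite valK// ht.
Qed.

Let ext U (s : E U) : I U :=
  match pselect (exists y, GL (val s) y) with left h => projT1 (cid h) | right _ => 0 end.

Let extP U (s : E U) : open U -> GL (val s) (ext s).
Proof.
move=> oU; rewrite /ext; case: pselect => [h|[]]; first by case: cid.
exact: valP'.
Qed.

Let ext_ohom : is_ohom (ext : omap E I).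
Proof.
split.
- move=> U s t oU; apply: (@GL_fun U (val (s + t))) => //; first exact: extP.
  have h0 : GL (0 : F U) 0 by apply: GL_of => //; exact: G0.
  have := GL_B oU (extP s oU) (GL_B oU h0 (extP t oU)).
  by rewrite !sub0r !opprK valD.
- move=> U f s oU hf; apply: (@GL_fun U (val (oact f s))) => //; first exact: extP.
  by rewrite val_act//; apply: GL_act => //; exact: extP.
- move=> U V s oU oV VU; apply: (@GL_fun V (val (ores V s))) => //; first exact: extP.
  by rewrite val_res//; apply: GL_res => //; exact: extP.
Qed.

(** Injectivity is used for the inclusion into [F] of the subsheaf on which the localised relation
    is defined. A relation is the convenient form, since in the applications values are prescribed
    on presentations of a section, not on the section. *)
Lemma extend_relation : oinjective I ->
  exists2 h : omap F I, is_ohom h & forall U (s : F U) y, open U -> G s y -> h U s = y.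
Proof.
move=> injI.
have [||h hh hE] := injI E F (fun U => val : E U -> F U) ext E_omodule hF _ ext_ohom.
- split; [by move=> U s t oU; exact: valD | by move=> *; exact: val_act | by move=> *; exact: val_res].
- by move=> U _; exact: val_inj.
exists h => // U s y oU hs; have h1 := GL_of oU hs.
have vs : val (to_sub (D U) s) = s by apply: valK => _; exists y.
rewrite -{1}vs hE//; apply: (@GL_fun U s) => //; rewrite -{1}vs; exact: extP.
Qed.

End ExtendRelation.

End OModuleTheory.

(** Dependent choice along the integers: [z] below [N], then each term from the previous one. As the
    types depend on the degree, terms indexed by natural numbers are transported; equality proofs
    between integers are unique, so the transport is immaterial. *)
Lemma int_chain (T : int -> Type) (N : int) (good : forall n, T n -> Prop)
    (rel : forall m n, T m -> T n -> Prop) (z : forall n, T n) :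
  (forall n, n < N -> good n (z n)) ->
  (forall m n, n = m + 1 -> n < N -> rel m n (z m) (z n)) ->
  (forall m n t, n = m + 1 -> good m t -> exists2 u, good n u & rel m n t u) ->
  exists g : forall n, T n, (forall n, good n (g n)) /\ (forall m n, n = m + 1 -> rel m n (g m) (g n)).
Proof.
move=> gz rz st.
(* The recursion starts at the last degree below [N], where [z] is known to be good. *)
pose M (k : nat) : int := N - 1 + k%:Z.
have MS k : M k.+1 = M k + 1 by rewrite /M; lia.
have M0 : M 0%N < N by rewrite /M; lia.
pose T' k := {t : T (M k) | good _ t}.
pose nx k (t : T' k) : T' k.+1 :=
  let h := st (M k) (M k.+1) (projT1 t) (MS k) (projT2 t) in
  exist _ (s2val (cid2 h)) (s2valP (cid2 h)).
pose gs := fix gs k : T' k := if k is k'.+1 then nx k' (gs k') else exist _ (z (M 0%N)) (gz _ M0).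
have gsS k : rel _ _ (projT1 (gs k)) (projT1 (gs k.+1)) by rewrite /=; exact: s2valP'.
have ex n : exists t : T n, (n < N -> t = z n) /\ (forall k (e : M k = n), t = eq_rect _ T (projT1 (gs k)) n e).
  have [h|h] := ltP n N.
    exists (z n); split => // k e; have k0 : k = 0%N by move: e; rewrite /M; lia.
    by subst k; subst n.
  have e : M (absz (n - N + 1)) = n by rewrite /M; lia.
  exists (eq_rect _ T (projT1 (gs (absz (n - N + 1)))) n e); split => // k e'.
  have ke : k = absz (n - N + 1) by move: e'; rewrite /M; lia.
  by subst k; rewrite (eq_irrelevance e e').
pose g n := projT1 (cid (ex n)).
have gP n : (n < N -> g n = z n) /\ (forall k (e : M k = n), g n = eq_rect _ T (projT1 (gs k)) n e).
  by rewrite /g; case: cid.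
have big n : N <= n -> exists k, M k = n by move=> h; exists (absz (n - N + 1)); rewrite /M; lia.
exists g; split => [n|m n e].
  have [h|h] := ltP n N; first by rewrite (gP n).1//; exact (gz n h).
  have [k ek] := big n h; rewrite ((gP n).2 k ek); clear h; case: n / ek; exact: projT2 (gs k).
have [h|h] := ltP n N.
  by rewrite (gP n).1// (gP m).1//; [exact: rz | lia].
have [k ek] : exists k, M k = m by exists (absz (m - N + 1)); rewrite /M; lia.
have ek1 : M k.+1 = n by rewrite MS ek.
rewrite ((gP m).2 k ek) ((gP n).2 _ ek1); clear e h.
by case: n / ek1; case: m / ek; exact: gsS.
Qed.

(** * Extension of rho along the inclusion, and its uniqueness up to homotopy *)

Section Comparison.
Variables (R : realType) (d : nat) (X : cmanifold R d).
Variables (K P I : ocomplex X) (incl : cmap K P) (rho : cmap K I).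
Hypotheses (hK : is_ocomplex K) (hP : is_ocomplex P) (hI : is_ocomplex I).
Hypotheses (hi : is_cmap incl) (hr : is_cmap rho) (qi : quasi_iso incl).
Hypothesis incl_inj : forall n U, open U -> injective (@incl n U).
Hypothesis injI : forall n, oinjective (I n).
Variable N : int.
Hypothesis P0 : forall n U (s : P n U), n < N -> open U -> s = 0.
Implicit Types U V : set X.

(** Two presentations incl k + d t of one section differ by such a pair. The pair is locally a
    boundary, which is the local exactness of the cone of [incl] written out in its two
    components. *)
Lemma extension_ambiguity n U (k : K n U) (t : P (n - 1) U) (x : X) : open U -> U x ->
  incl k + cdiff n t = 0 ->
  exists V, [/\ open V, V x, V `<=` U & exists k0 : K (n - 1) V, exists t' : P (n - 1 - 1) V,
    ores V t = incl k0 + cdiff (n - 1) t' /\ ores V k = - cdiff n k0].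
Proof.
move=> oU Ux e; have en : n - 1 + 1 = n by rewrite subrK.
have oP m := cobj_omodule hP m; have oK m := cobj_omodule hK m.
have hoi m := cmap_ohom hi m.
have hdP m m' := cdiff_ohom hP m m'; have hdK m m' := cdiff_ohom hK m m'.
have ek : incl k = - cdiff n t by apply/eqP; rewrite -subr_eq0 opprK e.
have ck : cocycle K n U k.
  apply: (incl_inj oU); rewrite (cmap_diff hi)// ek (ohomN (hdP _ _))// (cdiff_comp hP)//.
  by rewrite oppr0 (ohom0 (hoi _)).
have bk : coboundary P n U (incl k) by exists (- t); rewrite (ohomN (hdP _ _)).
have [V1 [oV1 V1x V1U [k' ek']]] := (qi n oU Ux).1 k ck bk.
pose t1 : P (n - 1) V1 := ores V1 t + incl k'.
have ct1 : cocycle P (n - 1) V1 t1.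
  rewrite /cocycle /= en (ohomD (hdP _ _))// -(cmap_diff hi)// -ek'.
  rewrite (ohom_res (hdP _ _))// -[cdiff n t]opprK -ek (oresN (oP _))//.
  by rewrite (ohom_res (hoi _))// addNr.
have [V [oV Vx VV1 [k'' ck'' [t' et']]]] := (qi (n - 1) oV1 V1x).2 t1 ct1.
have VU := subset_trans VV1 V1U.
exists V; split => //; exists (k'' - ores V k'), t'; split.
  rewrite -et' (ohomB (hoi _))// (ohom_res (hoi _))// /t1 (oresD (oP _))// (ores_comp (oP _))//.
  apply/eqP; rewrite -subr_eq0; apply/eqP.
  move: (ores V t) (incl k'') (ores V (incl k')) => p1 p2 p3.
  by rewrite [p2 - p3 + _]addrC addrA addrNK addrK subrr.
rewrite (ohomB (hdK _ _))// (ohom_res (hdK _ _))// -ek' (ores_comp (oK _))//.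
by have := ck''; rewrite /cocycle /= en => ->; rewrite sub0r opprK.
Qed.

(** The third clause, that d g vanishes on boundaries, is the consequence of the cochain equation by
    which the next relation is single-valued. *)
Let good n (g : omap (P n) (I n)) := [/\ is_ohom g,
  forall U (s : K n U), open U -> g U (incl s) = rho s &
  forall m p U (t : P m U), open U -> cdiff p (g U (cdiff n t)) = 0].

(** On sections incl k + d t the next component is forced to be rho k + d (g t); the relation so
    obtained is extended by injectivity. *)
Lemma extension_step n (g : omap (P (n - 1)) (I (n - 1))) : good g ->
  exists2 h : omap (P n) (I n), good h &
    forall U (t : P (n - 1) U), open U -> h U (cdiff n t) = cdiff n (g U t).
Proof.
move=> [hg gr gd].
have oP m := cobj_omodule hP m; have oI m := cobj_omodule hI m.
have hoi m := cmap_ohom hi m; have hor m := cmap_ohom hr m.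
have hdP m m' := cdiff_ohom hP m m'.
have hdI m m' := cdiff_ohom hI m m'.
pose G U (s : P n U) (y : I n U) := exists k : K n U, exists t : P (n - 1) U,
  s = incl k + cdiff n t /\ y = rho k + cdiff n (g U t).
have [||||||h hh hG] := @extend_relation R d X (P n) (I n) (oP n) (oI n) G.
- move=> U oU; exists 0, 0; rewrite (ohom0 (hoi _))// (ohom0 (hdP _ _))// (ohom0 (hor _))//.
  by rewrite (ohom0 hg)// (ohom0 (hdI _ _))// !addr0.
- move=> U _ _ _ _ oU [k [t [-> ->]]] [k' [t' [-> ->]]]; exists (k - k'), (t - t').
  rewrite (ohomB (hoi _))// (ohomB (hdP _ _))// (ohomB (hor _))// (ohomB hg)// (ohomB (hdI _ _))//.
  by split; rewrite opprD addrACA.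
- move=> U f _ _ oU hf [k [t [-> ->]]]; exists (oact f k), (oact f t).
  rewrite (ohomZ (hoi _))// (ohomZ (hdP _ _))// (ohomZ (hor _))// (ohomZ hg)// (ohomZ (hdI _ _))//.
  by rewrite (oactDr (oP _))// (oactDr (oI _)).
- move=> U V _ _ oU oV VU [k [t [-> ->]]]; exists (ores V k), (ores V t).
  rewrite (ohom_res (hoi _))// (ohom_res (hdP _ _))// (ohom_res (hor _))// (ohom_res hg)//.
  by rewrite (ohom_res (hdI _ _))// (oresD (oP _))// (oresD (oI _)).
- move=> U _ oU [k [t [e ->]]]; apply: (sections_eq (oI n) oU) => x Ux.
  have [V [oV Vx VU [k0 [t' [e1 e2]]]]] := extension_ambiguity oU Ux (esym e).
  exists V; split => //; rewrite (ores0 (oI _))// (oresD (oI _))// -(ohom_res (hor _))//.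
  rewrite -(ohom_res (hdI _ _))// -(ohom_res hg)// e1 e2 (ohomN (hor _))// (cmap_diff hr)//.
  by rewrite (ohomD hg)// gr// (ohomD (hdI _ _))// gd// addr0 addNr.
- exact: injI.
have hd U (t : P (n - 1) U) : open U -> h U (cdiff n t) = cdiff n (g U t).
  move=> oU; apply: hG => //; exists 0, t.
  by rewrite (ohom0 (hoi _))// (ohom0 (hor _))// !add0r.
exists h => //; split => //.
  move=> U s oU; apply: hG => //; exists s, 0.
  by rewrite (ohom0 (hdP _ _))// (ohom0 hg)// (ohom0 (hdI _ _))// !addr0.
move=> m p U t oU; have [e|ne] := eqVneq n (m + 1); last first.
  by rewrite (cdiff0 hP)// (ohom0 hh)// (ohom0 (hdI _ _)).
have em : m = n - 1 by rewrite e addrK.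
by clear e; subst m; rewrite hd// (cdiff_comp hI).
Qed.

Lemma extension_exists : exists2 g : cmap P I, is_cmap g &
  forall n U (s : K n U), open U -> g n U (incl s) = rho s.
Proof.
have hdI m m' := cdiff_ohom hI m m'.
have hor m := cmap_ohom hr m; have oI m := cobj_omodule hI m.
have K0 n U (k : K n U) : n < N -> open U -> k = 0.
  move=> nN oU; apply: (incl_inj oU); rewrite (P0 (incl k))// (ohom0 (cmap_ohom hi n))//.
pose rel m n (g : omap (P m) (I m)) (h : omap (P n) (I n)) :=
  forall U (t : P m U), open U -> h U (cdiff n t) = cdiff n (g U t).
have [|||g [gg gr]] := @int_chain (fun n => omap (P n) (I n)) N (@good) rel (fun n U _ => 0).
- move=> n nN; split.
  + split => [U s t oU|U f s oU hf|U V s oU oV VU]; first by rewrite addr0.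
    * by rewrite (oact0 (oI n)).
    * by rewrite (ores0 (oI n)).
  + by move=> U s oU; rewrite (K0 _ _ s)// (ohom0 (hor _)).
  + by move=> m p U t oU; rewrite (ohom0 (hdI _ _)).
- by move=> m n e nN U t oU; rewrite (ohom0 (hdI _ _)).
- move=> m n g e hg; have em : m = n - 1 by rewrite e addrK.
  clear e; subst m; exact: extension_step.
exists g => [|n U s oU]; last by have [_ h _] := gg n; exact: h.
split=> [n|m n U s oU]; first by have [] := gg n.
have [e|ne] := eqVneq n (m + 1); first exact: gr.
have [hn _ _] := gg n.
by rewrite (cdiff0 hP)// (ohom0 hn)// (cdiff0 hI).
Qed.

Section Homotopy.
Variable phi : cmap P I.
Hypotheses (hphi : is_cmap phi) (phi0 : forall n U (s : K n U), open U -> phi (incl s) = 0).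

(** The third clause is the homotopy equation on boundaries, where the component in the next degree
    does not enter. *)
Let goodh n (h : omap (P n) (I (n - 1))) := [/\ is_ohom h,
  forall U (s : K n U), open U -> h U (incl s) = 0 &
  forall m U (t : P m U), open U -> phi (cdiff n t) = cdiff n (h U (cdiff n t))].

Lemma homotopy_step n (h : omap (P (n - 1)) (I (n - 1 - 1))) : goodh h ->
  exists2 k : omap (P n) (I (n - 1)), goodh k &
    forall U (t : P (n - 1) U), open U -> k U (cdiff n t) = phi t - cdiff (n - 1) (h U t).
Proof.
move=> [hh h0 hd].
have oP m := cobj_omodule hP m; have oI m := cobj_omodule hI m.
have hoi m := cmap_ohom hi m; have hop m := cmap_ohom hphi m.
have hdP m m' := cdiff_ohom hP m m'; have hdI m m' := cdiff_ohom hI m m'.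
pose G U (s : P n U) (y : I (n - 1) U) := exists k : K n U, exists t : P (n - 1) U,
  s = incl k + cdiff n t /\ y = phi t - cdiff (n - 1) (h U t).
have [||||||k hk kG] := @extend_relation R d X (P n) (I (n - 1)) (oP n) (oI _) G.
- move=> U oU; exists 0, 0; rewrite (ohom0 (hoi _))// (ohom0 (hdP _ _))// (ohom0 (hop _))//.
  by rewrite (ohom0 hh)// (ohom0 (hdI _ _))// !addr0 subr0.
- move=> U _ _ _ _ oU [k [t [-> ->]]] [k' [t' [-> ->]]]; exists (k - k'), (t - t').
  rewrite (ohomB (hoi _))// (ohomB (hdP _ _))// (ohomB (hop _))// (ohomB hh)// (ohomB (hdI _ _))//.
  by split; rewrite opprD addrACA// opprD.
- move=> U f _ _ oU hf [k [t [-> ->]]]; exists (oact f k), (oact f t).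
  rewrite (ohomZ (hoi _))// (ohomZ (hdP _ _))// (ohomZ (hop _))// (ohomZ hh)// (ohomZ (hdI _ _))//.
  by rewrite (oactDr (oP _))// (oactB (oI _)).
- move=> U V _ _ oU oV VU [k [t [-> ->]]]; exists (ores V k), (ores V t).
  rewrite (ohom_res (hoi _))// (ohom_res (hdP _ _))// (ohom_res (hop _))// (ohom_res hh)//.
  by rewrite (ohom_res (hdI _ _))// (oresD (oP _))// (oresB (oI _)).
- move=> U _ oU [k [t [e ->]]]; apply: (sections_eq (oI _) oU) => x Ux.
  have [V [oV Vx VU [k0 [t' [e1 e2]]]]] := extension_ambiguity oU Ux (esym e).
  exists V; split => //; rewrite (ores0 (oI _))// (oresB (oI _))// -(ohom_res (hop _))//.
  rewrite -(ohom_res (hdI _ _))// -(ohom_res hh)// e1 (ohomD (hop _))// phi0// add0r.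
  by rewrite (ohomD hh)// h0// add0r hd// subrr.
- exact: injI.
have kd U (t : P (n - 1) U) : open U -> k U (cdiff n t) = phi t - cdiff (n - 1) (h U t).
  move=> oU; apply: kG => //; exists 0, t.
  by rewrite (ohom0 (hoi _))// add0r.
exists k => //; split => //.
  move=> U s oU; apply: kG => //; exists s, 0.
  by rewrite (ohom0 (hdP _ _))// (ohom0 hh)// (ohom0 (hdI _ _))// (ohom0 (hop _))// subr0 addr0.
move=> m U t oU; have [e|ne] := eqVneq n (m + 1); last first.
  by rewrite (cdiff0 hP)// (ohom0 hk)// (ohom0 (hop _))// (ohom0 (hdI _ _)).
have em : m = n - 1 by rewrite e addrK.
by clear e; subst m; rewrite kd// (ohomB (hdI _ _))// (cdiff_comp hI)// subr0 (cmap_diff hphi).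
Qed.

(** The equation phi = d h + h d is recorded on cocycles only, where the second term vanishes. In
    each degree the value at incl k + d t is forced to be phi t - d (h t). *)
Lemma null_homotopic n U (s : P n U) : open U -> cocycle P n U s -> coboundary I n U (phi s).
Proof.
move=> oU cs.
have hdI m m' := cdiff_ohom hI m m'; have hop m := cmap_ohom hphi m.
have oI m := cobj_omodule hI m.
pose rel m n (g : omap (P m) (I (m - 1))) (h : omap (P n) (I (n - 1))) :=
  forall U (t : P m U), open U -> cdiff n t = 0 -> phi t = cdiff m (g U t).
have [|||h [gh rh]] := @int_chain (fun n => omap (P n) (I (n - 1))) N (@goodh) rel (fun n U _ => 0).
- move=> m mN; split => //.
  + split => [V t u oV|V f t oV hf|V T t oV oT TV]; first by rewrite addr0.
    * by rewrite (oact0 (oI _)).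
    * by rewrite (ores0 (oI _)).
  + by move=> p V t oV; rewrite (P0 (cdiff m t))// (ohom0 (hop _))// (ohom0 (hdI _ _)).
- move=> m p e pN V t oV _; rewrite (P0 t)// ?(ohom0 (hop _))// ?(ohom0 (hdI _ _))//; lia.
- move=> m p g e hg; have em : m = p - 1 by rewrite e addrK.
  clear e; subst m; have [k gk ek] := homotopy_step hg; exists k => // V t oV dt.
  have := ek V t oV; have [hk _ _] := gk; rewrite dt (ohom0 hk)// => /esym/eqP.
  by rewrite subr_eq0 => /eqP.
exists (h n U s); exact: (rh n (n + 1)).
Qed.

End Homotopy.

Lemma extension_unique (g g' : cmap P I) n U (s : P n U) :
  is_cmap g -> is_cmap g' ->
  (forall n U (s : K n U), open U -> g n U (incl s) = rho s) ->
  (forall n U (s : K n U), open U -> g' n U (incl s) = rho s) ->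
  open U -> cocycle P n U s -> coboundary I n U (g' n U s - g n U s).
Proof.
move=> hg hg' gr gr' oU cs.
have oI m := cobj_omodule hI m; have hdI m m' := cdiff_ohom hI m m'.
apply: (@null_homotopic (fun n U s => g' n U s - g n U s)) => //; last first.
  by move=> m V t oV; rewrite gr// gr'// subrr.
have [og og'] := (cmap_ohom hg, cmap_ohom hg'); split => [m|m p V t oV].
  split => [V t u oV|V f t oV hf|V T t oV oT TV].
  - by rewrite (ohomD (og _))// (ohomD (og' _))// opprD addrACA.
  - by rewrite (ohomZ (og _))// (ohomZ (og' _))// (oactB (oI _)).
  - by rewrite (ohom_res (og _))// (ohom_res (og' _))// (oresB (oI _)).
by rewrite (cmap_diff hg)// (cmap_diff hg')// (ohomB (hdI _ _)).
Qed.

End Comparison.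

(** * Exhaustions, cutoff functions and softness *)

Section CompactSets.
Variable T : topologicalType.
Implicit Types A B S U V : set T.

(** Replaces the extraction of finite subcovers. The auxiliary filter consists of the families that
    contain every superset of some set with the property [P]. *)
Lemma compact_induction (P : set T -> Prop) S : compact S -> P set0 ->
  (forall A B, P A -> P B -> P (A `|` B)) -> (forall A B, A `<=` B -> P B -> P A) ->
  (forall x, S x -> exists V, [/\ open V, V x & P V]) -> P S.
Proof.
move=> /compact_near_coveringP cS P0 PU Pm Px.
pose F : set_system (set T) := [set Q | exists2 A, P A & forall B, A `<=` B -> Q B].
have FF : Filter F.
  split; first by exists set0.
  - move=> Q1 Q2 [A1 P1 h1] [A2 P2 h2]; exists (A1 `|` A2); first exact: PU.
    by move=> B AB; split; [apply: h1 | apply: h2] => x Ax; apply: AB; [left | right].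
  - by move=> Q1 Q2 Q12 [A PA h]; exists A => // B AB; apply: Q12; exact: h.
have [x Sx|A PA h] := cS (set T) F (fun B x => B x) FF.
  have [V [oV Vx PV]] := Px x Sx; exists (V, [set B | V `<=` B]).
    by split; [exact: open_nbhs_nbhs | exists V].
  by case=> y B /= [Vy]; exact.
by apply: (Pm _ A) => //; apply: h.
Qed.

Hypothesis hT : hausdorff_space T.

Lemma compactI S S' : compact S -> compact S' -> compact (S `&` S').
Proof. by move=> cS cS'; apply: compact_closedI => //; exact: compact_closed. Qed.

Lemma compact_separation S S' : compact S -> compact S' -> S `&` S' = set0 ->
  exists N1 N2, [/\ open N1, open N2, S `<=` N1, S' `<=` N2 & N1 `&` N2 = set0].
Proof.
move=> cS cS' SS'.
have I0 A B C D : A `&` B = set0 -> C `&` D = set0 -> (A `|` C) `&` (B `&` D) = set0.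
  move=> h1 h2; apply/seteqP; split => // x [[Ax|Cx] [Bx Dx]].
    by rewrite -h1.
  by rewrite -h2.
pose P A := exists N1 N2, [/\ open N1, open N2, A `<=` N1, S' `<=` N2 & N1 `&` N2 = set0].
apply: (compact_induction (P := P) cS).
- exists set0, setT; split => //; [exact: open0 | exact: openT | by rewrite set0I].
- move=> A B [N1 [N2 [h1 h2 h3 h4 h5]]] [N3 [N4 [h6 h7 h8 h9 h10]]].
  exists (N1 `|` N3), (N2 `&` N4); split; [exact: openU | exact: openI | | | exact: I0].
    by apply: setUSS.
  by move=> x Sx; split; [exact: h4 | exact: h9].
- by move=> A B AB [N1 [N2 [h1 h2 h3 h4 h5]]]; exists N1, N2; split => //; exact: subset_trans h3.
move=> x Sx.
have [N1 [N2 [h1 h2 h3 h4 h5]]] : exists N1 N2, [/\ open N1, open N2, N1 x, S' `<=` N2 & N1 `&` N2 = set0].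
  pose Q A := exists N1 N2, [/\ open N1, open N2, N1 x, A `<=` N2 & N1 `&` N2 = set0].
  apply: (compact_induction (P := Q) cS').
  - exists setT, set0; split => //; [exact: openT | exact: open0 | by rewrite setI0].
  - move=> A B [N1 [N2 [h1 h2 h3 h4 h5]]] [N3 [N4 [h6 h7 h8 h9 h10]]].
    exists (N1 `&` N3), (N2 `|` N4); split; [exact: openI | exact: openU | by [] | | ].
      exact: setUSS.
    by rewrite setIC I0// setIC.
  - by move=> A B AB [N1 [N2 [h1 h2 h3 h4 h5]]]; exists N1, N2; split => //; exact: subset_trans h4.
  move=> y Sy; have xy : x != y.
    apply/eqP => e; have h : (S `&` S') x by split => //; rewrite e.
    by rewrite SS' in h.
  move: hT; rewrite open_hausdorff => /(_ x y xy)[[N1 N2] [/set_mem h1 /set_mem h2] [h3 h4 /eqP h5]].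
  exists N2; split; [exact: h4 | exact: h2 | ]; exists N1, N2; split; [exact: h3|exact: h4|exact: h1|exact: subset_refl|exact: h5].
by exists N1; split; [exact: h1 | exact: h3 | ]; exists N1, N2; split; [exact: h1|exact: h2|exact: subset_refl|exact: h4|exact: h5].
Qed.

End CompactSets.

(** * Compact sets, cutoff functions and exhaustions of a manifold *)

Section ManifoldTopology.
Variables (R : realType) (d : nat) (X : cmanifold R d).
Implicit Types (U V S : set X).
Local Opaque real_deriv dir.

Lemma compact_param a (z : cspace R d) (r : R) : cbox z r `<=` img a setT -> compact (@param R d X a @` cbox z r).
Proof.
move=> h; apply: continuous_compact; last exact: compact_cbox.
apply: continuous_in_subspaceT => w; rewrite inE => /h[y [ay _] yw].
by apply: param_continuous; exists y.
Qed.

Lemma compact_chart a U (x : X) : open U -> dom a x -> U x -> exists2 r : R, 0 < r &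
  [/\ cbox (chart a x) (2 * r) `<=` img a U, compact (@param R d X a @` cbox (chart a x) (2 * r)),
      @param R d X a @` cbox (chart a x) (2 * r) `<=` U & cbx a x r `<=` @param R d X a @` cbox (chart a x) (2 * r)].
Proof.
move=> oU ax Ux; have [r r0 hr] := cbx_exists oU ax Ux.
(* A fifth, because the compact box of size 2r' lies in any open polydisc of radius above 4r'. *)
have r50 : 0 < r / 5 by rewrite divr_gt0.
exists (r / 5) => //; have sub : cbox (chart a x) (2 * (r / 5)) `<=` img a U.
  by apply: subset_trans hr; apply: cbox_box; lra.
split => //.
- by apply: compact_param; apply: subset_trans sub _; exact: img_sub.
- by move=> _ [w /sub/imgP[_ h _] <-].
move=> y [ay hy]; exists (chart a y); last by rewrite chartK.
by apply: box_cbox => k; apply: lt_trans (hy k) _; lra.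
Qed.

Lemma compact_neighborhood U (x : X) : open U -> U x ->
  exists K V, [/\ compact K, open V, V x, V `<=` K & K `<=` U].
Proof.
move=> oU Ux; have [a ax] := dom_cover x; have [r r0 [h1 h2 h3 h4]] := compact_chart oU ax Ux.
exists (@param R d X a @` cbox (chart a x) (2 * r)), (cbx a x r).
by split => //; [exact: cbx_open | exact: cbx_center].
Qed.

(** Bump functions of charts are combined by compact induction, two cutoffs giving 1 - (1 - c1)(1 -
    c2). The closed set [Q] inside [U] is recorded so that a product with a section over [U] can be
    extended by 0. *)
Lemma cutoff_function S U : compact S -> open U -> S `<=` U ->
  exists (chi : X -> R[i]) (Q V : set X), [/\ forall a, smooth_in a setT chi,
    [/\ closed Q, Q `<=` U, open V & S `<=` V],
    forall x, V x -> chi x = 1 & forall x, ~ Q x -> chi x = 0].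
Proof.
move=> cS oU.
pose P A := exists (chi : X -> R[i]) (Q V : set X), [/\ forall a, smooth_in a setT chi,
    [/\ closed Q, Q `<=` U, open V & A `<=` V],
    forall x, V x -> chi x = 1 & forall x, ~ Q x -> chi x = 0].
move=> SU; apply: (compact_induction (P := P) cS).
- exists (fun=> 0), set0, set0; split => //; last by split; [exact: closed0 | by [] | exact: open0 | by []].
  by move=> a; exact: smooth_cst.
- move=> A B [c1 [Q1 [V1 [h1 [h2 h3 h4 h5] h6 h7]]]] [c2 [Q2 [V2 [k1 [k2 k3 k4 k5] k6 k7]]]].
  exists (fun x => c1 x + c2 x + -1 * (c1 x * c2 x)), (Q1 `|` Q2), (V1 `|` V2); split.
  + move=> a; apply: smoothD; first by apply: smoothD; [exact: h1 | exact: k1].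
    by apply: smoothM; [exact: smooth_cst | apply: smoothM; [exact: h1 | exact: k1]].
  + split; [exact: closedU | by move=> x [/h3|/k3] | exact: openU | exact: setUSS].
  + by move=> x [/h6|/k6] ->; ring.
  + by move=> x hx; rewrite h7 ?k7; [ring | move=> ?; apply: hx; right | move=> ?; apply: hx; left].
- move=> A B AB [c [Q [V [h1 [h2 h3 h4 h5] h6 h7]]]]; exists c, Q, V; split => //.
  by split => //; exact: subset_trans h5.
move=> x Sx; have [a ax] := dom_cover x.
have [r r0 [h1 h2 h3 h4]] := compact_chart oU ax (SU x Sx).
set Q := @param R d X a @` _ in h2 h3 h4; have cQ : closed Q := compact_closed (@cm_hausdorff _ _ X) h2.
pose chi y : R[i] := if y \in dom a then bump (chart a x) r (chart a y) else 0.
have chi0 y : ~ Q y -> chi y = 0.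
  move=> Qy; rewrite /chi; case: ifP => // /set_mem ay; apply: bump0 => // hb; apply: Qy.
  by exists (chart a y); [exact: box_cbox | exact: chartK].
exists (cbx a x r); split; [exact: cbx_open | exact: cbx_center | ].
exists chi, Q, (cbx a x r); split => //; last first.
- by move=> y [ay hy]; rewrite /chi mem_set//; exact: bump1.
- by split => //; exact: cbx_open.
move=> b; apply: smooth_local; first by apply: img_open; exact: openT.
(* Smoothness is also needed outside of the chart: the bump vanishes off a compact set, which is
   closed because the manifold is Hausdorff. *)
move=> z /imgP[bz _ zE]; have [Qz|Qz] := pselect (Q (param b z)); last first.
  exists (img b (~` Q)); split.
  - by apply: img_open; exact: closed_openC.
  - by apply/imgP.
  apply: (smooth_ext _ _ (smooth_cst (img b (~` Q)) (0 : cplx R))).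
    by apply: img_open; exact: closed_openC.
  by move=> w; rewrite inE => /imgP[_ Qw _]; rewrite /local_expr chi0.
have az : dom a (param b z) by case: Qz => w /h1/imgP[aw _ _] <-.
have oI : open (img b (dom a `&` setT)) by apply: img_open; apply: domI_open; exact: openT.
exists (img b (dom a `&` setT)); split => //; first by apply/imgP.
have hT l : smooth (img b (dom a `&` setT)) (fun z => tr b a z 0 l : cplx R) by case: (@tr_holo R d X b a setT l).
have sub w : img b (dom a `&` setT) w -> [set: cspace R d] (tr b a w) by [].
have := smooth_comp oI openT sub (bump_smooth (chart a x) r0) hT.
apply: smooth_ext => // w; rewrite inE => /imgP[_ [aw _] _].
by rewrite /local_expr /chi mem_set.
Qed.

(** Paracompactness gives a locally finite covering by open sets contained in compact ones. A
    compact set meets finitely many members, and the next compact set is chosen to contain them; the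
    union is then open and closed, hence everything by connectedness. *)
Lemma compact_exhaustion : exists S : nat -> set X, [/\ forall k, compact (S k),
  forall k, S k `<=` interior (S k.+1) & forall x, exists k, S k x].
Proof.
have [[x0 _]|noX] := pselect (exists x : X, True); last first.
  exists (fun=> set0); split; [by move=> _; exact: compact0 | by move=> _ x | ].
  by move=> x; case: noX; exists x.
pose F : set (set X) := [set A | open A /\ exists2 K, compact K & A `<=` K].
have [||G [G1 G2 G3]] := @cm_paracompact _ _ X F.
- by move=> A [].
- apply/seteqP; split => // x _; have [K [V [h1 h2 h3 h4 h5]]] := @compact_neighborhood setT x openT I.
  by exists V => //; split => //; exists K.
have GK B : G B -> open B /\ exists2 K, compact K & B `<=` K.
  move=> /G1[oB [A [_ [K cK AK]] BA]]; split => //; exists K => //; exact: subset_trans AK.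
have Gx x : exists2 B, G B & B x by have : (\bigcup_(B in G) B) x by rewrite G2.
have step S : exists S', compact S -> compact S' /\ forall B, G B -> B `&` S !=set0 -> B `<=` S'.
  have [cS|nS] := pselect (compact S); last by exists set0.
  suff [S' cS' hS'] : exists2 S', compact S' & forall B, G B -> B `&` S !=set0 -> B `<=` S' by exists S'.
  pose P A := exists2 S', compact S' & forall B, G B -> B `&` A !=set0 -> B `<=` S'.
  apply: (compact_induction (P := P) cS).
  - by exists set0; [exact: compact0 | move=> B _ [? []]].
  - move=> A1 A2 [S1 c1 k1] [S2 c2 k2]; exists (S1 `|` S2); first exact: compactU.
    move=> B GB [y [By [A1y|A2y]]].
      by apply: subset_trans (@subsetUl _ _ _); apply: k1 => //; exists y.
    by apply: subset_trans (@subsetUr _ _ _); apply: k2 => //; exists y.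
  - move=> A1 A2 A12 [S1 c1 k1]; exists S1 => // B GB [y [By Ay]]; apply: k1 => //.
    by exists y; split => //; exact: A12.
  move=> x Sx; have [N Nx /finite_seqP[s sE]] := G3 x.
  exists (interior N); split; [exact: open_interior | by [] | ].
  have sG B : B \in s -> G B by move=> Bs; have : [set` s] B := Bs; rewrite -sE => -[].
  have [S' cS' hS'] : exists2 S', compact S' & forall B, B \in s -> B `<=` S'.
    clear sE; elim: s sG => [|B s IH] sG; first by exists set0 => //; exact: compact0.
    have [|S1 c1 k1] := IH; first by move=> C Cs; apply: sG; rewrite inE Cs orbT.
    have [_ [K cK BK]] := GK B (sG B (mem_head _ _)).
    exists (K `|` S1); first exact: compactU.
    by move=> C; rewrite inE => /orP[/eqP ->|/k1 h] y Cy; [left; exact: BK | right; exact: h].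
  exists S' => // B GB [y [By Ny]]; apply: hS'.
  have : [set B | G B /\ B `&` N !=set0] B by split => //; exists y; split => //; exact: interior_subset.
  by rewrite sE.
have [nx hnx] := choice step.
pose S := fix S k : set X := if k is k'.+1 then nx (S k') else [set x0].
have cS k : compact (S k).
  by elim: k => [|k IH]; [exact: compact_set1 | exact: (hnx _ IH).1].
have SB k B : G B -> B `&` S k !=set0 -> B `<=` S k.+1 := (hnx _ (cS k)).2 B.
have SS k : S k `<=` interior (S k.+1).
  move=> x Sx; have [B GB Bx] := Gx x; have [oB _] := GK B GB.
  have BS : B `<=` S k.+1 by apply: SB => //; exists x.
  by apply: filterS BS _; exact: open_nbhs_nbhs.
exists S; split => //.
have e : \bigcup_k S k = setT.
  have oT' : open (\bigcup_k S k).
    rewrite openE => x [k _ Sx]; have := SS k x Sx; apply: filterS => y Sy.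
    by exists k.+1.
  have cT' : closed (\bigcup_k S k).
    move=> x hx; have [B GB Bx] := Gx x; have [oB _] := GK B GB.
    have [y [[k _ Sy] By]] := hx B (open_nbhs_nbhs (conj oB Bx)).
    by exists k.+1 => //; apply: (SB k B GB) => //; exists y.
  apply: (@cm_connected _ _ X).
  - by exists x0; exists 0%N.
  - by exists (\bigcup_k S k) => //; rewrite setTI.
  - by exists (\bigcup_k S k) => //; rewrite setTI.
move=> x; have : (\bigcup_k S k) x by rewrite e.
by move=> [k _ Sx]; exists k.
Qed.

End ManifoldTopology.

(** * Soft sheaves and the solution of equations over the whole manifold *)

Section Softness.
Variables (R : realType) (d : nat) (X : cmanifold R d).
Implicit Types (S U V : set X).

Definition soft (A : omodule X) (Z : forall U, set (A U)) : Prop :=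
  forall S U (s : A U), compact S -> open U -> S `<=` U -> Z U s ->
  exists (t : A setT) V, [/\ Z setT t, open V, S `<=` V, V `<=` U & ores V t = ores V s].

Lemma glue_two (A : omodule X) (hA : is_omodule A) V1 V2 (c1 : A V1) (c2 : A V2) :
  open V1 -> open V2 -> ores (V1 `&` V2) c1 = ores (V1 `&` V2) c2 ->
  exists c : A (V1 `|` V2), ores V1 c = c1 /\ ores V2 c = c2.
Proof.
move=> oV1 oV2 e; have oU : open (V1 `|` V2) by exact: openU.
have oI : open (V1 `&` V2) by exact: openI.
pose P V (a : A V) := (V `<=` V1 /\ a = ores V c1) \/ (V `<=` V2 /\ a = ores V c2).
have agree V : open V -> V `<=` V1 -> V `<=` V2 -> ores V c1 = ores V c2.
  move=> oV h1 h2; have h : V `<=` V1 `&` V2 by move=> x Vx; split; [exact: h1 | exact: h2].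
  by rewrite -(ores_comp hA (V := V1 `&` V2)) ?e ?(ores_comp hA).
have [|||t ht] := sections_glue hA (U := V1 `|` V2) (P := P) oU.
- move=> V V' a oV oV' VU V'V [[h ->]|[h ->]]; [left | right]; split; try exact: subset_trans h.
    by rewrite (ores_comp hA).
  by rewrite (ores_comp hA).
- move=> V a b oV VU [[h ->]|[h ->]] [[h' ->]|[h' ->]]; [by []|exact: agree|symmetry; exact: agree|by []].
- move=> x [h|h]; [exists V1 | exists V2]; split => //; try exact: subsetUl; try exact: subsetUr.
    by exists c1; left; split; [exact: subset_refl | rewrite (ores_id hA)].
  by exists c2; right; split; [exact: subset_refl | rewrite (ores_id hA)].
exists t; split; apply: ht => //; try exact: subsetUl; try exact: subsetUr.
  by left; split; [exact: subset_refl | rewrite (ores_id hA)].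
by right; split; [exact: subset_refl | rewrite (ores_id hA)].
Qed.

Section ExactStep.
Variables (A B : omodule X) (hA : is_omodule A) (hB : is_omodule B).
Variables (D : omap A B) (Z : forall U, set (B U)).
Arguments D {U}.
Arguments Z {U}.
Hypothesis DD : forall U (s t : A U), open U -> D (s + t) = D s + D t.
Hypothesis Dres : forall U V (s : A U), open U -> open V -> V `<=` U -> D (ores V s) = ores V (D s).
Hypothesis ZD : forall U (s : A U), open U -> Z (D s).
Hypothesis Zloc : forall U (z : B U) x, open U -> U x -> Z z ->
  exists V, [/\ open V, V x, V `<=` U & exists c : A V, D c = ores V z].
Hypothesis softA : soft (fun U => [set: A U]).
Hypothesis softD : soft (fun U => [set c : A U | D c = 0]).

Let DB U (s t : A U) : open U -> D (s - t) = D s - D t.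
Proof. by move=> oU; apply: additive_mapB => ? ?; exact: DD. Qed.

(** Near [S] the two solutions differ by a section of the kernel of [D]; softness makes it global,
    and it is added to the second solution. *)
Lemma adjust_solution U (z : B U) V1 V2 (c1 : A V1) (c2 : A V2) S : open U -> compact S ->
  open V1 -> open V2 -> V1 `<=` U -> V2 `<=` U -> S `<=` V1 -> S `<=` V2 ->
  D c1 = ores V1 z -> D c2 = ores V2 z ->
  exists (c : A V2) V, [/\ open V, S `<=` V, V `<=` V1 `&` V2, D c = ores V2 z & ores V c1 = ores V c].
Proof.
move=> oU cS oV1 oV2 V1U V2U SV1 SV2 e1 e2; pose N := V1 `&` V2.
have oN : open N by exact: openI.
have NV1 : N `<=` V1 by exact: subIsetl.
have NV2 : N `<=` V2 by exact: subIsetr.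
have SN : S `<=` N by move=> x Sx; split; [exact: SV1 | exact: SV2].
pose s := ores N c1 - ores N c2.
have Ds : D s = 0.
  by rewrite DB// !Dres// e1 e2 !(ores_comp hB)// subrr.
have [e [V [De oV SV VN ee]]] := softD cS oN SN Ds.
have VV1 := subset_trans VN NV1; have VV2 := subset_trans VN NV2.
exists (c2 + ores V2 e), V; split => //.
  by rewrite DD// Dres//; [rewrite De (ores0 hB)// ?addr0//; exact: openT | exact: openT].
rewrite (oresD hA)// (ores_comp hA)//; last exact: openT.
by rewrite ee /s (oresB hA)// !(ores_comp hA)// addrC subrK.
Qed.

(** Local solutions are merged by compact induction. The property speaks of a compact set containing
    [T], so that it makes sense for arbitrary subsets and the intersection of two such sets is again
    compact. *)
Lemma near_solution U (z : B U) S : compact S -> open U -> S `<=` U -> Z z ->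
  exists V (c : A V), [/\ open V, S `<=` V, V `<=` U & D c = ores V z].
Proof.
move=> cS oU SU Zz.
have hausX := @cm_hausdorff R d X.
pose P T := exists K, [/\ compact K, T `<=` K & exists V (c : A V),
  [/\ open V, K `<=` V, V `<=` U & D c = ores V z]].
have [||||K [_ SK [V [c [oV KV VU e]]]]] := @compact_induction X P S cS.
- exists set0; split => //; first exact: compact0.
  exists set0, 0; split => //; first exact: open0.
  by apply: (sections_eq hB) => //; exact: open0.
- move=> T1 T2 [K1 [cK1 TK1 [V1 [c1 [oV1 KV1 V1U e1]]]]] [K2 [cK2 TK2 [V2 [c2 [oV2 KV2 V2U e2]]]]].
  exists (K1 `|` K2); split; [exact: compactU | exact: setUSS | ].
  have [|||c2' [V' [oV' KV' V'V e2' ee]]] :=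
    @adjust_solution U z V1 V2 c1 c2 (K1 `&` K2) oU _ oV1 oV2 V1U V2U _ _ e1 e2.
  + exact: compactI.
  + by apply: subset_trans KV1; exact: subIsetl.
  + by apply: subset_trans KV2; exact: subIsetr.
  have cC : closed (~` V') by exact: open_closedC.
  (* Off [V'], where the solutions agree, the two compact sets are disjoint; separating them shrinks
     the domains until they overlap inside [V'] only. *)
  have [N1 [N2 [oN1 oN2 KN1 KN2 NN]]] : exists N1 N2, [/\ open N1, open N2, K1 `\` V' `<=` N1,
      K2 `\` V' `<=` N2 & N1 `&` N2 = set0].
    apply: compact_separation => //; [exact: compact_closedI | exact: compact_closedI | ].
    by apply/seteqP; split => // x [[h1 h2] [h3 _]]; apply: h2; exact: KV'.
  pose W1 := V1 `&` (N1 `|` V'); pose W2 := V2 `&` (N2 `|` V').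
  have oW1 : open W1 by apply: openI => //; exact: openU.
  have oW2 : open W2 by apply: openI => //; exact: openU.
  have sW1 : W1 `<=` V1 by exact: subIsetl.
  have sW2 : W2 `<=` V2 by exact: subIsetl.
  have sW : W1 `&` W2 `<=` V'.
    move=> x [[_ [h1|//]] [_ [h2|//]]]; have : (N1 `&` N2) x by [].
    by rewrite NN.
  have oW : open (W1 `&` W2) by exact: openI.
  have V'1 : V' `<=` V1 by move=> x /V'V[].
  have V'2 : V' `<=` V2 by move=> x /V'V[].
  have [|c [hc1 hc2]] := @glue_two A hA W1 W2 (ores W1 c1) (ores W2 c2') oW1 oW2.
    rewrite !(ores_comp hA)//; try exact: subIsetl; try exact: subIsetr.
    by rewrite -(ores_comp hA (V := V')) ?ee ?(ores_comp hA).
  have oU' : open (W1 `|` W2) by exact: openU.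
  have sU1 := subset_trans sW1 V1U; have sU2 := subset_trans sW2 V2U.
  have sU : W1 `|` W2 `<=` U by move=> x [/sU1|/sU2].
  have sWl : W1 `<=` W1 `|` W2 by exact: subsetUl.
  have sWr : W2 `<=` W1 `|` W2 by exact: subsetUr.
  exists (W1 `|` W2), c; split => //.
    move=> x [h|h]; [left | right].
      split; first exact: KV1.
      by have [?|?] := pselect (V' x); [right | left; apply: KN1].
    split; first exact: KV2.
    by have [?|?] := pselect (V' x); [right | left; apply: KN2].
  apply: (sections_eq hB) => // x [h|h]; [exists W1 | exists W2]; split => //.
    by rewrite -Dres// hc1 Dres// e1 !(ores_comp hB).
  by rewrite -Dres// hc2 Dres// e2' !(ores_comp hB).
- by move=> T1 T2 T12 [K [cK TK h]]; exists K; split => //; exact: subset_trans TK.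
- move=> x Sx; have [V [oV Vx VU [c e]]] := Zloc oU (SU x Sx) Zz.
  have [K [V0 [cK oV0 V0x V0K KV]]] := compact_neighborhood oV Vx.
  by exists V0; split => //; exists K; split => //; exists V, c.
by exists V, c; split => //; exact: subset_trans KV.
Qed.

(** A section of [Z] near [S] is written as D c, and c is extended instead of the section: applying
    [D] afterwards keeps the result in [Z]. *)
Lemma soft_image : soft (fun U => @Z U).
Proof.
move=> S U z cS oU SU Zz; have [V [c [oV SV VU e]]] := near_solution cS oU SU Zz.
have [t [V' [_ oV' SV' V'V et]]] := softA cS oV SV (s := c) I.
have V'U := subset_trans V'V VU.
exists (D t), V'; split => //; first by apply: ZD; exact: openT.
rewrite -Dres//; last exact: openT.
by rewrite et Dres// e (ores_comp hB).
Qed.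

(** Along an exhaustion each solution is corrected so as to agree with the previous one near the
    previous compact set. On the interior of each compact set the sequence is eventually constant,
    and no limit process is involved. *)
Lemma global_solution (z : B setT) : Z z -> exists c : A setT, D c = z.
Proof.
move=> Zz; have oT : open [set: X] by exact: openT.
have [S [cS SS Sx]] := compact_exhaustion X.
pose T := {V : set X & A V}.
pose good k (p : T) := [/\ open (projT1 p), S k `<=` projT1 p & D (projT2 p) = ores (projT1 p) z].
pose N k := interior (S k).
have oO k : open (N k) by exact: open_interior.
have OS k : N k `<=` S k by exact: interior_subset.
have OO k : N k `<=` N k.+1 by move=> x /OS/SS.
have [p0 gp0] : exists p, good 0%N p.
  have [V [c [oV SV _ e]]] := near_solution (cS 0%N) oT (@subsetT _ _) Zz.
  by exists (existT _ V c).
have step (kp : nat * T) : exists q, good kp.1 kp.2 -> good kp.1.+1 q /\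
    ores (N kp.1) (projT2 kp.2) = ores (N kp.1) (projT2 q).
  case: kp => k [V1 c1] /=; have [[oV1 SV1 e1]|ng] := pselect (good k (existT _ V1 c1)); last by exists p0.
  have [V2 [c2 [oV2 SV2 _ e2]]] := near_solution (cS k.+1) oT (@subsetT _ _) Zz.
  have Sk : S k `<=` V2 by move=> x /SS/interior_subset; exact: SV2.
  have [c [V [oV SV VV e ee]]] :=
    adjust_solution oT (cS k) oV1 oV2 (@subsetT _ _) (@subsetT _ _) SV1 Sk e1 e2.
  exists (existT _ V2 c) => _; split => //=.
  have h1 : V `<=` V1 by move=> x /VV[].
  have h2 : V `<=` V2 by move=> x /VV[].
  have h3 : N k `<=` V by move=> x /OS; exact: SV.
  by rewrite -(ores_comp hA (V := V)) ?ee ?(ores_comp hA).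
have [nx hnx] := choice step.
pose p := fix p k : T := if k is k'.+1 then nx (k', p k') else p0.
have gp k : good k (p k) by elim: k => [|k IH] //; exact: (hnx (k, p k) IH).1.
have rp k : ores (N k) (projT2 (p k)) = ores (N k) (projT2 (p k.+1)) := (hnx (k, p k) (gp k)).2.
have oV k : open (projT1 (p k)) by have [] := gp k.
have OV k l : (k <= l)%N -> N k `<=` projT1 (p l).
  move=> kl; apply: (@subset_trans _ (N l)); last first.
    by apply: subset_trans (OS l) _; have [] := gp l.
  elim: l kl => [|l IH]; first by rewrite leqn0 => /eqP ->.
  by rewrite leq_eqVlt => /orP[/eqP ->//|/IH h]; exact: (subset_trans h (OO l)).
have Okl k l : (k <= l)%N -> N k `<=` N l.
  elim: l => [|l IH]; first by rewrite leqn0 => /eqP ->.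
  by rewrite leq_eqVlt => /orP[/eqP ->//|/IH h]; exact: (subset_trans h (OO l)).
have rpl k l V : open V -> V `<=` N k -> (k <= l)%N -> ores V (projT2 (p k)) = ores V (projT2 (p l)).
  move=> oV' VO; elim: l => [|l IH]; first by rewrite leqn0 => /eqP ->.
  rewrite leq_eqVlt => /orP[/eqP ->//|kl]; rewrite IH//.
  have h : V `<=` N l by exact: (subset_trans VO (Okl k l kl)).
  by rewrite -(ores_comp hA (V := N l)) ?rp ?(ores_comp hA)//; exact: OV.
pose P V (a : A V) := exists2 k, V `<=` N k & a = ores V (projT2 (p k)).
have [|||t ht] := sections_glue hA (U := setT) (P := P) oT.
- move=> V V' a oV1 oV' _ V'V [k h ->]; exists k; first exact: subset_trans h.
  by rewrite (ores_comp hA)//; apply: subset_trans h _; exact: OV.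
- move=> V a b oV1 _ [k h ->] [l h' ->]; have [kl|/ltnW lk] := leqP k l; first exact: rpl.
  by symmetry; exact: rpl.
- move=> x _; have [k Sk] := Sx x; exists (N k.+1); split => //; first exact: SS.
  by exists (ores (N k.+1) (projT2 (p k.+1))); exists k.+1.
exists t; apply: (sections_eq hB) => // x _; have [k Sk] := Sx x.
exists (N k.+1); split => //; first exact: SS.
rewrite -Dres// (ht (N k.+1) (ores (N k.+1) (projT2 (p k.+1))))//; last by exists k.+1.
have [_ _ e] := gp k.+1.
by rewrite Dres ?e ?(ores_comp hB)//; exact: OV.
Qed.

End ExactStep.

Section Flasque.
Variables (I : omodule X) (hI : is_omodule I) (injI : oinjective I).

Let pushforward U : omodule X := @OModule R d X (fun V => I (U `&` V))
  (fun V f s => oact f s) (fun V T s => ores (U `&` T) s).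

Let holo_sub U V f : V `<=` U -> holo_fun U f -> holo_fun V f.
Proof. by move=> VU hf a; apply: holomorphic_sub (hf a); exact: img_sub. Qed.

Let pushforward_omodule U : open U -> is_omodule (pushforward U).
Proof.
move=> oU; have oI V : open V -> open (U `&` V) by move=> ?; exact: openI.
have hs V f : holo_fun V f -> holo_fun (U `&` V) f by apply: holo_sub; exact: subIsetr.
have IS V V' : V' `<=` V -> U `&` V' `<=` U `&` V by move=> h; exact: setIS.
split.
- by move=> V f s t oV hf; apply: (oactDr hI); [exact: oI | exact: hs].
- by move=> V f g s oV hf hg; apply: (oactDl hI); [exact: oI | exact: hs | exact: hs].
- by move=> V f g s oV hf hg; apply: (oactM hI); [exact: oI | exact: hs | exact: hs].
- by move=> V s oV; apply: (oact1 hI); exact: oI.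
- by move=> V f g s oV hf fg; apply: (oact_ext hI); [exact: oI | exact: hs | move=> x [_]; exact: fg].
- by move=> V s oV; apply: (ores_id hI); exact: oI.
- by move=> V V' T s oV oV' oT VV TV; apply: (ores_comp hI); [exact: oI|exact: oI|exact: oI|exact: IS|exact: IS].
- by move=> V T s t oV oT TV; apply: (oresD hI); [exact: oI|exact: oI|exact: IS].
- by move=> V T f s oV oT TV hf; apply: (ores_act hI); [exact: oI|exact: oI|exact: IS|exact: hs].
- move=> V C s t oV oC CV h; apply: (sections_eq hI); first exact: oI.
  move=> x [Ux]; rewrite -{1}CV => -[T CT Tx]; exists (U `&` T); split => //; [exact: oI (oC T CT) | | exact: h].
  by apply: IS => y Ty; rewrite -CV; exists T.
move=> V C s oV oC CV h.
pose P T (a : I T) := exists2 T', C T' & T `<=` U `&` T' /\ a = @ores R d X I (U `&` T') T (s T').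
have TV T : C T -> T `<=` V by move=> CT y Ty; rewrite -CV; exists T.
have [|||t ht] := sections_glue hI (U := U `&` V) (P := P) (oI V oV).
- move=> T T' a oT oT' _ T'T [T'' C'' [h1 ->]]; exists T'' => //; split; first exact: subset_trans h1.
  by rewrite (ores_comp hI)//; apply: oI; exact: oC.
- move=> T a b oT _ [T1 C1 [h1 ->]] [T2 C2 [h2 ->]].
  have := h T1 T2 C1 C2; rewrite /= => e.
  have o1 : open (U `&` (T1 `&` T2)) by apply: oI; apply: openI; exact: oC.
  have sT : T `<=` U `&` (T1 `&` T2).
    by move=> x Tx; have [Ux T1x] := h1 x Tx; have [_ T2x] := h2 x Tx.
  have s1 : U `&` (T1 `&` T2) `<=` U `&` T1 by apply: IS; exact: subIsetl.
  have s2 : U `&` (T1 `&` T2) `<=` U `&` T2 by apply: IS; exact: subIsetr.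
  have oU1 := oI T1 (oC T1 C1); have oU2 := oI T2 (oC T2 C2).
  rewrite -(ores_comp hI (V := U `&` (T1 `&` T2)) (s T1))// -(ores_comp hI (V := U `&` (T1 `&` T2)) (s T2))//.
  by rewrite e.
- move=> x [Ux]; rewrite -{1}CV => -[T CT Tx]; exists (U `&` T); split => //; [exact: oI (oC T CT)|apply: IS; exact: TV|].
  exists (s T); exists T => //; split => //; rewrite (ores_id hI)//; exact: oI (oC T CT).
exists t => T CT; apply: ht; [exact: oI (oC T CT) | apply: IS; exact: TV|].
by exists T => //; split => //; rewrite (ores_id hI)//; exact: oI (oC T CT).
Qed.

(* Extend, along the direct image of I|U, the relation between the sections of
   I over U `&` V with V `<=` U and themselves. *)
Lemma injective_flasque U (s : I U) : open U -> exists t : I setT, ores U t = s.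
Proof.
move=> oU; have oI V : open V -> open (U `&` V) by move=> ?; exact: openI.
have hF := pushforward_omodule oU.
pose G V (f : pushforward U V) (y : I V) := (V `<=` U /\ f = ores (U `&` V) y) \/ (f = 0 /\ y = 0).
have VV V : U `&` V `<=` V by exact: subIsetr.
have holo_subI V f : holo_fun V f -> holo_fun (U `&` V) f by apply: holo_sub; exact: subIsetr.
have [|||||h hh hG] := @extend_relation R d X (pushforward U) I hF hI G _ _ _ _ _ injI.
- by move=> V oV; right.
- move=> V f1 f2 y1 y2 oV [[h1 ->]|[-> ->]] [[h2 ->]|[-> ->]].
  + by left; split => //; rewrite (oresB hI)//; exact: oI.
  + by left; rewrite !subr0.
  + by left; split => //; rewrite !sub0r (oresN hI)//; exact: oI.
  + by right; rewrite !subr0.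
- move=> V f s' y oV hf [[h1 ->]|[-> ->]]; [left; split => // | right].
    by rewrite (ores_act hI)//; exact: oI.
  by rewrite (oact0 hI)//; split => //; apply: (oact0 hI); [exact: oI | exact: holo_subI].
- move=> V T f y oV oT TV [[h1 ->]|[-> ->]]; [left | right].
    split; first exact: subset_trans h1.
    have TU : U `&` T `<=` U `&` V by exact: setIS.
    by rewrite /= !(ores_comp hI)//; exact: oI.
  rewrite (ores0 hI)//; split => //; apply: (ores0 hI); [exact: oI|exact: oI|exact: setIS].
- move=> V y oV [[h1 e]|[]]//.
  apply: (sections_eq hI) => // x Vx; exists (U `&` V); split => //; first exact: oI.
    by split => //; exact: h1.
  by rewrite -e (ores0 hI)//; exact: oI.
have oT : open [set: X] by exact: openT.
exists (h setT (ores (U `&` setT) s)).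
rewrite -(ohom_res hh) => //; apply: hG => //; left; split => //=.
have [oI1 oI2] := (oI _ oT, oI _ oU).
have s1 : U `&` setT `<=` U by exact: subIsetl.
have s2 : U `&` U `<=` U `&` setT by move=> x [].
by rewrite (ores_comp hI).
Qed.

End Flasque.

End Softness.

Section Pairs.
Variables (R : realType) (d : nat) (X : cmanifold R d).
Implicit Types (S U V : set X).

Definition pair_omodule (E F : omodule X) : omodule X := @OModule R d X (fun U => (E U * F U)%type)
  (fun U f s => (oact f s.1, oact f s.2)) (fun U V s => (ores V s.1, ores V s.2)).

Lemma pair_is_omodule E F : is_omodule E -> is_omodule F -> is_omodule (pair_omodule E F).
Proof.
move=> hE hF; split.
- by move=> U f s t oU hf; rewrite /= (oactDr hE)// (oactDr hF).
- by move=> U f g s oU hf hg; rewrite /= (oactDl hE)// (oactDl hF).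
- by move=> U f g s oU hf hg; rewrite /= (oactM hE)// (oactM hF).
- by move=> U [s t] oU; rewrite /= (oact1 hE)// (oact1 hF).
- by move=> U f g s oU hf fg; congr pair; [apply: (oact_ext hE) | apply: (oact_ext hF)].
- by move=> U [s t] oU; rewrite /= (ores_id hE)// (ores_id hF).
- by move=> U V T s oU oV oT VU TV; rewrite /= (ores_comp hE)// (ores_comp hF).
- by move=> U V s t oU oV VU; rewrite /= (oresD hE)// (oresD hF).
- by move=> U V f s oU oV VU hf; rewrite /= (ores_act hE)// (ores_act hF).
- move=> U C [s1 s2] [t1 t2] oU oC CU h; congr pair.
    by apply: (osheaf_separated hE oU oC CU) => V CV; have [] := h V CV.
  by apply: (osheaf_separated hF oU oC CU) => V CV; have [] := h V CV.
move=> U C s oU oC CU h.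
have [|t1 h1] := osheaf_glue hE (s := fun V => (s V).1) oU oC CU.
  by move=> V V' CV CV'; have [] := h V V' CV CV'.
have [|t2 h2] := osheaf_glue hF (s := fun V => (s V).2) oU oC CU.
  by move=> V V' CV CV'; have [] := h V V' CV CV'.
by exists (t1, t2) => V CV; rewrite /= h1// h2//; case: (s V).
Qed.

Lemma pair_soft E F : is_omodule E -> is_omodule F -> soft (fun U => [set: E U]) ->
  (forall U (s : F U), open U -> exists t : F setT, ores U t = s) ->
  soft (fun U => [set: pair_omodule E F U]).
Proof.
move=> hE hF sE fF S U [s1 s2] cS oU SU _; have [t1 [V [_ oV SV VU e]]] := sE S U s1 cS oU SU I.
have [t2 e2] := fF U s2 oU; exists (t1, t2), V; split => //=; rewrite e -e2.
by rewrite (ores_comp hF)//; exact: openT.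
Qed.

End Pairs.

Lemma int_induction (Q : int -> Prop) (N : int) :
  (forall a, a < N -> Q a) -> (forall a, Q (a - 1) -> Q a) -> forall a, Q a.
Proof.
move=> h1 h2; suff H (m : nat) : forall a, a < N + m%:Z -> Q a.
  by move=> a; apply: (H (absz (a - N)).+1); lia.
elim: m => [|m IH] a ha; first by apply: h1; move: ha; lia.
by apply: h2; apply: IH; lia.
Qed.

(** * Exactness of the mapping cone of the comparison map *)

Section Cone.
Variables (R : realType) (d : nat) (X : cmanifold R d).
Variables (K P I : ocomplex X) (incl : cmap K P) (rho : cmap K I) (g : cmap P I).
Hypotheses (hP : is_ocomplex P) (hI : is_ocomplex I).
Hypotheses (hi : is_cmap incl) (hg : is_cmap g).
Hypotheses (qi : quasi_iso incl) (qr : quasi_iso rho).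
Hypothesis grho : forall n U (s : K n U), open U -> g (incl s) = @rho n U s.
Hypothesis injI : forall n, oinjective (I n).
Hypothesis softP : forall n, soft (fun U => [set: P n U]).
Hypotheses (bP : bounded_below P) (bI : bounded_below I).
Implicit Types U V : set X.

Let oP m := cobj_omodule hP m.
Let oI m := cobj_omodule hI m.
Let hoi m := cmap_ohom hi m.
Let hog m := cmap_ohom hg m.
Let hdP m m' := cdiff_ohom hP m m'.
Let hdI m m' := cdiff_ohom hI m m'.

Local Notation cone a b := (pair_omodule (P a) (I b)).

(** The degrees of the two summands are independent variables, and the relation between them is
    imposed in the statements only; this avoids transports between terms such as those of degrees a
    + 1 - 1 and a. *)
Definition cone_diff (a b c : int) : omap (cone a b) (cone c a) :=
  fun U p => (- cdiff c p.1, g p.1 + cdiff a p.2).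
Arguments cone_diff a b c {U}.

Let hcone a b : is_omodule (cone a b).
Proof. exact: pair_is_omodule. Qed.

Lemma cone_diffD a b c U (s t : cone a b U) : open U ->
  cone_diff a b c (s + t) = cone_diff a b c s + cone_diff a b c t.
Proof.
move=> oU; rewrite /cone_diff /= (ohomD (hdP _ _))// (ohomD (hog _))// (ohomD (hdI _ _))//.
by congr pair; [rewrite opprD | rewrite addrACA].
Qed.

Lemma cone_diff_res a b c U V (s : cone a b U) : open U -> open V -> V `<=` U ->
  cone_diff a b c (ores V s) = ores V (cone_diff a b c s).
Proof.
move=> oU oV VU; rewrite /cone_diff /= (ohom_res (hdP _ _))// (ohom_res (hog _))//.
by rewrite (ohom_res (hdI _ _))// (oresN (oP _))// (oresD (oI _)).
Qed.

Lemma cone_diff_diff a b c e U (s : cone a b U) : open U ->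
  cone_diff c a e (cone_diff a b c s) = 0.
Proof.
move=> oU; rewrite /cone_diff /= (ohomN (hdP _ _))// (cdiff_comp hP)// !oppr0.
rewrite (ohomN (hog _))// (cmap_diff hg)// (ohomD (hdI _ _))// (cdiff_comp hI)// addr0.
by rewrite addNr.
Qed.

(** A quasi-isomorphism argument for [g] by elements: the component in [P] is cohomologous to incl
    k, and rho k is a boundary, hence so is k. The component in [I], once corrected by the image of
    a primitive, is a cocycle and comes from [K] up to a boundary. *)
Lemma cone_locally_exact a U (x : X) (p : cone a (a - 1) U) : open U -> U x ->
  cone_diff a (a - 1) (a + 1) p = 0 ->
  exists V, [/\ open V, V x, V `<=` U &
    exists q : cone (a - 1) (a - 1 - 1) V, cone_diff (a - 1) (a - 1 - 1) a q = ores V p].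
Proof.
case: p => w y oU Ux [/eqP]; rewrite oppr_eq0 => /eqP dw e.
have [V1 [oV1 V1x V1U [k ck [w1 ew1]]]] := (qi a oU Ux).2 w dw.
have ew : ores V1 w = incl k + cdiff a w1 by rewrite -ew1 addrC subrK.
have bk : coboundary I a V1 (rho k).
  exists (- (ores V1 y + g w1)); rewrite (ohomN (hdI _ _))// (ohomD (hdI _ _))//.
  rewrite -(cmap_diff hg)// -grho//; apply/eqP; rewrite -subr_eq0 opprK addrA addrAC.
  rewrite -(ohomD (hog _))// -ew (ohom_res (hog _))// (ohom_res (hdI _ _))// -(oresD (oI _))// e.
  by rewrite (ores0 (oI _)).
have [V2 [oV2 V2x V21 [k' ek']]] := (qr a oV1 V1x).1 k ck bk.
pose w2 := incl k' + ores V2 w1; pose y2 := ores V2 (ores V1 y) + g w2.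
have V2U := subset_trans V21 V1U.
have ew2 : ores V2 w = cdiff a w2.
  rewrite (ohomD (hdP _ _))// -(cmap_diff hi)// -ek' (ohom_res (hoi _))// (ohom_res (hdP _ _))//.
  by rewrite -(oresD (oP _))// -ew (ores_comp (oP _)).
have ea : a - 1 + 1 = a by rewrite subrK.
have cy2 : cocycle I (a - 1) V2 y2.
  rewrite /cocycle /= ea (ohomD (hdI _ _))// -(cmap_diff hg)// -ew2 (ohom_res (hog _))//.
  by rewrite (ores_comp (oI _))// (ohom_res (hdI _ _))// addrC -(oresD (oI _))// e (ores0 (oI _)).
have [V [oV Vx V2V [k'' ck'' [y'' ey'']]]] := (qr (a - 1) oV2 V2x).2 y2 cy2.
have VU := subset_trans V2V V2U; have VV1 := subset_trans V2V V21.
exists V; split => //; exists (incl k'' - ores V w2, y''); rewrite /cone_diff /=; congr pair.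
  rewrite (ohomB (hdP _ _))// -(cmap_diff hi)// (ohom_res (hdP _ _))// -ew2 (ores_comp (oP _))//.
  by have := ck''; rewrite /cocycle /= ea => ->; rewrite (ohom0 (hoi _))// sub0r opprK.
rewrite (ohomB (hog _))// grho// -ey'' (ohom_res (hog _))// /y2 (oresD (oI _))// !(ores_comp (oI _))//.
move: (rho k'') (ores V (g w2)) (ores V y) => r1 r2 r3.
by rewrite [X in X = _]addrC addrA subrK addrK.
Qed.

(** The kernel in one degree is locally the image of the preceding term, whose own kernel is soft by
    induction; the induction starts below the lower bounds of both complexes, where everything is
    0. *)
Lemma cone_kernel_soft a : soft (fun U => [set p : cone a (a - 1) U | cone_diff a (a - 1) (a + 1) p = 0]).
Proof.
have flI n U (s : I n U) : open U -> exists t : I n setT, ores U t = s.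
  exact: injective_flasque.
have [N1 h1] := bP; have [N2 h2] := bI; pose N := Order.min N1 N2.
move: a; apply: (@int_induction _ N) => a ha.
  have [a1 a2] : a < N1 /\ a - 1 < N2 by move: ha; rewrite /N; lia.
  move=> S U s cS oU SU _; exists 0, U; split => //.
    by apply: (additive_map0 (f := cone_diff a (a - 1) (a + 1) (U := setT))) => ? ?; apply: cone_diffD; exact: openT.
  rewrite (ores0 (hcone _ _))//; last exact: openT.
  by case: s => s t; rewrite [s]h1// [t]h2//= (ores0 (oP _))// (ores0 (oI _)).
have ea : a - 1 + 1 = a by rewrite subrK.
rewrite ea in ha.
apply: (@soft_image R d X (cone (a - 1) (a - 1 - 1)) (cone a (a - 1)) (hcone _ _) (hcone _ _)
  (@cone_diff (a - 1) (a - 1 - 1) a)) => //.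
- by move=> U s t; exact: cone_diffD.
- by move=> U V s; exact: cone_diff_res.
- by move=> U s oU; exact: cone_diff_diff.
- by move=> U z x oU Ux hz; exact: cone_locally_exact.
- by apply: pair_soft => // U s oU; exact: flI.
Qed.

Lemma cone_exact a b (p : cone a b setT) : b = a - 1 -> cone_diff a b (a + 1) p = 0 ->
  exists q : cone b (b - 1) setT, cone_diff b (b - 1) a q = p.
Proof.
move=> eb; subst b => hp; have ea : a - 1 + 1 = a by rewrite subrK.
have ha := @cone_kernel_soft (a - 1); rewrite ea in ha.
apply: (@global_solution R d X (cone (a - 1) (a - 1 - 1)) (cone a (a - 1)) (hcone _ _) (hcone _ _)
  (@cone_diff (a - 1) (a - 1 - 1) a) (fun U => [set p | cone_diff a (a - 1) (a + 1) p = 0])) => //.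
- by move=> U s t; exact: cone_diffD.
- by move=> U V s; exact: cone_diff_res.
- by move=> U z x oU Ux hz; exact: cone_locally_exact.
Qed.

(** Exactness of the cone at (z, - y), where g z = d y, gives injectivity; exactness at (0, z')
    gives surjectivity. *)
Lemma cone_cohomology_iso k :
  subquotient_iso (holo_fun setT) (@oact _ _ _ (P k) setT) (@oact _ _ _ (I k) setT)
    (cocycle P k setT) (coboundary P k setT) (cocycle I k setT) (coboundary I k setT) (@g k setT).
Proof.
have oT : open [set: X] by exact: openT.
have b0 : coboundary I k setT 0 by exists 0; rewrite (ohom0 (hdI _ _)).
split.
- by move=> z cz; rewrite /cocycle /= -(cmap_diff hg)// cz (ohom0 (hog _)).
- by move=> z1 z2 _ _; rewrite (ohomD (hog _))// subrr.
- by move=> f z hf _; rewrite (ohomZ (hog _))// subrr.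
- move=> z cz; split => [[y ey]|[y ->]]; last by exists (g y); rewrite (cmap_diff hg).
  have [|[w' y'] [e1 _]] := @cone_exact k (k - 1) (z, - y) erefl.
    by rewrite /cone_diff /= cz oppr0 (ohomN (hdI _ _))// ey subrr.
  by exists (- w'); rewrite (ohomN (hdP _ _)).
move=> z' cz'; have e : k = k + 1 - 1 by rewrite addrK.
have [|[w y] [/eqP + e2]] := @cone_exact (k + 1) k (0, z') e.
  by rewrite /cone_diff /= (ohom0 (hdP _ _))// (ohom0 (hog _))// cz' oppr0 addr0.
rewrite oppr_eq0 => /eqP e1; exists w => //; exists y.
by rewrite -e2 addrC addKr.
Qed.

End Cone.

(** * Convergence of the spectral sequence *)

Section LinearExtension.
Variables (F : fieldType) (V U : zmodType) (aV : F -> V -> V) (aU : F -> U -> U).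
Hypothesis aVD : forall c v w, aV c (v + w) = aV c v + aV c w.
Hypothesis aVDl : forall c e v, aV (c + e) v = aV c v + aV e v.
Hypothesis aVM : forall c e v, aV (c * e) v = aV c (aV e v).
Hypothesis aV1 : forall v, aV 1 v = v.
Variables (C B : set U) (G : V -> U -> Prop).
Hypothesis G0 : G 0 0.
Hypothesis GB : forall v w u t, G v u -> G w t -> G (v - w) (u - t).
Hypothesis Gsc : forall c v u, G v u -> G (aV c v) (aU c u).
Hypothesis Gfun : forall u, G 0 u -> B u.
Hypothesis GC : forall v u, G v u -> C u.

Let good (Q : set (V * U)) := [/\ Q (0, 0),
  forall v w u t, Q (v, u) -> Q (w, t) -> Q (v - w, u - t),
  forall c v u, Q (v, u) -> Q (aV c v, aU c u),
  forall u, Q (0, u) -> B u & forall v u, Q (v, u) -> C u].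

Let G' : set (V * U) := [set p | G p.1 p.2].

(* A graph which is maximal among the linear relations is total: one may map a
   vector outside of its domain to 0. *)
Lemma linear_extension : exists psi : V -> U, [/\ forall v, C (psi v),
  forall v w, B (psi (v + w) - (psi v + psi w)),
  forall c v, B (psi (aV c v) - aU c (psi v)) &
  forall v u, G v u -> B (psi v - u)].
Proof.
have [A [[A0 AB Asc Afun AC] Amax]] : exists A, good (A `|` G') /\ forall Q, A `<` Q -> ~ good (Q `|` G').
  (* Conditions are put on the union with [G'], so that the empty chain is admissible as well. *)
  apply: (@Zorn_bigcup _ [set Q | good (Q `|` G')]) => K KP Ktot.
  have one p : (\bigcup_(Q in K) Q `|` G') p -> exists Q, [/\ good Q, Q p & Q `<=` \bigcup_(Q in K) Q `|` G'].
    move=> [[Q KQ Qp]|Gp]; last by exists G'; split => //; exact: subsetUr.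
    exists (Q `|` G'); split; [exact: KP | by left | ].
    by move=> q [Qq|Gq]; [left; exists Q | right].
  have two p q : (\bigcup_(Q in K) Q `|` G') p -> (\bigcup_(Q in K) Q `|` G') q ->
      exists Q, [/\ good Q, Q p, Q q & Q `<=` \bigcup_(Q in K) Q `|` G'].
    move=> [[Q KQ Qp]|Gp] hq; last first.
      case: hq => [[Q' KQ' Q'q]|Gq]; last by exists G'; split => //; exact: subsetUr.
      exists (Q' `|` G'); split; [exact: KP | by right | by left | ].
      by move=> r [?|?]; [left; exists Q' | right].
    case: hq => [[Q' KQ' Q'q]|Gq].
      have [h|h] := Ktot Q Q' KQ KQ'.
        exists (Q' `|` G'); split; [exact: KP | left; exact: h | by left | ].
        by move=> r [?|?]; [left; exists Q' | right].
      exists (Q `|` G'); split; [exact: KP | by left | left; exact: h | ].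
      by move=> r [?|?]; [left; exists Q | right].
    exists (Q `|` G'); split; [exact: KP | by left | by right | ].
    by move=> r [?|?]; [left; exists Q | right].
  split.
  - by right.
  - by move=> v w u t h1 h2; have [Q [[_ hB _ _ _] q1 q2 QK]] := two _ _ h1 h2; apply: QK; exact: hB.
  - by move=> c v u h; have [Q [[_ _ hs _ _] q1 QK]] := one _ h; apply: QK; exact: hs.
  - by move=> u h; have [Q [[_ _ _ hf _] q1 _]] := one _ h; exact: hf.
  - by move=> v u h; have [Q [[_ _ _ _ hc] q1 _]] := one _ h; exact: hc q1.
set M := A `|` G' in A0 AB Asc Afun AC.
have aV0l v : aV 0 v = 0 by apply: (addrI (aV 0 v)); rewrite -aVDl !addr0.
have aVNl c v : aV (- c) v = - aV c v by apply: (addrI (aV c v)); rewrite -aVDl !subrr.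
have tot v0 : exists u, M (v0, u).
  apply: contrapT => nv0; pose Q : set (V * U) := [set p | exists c v, M (v, p.2) /\ p.1 = v + aV c v0].
  have MQ : M `<=` Q by move=> [v u] h; exists 0, v; rewrite /= aV0l addr0.
  have QG : Q `|` G' = Q by apply/seteqP; split => [p [//|h]|p h]; [apply: MQ; right | left].
  apply: (Amax Q).
    split; first by apply: subset_trans MQ; exact: subsetUl.
    move=> QA; apply: nv0; exists 0; left; apply: QA; exists 1, 0; rewrite /= aV1 add0r.
    by split.
  rewrite QG; split; first exact: MQ.
  - move=> v w u t [c [v1 [h1 /= ->]]] [e [w1 [h2 /= ->]]]; exists (c - e), (v1 - w1); split; first exact: AB.
    by rewrite /= aVDl aVNl opprD addrACA.
  - move=> c v u [e [v1 [h1 /= ->]]]; exists (c * e), (aV c v1); split; first exact: Asc.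
    by rewrite /= aVD aVM.
  - move=> u [c [v1 [h1 /= e]]]; have [c0|c0] := eqVneq c 0.
      by apply: Afun; rewrite c0 aV0l addr0 in e; move: h1; rewrite -e.
    (* Here v1 = - c v0 is in the domain of the maximal relation, and then so is v0, against the
       assumption. *)
    case: nv0; exists (aU (- c^-1) u).
    suff -> : v0 = aV (- c^-1) v1 by exact: Asc.
    have ev : v1 = aV (- c) v0 by apply/eqP; rewrite aVNl -addr_eq0 -e.
    by rewrite ev -aVM mulrNN mulVf// aV1.
  - by move=> v u [c [v1 [h1 _]]]; exact: AC h1.
have [psi hpsi] := choice tot.
have MB v u t : M (v, u) -> M (v, t) -> B (u - t) by move=> h1 h2; apply: Afun; rewrite -(subrr v); exact: AB.
have MD v w u t : M (v, u) -> M (w, t) -> M (v + w, u + t).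
  move=> h1 h2; have := AB _ _ _ _ h1 (AB _ _ _ _ A0 h2).
  by rewrite !sub0r !opprK.
exists psi; split => [v|v w|c v|v u h].
- exact: AC (hpsi v).
- by apply: MB (hpsi _) _; exact: MD.
- by apply: MB (hpsi _) _; exact: Asc.
- by apply: MB (hpsi _) _; right.
Qed.

End LinearExtension.

(** * Bigraded components and softness of PV *)

Section Components.
Variables (R : realType) (d : nat) (X : cmanifold R d).
Local Notation family := (chart_family R d X).
Implicit Types (U : set X) (s t u : family) (A B : {set 'I_d}).
Implicit Types D : {set 'I_d} -> {set 'I_d} -> bool.

(** Changes of charts only mix coefficients with fixed |A| and |B|, so a selection by cardinals is
    compatible with them. *)
Lemma component_section D U s :
  (forall A B A' B', #|A| = #|A'| -> #|B| = #|B'| -> D A B = D A' B') ->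
  is_section U s -> is_section U (component D s).
Proof.
move=> hD [s1 s2 s3]; split.
- by move=> a x A B h; rewrite /component s1//; case: ifP.
- move=> a A B; rewrite /component; case: (D A B); first exact: s2.
  exact: smooth_cst.
move=> a b x A B Ux ax bx; rewrite /component; case: ifPn => [DAB|DAB].
  rewrite (s3 a b)//; apply: eq_bigr => A' _; apply: eq_bigr => B' _.
  have [hA|hA] := eqVneq #|A| #|A'|; last by rewrite !(zero_termL _ _ (minor_card _ hA)).
  have [hB|hB] := eqVneq #|B'| #|B|; last by rewrite !(zero_termR _ _ (minor_card _ hB)).
  by rewrite -(hD A B)// DAB.
rewrite big1// => A' _; rewrite big1// => B' _.
have [hA|hA] := eqVneq #|A| #|A'|; last exact: (zero_termL _ _ (minor_card _ hA)).
have [hB|hB] := eqVneq #|B'| #|B|; last exact: (zero_termR _ _ (minor_card _ hB)).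
by rewrite -(hD A B)// (negbTE DAB) mulr0.
Qed.

Lemma componentB D s t : component D (s - t) = component D s - component D t.
Proof.
by apply: familyP => a x A B; rewrite familyBE /component familyBE; case: ifP; rewrite ?subr0.
Qed.

Lemma component_fact D f s : component D (fact f s) = fact f (component D s).
Proof. by apply: familyP => a x A B; rewrite /component /fact; case: ifP; rewrite ?mulr0. Qed.

Lemma component_supported D s : supported D (component D s).
Proof. by move=> a x A B /negbTE h; rewrite /component h. Qed.

Lemma component_id D s : supported D s -> component D s = s.
Proof. by move=> h; apply: familyP => a x A B; rewrite /component; case: ifPn => // /h ->. Qed.

Lemma component_eq0 D D' s : supported D' s -> (forall A B, D A B -> ~~ D' A B) -> component D s = 0.
Proof.
by move=> hs h; apply: familyP => a x A B; rewrite /component; case: ifPn => // /h /hs ->.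
Qed.

Lemma bidegree_card i j A B A' B' : #|A| = #|A'| -> #|B| = #|B'| ->
  pv_bidegree i j A B = pv_bidegree i j A' B'.
Proof. by move=> h1 h2; rewrite /pv_bidegree h1 h2. Qed.

End Components.

Section PVSoft.
Variables (R : realType) (d : nat) (X : cmanifold R d) (W : X -> R[i]).
Hypothesis hW : holo_fun setT W.
Local Notation family := (chart_family R d X).

(** The product with a cutoff function, extended by 0: smooth functions act on families, although
    the structure of O-module only retains the action of the holomorphic ones. *)
Lemma pv_soft n : soft (fun U => [set: pv_complex W n U]).
Proof.
move=> S U s cS oU SU _; have oT : open [set: X] by exact: openT.
have [chi [Q [V [hchi [cQ QU oV SV] chi1 chi0]]]] := cutoff_function cS oU SU.
have hs := pv_valP s.
pose t0 : family := fact chi (val s).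
have out a x A B : ~ U x -> t0 a x A B = 0.
  by move=> Ux; rewrite /t0 /fact (pv_out A B hs) ?mulr0// => -[].
have ht : pv_set setT n t0.
  apply: pv_loc => //.
    by move=> a x A B h; rewrite /t0 /fact (pv_out A B hs) ?mulr0// => -[ax _]; apply: h.
  move=> x _; have [Ux|Ux] := pselect (U x).
    exists U; split => //.
    have -> : restrict U t0 = t0.
      apply: familyP => a y A B; have [Uy|Uy] := pselect (U y); first by rewrite restrictE.
      by rewrite restrict_out// out.
    by apply: pv_fact => // a; apply: smooth_sub (hchi a); exact: img_sub.
  exists (~` Q); split => //; [exact: closed_openC | by move=> /QU | ].
  have -> : restrict (~` Q) t0 = 0.
    apply: familyP => a y A B; have [Qy|Qy] := pselect ((~` Q) y); last by rewrite restrict_out.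
    by rewrite restrictE// /t0 /fact chi0// mul0r.
  by split; [exact: is_section0 | ].
have oVU : open (V `&` U) by exact: openI.
have VUU : V `&` U `<=` U by exact: subIsetr.
exists (to_sub (pv_subgroup setT n) t0), (V `&` U); split => //.
  by move=> x Sx; split; [exact: SV | exact: SU].
apply: val_inj; rewrite (val_pv_res _ oT oVU (@subsetT _ _)) (val_pv_res s oU oVU VUU).
rewrite (@to_subK _ (pv_subgroup setT n) t0 ht); apply: familyP => a x A B.
have [Vx|Vx] := pselect ((V `&` U) x); last by rewrite !restrict_out.
by rewrite !restrictE// /t0 /fact chi1 ?mul1r//; case: Vx.
Qed.

End PVSoft.

Lemma sub_interchange (M : zmodType) (a b c e : M) : a - b - (c - e) = a - c - (b - e).
Proof. by rewrite !opprB addrACA [RHS]addrACA (addrC (- b)). Qed.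

Lemma sub_sub_sub (M : zmodType) (a b c e : M) : a - b - c - (e - (b + c)) = a - e.
Proof. by rewrite -[a - b - c]addrA -opprD opprB addrA subrK. Qed.

(** * The filtration and the limit of the spectral sequence *)

Section SpectralSequence.
Variables (R : realType) (d : nat) (X : cmanifold R d) (W : X -> R[i]).
Hypothesis hW : holo_fun setT W.
Local Notation family := (chart_family R d X).
Implicit Types (s t u x : family) (A B : {set 'I_d}) (i j k n p q : int).
Local Opaque real_deriv dir jacobian jac dbar.

Let oT : open [set: X].
Proof. exact: openT. Qed.

Let card_set_le (A : {set 'I_d}) : (#|A| <= d)%N.
Proof. by rewrite -[X in (_ <= X)%N]card_ord max_card. Qed.

Lemma pv_setB U n s t : pv_set U n s -> pv_set U n t -> pv_set U n (s - t).
Proof. by move=> [h1 h2] [h3 h4]; split; [exact: is_section_sub | exact: supported_sub]. Qed.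

Lemma pv_set0 U n : pv_set (X := X) U n 0.
Proof. by split; [exact: is_section0 | ]. Qed.

Lemma filtrationB p n s t : pv_filtration p n s -> pv_filtration p n t -> pv_filtration p n (s - t).
Proof. by move=> [h1 h2] [h3 h4]; split; [exact: pv_setB | exact: supported_sub]. Qed.

Lemma filtration0 p n : pv_filtration (X := X) p n 0.
Proof. by split; [exact: pv_set0 | ]. Qed.

Lemma filtration_fact p n (c : R[i]) s : pv_filtration p n s -> pv_filtration p n (fact (fun=> c) s).
Proof.
move=> [h1 h2]; split; last exact: supported_fact.
by apply: pv_fact => // a; exact: smooth_cst.
Qed.

Lemma filtration_le p q n s : p <= q -> pv_filtration q n s -> pv_filtration p n s.
Proof.
move=> pq [h1 h2]; split => // a x A B h; apply: h2; apply: contraNN h => /=; exact: le_trans.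
Qed.

Lemma filtration_gt0 p n s : 0 < p -> pv_filtration p n s -> s = 0.
Proof. by move=> p0 [_ h]; apply: familyP => a x A B; apply: h => /=; lia. Qed.

Lemma filtration_bottom p n s : p <= - d%:Z -> pv_set setT n s -> pv_filtration p n s.
Proof.
move=> pd h; split => // a x A B; have hA := card_set_le A.
by move=> /negP[] /=; apply: le_trans pd _; rewrite lerN2 lez_nat.
Qed.

Lemma filtration_delta p n s : pv_filtration p n s -> pv_filtration p (n + 1) (delta_op W setT s).
Proof.
move=> [h1 h2]; split; first exact: pv_delta.
apply: supported_delta h2 => A B k // kA /=; apply: contraNN.
by rewrite cardsU1 kA PoszD => h; apply: le_trans h _; rewrite lerN2 lerDr.
Qed.

Lemma component_next i j p n s : i < p -> pv_filtration p n s -> component (pv_bidegree i j) s = 0.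
Proof.
move=> ip [_ h]; apply: component_eq0 h _ => A B /andP[/eqP hA _]; rewrite hA -ltNge.
exact: ip.
Qed.

(** In a fixed total degree the horizontal degree determines the bidegree, so a single component
    detects the quotient of two successive steps. *)
Lemma filtration_next i k s : pv_filtration i k s -> component (pv_bidegree i (k - i)) s = 0 ->
  pv_filtration (i + 1) k s.
Proof.
move=> [h1 h2] e; split => // a x A B hA; have [Ai|Ai] := eqVneq (- #|A|%:Z) i; last first.
  by apply: h2; rewrite /= -ltNge lt_neqAle Ai -ltzD1 ltNge.
have [hB|hB] := boolP (pv_degree k A B); last by have [_ h] := h1; exact: h.
have : component (pv_bidegree i (k - i)) s a x A B = 0 by rewrite e.
rewrite /component; case: ifPn => // /negP[]; rewrite /pv_bidegree Ai eqxx /=.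
by move: hB => /eqP <-; rewrite -Ai opprK subrK eqxx.
Qed.

Lemma bigraded_filtration i j u : pv_bigraded i j u -> pv_filtration i (i + j) u.
Proof.
move=> [h1 h2]; split; first split => //.
  by move=> a x A B h; apply: h2; apply: contraNN h => /andP[/eqP <- /eqP <-]; rewrite /pv_degree addrC.
by move=> a x A B h; apply: h2; apply: contraNN h => /andP[/eqP <- _] /=; exact: lexx.
Qed.

Lemma component_bigraded i j s : is_section setT s -> pv_bigraded i j (component (pv_bidegree i j) s).
Proof.
move=> hs; split; last exact: component_supported.
by apply: component_section hs => *; exact: bidegree_card.
Qed.

(** The contraction lowers |A|, hence raises the horizontal degree - |A|; on the leading component
    only dbar acts. *)
Lemma component_delta i j x : pv_filtration i (i + j) x ->
  component (pv_bidegree i (j + 1)) (delta_op W setT x) =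
  dolbeault_op setT (component (pv_bidegree i j) x).
Proof.
move=> [[[x1 _ _] hd] hf]; apply: familyP => a p A B; have [ap|ap] := pselect (dom a p); last first.
  rewrite (@dolbeault_out _ _ _ setT); last by case.
  rewrite /component; case: ifP => // _; rewrite /delta_op familyDE dolbeault_out; last by case.
  by rewrite add0r /contract_op big1// => k _; rewrite x1 ?mulr0//; case.
rewrite (@dolbeault_inE R d X setT (component (pv_bidegree i j) x) a p A B ap I) dbarE.
rewrite [LHS]/component; case: ifPn => [/andP[/eqP hA /eqP hB]|hAB]; last first.
  rewrite big1// => k kB.
  have -> : coef (component (pv_bidegree i j) x) a A (B :\ k) = fun=> 0.
    apply: coef0 => pt; rewrite /component; case: ifP => // /andP[/eqP hA /eqP hB]; case/negP: hAB.
    by rewrite /pv_bidegree hA eqxx (cardsD1 k B) kB PoszD hB addrC eqxx.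
  by rewrite pd_zbarE wdir_cst mulr0.
rewrite /delta_op familyDE [X in _ + X]big1 ?addr0; last first.
  by move=> k kA; rewrite hf ?mulr0//= cardsU1 kA -hA -ltNge PoszD opprD gtrDr.
rewrite (@dolbeault_inE R d X setT x a p A B ap I) dbarE; apply: eq_bigr => k kB.
have -> // : coef (component (pv_bidegree i j) x) a A (B :\ k) = coef x a A (B :\ k).
apply/funext => pt; rewrite /coef /local_expr /component.
have -> // : pv_bidegree i j A (B :\ k).
by rewrite /pv_bidegree hA eqxx; move: hB; rewrite (cardsD1 k B) kB PoszD addrC => /(addIr (1 : int)) ->; rewrite eqxx.
Qed.

(** For r = 0 the boundaries come from the step i + 1, which [delta_op] preserves and which has no
    component in horizontal degree i. *)
Lemma spectral_sequence_starts : ss_starts_with_dolbeault W.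
Proof.
move=> i j.
have fil u : pv_bigraded i j u -> pv_filtration (i + 0%N%:Z) (i + j + 1) (delta_op W setT u).
  by move=> /bigraded_filtration/filtration_delta; rewrite addr0.
have cmp u : pv_bigraded i j u -> u = component (pv_bidegree i j) u by move=> [_ h]; rewrite component_id.
split.
- apply/seteqP; split => u; first by move=> [x [[[hx _] _] _ ->]]; exact: component_bigraded.
  by move=> hu; exists u; split; [exact: bigraded_filtration | exact: fil | exact: cmp].
- apply/seteqP; split => u.
    move=> [y [hy _ ->]]; have := filtration_delta hy; rewrite subr0 => h.
    by apply: component_next h; lia.
  move=> ->; exists 0; rewrite delta0//; split; [exact: filtration0 | exact: filtration0 | ].
  by rewrite component_id.
move=> u v hu; have e0 : i + 0%N%:Z = i by rewrite addr0.
have e1 : j - 0%N%:Z + 1 = j + 1 by rewrite subr0.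
rewrite /ss_diff e0 e1; split => [[x [hx _ -> ->]]|->]; first exact: component_delta.
exists u; split; [exact: bigraded_filtration | | exact: cmp | ].
  by have := fil u hu; rewrite e0.
by rewrite component_delta -?cmp//; exact: bigraded_filtration.
Qed.

Lemma cycle_limP i k u : ss_cycle_lim W i (k - i) u <->
  exists z, [/\ pv_filtration i k z, delta_op W setT z = 0 & u = component (pv_bidegree i (k - i)) z].
Proof.
have e : i + (k - i) = k by rewrite addrC subrK.
rewrite /ss_cycle_lim /ss_cycle e; split => [h|[z [h1 h2 h3]] r _]; last first.
  by exists z; split => //; rewrite h2; exact: filtration0.
(* With r > |i| the step i + r is a positive one, hence 0, so that x is a cocycle. *)
have [x [h1 h2 h3]] := h (absz i).+1 I; exists x; split => //.
by apply: filtration_gt0 h2; lia.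
Qed.

Lemma boundary_limP i k u : ss_boundary_lim W i (k - i) u <->
  exists y, [/\ pv_set setT (k - 1) y, pv_filtration i k (delta_op W setT y) &
    u = component (pv_bidegree i (k - i)) (delta_op W setT y)].
Proof.
have e : i + (k - i) = k by rewrite addrC subrK.
rewrite /ss_boundary_lim /ss_boundary e; split => [[r _ [y [[h1 _] h2 h3]]]|[y [h1 h2 h3]]].
  by exists y.
(* With this r one has i - r + 1 <= - d, and every cochain belongs to that step of the
   filtration. *)
exists (absz i + d).+1 => //; exists y; split => //; apply: filtration_bottom => //; lia.
Qed.

Lemma boundary_limB i k u v : ss_boundary_lim W i (k - i) u -> ss_boundary_lim W i (k - i) v ->
  ss_boundary_lim W i (k - i) (u - v).
Proof.
move=> /boundary_limP[y [h1 h2 ->]] /boundary_limP[z [k1 k2 ->]]; apply/boundary_limP.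
by exists (y - z); rewrite (deltaB _ oT h1.1 k1.1) componentB; split => //; [exact: pv_setB | exact: filtrationB].
Qed.

Lemma boundary_lim0 i k : ss_boundary_lim W i (k - i) 0.
Proof.
by apply/boundary_limP; exists 0; rewrite delta0// component_id//; split => //; [exact: pv_set0 | exact: filtration0].
Qed.

Lemma cycle_limB i k u v : ss_cycle_lim W i (k - i) u -> ss_cycle_lim W i (k - i) v ->
  ss_cycle_lim W i (k - i) (u - v).
Proof.
move=> /cycle_limP[y [h1 h2 ->]] /cycle_limP[z [k1 k2 ->]]; apply/cycle_limP.
exists (y - z); rewrite (deltaB _ oT h1.1.1 k1.1.1) h2 k2 subrr componentB.
by split => //; exact: filtrationB.
Qed.

Lemma cycle_lim_out i k u : ss_cycle_lim W i (k - i) u -> (0 < i) || (i < - d%:Z) -> u = 0.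
Proof.
move=> /cycle_limP[z [h1 _ ->]] /orP[i0|id]; first by rewrite (filtration_gt0 i0 h1) component_id.
apply: (@component_eq0 _ _ _ _ (fun _ _ => true)) => // A B /andP[/eqP hA _].
by have h := card_set_le A; exfalso; lia.
Qed.

Section Limit.
Variables (I : ocomplex X) (g : cmap (pv_complex W) I).
Hypotheses (hI : is_ocomplex I) (hg : is_cmap g).
Variable k : int.
Hypothesis iso : cohomology_iso g k.
Local Notation P := (pv_complex W k setT).
Local Notation cob := (coboundary I k setT).

Let oI := cobj_omodule hI k.
Let hog := cmap_ohom hg k.
Let hdI m m' := cdiff_ohom hI m m'.

Lemma pv_cocycleP (w : P) : cocycle (pv_complex W) k setT w <-> delta_op W setT (val w) = 0.
Proof.
split=> [h|h]; first by rewrite -(val_pv_diff hW w oT) h.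
by apply: val_inj; rewrite (val_pv_diff hW w oT) h.
Qed.

Lemma val_pv_coboundary (t : pv_complex W (k - 1) setT) :
  val (cdiff k t : P) = delta_op W setT (val t).
Proof.
apply: (@to_subK _ (pv_subgroup setT k)).
by have := pv_delta hW oT (pv_valP t); rewrite subrK.
Qed.

Lemma coboundaryB (z z' : I k setT) : cob z -> cob z' -> cob (z - z').
Proof. by move=> [t ->] [t' ->]; exists (t - t'); rewrite (ohomB (hdI _ _)). Qed.

Lemma coboundary0 : cob 0.
Proof. by exists 0; rewrite (ohom0 (hdI _ _)). Qed.

(** [u] is the leading component of a cocycle in the i-th step whose image under [g] is cohomologous
    to [z]. The relation is linear, and single-valued modulo boundaries because [g] is injective in
    cohomology. *)
Let leading (i : int) (z : I k setT) u := exists w : P,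
  [/\ cocycle (pv_complex W) k setT w, pv_filtration i k (val w), cob (z - g w) &
      u = component (pv_bidegree i (k - i)) (val w)].

(** For a [z] not represented in the i-th step the value is that of an arbitrary linear extension;
    on cohomology this amounts to choosing a splitting of the filtration. *)
Lemma leading_coefficient_map i : exists psi : I k setT -> family,
  [/\ forall z, ss_cycle_lim W i (k - i) (psi z),
      forall z z', ss_boundary_lim W i (k - i) (psi (z + z') - (psi z + psi z')),
      forall (c : R[i]) z, ss_boundary_lim W i (k - i) (psi (oact (fun=> c) z) - fact (fun=> c) (psi z)) &
      forall z u, leading i z u -> ss_boundary_lim W i (k - i) (psi z - u)].
Proof.
have hc (c : R[i]) : holo_fun [set: X] (fun=> c) by exact: fact_cst_holo.
refine (@linear_extension R[i] (I k setT) family (fun c z => oact (fun=> c) z)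
  (fun c u => fact (fun=> c) u) _ _ _ _ (ss_cycle_lim W i (k - i)) (ss_boundary_lim W i (k - i))
  (leading i) _ _ _ _ _).
- by move=> c v w; exact: (oactDr oI).
- move=> c e v; rewrite -(oactDl oI)//.
- by move=> c e v; rewrite -(oactM oI).
- by move=> v; exact: (oact1 oI).
- exists 0; split.
  + by apply/pv_cocycleP; rewrite delta0.
  + exact: filtration0.
  + by rewrite (ohom0 hog)// subr0; exact: coboundary0.
  + by rewrite component_id.
- move=> v w u t [x [x1 x2 x3 ->]] [y [y1 y2 y3 ->]]; exists (x - y).
  have e : val (x - y) = val x - val y by exact: (raddfB val).
  split; [ | by rewrite e; exact: filtrationB | | by rewrite e componentB].
    apply/pv_cocycleP; rewrite e (deltaB _ oT (pv_valP x).1 (pv_valP y).1).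
    by move/pv_cocycleP: x1 => ->; move/pv_cocycleP: y1 => ->; rewrite subrr.
  by rewrite (ohomB hog)// sub_interchange; exact: coboundaryB.
- move=> c v u [x [x1 x2 [t x3] ->]]; exists (oact (fun=> c) x).
  have e : val (oact (fun=> c) x) = fact (fun=> c) (val x) by exact: val_pv_act.
  split; [ | by rewrite e; exact: filtration_fact | | by rewrite e component_fact].
    apply/pv_cocycleP; rewrite e (delta_fact _ oT (hc c) (pv_valP x).1).
    move/pv_cocycleP: x1 => ->; apply: familyP => a p A B; exact: mulr0.
  exists (oact (fun=> c) t); rewrite (ohomZ hog)// -(oactB oI)// x3 (ohomZ (hdI _ _))//.
- move=> u [x [x1 x2 x3 ->]]; have [_ _ _ h4 _] := iso.
  have : cob (g x) by have := coboundaryB coboundary0 x3; rewrite !sub0r opprK.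
  move=> /(h4 x x1)[t et]; apply/boundary_limP; exists (val t).
  by rewrite -val_pv_coboundary -et; split => //; exact: pv_valP.
- move=> v u [x [x1 x2 x3 ->]]; apply/cycle_limP; exists (val x); split => //.
  exact/pv_cocycleP.
Qed.

Lemma spectral_convergence : converges g k.
Proof.
have [h1 h2 h3 h4 h5] := iso.
have [psi hpsi] := choice leading_coefficient_map.
have psi1 i z : ss_cycle_lim W i (k - i) (psi i z) by have [] := hpsi i.
have psi2 i z z' : ss_boundary_lim W i (k - i) (psi i (z + z') - (psi i z + psi i z')) by have [] := hpsi i.
have psi3 i c z : ss_boundary_lim W i (k - i) (psi i (oact (fun=> c) z) - fact (fun=> c) (psi i z)) by have [] := hpsi i.
have psi4 i z u : leading i z u -> ss_boundary_lim W i (k - i) (psi i z - u) by have [_ _ _] := hpsi i; exact.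
have B0 i := boundary_lim0 i k.
have BB i u v : ss_boundary_lim W i (k - i) u -> ss_boundary_lim W i (k - i) v ->
  ss_boundary_lim W i (k - i) (u - v) := @boundary_limB i k u v.
have lead p (w : P) : cocycle (pv_complex W) k setT w -> pv_filtration p k (val w) ->
    (forall i, i < p -> ss_boundary_lim W i (k - i) (psi i (g w))) /\
    ss_boundary_lim W p (k - p) (psi p (g w) - component (pv_bidegree p (k - p)) (val w)).
  move=> cw fw; have c0 : cob (g w - g w) by rewrite subrr; exact: coboundary0.
  split => [i ip|]; last by apply: psi4; exists w.
  rewrite -[psi i (g w)]subr0; apply: psi4; exists w; split => //.
    by apply: filtration_le fw; exact: ltW.
  by rewrite (component_next (k - i) ip fw).
exists (fun z i => psi i z); split; last exact: lead.
have oT' := oT; split.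
- by move=> z _ i; exact: psi1.
- by move=> z1 z2 _ _ i; exact: psi2.
- by move=> _ z [c _ <-] _ i; exact: psi3.
- move=> z cz; split => [hz|hz i]; last first.
    rewrite -[psi i z]subr0; apply: psi4; exists 0; split.
    + by apply/pv_cocycleP; rewrite delta0.
    + exact: filtration0.
    + by rewrite (ohom0 hog)// subr0.
    + by rewrite component_id.
  (* A cocycle representing [z] is pushed one step deeper at a time: its leading component is a
     limit boundary because psi_p z is one, and the corresponding coboundary is subtracted. After d
     + 1 steps the cocycle is 0. *)
  suff H (m : nat) : exists w : P, [/\ cocycle (pv_complex W) k setT w,
      pv_filtration (- d%:Z + m%:Z) k (val w) & cob (z - g w)].
    have [w [_ fw cw]] := H d.+1; have w0 : w = 0.
      by apply: val_inj; apply: filtration_gt0 fw; lia.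
    by move: cw; rewrite w0 (ohom0 hog)// subr0.
  elim: m => [|m [w [cw fw cb]]].
    have [w cw cb] := h5 z cz; exists w; split => //; apply: filtration_bottom; last exact: pv_valP.
    by rewrite addr0.
  set p := - d%:Z + m%:Z in fw.
  have : ss_boundary_lim W p (k - p) (component (pv_bidegree p (k - p)) (val w)).
    have hl : leading p z (component (pv_bidegree p (k - p)) (val w)) by exists w.
    by have := BB _ _ _ (hz p) (psi4 _ _ _ hl); rewrite subKr.
  move=> /boundary_limP[y [y1 y2 y3]].
  pose t : pv_complex W (k - 1) setT := to_sub (pv_subgroup setT (k - 1)) y.
  have vt : val t = y by exact: (@to_subK _ (pv_subgroup setT (k - 1)) y y1).
  have vdt : val (cdiff k t : P) = delta_op W setT y by rewrite val_pv_coboundary vt.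
  exists (w - cdiff k t); have e : val (w - cdiff k t) = val w - delta_op W setT y.
    by rewrite -vdt; exact: (raddfB val).
  split.
  + apply/pv_cocycleP; rewrite e (deltaB _ oT (pv_valP w).1 y2.1.1).
    by move/pv_cocycleP: cw => ->; rewrite (delta_delta hW oT y1.1) subrr.
  + have -> : - d%:Z + m.+1%:Z = p + 1 by rewrite /p; lia.
    by rewrite e; apply: filtration_next; [exact: filtrationB | rewrite componentB -y3 subrr].
  + rewrite (ohomB hog)// opprB addrA [z + _]addrC -addrA; have [t' ht'] := cb.
    exists (g t + t'); rewrite (ohomD (hdI _ _))// -(cmap_diff hg)// -ht'.
    by [].
move=> e he.
(* The components are prescribed by increasing degree: a correction by the image of a cocycle in the
   p-th step changes the components of degree below p by boundaries only. *)
suff H (m : nat) : exists z : I k setT, cocycle I k setT z /\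
    forall i, i < - d%:Z + m%:Z -> ss_boundary_lim W i (k - i) (e i - psi i z).
  have [z [cz hz]] := H d.+1; exists z => // i; have [i0|i0] := leP i 0; first by apply: hz; lia.
  have hi : (0 < i) || (i < - d%:Z) by rewrite i0.
  rewrite -[X in ss_boundary_lim W i _ X]/(e i - psi i z) (cycle_lim_out (he i) hi) (cycle_lim_out (psi1 i z) hi) subrr; exact: B0.
elim: m => [|m [z [cz hz]]].
  exists 0; split => [|i ip]; first by rewrite /cocycle /= (ohom0 (hdI _ _)).
  have hi : (0 < i) || (i < - d%:Z) by apply/orP; right; lia.
  by rewrite (cycle_lim_out (he i) hi) (cycle_lim_out (psi1 i _) hi) subrr; exact: B0.
set p := - d%:Z + m%:Z in hz.
have /cycle_limP[y [y1 y2 y3]] := cycle_limB (he p) (psi1 p z).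
pose w : P := to_sub (pv_subgroup setT k) y.
have vw : val w = y by exact: (@to_subK _ (pv_subgroup setT k) y y1.1).
have cw : cocycle (pv_complex W) k setT w by apply/pv_cocycleP; rewrite vw.
have fw : pv_filtration p k (val w) by rewrite vw.
have [l1 l2] := lead p w cw fw; rewrite vw -y3 in l2.
exists (z + g w); split => [|i ip].
  by rewrite /cocycle /= (ohomD (hdI _ _))// cz add0r; exact: h1.
have sum3 (a b c q : family) : ss_boundary_lim W i (k - i) (q - (b + c)) ->
    ss_boundary_lim W i (k - i) (a - b - c) -> ss_boundary_lim W i (k - i) (a - q).
  move=> hq ha; have := BB _ _ _ ha hq.
  by rewrite sub_sub_sub.
apply: sum3 (psi2 i z (g w)) _.
have [ip'|pi] := ltP i p; first by apply: BB; [exact: hz | exact: l1].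
have -> : i = p by rewrite /p; move: ip pi; rewrite /p; lia.
by have := BB _ _ _ (B0 p) l2; rewrite sub0r opprB.
Qed.

End Limit.

End SpectralSequence.

Theorem proposition4p1 (R : realType) (d : nat) (X : cmanifold R d)
    (W : X -> R[i]) (LG : LG_pair W) :
  ss_starts_with_dolbeault W /\
  forall (I : ocomplex X) (rho : cmap (koszul_complex W) I),
    injective_resolution rho ->
    exists g : cmap (pv_complex W) I,
      [/\ extends_koszul g rho,
          forall (g' : cmap (pv_complex W) I) (k : int) (w : pv_complex W k setT),
            extends_koszul g' rho -> cocycle (pv_complex W) k setT w ->
            coboundary I k setT (g' k setT w - g k setT w),
          forall k : int, cohomology_iso g k &
          forall k : int, converges g k].
Proof.
have hW := lg_holomorphic LG; split; first exact: spectral_sequence_starts.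
move=> I rho [hI bI injI hr qr].
have hK := koszul_ocomplex hW; have hP := pv_ocomplex hW.
have hi := koszul_incl_cmap hW; have qi := koszul_incl_quasi_iso hW.
have inj n U : open U -> injective (@koszul_incl R d X W n U) by move=> _; exact: koszul_incl_inj.
have [N P0] := @pv_bounded R d X W.
have [g hg grho] := extension_exists hK hP hI hi hr qi inj injI P0.
have iso k : cohomology_iso g k.
  exact: (cone_cohomology_iso hP hI hi hg qi qr grho injI (@pv_soft R d X W) (@pv_bounded R d X W) bI k).
exists g; split.
- by [].
- move=> g' k w [hg' g'rho] cw.
  exact: (extension_unique hK hP hI hi qi inj injI P0 hg hg' grho g'rho (@openT X) cw).
- exact: iso.
- by move=> k; exact: (spectral_convergence hW hI hg (iso k)).
Qed.
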